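(* Let $N\ge2$, $M\ge0$, and let $t\in\mathcal{S}'(\mathbb{R}^N\times\mathbb{R}^M)$ be of the form $t(y,x)=s(y,x)f(x)$ with $s\in\mathcal{S}'(\mathbb{R}^N\times\mathbb{R}^M)$ and $f\in\mathcal{S}(\mathbb{R}^M)$ (for $M=0$ this means $t$ is an arbitrary element of $\mathcal{S}'(\mathbb{R}^N)$). Suppose $\tilde t(q,q')=O^{\mathrm{dist}}(|q|^{d-\varepsilon})$ with $d\in\mathbb{Z}$ and $\varepsilon\in(0,1)$. Then for an arbitrary UV regular splitting function $\Theta$ in $\mathbb{R}^N$ there exist $c_\gamma\in C(\mathbb{R}^M)$, for multi-indices $\gamma\in\mathbb{N}_0^N$ with $|\gamma|<d$, such that $$\widetilde{t_\Theta}(q,q')=O^{\mathrm{dist}}(|q|^{d-\varepsilon})+\sum_{|\gamma|<d}c_\gamma(q')\,q^\gamma,$$ where $t_\Theta(y,x):=\Theta(y)\,t(y,x)$.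
   Context: Fourier transform convention: $\tilde f(k)=\int e^{\mathrm{i}k\cdot y}f(y)\,\mathrm{d}y$ (in all variables, as tempered distributions); $q$ is the variable dual to $y\in\mathbb{R}^N$ and $q'$ dual to $x\in\mathbb{R}^M$. A function $\Theta:\mathbb{R}^N\to\mathbb{R}$ is a UV regular splitting function iff it is smooth, $0\le\Theta\le1$, $\Theta\equiv0$ in a neighborhood of the origin, and there is $\ell>0$ with $\Theta(\lambda y)=\Theta(y)$ for all $\lambda>1$, $|y|>\ell$. For $u\in\mathcal{S}'(\mathbb{R}^N\times\mathbb{R}^M)$ and $\delta\in\mathbb{R}$, $u(q,q')=O^{\mathrm{dist}}(|q|^\delta)$ means: there exist a neighborhood $\mathcal{O}$ of the origin in $\mathbb{R}^N\times\mathbb{R}^M$ and $u_\alpha\in C(\mathcal{O})$ indexed by $\alpha\in\mathbb{N}_0^N$ with finitely many nonzero, $u_\alpha\equiv0$ if $\delta+|\alpha|<0$, $|u_\alpha(q,q')|\le\mathrm{const}\,|q|^{\delta+|\alpha|}$ on $\mathcal{O}$, and $u=\sum_\alpha\partial_q^\alpha u_\alpha$ on $\mathcal{O}$ in the sense of distributions. *)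

(* Defs.v *)
From HB Require Import structures.
From mathcomp Require Import all_boot all_order all_algebra complex.
From mathcomp Require Import all_classical all_reals all_analysis.
Set Implicit Arguments. Unset Strict Implicit. Unset Printing Implicit Defensive.
Import Order.TTheory GRing.Theory Num.Theory.
Import numFieldTopology.Exports numFieldNormedType.Exports.
Local Open Scope classical_set_scope.
Local Open Scope ring_scope.

Definition cR {R : realType} (x : R) : R[i] := Complex x 0.
Definition cabs {R : realType} (z : R[i]) : R :=
  Num.sqrt (complex.Re z ^+ 2 + complex.Im z ^+ 2).
Definition cRe {R : realType} {T} (g : T -> R[i]) : T -> R := fun x => complex.Re (g x).
Definition cIm {R : realType} {T} (g : T -> R[i]) : T -> R := fun x => complex.Im (g x).

Definition evec {R : realType} {n : nat} (i : 'I_n) : 'rV[R]_n := delta_mx 0 i.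
Definition enorm {R : realType} {n : nat} (x : 'rV[R]_n) : R :=
  Num.sqrt (\sum_i x ord0 i ^+ 2).
Definition dotp {R : realType} {n : nat} (k y : 'rV[R]_n) : R :=
  \sum_i k ord0 i * y ord0 i.

Definition mabs {n : nat} (a : 'I_n -> nat) : nat := (\sum_i a i)%N.
Definition xpow {R : realType} {n : nat} (x : 'rV[R]_n) (a : 'I_n -> nat) : R :=
  \prod_i x ord0 i ^+ a i.

Definition pd {R : realType} {n : nat} (i : 'I_n) (g : 'rV[R]_n -> R) : 'rV[R]_n -> R :=
  fun x => derive1 (fun h : R => g (x + h *: evec i)) 0.
Definition iter_pd {R : realType} {n : nat} (s : seq 'I_n) (g : 'rV[R]_n -> R) :=
  foldr (@pd R n) g s.
Definition smooth {R : realType} {n : nat} (g : 'rV[R]_n -> R) : Prop :=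
  forall s : seq 'I_n, continuous (iter_pd s g) /\
    forall (i : 'I_n) (x : 'rV[R]_n),
      derivable (fun h : R => iter_pd s g (x + h *: evec i)) 0 1.
Definition mseq {n : nat} (a : 'I_n -> nat) : seq 'I_n :=
  flatten [seq nseq (a i) i | i <- enum 'I_n].
Definition Dr {R : realType} {n : nat} (a : 'I_n -> nat) (g : 'rV[R]_n -> R) :=
  iter_pd (mseq a) g.
Definition csmooth {R : realType} {n : nat} (g : 'rV[R]_n -> R[i]) : Prop :=
  smooth (cRe g) /\ smooth (cIm g).
Definition Dc {R : realType} {n : nat} (a : 'I_n -> nat) (g : 'rV[R]_n -> R[i]) :
  'rV[R]_n -> R[i] := fun x => Complex (Dr a (cRe g) x) (Dr a (cIm g) x).

Definition schwartz {R : realType} {n : nat} (g : 'rV[R]_n -> R[i]) : Prop :=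
  csmooth g /\ forall a b : 'I_n -> nat,
    exists C : R, forall x, cabs (cR (xpow x a) * Dc b g x) <= C.

Definition distr (R : realType) (n : nat) := ('rV[R]_n -> R[i]) -> R[i].

Definition tempered {R : realType} {n : nat} (T : distr R n) : Prop :=
  (forall (a : R[i]) (g h : 'rV[R]_n -> R[i]), schwartz g -> schwartz h ->
     T (fun x => a * g x + h x) = a * T g + T h) /\
  exists (k : nat) (C : R), forall g, schwartz g ->
    forall B : R, (forall (a b : 'I_n -> nat) x, (mabs a <= k)%N -> (mabs b <= k)%N ->
                    cabs (cR (xpow x a) * Dc b g x) <= B) ->
    cabs (T g) <= C * B.

Fixpoint intRn {R : realType} (n : nat) : ('rV[R]_n -> R) -> R :=
  match n return ('rV[R]_n -> R) -> R with
  | 0 => fun g => g 0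
  | n'.+1 => fun g => Rintegral (@lebesgue_measure R) setT
      (fun t : R => intRn (fun v : 'rV[R]_n' => g (row_mx (const_mx t : 'M[R]_(1, 1)) v)))
  end.
Definition cint {R : realType} {n : nat} (g : 'rV[R]_n -> R[i]) : R[i] :=
  Complex (intRn (cRe g)) (intRn (cIm g)).

Definition FTf {R : realType} {n : nat} (g : 'rV[R]_n -> R[i]) : 'rV[R]_n -> R[i] :=
  fun k => cint (fun y => Complex (cos (dotp k y)) (sin (dotp k y)) * g y).
Definition FTd {R : realType} {n : nat} (T : distr R n) : distr R n :=
  fun g => T (FTf g).

Definition tprod {R : realType} {N M : nat} (s : distr R (N + M))
  (f : 'rV[R]_M -> R[i]) : distr R (N + M) :=
  fun g => s (fun z => f (rsubmx z) * g z).
Definition tTheta {R : realType} {N M : nat} (Th : 'rV[R]_N -> R)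
  (t : distr R (N + M)) : distr R (N + M) :=
  fun g => t (fun z => cR (Th (lsubmx z)) * g z).

Definition UVsplit {R : realType} {N : nat} (Th : 'rV[R]_N -> R) : Prop :=
  smooth Th /\ (forall y, 0 <= Th y <= 1) /\
  (\forall y \near (0 : 'rV[R]_N), Th y = 0) /\
  exists l : R, 0 < l /\
    forall (lam : R) (y : 'rV[R]_N), 1 < lam -> l < enorm y -> Th (lam *: y) = Th y.

Definition testfn {R : realType} {n : nat} (O : set 'rV[R]_n) (g : 'rV[R]_n -> R[i]) :=
  csmooth g /\ exists K : set 'rV[R]_n, compact K /\ K `<=` O /\
     forall x, ~ K x -> g x = 0.
Definition liftN {N M : nat} (a : 'I_N -> nat) : 'I_(N + M) -> nat :=
  fun j => match fintype.split j with inl i => a i | inr _ => 0%N end.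
Definition ordmi {N K : nat} (a : {ffun 'I_N -> 'I_K}) : 'I_N -> nat :=
  fun i => nat_of_ord (a i).

Definition Odist {R : realType} (N M : nat) (u : distr R (N + M)) (delta : R) : Prop :=
  exists O : set 'rV[R]_(N + M), open O /\ O 0 /\
  exists (K : nat) (ua : {ffun 'I_N -> 'I_K.+1} -> 'rV[R]_(N + M) -> R[i]),
    (forall a, forall z, O z ->
        {for z, continuous (cRe (ua a))} /\ {for z, continuous (cIm (ua a))}) /\
    (forall a, delta + (mabs (ordmi a))%:R < 0 -> forall z, O z -> ua a z = 0) /\
    (forall a, exists C : R, forall z, O z ->
        cabs (ua a z) <= C * powR (enorm (lsubmx z)) (delta + (mabs (ordmi a))%:R)) /\
    (forall g, testfn O g ->
       u g = \sum_a (-1) ^+ (mabs (ordmi a)) *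
                cint (fun z => ua a z * Dc (liftN (ordmi a)) g z)).

Definition polyterm {R : realType} {N M : nat} (d : int)
  (c : {ffun 'I_N -> 'I_(`|d|%N.+1)} -> 'rV[R]_M -> R[i]) : distr R (N + M) :=
  fun g => \sum_(gm | ((mabs (ordmi gm))%:Z < d)%R)
     cint (fun z => c gm (rsubmx z) * cR (xpow (lsubmx z) (ordmi gm)) * g z).

(* Main.v *)
(* Idea. Put psi(y) = Theta(y) - Theta(y/2). This is smooth, compactly supported and vanishes near 0,
   and Theta is the sum of the psi(y/2^n). Away from 0 one has 1 = sum_s y_s y_s / |y|^(2L) over words s
   of length L, so psi(y/2^n) = sum_s 2^(-nL) y_s psi_s(y/2^n); the factors y_s become L derivatives on
   the test function, which leaves series with the extra convergence factor 2^(-nL).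
   Each psi_s is the Fourier transform of a rapidly decreasing kernel phi (Fourier inversion), and phi is
   cut at radius about 2^n. The truncated kernel acts as a convolution that stays inside the neighbourhood
   where the O^dist representation is given: a Taylor expansion of the kernel yields polynomials in q with
   coefficients depending on q', plus remainders bounded by 2^(-nb) min(X^m, X^(m-1)) with X = 2^n |q|,
   whose sum is O(|q|^b) for m-1 < b < m. The discarded part of phi decays faster than every power of 2^n;
   there the expansion in q of the exponential inside the tempered distribution gives geometric series.
   Integration by parts finally turns derivatives of polynomial terms into polynomials of lower degree. *)

(* The representation of the transform of [t] is known only near the origin of momentum space, while
   multiplication by [Th] is a nonlocal convolution there. This forces the cut of every kernel: the
   near part never leaves the neighbourhood, and the far part must live on temperedness alone. What
   saves the far part is that it multiplies the distribution by a function that is Schwartz in y,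
   through the kernel, and in x, through [f], so that its transform is a continuous function that
   can be expanded in q at fixed q'. The number [L] of factors y is taken at least |d - eps| + 1.
   Then d - eps + [L] is positive, so that an expansion at q = 0 makes sense, and [L] >= 1 supplies
   geometric decay. As 0 < eps < 1, no exponent d - eps + |alpha| + [L] is an integer; this
   strictness makes the dyadic remainders summable for both small and large X. The analysis is real:
   cos(k.y + c) with a free phase c replaces the exponential, and differentiation only moves c by pi
   / 2. Derivatives are indexed by words, which spares multinomial coefficients; multi-indices
   return at the end. *)
Require Import Defs.
From HB Require Import structures.
From mathcomp Require Import all_boot all_order all_algebra complex.
From mathcomp Require Import all_classical all_reals all_analysis.
From mathcomp Require finmap.
From mathcomp Require Import measurable_realfun ring lra.
Set Implicit Arguments. Unset Strict Implicit. Unset Printing Implicit Defensive.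
Import Order.TTheory GRing.Theory Num.Theory.
Import numFieldTopology.Exports numFieldNormedType.Exports.
Local Open Scope classical_set_scope.
Local Open Scope ring_scope.

(** * Continuity and polynomial weights *)

Section ContinuityToolkit.
Context {R : realType} {X : topologicalType}.

Lemma nearS (x : X) (P Q : X -> Prop) : (forall z, P z -> Q z) ->
  (\forall z \near x, P z) -> \forall z \near x, Q z.
Proof. exact: filterS. Qed.

Lemma contP (Y : topologicalType) (f : X -> Y) :
  (forall x : X, {for x, continuous f}) -> continuous f.
Proof. by []. Qed.

Lemma cont_eps (f : X -> R) (x : X) :
  (forall e, 0 < e -> \forall z \near x, `|f z - f x| <= e) -> {for x, continuous f}.
Proof.
move=> fe; apply/cvgrPdist_le => e e0; apply: nearS (fe e e0) => z.
by rewrite distrC.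
Qed.

Lemma cont_near (f : X -> R) (x : X) (e : R) : {for x, continuous f} -> 0 < e ->
  \forall z \near x, `|f z - f x| <= e.
Proof.
move=> /cvgrPdist_le cf e0; apply: nearS (cf e e0) => z.
by rewrite distrC.
Qed.

Lemma cont_pair (Y Z : topologicalType) (f : X -> Y) (g : X -> Z) x :
  {for x, continuous f} -> {for x, continuous g} ->
  {for x, continuous (fun z => (f z, g z))}.
Proof. by move=> cf cg; apply: (@cvg_pair _ _ _ (nbhs x) (nbhs (f x)) (nbhs (g x))). Qed.

Lemma cont_comp (Y Z : topologicalType) (f : X -> Y) (g : Y -> Z) x :
  {for x, continuous f} -> {for f x, continuous g} ->
  {for x, continuous (fun z => g (f z))}.
Proof. by move=> cf cg; apply: continuous_comp. Qed.

Lemma contD (f g : X -> R) x : {for x, continuous f} -> {for x, continuous g} ->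
  {for x, continuous (fun z => f z + g z)}.
Proof. exact: (@continuousD R R^o X). Qed.

Lemma contB (f g : X -> R) x : {for x, continuous f} -> {for x, continuous g} ->
  {for x, continuous (fun z => f z - g z)}.
Proof. exact: (@continuousB R R^o X). Qed.

Lemma contN (f : X -> R) x : {for x, continuous f} ->
  {for x, continuous (fun z => - f z)}.
Proof. exact: (@continuousN R R^o X). Qed.

Lemma contM (f g : X -> R) x : {for x, continuous f} -> {for x, continuous g} ->
  {for x, continuous (fun z => f z * g z)}.
Proof. exact: (@continuousM R X). Qed.

Lemma contC (Y : topologicalType) (c : Y) (x : X) : {for x, continuous (fun _ : X => c)}.
Proof. exact: cst_continuous. Qed.

Lemma contid (x : X) : {for x, continuous (fun z : X => z)}.
Proof. exact: cvg_id. Qed.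

Lemma contfst (Y : topologicalType) (z : X * Y) : {for z, continuous (fun p : X * Y => p.1)}.
Proof. exact: cvg_fst. Qed.

Lemma contsnd (Y : topologicalType) (z : Y * X) : {for z, continuous (fun p : Y * X => p.2)}.
Proof. exact: cvg_snd. Qed.

Lemma contX (f : X -> R) k x : {for x, continuous f} ->
  {for x, continuous (fun z => f z ^+ k)}.
Proof.
by move=> cf; apply: (@cont_comp _ _ f (fun t => t ^+ k)) => //; exact: exprn_continuous.
Qed.

Lemma cont_norm (V : normedModType R) (f : X -> V) x : {for x, continuous f} ->
  {for x, continuous (fun z => `|f z|)}.
Proof.
by move=> cf; apply: (@cont_comp _ _ f (fun t => `|t|)) => //; exact: norm_continuous.
Qed.

Lemma contDV (V : normedModType R) (f g : X -> V) x : {for x, continuous f} ->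
  {for x, continuous g} -> {for x, continuous (fun z => f z + g z)}.
Proof. exact: (@continuousD R V X). Qed.

Lemma contBV (V : normedModType R) (f g : X -> V) x : {for x, continuous f} ->
  {for x, continuous g} -> {for x, continuous (fun z => f z - g z)}.
Proof. exact: (@continuousB R V X). Qed.

Lemma contZV (V : normedModType R) (f : X -> R) (g : X -> V) x : {for x, continuous f} ->
  {for x, continuous g} -> {for x, continuous (fun z => f z *: g z)}.
Proof. exact: (@continuousZ R V X). Qed.

End ContinuityToolkit.

Section Coordinates.
Context {R : realType}.

(** Literally the vector used in the recursion of [intRn], so that peeling off one integral is a
    conversion. *)
Definition rcons0 {n} (t : R) (v : 'rV[R]_n) : 'rV[R]_n.+1 :=
  row_mx (const_mx t : 'M[R]_(1, 1)) v.

Lemma rcons0_0 n t (v : 'rV[R]_n) : rcons0 t v ord0 ord0 = t.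
Proof.
rewrite /rcons0 (_ : (ord0 : 'I_n.+1) = lshift n (ord0 : 'I_1)); last exact/val_inj.
by rewrite (@row_mxEl R 1 1 n) mxE.
Qed.

Lemma rcons0_lift n t (v : 'rV[R]_n) i : rcons0 t v ord0 (lift ord0 i) = v ord0 i.
Proof.
rewrite /rcons0 (_ : lift ord0 i = rshift 1 i); last exact/val_inj.
by rewrite (@row_mxEr R 1 1 n).
Qed.

Definition rbehead {n} (x : 'rV[R]_n.+1) : 'rV[R]_n := \row_i x ord0 (lift ord0 i).

Lemma rcons0K n (x : 'rV[R]_n.+1) : rcons0 (x ord0 ord0) (rbehead x) = x.
Proof.
apply/rowP => i; case: (unliftP ord0 i) => [j ->|->].
  by rewrite rcons0_lift mxE.
by rewrite rcons0_0.
Qed.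

Lemma rcons0D n t u (v w : 'rV[R]_n) :
  rcons0 t v + rcons0 u w = rcons0 (t + u) (v + w).
Proof.
apply/rowP => i; rewrite mxE; case: (unliftP ord0 i) => [j ->|->].
  by rewrite !rcons0_lift mxE.
by rewrite !rcons0_0.
Qed.

(** A product weight instead of 1 + |x|^2: it factors coordinate by coordinate, as the iterated
    integral does, and its inverse is integrable. *)
Definition nW {n} (x : 'rV[R]_n) : R := \prod_i (1 + x ord0 i ^+ 2).

Lemma nW_rcons0 n t (v : 'rV[R]_n) : nW (rcons0 t v) = (1 + t ^+ 2) * nW v.
Proof.
rewrite /nW big_ord_recl rcons0_0; congr (_ * _).
by apply: eq_bigr => i _; rewrite rcons0_lift.
Qed.

Lemma onesq_ge1 (t : R) : 1 <= 1 + t ^+ 2.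
Proof. by rewrite lerDl sqr_ge0. Qed.

Lemma onesq_gt0 (t : R) : 0 < 1 + t ^+ 2.
Proof. exact: lt_le_trans (onesq_ge1 t). Qed.

Lemma prodr_ge1 (I : Type) (r : seq I) (P : pred I) (f : I -> R) :
  (forall i, 1 <= f i) -> 1 <= \prod_(i <- r | P i) f i.
Proof.
move=> f1; apply: (big_ind (fun y => 1 <= y)) => // x y x1 y1.
by rewrite -[leLHS]mulr1 ler_pM.
Qed.

Lemma nW_ge1 n (x : 'rV[R]_n) : 1 <= nW x.
Proof. by rewrite /nW; apply: prodr_ge1 => i; exact: onesq_ge1. Qed.

Lemma nW_gt0 n (x : 'rV[R]_n) : 0 < nW x.
Proof. exact: lt_le_trans (nW_ge1 x). Qed.

Lemma nW_ge_coord n (x : 'rV[R]_n) i : 1 + x ord0 i ^+ 2 <= nW x.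
Proof.
rewrite /nW (bigD1 i)//= ler_peMr ?(ltW (onesq_gt0 _))//.
by apply: prodr_ge1 => j; exact: onesq_ge1.
Qed.

Lemma normr_le_onesq (t : R) : `|t| <= 1 + t ^+ 2.
Proof.
rewrite -real_normK ?num_real//; have := sqr_ge0 (`|t| - 1).
have := normr_ge0 t; nra.
Qed.

Lemma coord_le_nW n (x : 'rV[R]_n) i : `|x ord0 i| <= nW x.
Proof. exact: le_trans (normr_le_onesq _) (nW_ge_coord x i). Qed.

Lemma ler_nWX n (x : 'rV[R]_n) k l : (k <= l)%N -> nW x ^+ k <= nW x ^+ l.
Proof. by move=> kl; apply: ler_weXn2l => //; exact: nW_ge1. Qed.

Lemma prod_continuous (Y : topologicalType) (I : Type) (r : seq I) (f : I -> Y -> R) (y : Y) :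
  (forall i, {for y, continuous (f i)}) ->
  {for y, continuous (fun x => \prod_(i <- r) f i x)}.
Proof.
move=> cf; elim: r => [|i r IH].
  have -> : (fun x => \prod_(i <- [::]) f i x) = cst 1.
    by apply/funext => x; rewrite big_nil.
  exact: cst_continuous.
have -> : (fun x => \prod_(j <- i :: r) f j x) =
    (f i : Y -> R) \* (fun x => \prod_(j <- r) f j x).
  by apply/funext => x; rewrite big_cons.
exact: (@continuousM R Y).
Qed.

Lemma sum_continuous (Y : topologicalType) (I : Type) (r : seq I) (f : I -> Y -> R) (y : Y) :
  (forall i, {for y, continuous (f i)}) ->
  {for y, continuous (fun x => \sum_(i <- r) f i x)}.
Proof.
move=> cf; elim: r => [|i r IH].
  have -> : (fun x => \sum_(i <- [::]) f i x) = cst 0.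
    by apply/funext => x; rewrite big_nil.
  exact: cst_continuous.
have -> : (fun x => \sum_(j <- i :: r) f j x) =
    (f i : Y -> R) \+ (fun x => \sum_(j <- r) f j x).
  by apply/funext => x; rewrite big_cons.
exact: (@continuousD R R^o Y).
Qed.

Lemma coordc n (i : 'I_n) : continuous (fun x : 'rV[R]_n => x ord0 i).
Proof. exact: coord_continuous. Qed.

Lemma nW_continuous n : continuous (@nW n).
Proof.
move=> x; apply: prod_continuous => i.
apply: (@continuousD R R^o) => //; first exact: cst_continuous.
by apply: (@continuousM R); exact: coordc.
Qed.

Lemma rV_continuousP (Y : topologicalType) n (F : Y -> 'rV[R]_n) (y : Y) :
  (forall i, {for y, continuous (fun y => F y ord0 i)}) -> {for y, continuous F}.
Proof.
move=> cF U [P]; rewrite /= => Pn PU.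
have : \forall z \near y, forall i, P ord0 i (F z ord0 i).
  by apply: filter_forall => i; exact: cF (Pn ord0 i).
by apply: filterS => z Pz; apply: PU => i j; rewrite ord1.
Qed.

Lemma rcons0_continuous n : continuous (fun p : R * 'rV[R]_n => rcons0 p.1 p.2).
Proof.
move=> p; apply: rV_continuousP => i; case: (unliftP ord0 i) => [j ->|->].
  have -> : (fun p : R * 'rV[R]_n => rcons0 p.1 p.2 ord0 (lift ord0 j)) =
     (fun v : 'rV[R]_n => v ord0 j) \o snd.
    by apply/funext => q /=; rewrite rcons0_lift.
  by apply: continuous_comp; [exact: cvg_snd | exact: coordc].
have -> : (fun p : R * 'rV[R]_n => rcons0 p.1 p.2 ord0 ord0) = fst.
  by apply/funext => q /=; rewrite rcons0_0.
exact: cvg_fst.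
Qed.

End Coordinates.

(** * Iterated integrals of dominated functions *)

Section DominatedUniformity.
Context {R : realType}.

Lemma nW_sublevel_compact n (M : R) : compact [set x : 'rV[R]_n | nW x <= M].
Proof.
apply: bounded_closed_compact.
  exists M; split; first exact: num_real.
  move=> N MN x /= xM; rewrite [leLHS]/Num.norm /= mx_normrE.
  apply/bigmax_leP; split=> [|[i j] _ /=].
    exact: le_trans (le_trans ler01 (nW_ge1 x)) (le_trans xM (ltW MN)).
  by rewrite ord1; exact: le_trans (coord_le_nW x j) (le_trans xM (ltW MN)).
rewrite (_ : [set x | _] = (@nW R n) @^-1` [set y | y <= M]); last by [].
by apply: closed_comp => [x _|]; [exact: nW_continuous | exact: closed_le].
Qed.

(** One power of the weight is given up to turn joint continuity into uniformity in [x]: a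
    compactness argument works where [nW] is bounded, and domination by [nW ^- 2] settles the
    rest. *)
Lemma dominated_unif (Y : topologicalType) n (F : 'rV[R]_n -> Y -> R) (y : Y) (C : R) :
  (forall x, {for (x, y), continuous (fun p : 'rV[R]_n * Y => F p.1 p.2)}) ->
  (\forall y' \near y, forall x, `|F x y'| * nW x ^+ 2 <= C) ->
  forall e, 0 < e -> \forall y' \near y, forall x, `|F x y' - F x y| * nW x <= e.
Proof.
move=> cF domF e e0.
have dom0 := nbhs_singleton domF.
(* Outside this set the two values differ by at most 2C / nW^2, which is at most e / nW. *)
pose K := [set x : 'rV[R]_n | nW x <= 2 * C / e].
have cK : compact K by exact: nW_sublevel_compact.
have cov : \forall y' \near y, K `<=` [set x | `|F x y' - F x y| * nW x <= e].
  move/compact_near_coveringP : cK; apply => x _.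
  have cFy : {for x, continuous (F ^~ y)}.
    apply: (@cont_comp _ _ _ (fun x' : 'rV[R]_n => (x', y))
       (fun p : 'rV[R]_n * Y => F p.1 p.2)); last exact: cF.
    by apply: cont_pair; [exact: contid|exact: contC].
  have cG : {for (x, y), continuous (fun p : 'rV[R]_n * Y =>
      (F p.1 p.2 - F p.1 y) * nW p.1)}.
    apply: contM.
      apply: contB; first exact: cF.
      by apply: (@cont_comp _ _ _ fst (F ^~ y)); [exact: contfst | exact: cFy].
    by apply: (@cont_comp _ _ _ fst (@nW R n)); [exact: contfst | exact: nW_continuous].
  have /cG : nbhs ((F x y - F x y) * nW x) [set z : R | `|z| < e].
    rewrite subrr mul0r; apply/nbhs_ballP; exists e => //= z.
    by rewrite /ball/= sub0r normrN.
  case=> -[U V] /= [Ux Vy] UV; exists (U, V) => //= -[x' y'] [/= Ux' Vy'].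
  have := UV (x', y') (conj Ux' Vy'); rewrite /= normrM (gtr0_norm (nW_gt0 _)).
  exact: ltW.
apply: filterS2 cov domF => y' covy domy x.
have [xK|xK] := leP (nW x) (2 * C / e); first exact: covy.
have Wx := nW_gt0 x.
rewrite -(ler_pM2r Wx) -mulrA -expr2.
apply: (@le_trans _ _ (2 * C)).
  apply: (@le_trans _ _ ((`|F x y'| + `|F x y|) * nW x ^+ 2)).
    by rewrite ler_wpM2r ?exprn_ge0 ?(ltW Wx)// ler_normB.
  by rewrite mulrDl mulr_natl mulr2n lerD.
by rewrite [leRHS]mulrC -ler_pdivrMr// ltW.
Qed.

End DominatedUniformity.

Section Integral1.
Context {R : realType}.
Local Notation mu := (@lebesgue_measure R).

Definition lint (f : R -> R) : Prop := mu.-integrable setT (EFin \o f).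

Lemma lint_onesqV : lint (fun t => (1 + t ^+ 2)^-1).
Proof.
apply/integrableP; split.
  apply/measurable_EFinP; apply: continuous_measurable_fun.
  exact: (@continuous_oneDsqrV R).
under eq_integral => x _.
  rewrite /= ger0_norm ?invr_ge0 ?(ltW (onesq_gt0 _))//; over.
rewrite (@ge0_symfun_integralT _ (fun t => (1 + t ^+ 2)^-1)).
- rewrite (_ : [set x : R | 0 <= x] = `[0, +oo[%classic); last first.
    by apply/seteqP; split => x/=; rewrite in_itv/= andbT.
  by rewrite (integral0y_oneDsqr R) -EFinM ltry.
- by move=> x; rewrite invr_ge0 (ltW (onesq_gt0 _)).
- exact: (@continuous_oneDsqrV R).
- by move=> x /=; rewrite sqrrN.
Qed.

Lemma lint_dom (f g : R -> R) : continuous f -> lint g ->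
  (forall t, `|f t| <= g t) -> lint f.
Proof.
move=> cf lg fg.
apply: (le_integrable measurableT _ _ lg).
  by apply/measurable_EFinP; apply: continuous_measurable_fun.
by move=> t _ /=; rewrite lee_fin (le_trans (fg t))// ler_norm.
Qed.

Lemma lintZ (c : R) f : lint f -> lint (fun t => c * f t).
Proof.
move=> lf; rewrite /lint (_ : EFin \o _ = fun x => (c%:E * (EFin \o f) x)%E).
  exact: integrableZl.
by apply/funext => t.
Qed.

Lemma lintD f g : lint f -> lint g -> lint (fun t => f t + g t).
Proof.
move=> lf lg; rewrite /lint (_ : EFin \o _ = (EFin \o f) \+ (EFin \o g))%E.
  exact: integrableD.
by apply/funext => t.
Qed.

End Integral1.

Section IteratedIntegral.
Context {R : realType}.
Local Notation mu := (@lebesgue_measure R).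

Lemma intRnS n (g : 'rV[R]_n.+1 -> R) :
  intRn g = Rintegral mu setT (fun t => intRn (fun v => g (rcons0 t v))).
Proof. by []. Qed.

(** [Rintegral] takes a default value on functions that are not integrable, so linearity of [intRn]
    needs integrability at every level of the iteration. *)
Fixpoint intble (n : nat) : ('rV[R]_n -> R) -> Prop :=
  match n return ('rV[R]_n -> R) -> Prop with
  | 0 => fun _ => True
  | n'.+1 => fun g => (forall t, intble (fun v : 'rV[R]_n' => g (rcons0 t v))) /\
      lint (fun t => intRn (fun v : 'rV[R]_n' => g (rcons0 t v)))
  end.

Lemma intbleS n (g : 'rV[R]_n.+1 -> R) : intble g <->
  (forall t, intble (fun v => g (rcons0 t v))) /\
  lint (fun t => intRn (fun v => g (rcons0 t v))).
Proof. by []. Qed.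

Lemma intRnZ n c (g : 'rV[R]_n -> R) : intble g ->
  intRn (fun x => c * g x) = c * intRn g.
Proof.
elim: n g => [//|n IH] g /intbleS[ig lg]; rewrite !intRnS -RintegralZl//.
by apply: eq_Rintegral => t _; apply: IH.
Qed.

Lemma intbleZ n c (g : 'rV[R]_n -> R) : intble g -> intble (fun x => c * g x).
Proof.
elim: n g => [//|n IH] g /intbleS[ig lg]; apply/intbleS; split; first by move=> t; exact: IH.
have -> : (fun t => intRn (fun v : 'rV[R]_n => c * g (rcons0 t v))) =
    (fun t => c * intRn (fun v : 'rV[R]_n => g (rcons0 t v))).
  by apply/funext => t; rewrite intRnZ.
exact: lintZ.
Qed.

Lemma intRnD n (f g : 'rV[R]_n -> R) : intble f -> intble g ->
  intRn (fun x => f x + g x) = intRn f + intRn g.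
Proof.
elim: n f g => [//|n IH] f g /intbleS[jf lf] /intbleS[jg lg]; rewrite !intRnS -RintegralD//.
by apply: eq_Rintegral => t _; apply: IH.
Qed.

Lemma intbleD n (f g : 'rV[R]_n -> R) : intble f -> intble g ->
  intble (fun x => f x + g x).
Proof.
elim: n f g => [//|n IH] f g /intbleS[jf lf] /intbleS[jg lg]; apply/intbleS; split; first by move=> t; exact: IH.
have -> : (fun t => intRn (fun v : 'rV[R]_n => f (rcons0 t v) + g (rcons0 t v))) =
    (fun t => intRn (fun v : 'rV[R]_n => f (rcons0 t v)) +
              intRn (fun v : 'rV[R]_n => g (rcons0 t v))).
  by apply/funext => t; rewrite intRnD.
exact: lintD.
Qed.

Lemma intRnN n (g : 'rV[R]_n -> R) : intble g ->
  intRn (fun x => - g x) = - intRn g.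
Proof.
move=> ig; rewrite -mulN1r -intRnZ//; congr intRn.
by apply/funext => x; rewrite mulN1r.
Qed.

Lemma intbleN n (g : 'rV[R]_n -> R) : intble g -> intble (fun x => - g x).
Proof.
move=> ig; have -> : (fun x => - g x) = (fun x => -1 * g x).
  by apply/funext => x; rewrite mulN1r.
exact: intbleZ.
Qed.

Lemma intRn_le n (f g : 'rV[R]_n -> R) : intble f -> intble g ->
  (forall x, f x <= g x) -> intRn f <= intRn g.
Proof.
elim: n f g => [f g _ _ fg|n IH f g /intbleS[jf lf] /intbleS[jg lg] fg]; first exact: fg.
by rewrite !intRnS; apply: le_Rintegral => // t _; exact: IH.
Qed.

Lemma intRn_abs_le n (f g : 'rV[R]_n -> R) : intble f -> intble g ->
  (forall x, `|f x| <= g x) -> `|intRn f| <= intRn g.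
Proof.
move=> jf jg fg; rewrite ler_norml; apply/andP; split.
  rewrite -intRnN//; apply: intRn_le => //; first exact: intbleN.
  by move=> x; have := fg x; rewrite ler_norml => /andP[].
by apply: intRn_le => // x; have := fg x; rewrite ler_norml => /andP[].
Qed.

Lemma intble_nWV n : intble (fun x : 'rV[R]_n => (nW x)^-1).
Proof.
elim: n => [//|n IH]; apply/intbleS; split=> [t|].
  have -> : (fun v : 'rV[R]_n => (nW (rcons0 t v))^-1) =
      (fun v => (1 + t ^+ 2)^-1 * (nW v)^-1).
    by apply/funext => v; rewrite nW_rcons0 invfM.
  exact: intbleZ.
have -> : (fun t => intRn (fun v : 'rV[R]_n => (nW (rcons0 t v))^-1)) =
    (fun t => intRn (fun v : 'rV[R]_n => (nW v)^-1) * (1 + t ^+ 2)^-1).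
  apply/funext => t; rewrite mulrC -intRnZ//; congr intRn.
  by apply/funext => v; rewrite nW_rcons0 invfM.
exact/lintZ/lint_onesqV.
Qed.

Definition InW n : R := intRn (fun x : 'rV[R]_n => (nW x)^-1).

Lemma InW_ge0 n : 0 <= InW n.
Proof.
have := @intRn_le n (fun x => 0 * (nW x)^-1) (fun x => (nW x)^-1)
  (intbleZ 0 (intble_nWV n)) (intble_nWV n).
rewrite intRnZ; last exact: intble_nWV.
by rewrite mul0r; apply => x; rewrite mul0r invr_ge0 (ltW (nW_gt0 x)).
Qed.

(** The square of the weight is deliberate: one power makes the function integrable, the other is
    spent in [dominated_unif] for continuity in parameters. *)
Definition dec n (F : 'rV[R]_n -> R) : Prop :=
  continuous F /\ exists C, forall x, `|F x| * nW x ^+ 2 <= C.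

Lemma dec_rcons0 n (F : 'rV[R]_n.+1 -> R) t : dec F -> dec (fun v => F (rcons0 t v)).
Proof.
move=> [cF [C FC]]; split.
  move=> v; apply: (@cont_comp _ _ _ (rcons0 t) F); last exact: cF.
  apply: (@cont_comp _ _ _ (fun v => (t, v)) (fun p : R * 'rV[R]_n => rcons0 p.1 p.2)).
    by apply: cont_pair; [exact: contC | exact: contid].
  exact: rcons0_continuous.
exists C => v; apply: le_trans (FC (rcons0 t v)).
rewrite ler_wpM2l// nW_rcons0 exprMn ler_peMl ?exprn_ge0 ?(ltW (nW_gt0 _))//.
exact/exprn_ege1/onesq_ge1.
Qed.

Lemma intRn_small n (f : 'rV[R]_n -> R) e : intble f ->
  (forall x, `|f x| * nW x <= e) -> `|intRn f| <= e * InW n.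
Proof.
move=> jf fe; rewrite -intRnZ; last exact: intble_nWV.
apply: intRn_abs_le => // [|x]; first exact/intbleZ/intble_nWV.
by rewrite ler_pdivlMr ?nW_gt0.
Qed.

Lemma dec_bound1 n (F : 'rV[R]_n -> R) C :
  (forall x, `|F x| * nW x ^+ 2 <= C) -> forall x, `|F x| * nW x <= C.
Proof.
move=> FC x; apply: le_trans (FC x); rewrite ler_wpM2l//.
by rewrite expr2 ler_peMr ?nW_ge1// (ltW (nW_gt0 x)).
Qed.

Lemma intRn_continuous_param (Y : topologicalType) n (F : 'rV[R]_n -> Y -> R) y C :
  (forall y', intble (F ^~ y')) ->
  (forall x, {for (x, y), continuous (fun p : 'rV[R]_n * Y => F p.1 p.2)}) ->
  (\forall y' \near y, forall x, `|F x y'| * nW x ^+ 2 <= C) ->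
  {for y, continuous (fun y' => intRn (F ^~ y'))}.
Proof.
move=> iF cF dF; apply/cvgrPdist_le => e e0.
have e1 : 0 < e / (InW n + 1) by rewrite divr_gt0// ltr_wpDl// InW_ge0.
apply: filterS (dominated_unif cF dF e1) => y' Fy'.
rewrite distrC -intRnN// -intRnD//; last exact: intbleN.
apply: le_trans (@intRn_small _ (fun x => F x y' - F x y) _ _ Fy') _.
  by apply: intbleD => //; exact: intbleN.
rewrite mulrAC ler_pdivrMr ?ltr_wpDl ?InW_ge0// ler_wpM2l ?(ltW e0)//.
by rewrite lerDl.
Qed.

(** Measurability in the outermost variable is obtained from continuity of the inner integral, which
    is why continuity in parameters had to come first. *)
Lemma dec_intble n (F : 'rV[R]_n -> R) : dec F -> intble F.
Proof.
elim: n F => [//|n IH] F dF; apply/intbleS; split=> [t|]; first exact/IH/dec_rcons0.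
have [cF [C FC]] := dF.
apply: (@lint_dom _ _ (fun t => C * InW n * (1 + t ^+ 2)^-1)).
- move=> t; apply: (@intRn_continuous_param R _ (fun v t => F (rcons0 t v)) t C).
  + by move=> t'; exact/IH/dec_rcons0.
  + move=> v; apply: (@cont_comp _ _ _ (fun p : 'rV[R]_n * R => rcons0 p.2 p.1) F);
      last exact: cF.
    apply: (@cont_comp _ _ _ (fun p : 'rV[R]_n * R => (p.2, p.1))
       (fun p : R * 'rV[R]_n => rcons0 p.1 p.2)); last exact: rcons0_continuous.
    by apply: cont_pair; [exact: contsnd | exact: contfst].
  + apply: (@filterE R (nbhs (t : R)) _ _ _) => t' x; apply: le_trans (FC (rcons0 t' x)).
    rewrite ler_wpM2l// nW_rcons0 exprMn ler_peMl ?exprn_ge0 ?(ltW (nW_gt0 _))//.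
    exact/exprn_ege1/onesq_ge1.
- exact/lintZ/lint_onesqV.
- move=> t; rewrite mulrAC; apply: intRn_small; first exact/IH/dec_rcons0.
  move=> v; rewrite ler_pdivlMr ?onesq_gt0// -mulrA [nW v * _]mulrC -nW_rcons0.
  exact: dec_bound1.
Qed.

End IteratedIntegral.

Section DecayClosure.
Context {R : realType}.

Lemma dec_compact n (F : 'rV[R]_n -> R) (K : set 'rV[R]_n) : continuous F -> compact K ->
  (forall x, ~ K x -> F x = 0) -> dec F.
Proof.
move=> cF cK F0; split=> //.
pose G x := `|F x| * nW x ^+ 2.
have cG : continuous (fun x => `|F x| * nW x ^+ 2).
  apply: contP => x; apply: contM.
    by apply: cont_norm; exact: cF.
  by apply: contX; exact: nW_continuous.
have /compact_bounded [M [Mr MG]] : compact (G @` K).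
  by apply: continuous_compact => //; exact: continuous_subspaceT.
exists (Num.max 0 (M + 1)) => x; have [Kx|nKx] := pselect (K x).
  rewrite le_max; apply/orP; right.
  by apply: le_trans (ler_norm _) (MG (M + 1) _ (G x) _); [rewrite ltrDl|exists x].
by rewrite F0// normr0 mul0r le_max lexx.
Qed.

Lemma closed_ball_compact n (c : 'rV[R]_n) r : compact [set x | `|x - c| <= r].
Proof.
apply: bounded_closed_compact.
  exists (`|c| + r); split; first exact: num_real.
  move=> N MN x /= xM; apply: le_trans (ltW MN).
  by rewrite -[x](subrK c) addrC (le_trans (ler_normD _ _))// lerD2l.
rewrite (_ : [set x | _] = (fun x => `|x - c|) @^-1` [set y | y <= r]); last by [].
apply: closed_comp; last exact: closed_le.
move=> x _; apply: contP => {}x.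
by apply: cont_norm; apply: contBV; [exact: contid | exact: contC].
Qed.

Lemma decZ n c (f : 'rV[R]_n -> R) : dec f -> dec (fun x => c * f x).
Proof.
move=> [cf [C fC]]; split; first by apply: contP => x; apply: contM; [exact: contC|exact: cf].
by exists (`|c| * C) => x; rewrite normrM -mulrA ler_wpM2l.
Qed.

Lemma decD n (f g : 'rV[R]_n -> R) : dec f -> dec g -> dec (fun x => f x + g x).
Proof.
move=> [cf [C fC]] [cg [D gD]]; split; first by apply: contP => x; apply: contD; [exact: cf|exact: cg].
exists (C + D) => x; apply: le_trans (lerD (fC x) (gD x)).
by rewrite -mulrDl ler_wpM2r ?exprn_ge0 ?(ltW (nW_gt0 x))// ler_normD.
Qed.

Lemma decN n (f : 'rV[R]_n -> R) : dec f -> dec (fun x => - f x).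
Proof.
move=> df; have -> : (fun x => - f x) = (fun x => -1 * f x).
  by apply/funext => x; rewrite mulN1r.
exact: decZ.
Qed.

Lemma dec0 n : dec (fun _ : 'rV[R]_n => 0).
Proof. by split; [exact: contC | exists 0 => x; rewrite normr0 mul0r]. Qed.

Lemma dec_sum n (I : Type) (r : seq I) (f : I -> 'rV[R]_n -> R) :
  (forall i, dec (f i)) -> dec (fun x => \sum_(i <- r) f i x).
Proof.
move=> df; elim: r => [|i r IH].
  have -> : (fun x => \sum_(i <- [::]) f i x) = fun=> 0.
    by apply/funext => x; rewrite big_nil.
  exact: dec0.
have -> : (fun x => \sum_(j <- i :: r) f j x) = (fun x => f i x + \sum_(j <- r) f j x).
  by apply/funext => x; rewrite big_cons.
exact: decD.
Qed.

Lemma intRn0 n : intRn (fun _ : 'rV[R]_n => 0) = 0 :> R.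
Proof.
have -> : (fun _ : 'rV[R]_n => 0) = (fun x => 0 * (nW x)^-1).
  by apply/funext => x; rewrite mul0r.
by rewrite intRnZ ?mul0r//; exact: intble_nWV.
Qed.

Lemma intRn_sum n (I : Type) (r : seq I) (f : I -> 'rV[R]_n -> R) :
  (forall i, dec (f i)) ->
  intRn (fun x => \sum_(i <- r) f i x) = \sum_(i <- r) intRn (f i).
Proof.
move=> df; elim: r => [|i r IH].
  rewrite big_nil -[RHS](intRn0 n); congr intRn; apply/funext => x.
  by rewrite big_nil.
rewrite big_cons -IH -intRnD; [|exact: dec_intble|exact/dec_intble/dec_sum].
by congr intRn; apply/funext => x; rewrite big_cons.
Qed.

Lemma dec_dom n (f g : 'rV[R]_n -> R) : continuous f -> dec g ->
  (forall x, `|f x| <= `|g x|) -> dec f.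
Proof.
move=> cf [_ [C gC]] fg; split=> //; exists C => x; apply: le_trans (gC x).
by rewrite ler_wpM2r// exprn_ge0// (ltW (nW_gt0 x)).
Qed.

End DecayClosure.

(** * Exchanging a continuous functional with an integral *)

Section PartitionOfUnity.
Context {R : realType} {X : Type} {n : nat}.
Variables (bd : (X -> R) -> R -> Prop) (S : 'rV[R]_n -> X -> R).
Hypothesis bd0 : bd (fun=> 0) 0.
Hypothesis bdD : forall f g A B, bd f A -> bd g B -> bd (fun x => f x + g x) (A + B).
Hypothesis bdZ : forall c f A, 0 <= c -> bd f A -> bd (fun x => c * f x) (c * A).
Hypothesis bd_le : forall f A B, bd f A -> A <= B -> bd f B.

Lemma bd_sum (I : Type) (r : seq I) (f : I -> X -> R) (A : I -> R) :
  (forall i, bd (f i) (A i)) ->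
  bd (fun x => \sum_(i <- r) f i x) (\sum_(i <- r) A i).
Proof.
move=> bf; elim: r => [|i r IH].
  rewrite big_nil; have -> : (fun x => \sum_(i <- [::]) f i x) = fun=> 0.
    by apply/funext => x; rewrite big_nil.
  exact: bd0.
rewrite big_cons.
have -> : (fun x => \sum_(j <- i :: r) f j x) = (fun x => f i x + \sum_(j <- r) f j x).
  by apply/funext => x; rewrite big_cons.
exact: bdD.
Qed.

Variable C : R.
Hypothesis S_cont : forall z0 e, 0 < e ->
  \forall z \near z0, bd (fun x => S z x - S z0 x) (e / nW z).
Hypothesis S_dom : forall z, bd (S z) (C / nW z ^+ 2).

(** A substitute for Riemann sums of a function-valued map [S]: normalized tents around finitely
    many centres interpolate [S] in the gauge [bd]. A partition of unity keeps the coefficients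
    continuous in [z], hence integrable. *)
Lemma partition_approx e : 0 < e -> exists (l : seq 'rV[R]_n) (lam : 'rV[R]_n -> 'rV[R]_n -> R),
  (forall c, dec (lam c)) /\
  forall z, bd (fun x => S z x - \sum_(c <- l) lam c z * S c x) (e / nW z).
Proof.
move=> e0.
have /choice[r Hr] : forall c : 'rV[R]_n, exists r : R, 0 < r /\
    forall z, `|z - c| < r -> bd (fun x => S z x - S c x) (e / nW z).
  move=> c; have /nbhs_ballP[r r0 rP] := S_cont c e0.
  by exists r; split=> // z zc; apply: rP; rewrite mx_norm_ball /ball_/= distrC.
(* Where [nW z >= C / e], the bound [S_dom] alone is below [e / nW z]. *)
pose M := C / e.
pose K := [set z : 'rV[R]_n | nW z <= M].
have cK : compact K by exact: nW_sublevel_compact.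
have : cover_compact K by rewrite -compact_cover.
move=> /(_ _ setT (fun c => ball c (r c))) [].
- by move=> c _; exact: ball_open.
- by move=> z _; exists z => //; exact: ballxx (proj1 (Hr z)).
move=> D _ KD; pose l : seq 'rV[R]_n := finmap.enum_fset D.
pose b c (z : 'rV[R]_n) := Num.max 0 (r c - `|z - c|).
(* This member of the partition covers the neighbourhood of infinity. It has no centre: it is
   dropped from the approximating sum because [S z] is itself small where it is positive. *)
pose binf (z : 'rV[R]_n) := Num.max 0 (nW z - M).
pose B z := \sum_(c <- l) b c z + binf z.
have b_ge0 c z : 0 <= b c z by rewrite le_max lexx.
have binf_ge0 z : 0 <= binf z by rewrite le_max lexx.
have sb_ge0 z : 0 <= \sum_(c <- l) b c z by apply: sumr_ge0.
have B_gt0 z : 0 < B z.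
  have [Kz|] := leP (nW z) M; last first.
    move=> Mz; apply: ltr_wpDl => //.
    by rewrite /binf lt_max subr_gt0 Mz orbT.
  apply: ltr_pwDl => //.
  have [c /= cD zc] := KD z Kz.
  have bc : 0 < b c z.
    by rewrite /b lt_max subr_gt0; move: zc; rewrite mx_norm_ball/= /ball_/= distrC => ->; rewrite orbT.
  rewrite (big_rem c) /=; last exact: cD.
  by apply: ltr_pwDl => //; apply: sumr_ge0.
have cb c : continuous (b c).
  apply: contP => z; apply: (@continuous_max R); first exact: contC.
  apply: contB; first exact: contC.
  by apply: cont_norm; apply: contBV; [exact: contid | exact: contC].
have cB : continuous B.
  apply: contP => z; apply: contD; first by apply: sum_continuous => c; exact: cb.
  apply: (@continuous_max R); first exact: contC.
  by apply: contB; [exact: nW_continuous | exact: contC].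
have cBV : continuous (fun z => (B z)^-1).
  by move=> z; apply: continuousV; [rewrite gt_eqF | exact: cB].
exists l, (fun c z => b c z / B z); split.
  move=> c; apply: (@dec_compact _ _ _ [set z | `|z - c| <= r c]).
  - by apply: contP => z; apply: contM; [exact: cb | exact: cBV].
  - exact: closed_ball_compact.
  - move=> z /= /negP; rewrite -ltNge => rz; rewrite /b max_l ?mul0r//.
    by rewrite subr_le0 ltW.
move=> z.
have B1 : \sum_(c <- l) b c z / B z + binf z / B z = 1.
  by rewrite -mulr_suml -mulrDl -/(B z) divff// gt_eqF ?B_gt0.
have -> : (fun x => S z x - \sum_(c <- l) b c z / B z * S c x) =
    (fun x => \sum_(c <- l) b c z / B z * (S z x - S c x) + binf z / B z * S z x).
  apply/funext => x.
  under [in RHS]eq_bigr do rewrite mulrBr.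
  rewrite sumrB -mulr_suml addrAC -mulrDl.
  by rewrite B1 mul1r.
rewrite (_ : e / nW z = \sum_(c <- l) b c z / B z * (e / nW z) + binf z / B z * (e / nW z)); last first.
  by rewrite -mulr_suml -mulrDl B1 mul1r.
have eW0 : 0 <= e / nW z by rewrite divr_ge0 ?ltW// nW_gt0.
apply: bdD.
  apply: bd_sum => c.
  have [bc|bc] := leP (b c z) 0.
    have -> : b c z = 0 by apply/le_anti; rewrite bc b_ge0.
    rewrite mul0r mul0r; have -> : (fun x => 0 * (S z x - S c x)) = (fun=> 0).
      by apply/funext => x; rewrite mul0r.
    exact: bd0.
  apply: bdZ; first by rewrite divr_ge0 ?(ltW (B_gt0 z)).
  by apply: (proj2 (Hr c)); move: bc; rewrite /b lt_max ltxx/= subr_gt0.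
have [bc|bc] := leP (binf z) 0.
  have -> : binf z = 0 by apply/le_anti; rewrite bc binf_ge0.
  rewrite mul0r mul0r; have -> : (fun x => 0 * S z x) = (fun=> 0).
    by apply/funext => x; rewrite mul0r.
  exact: bd0.
apply: bdZ; first by rewrite divr_ge0 ?(ltW (B_gt0 z)).
apply: bd_le (S_dom z) _; have Wz := nW_gt0 z.
have MW : M <= nW z by move: bc; rewrite /binf lt_max ltxx/= subr_gt0 => /ltW.
rewrite expr2 invfM mulrA ler_wpM2r ?invr_ge0 ?(ltW Wz)//.
by rewrite ler_pdivrMr// -ler_pdivrMl// mulrC.
Qed.

End PartitionOfUnity.

Section IntegralCommutes.
Context {R : realType} {X : Type} {n : nat}.
Variables (E : (X -> R) -> Prop) (bd : (X -> R) -> R -> Prop).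
Variables (T : (X -> R) -> R) (K : R) (S : 'rV[R]_n -> X -> R) (C : R).
Hypothesis bd0 : bd (fun=> 0) 0.
Hypothesis bdD : forall f g A B, bd f A -> bd g B -> bd (fun x => f x + g x) (A + B).
Hypothesis bdZ : forall (c : R) f A, 0 <= c -> bd f A -> bd (fun x => c * f x) (c * A).
Hypothesis bd_le : forall f A B, bd f A -> A <= B -> bd f B.
Hypothesis S_cont : forall (z0 : 'rV[R]_n) e, 0 < e ->
  \forall z \near z0, bd (fun x => S z x - S z0 x) (e / nW z).
Hypothesis S_dom : forall z, bd (S z) (C / nW z ^+ 2).
Hypothesis E_lin : forall a f g, E f -> E g -> E (fun x => a * f x + g x).
Hypothesis ES : forall z, E (S z).
Hypothesis EI : E (fun x => intRn (S ^~ x)).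
Hypothesis T_lin : forall a f g, E f -> E g ->
  T (fun x => a * f x + g x) = a * T f + T g.
Hypothesis K_ge0 : 0 <= K.
Hypothesis T_bd : forall f B, E f -> bd f B -> `|T f| <= K * B.
(** The gauge is abstract, so each application has to supply its own passage of a pointwise estimate
    through the integral. *)
Hypothesis bd_int : forall (l : seq 'rV[R]_n) (lam : 'rV[R]_n -> 'rV[R]_n -> R) e,
  (forall c, dec (lam c)) ->
  (forall z, bd (fun x => S z x - \sum_(c <- l) lam c z * S c x) (e / nW z)) ->
  bd (fun x => intRn (S ^~ x) - \sum_(c <- l) intRn (lam c) * S c x) (e * InW n).

Let E_sub f g : E f -> E g -> E (fun x => f x - g x).
Proof.
move=> Ef Eg; have -> : (fun x => f x - g x) = (fun x => -1 * g x + f x).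
  by apply/funext => x; rewrite mulN1r addrC.
exact: E_lin.
Qed.

Let T_sub f g : E f -> E g -> T (fun x => f x - g x) = T f - T g.
Proof.
move=> Ef Eg; have -> : (fun x => f x - g x) = (fun x => -1 * g x + f x).
  by apply/funext => x; rewrite mulN1r addrC.
by rewrite T_lin// mulN1r addrC.
Qed.

Let E0 : E (fun=> 0).
Proof.
have := E_sub (ES 0) (ES 0).
by have -> : (fun x => S 0 x - S 0 x) = fun=> 0 by apply/funext => x; rewrite subrr.
Qed.

Let T0 : T (fun=> 0) = 0.
Proof.
have := T_sub E0 E0.
have -> : (fun x : X => 0 - 0 : R) = fun=> 0 by apply/funext => x; rewrite subrr.
by rewrite subrr.
Qed.

Let E_comb l (a : 'rV[R]_n -> R) : E (fun x => \sum_(c <- l) a c * S c x) /\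
  T (fun x => \sum_(c <- l) a c * S c x) = \sum_(c <- l) a c * T (S c).
Proof.
elim: l => [|c l [IH1 IH2]].
  have -> : (fun x : X => \sum_(c <- [::]) a c * S c x) = fun=> 0.
    by apply/funext => x; rewrite big_nil.
  by rewrite big_nil T0; split=> //; exact: E0.
have -> : (fun x : X => \sum_(d <- c :: l) a d * S d x) =
    (fun x => a c * S c x + \sum_(d <- l) a d * S d x).
  by apply/funext => x; rewrite big_cons.
by rewrite T_lin// IH2 big_cons; split=> //; exact: E_lin.
Qed.

Lemma dec_commute : dec (fun z => T (S z)).
Proof.
split.
  apply: contP => z0; apply: cont_eps => e e0.
  have e1 : 0 < e / (K + 1) by rewrite divr_gt0// ltr_wpDl.
  apply: nearS (S_cont z0 e1) => z bz.
  rewrite -T_sub//; apply: (le_trans (T_bd (E_sub (ES z) (ES z0)) bz)).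
  apply: (@le_trans _ _ (K * (e / (K + 1)))).
    rewrite ler_wpM2l// ler_piMr ?(ltW e1)//.
    by rewrite invf_le1 ?nW_gt0// nW_ge1.
  by rewrite mulrCA ger_pMr// ler_pdivrMr ?mul1r ?ltr_wpDl// lerDl.
exists (K * C) => z; have := T_bd (ES z) (S_dom z).
by rewrite mulrA ler_pdivlMr// exprn_gt0// nW_gt0.
Qed.

(** Both sides are close to the same finite combination of the [T (S c)]. The result serves twice:
    with [T] an integral it yields Fubini, with [T] a tempered functional it yields
    [tau_osc_commute]. *)
Lemma intRn_commute : T (fun x => intRn (S ^~ x)) = intRn (fun z => T (S z)).
Proof.
apply/eqP; rewrite -subr_eq0 -normr_eq0 eq_le normr_ge0 andbT.
apply/ler_addgt0Pr => e e0; rewrite add0r.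
(* Each of the two comparisons below costs K (e / D) [InW n]; the summand 1 keeps [D] positive. *)
pose D := 2 * K * InW n + 1.
have D0 : 0 < D by rewrite ltr_wpDl// mulr_ge0 ?InW_ge0// mulr_ge0.
have e1 : 0 < e / D by rewrite divr_gt0.
have [l [lam [dlam Hl]]] := partition_approx bd0 bdD bdZ bd_le S_cont S_dom e1.
pose A := \sum_(c <- l) intRn (lam c) * T (S c).
have h1 : `|T (fun x => intRn (S ^~ x)) - A| <= K * (e / D * InW n).
  have [EA TA] := E_comb l (fun c => intRn (lam c)).
  by rewrite /A -TA -T_sub//; apply: T_bd; [exact: E_sub | exact: bd_int].
have h2 : `|intRn (fun z => T (S z)) - A| <= K * (e / D) * InW n.
  have dl c : dec (fun z => lam c z * T (S c)).
    have -> : (fun z => lam c z * T (S c)) = (fun z => T (S c) * lam c z).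
      by apply/funext => z; rewrite mulrC.
    exact: decZ.
  have dsum : intble (fun z => \sum_(c <- l) lam c z * T (S c)).
    by apply: dec_intble; apply: dec_sum.
  have dS := dec_intble dec_commute.
  have -> : A = intRn (fun z => \sum_(c <- l) lam c z * T (S c)).
    rewrite intRn_sum//; apply: eq_bigr => c _.
    rewrite mulrC -intRnZ; last exact: dec_intble.
    by congr intRn; apply/funext => z; rewrite mulrC.
  rewrite -intRnN// -intRnD//; last exact: intbleN.
  apply: intRn_small; first by apply: intbleD => //; exact: intbleN.
  move=> z; have [EA TA] := E_comb l (fun c => lam c z).
  rewrite -TA -T_sub//; have := T_bd (E_sub (ES z) EA) (Hl z).
  by rewrite mulrA ler_pdivlMr ?nW_gt0.
apply: (le_trans _ (le_trans (lerD h1 h2) _)).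
  by rewrite [`|intRn _ - A|]distrC; exact: ler_distD.
rewrite (_ : _ + _ = e * (2 * K * InW n / D)); last by ring.
by rewrite ger_pMr// ler_pdivrMr// mul1r /D lerDl.
Qed.

End IntegralCommutes.

Section FubiniIterated.
Context {R : realType} {n m : nat}.
Variables (F : 'rV[R]_n -> 'rV[R]_m -> R) (C : R).
Hypothesis cF : continuous (fun p : 'rV[R]_n * 'rV[R]_m => F p.1 p.2).
Hypothesis dF : forall x y, `|F x y| * nW x ^+ 2 * nW y ^+ 2 <= C.

Let F_contl y : continuous (F ^~ y).
Proof.
apply: contP => x; apply: (@cont_comp _ _ _ (fun x => (x, y)) (fun p => F p.1 p.2)).
  by apply: cont_pair; [exact: contid | exact: contC].
exact: cF.
Qed.

Let F_contr x : continuous (F x).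
Proof.
apply: contP => y; apply: (@cont_comp _ _ _ (fun y => (x, y)) (fun p => F p.1 p.2)).
  by apply: cont_pair; [exact: contC | exact: contid].
exact: cF.
Qed.

Let nW2_ge1 k (x : 'rV[R]_k) : 1 <= nW x ^+ 2.
Proof. exact/exprn_ege1/nW_ge1. Qed.

Let domr x y : `|F x y| * nW y ^+ 2 <= C.
Proof.
apply: le_trans (dF x y); rewrite ler_wpM2r ?exprn_ge0 ?(ltW (nW_gt0 y))//.
by rewrite ler_peMr.
Qed.

Let doml x y : `|F x y| * nW x ^+ 2 <= C.
Proof.
apply: le_trans (dF x y); rewrite ler_peMr// mulr_ge0//.
by rewrite exprn_ge0// (ltW (nW_gt0 x)).
Qed.

Lemma dec_sliceL y : dec (F ^~ y).
Proof. by split=> //; exists C => x; exact: doml. Qed.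

Lemma dec_sliceR x : dec (F x).
Proof. by split=> //; exists C => y; exact: domr. Qed.

Lemma dec_intRnL : dec (fun y => intRn (F ^~ y)).
Proof.
split.
  apply: contP => y; apply: (@intRn_continuous_param _ _ _ F y C).
  - by move=> y'; exact/dec_intble/dec_sliceL.
  - by move=> x; exact: cF.
  - by apply: filterE => y' x; exact: doml.
exists (C * InW n) => y.
rewrite mulrC -[X in X * _]ger0_norm; last by rewrite exprn_ge0// (ltW (nW_gt0 y)).
rewrite -normrM -intRnZ; last exact/dec_intble/dec_sliceL.
apply: intRn_small; first exact/intbleZ/dec_intble/dec_sliceL.
move=> x; rewrite normrM [`|_ ^+ 2|]ger0_norm; last by rewrite exprn_ge0// (ltW (nW_gt0 y)).
apply: le_trans (dF x y).
rewrite [leLHS](_ : _ = `|F x y| * nW x * nW y ^+ 2); last by ring.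
rewrite ler_wpM2r ?exprn_ge0 ?(ltW (nW_gt0 y))// ler_wpM2l// expr2 ler_peMr ?nW_ge1//.
exact: ltW (nW_gt0 x).
Qed.

(** The integral over the second block is a linear functional that is bounded in the gauge sup |f|
    [nW], so it commutes with the integral over the first block. *)
Lemma intRn_Fubini :
  dec (fun x => intRn (F x)) /\
  intRn (fun x => intRn (F x)) = intRn (fun y => intRn (F ^~ y)).
Proof.
pose bd (f : 'rV[R]_m -> R) (B : R) := forall y, `|f y| * nW y <= B.
have bd0 : bd (fun=> 0) 0 by move=> y; rewrite normr0 mul0r.
have bdD f g A B : bd f A -> bd g B -> bd (fun x => f x + g x) (A + B).
  move=> fA gB y; apply: le_trans (lerD (fA y) (gB y)).
  by rewrite -mulrDl ler_wpM2r ?(ltW (nW_gt0 y))// ler_normD.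
have bdZ (c : R) f A : 0 <= c -> bd f A -> bd (fun x => c * f x) (c * A).
  by move=> c0 fA y; rewrite normrM ger0_norm// -mulrA ler_wpM2l.
have bd_le f A B : bd f A -> A <= B -> bd f B.
  by move=> fA AB y; exact: le_trans (fA y) AB.
have S_cont (z0 : 'rV[R]_n) e : 0 < e ->
    \forall z \near z0, bd (fun x => F z x - F z0 x) (e / nW z).
  move=> e0; have W0 : 0 < nW z0 + 1 by rewrite ltr_wpDl// (ltW (nW_gt0 z0)).
  have e1 : 0 < e / (nW z0 + 1) by rewrite divr_gt0.
  have cF' y : {for (y, z0), continuous (fun p : 'rV[R]_m * 'rV[R]_n => F p.2 p.1)}.
    apply: (@cont_comp _ _ _ (fun p => (p.2, p.1)) (fun p => F p.1 p.2)).
      by apply: cont_pair; [exact: contsnd | exact: contfst].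
    exact: cF.
  have h1 : \forall z \near z0, forall y, `|F z y - F z0 y| * nW y <= e / (nW z0 + 1).
    apply: (@dominated_unif _ _ _ (fun y z => F z y) z0 C) => //.
    by apply: filterE => z y; exact: domr.
  have h2 := cont_near (@nW_continuous R n z0) ltr01.
  apply: filterS2 h1 h2 => z h1 h2 y; apply: le_trans (h1 y) _.
  rewrite ler_wpM2l ?(ltW e0)// lef_pV2 ?posrE ?nW_gt0//.
  by move: h2 => /(le_trans (ler_norm _)); rewrite lerBlDl.
have S_dom z : bd (F z) (C / nW z ^+ 2).
  move=> y; rewrite ler_pdivlMr ?exprn_gt0 ?nW_gt0//.
  apply: le_trans (dF z y); rewrite mulrAC ler_wpM2l//.
    by rewrite mulr_ge0// exprn_ge0// (ltW (nW_gt0 z)).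
  by rewrite expr2 ler_peMr ?nW_ge1// (ltW (nW_gt0 y)).
have E_lin (a : R) (f g : 'rV[R]_m -> R) : dec f -> dec g -> dec (fun x => a * f x + g x).
  by move=> df dg; apply: decD => //; exact: decZ.
have T_lin (a : R) (f g : 'rV[R]_m -> R) : dec f -> dec g ->
    intRn (fun x => a * f x + g x) = a * intRn f + intRn g.
  move=> df dg; rewrite intRnD ?intRnZ//; [exact: dec_intble| |exact: dec_intble].
  exact/intbleZ/dec_intble.
have T_bd f B : dec f -> bd f B -> `|intRn f| <= InW m * B.
  by move=> df fB; rewrite mulrC; apply: intRn_small => //; exact: dec_intble.
have bd_int (l : seq 'rV[R]_n) (lam : 'rV[R]_n -> 'rV[R]_n -> R) e :
    (forall c, dec (lam c)) ->
    (forall z, bd (fun x => F z x - \sum_(c <- l) lam c z * F c x) (e / nW z)) ->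
    bd (fun x => intRn (F ^~ x) - \sum_(c <- l) intRn (lam c) * F c x) (e * InW n).
  move=> dlam Hl y.
  have dl c : dec (fun z => lam c z * F c y).
    have -> : (fun z => lam c z * F c y) = (fun z => F c y * lam c z).
      by apply/funext => z; rewrite mulrC.
    exact: decZ.
  have -> : \sum_(c <- l) intRn (lam c) * F c y =
      intRn (fun z => \sum_(c <- l) lam c z * F c y).
    rewrite intRn_sum//; apply: eq_bigr => c _.
    rewrite mulrC -intRnZ; last exact: dec_intble.
    by congr intRn; apply/funext => z; rewrite mulrC.
  have dsum : dec (fun z => \sum_(c <- l) lam c z * F c y) by apply: dec_sum.
  have iF := dec_intble (dec_sliceL y).
  have iS := intbleN (dec_intble dsum).
  rewrite -intRnN -?intRnD//; last exact: dec_intble.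
  rewrite mulrC -[X in X * _]ger0_norm ?(ltW (nW_gt0 y))// -normrM -intRnZ; last exact: intbleD.
  apply: intRn_small; first by apply/intbleZ/intbleD.
  move=> z; have := Hl z y; rewrite ler_pdivlMr ?nW_gt0// normrM ger0_norm ?(ltW (nW_gt0 y))//.
  by rewrite [nW y * _]mulrC.
have ES z : dec (F z) := dec_sliceR z.
have EI := dec_intRnL.
split.
  exact: (dec_commute S_cont S_dom E_lin ES T_lin (InW_ge0 m) T_bd).
apply/esym.
exact: (intRn_commute bd0 bdD bdZ bd_le S_cont S_dom E_lin ES EI T_lin (InW_ge0 m) T_bd bd_int).
Qed.

End FubiniIterated.

(** * Translation invariance *)

Section Shift1.
Context {R : realType}.
Local Notation mu := (@lebesgue_measure R).

Lemma is_derive_shift1 (a x : R) : is_derive x 1 (fun t : R => t + a) 1.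
Proof.
have := @is_deriveD _ _ _ id (cst a) x 1 1 0 _ _.
by rewrite addr0; apply.
Qed.

Lemma ge0_integral_shift (f : R -> R) a : continuous f -> (forall t, 0 <= f t) ->
  (\int[mu]_t (f (t + a))%:E = \int[mu]_t (f t)%:E)%E.
Proof.
move=> cf f0; pose F (t : R) := t + a.
have dF : derive1 F = cst 1.
  by apply/funext => x; rewrite derive1E; have [_ ->] := is_derive_shift1 a x.
rewrite [RHS](@increasing_ge0_integration_by_substitutionT _ F)//.
- by apply: eq_integral => t _; rewrite /= dF /= mulr1.
- by move=> x y xy; rewrite /F ltrD2r.
- by rewrite dF; exact: cst_continuous.
- by rewrite dF; exact: is_cvg_cst.
- by rewrite dF; exact: is_cvg_cst.
- apply/cvgrNyPle => A; near=> x; rewrite /F -lerBrDr.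
  by near: x; apply: nbhs_ninfty_le; exact: num_real.
- apply/cvgryPge => A; near=> x; rewrite /F -lerBlDr.
  by near: x; apply: nbhs_pinfty_ge; exact: num_real.
Unshelve. all: by end_near. Qed.

Lemma integral_shift (f : R -> R) a : continuous f ->
  (\int[mu]_t (f (t + a))%:E = \int[mu]_t (f t)%:E)%E.
Proof.
move=> cf; rewrite [LHS]integralE [RHS]integralE; congr (_ - _)%E.
  have -> : (fun t => (f t)%:E)^\+%E = (fun t => (Num.max (f t) 0)%:E).
    by apply/funext => t; rewrite funeposE /= EFin_max.
  have -> : (fun t => (f (t + a))%:E)^\+%E = (fun t => (Num.max (f (t + a)) 0)%:E).
    by apply/funext => t; rewrite funeposE /= EFin_max.
  apply: (@ge0_integral_shift (fun t => Num.max (f t) 0)).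
    apply: contP => t; apply: (@continuous_max R); [exact: cf | exact: contC].
  by move=> t; rewrite le_max lexx orbT.
have -> : (fun t => (f t)%:E)^\-%E = (fun t => (Num.max (- f t) 0)%:E).
  by apply/funext => t; rewrite funenegE /= EFin_max.
have -> : (fun t => (f (t + a))%:E)^\-%E = (fun t => (Num.max (- f (t + a)) 0)%:E).
  by apply/funext => t; rewrite funenegE /= EFin_max.
apply: (@ge0_integral_shift (fun t => Num.max (- f t) 0)).
  by apply: contP => t; apply: (@continuous_max R); [apply: contN; exact: cf | exact: contC].
by move=> t; rewrite le_max lexx orbT.
Qed.

End Shift1.

Section ShiftN.
Context {R : realType}.

(** Peetre's inequality, with a factor 2 lost in each coordinate. *)
Lemma nW_shift n (a x : 'rV[R]_n) : nW x <= (2 ^+ n * nW a) * nW (x + a).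
Proof.
elim: n a x => [|n IH] a x; first by rewrite /nW !big_ord0 expr0 !mul1r.
rewrite -(rcons0K a) -(rcons0K x) rcons0D !nW_rcons0.
set u := a _ _; set t := x _ _; set b := rbehead a; set v := rbehead x.
(* The right side minus the left side is 1 + (t + 2u)^2 + 2 (u (t + u))^2. *)
have h1 : 1 + t ^+ 2 <= 2 * (1 + u ^+ 2) * (1 + (t + u) ^+ 2).
  by have := sqr_ge0 (t + 2 * u); have := sqr_ge0 (u * (t + u)); nra.
have := ler_pM _ _ h1 (IH b v).
rewrite !(ltW (onesq_gt0 _)) !(ltW (nW_gt0 _)) => /(_ isT isT)/le_trans; apply.
by rewrite [2 ^+ n.+1]exprS le_eqVlt; apply/orP; left; apply/eqP; ring.
Qed.

Lemma dec_shift n (a : 'rV[R]_n) (F : 'rV[R]_n -> R) : dec F -> dec (fun x => F (x + a)).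
Proof.
move=> [cF [C FC]]; split.
  apply: contP => x; apply: (@cont_comp _ _ _ (fun x : 'rV[R]_n => x + a) F); last exact: cF.
  by apply: contDV; [exact: contid | exact: contC].
exists ((2 ^+ n * nW a) ^+ 2 * C) => x.
apply: (@le_trans _ _ (`|F (x + a)| * ((2 ^+ n * nW a) * nW (x + a)) ^+ 2)).
  by rewrite ler_wpM2l// ler_pXn2r ?nnegrE ?nW_shift ?(ltW (nW_gt0 _)) ?mulr_ge0 ?exprn_ge0 ?(ltW (nW_gt0 _)).
by rewrite exprMn mulrCA ler_wpM2l// exprn_ge0 // mulr_ge0 ?exprn_ge0 ?(ltW (nW_gt0 _)).
Qed.

Lemma intRn_shift n (a : 'rV[R]_n) (F : 'rV[R]_n -> R) : dec F ->
  intRn (fun x => F (x + a)) = intRn F.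
Proof.
elim: n a F => [|n IH] a F dF; first by rewrite /= add0r (_ : a = 0)//; apply/rowP => -[].
rewrite !intRnS -(rcons0K a); set u := a _ _; set b := rbehead a.
transitivity (Rintegral (@lebesgue_measure R) setT
    (fun t => intRn (fun v => F (rcons0 (t + u) v)))).
  apply: eq_Rintegral => t _.
  rewrite -(IH b (fun v => F (rcons0 (t + u) v))); last exact: dec_rcons0.
  by congr intRn; apply/funext => v; rewrite rcons0D.
rewrite /Rintegral; congr fine.
apply: (@integral_shift _ (fun t => intRn (fun v => F (rcons0 t v)))).
have [cF [C FC]] := dF.
apply: contP => t; apply: (@intRn_continuous_param R _ _ (fun v t => F (rcons0 t v)) t C).
- by move=> t'; exact/dec_intble/dec_rcons0.
- move=> v; apply: (@cont_comp _ _ _ (fun p : 'rV[R]_n * R => rcons0 p.2 p.1) F);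
      last exact: cF.
  apply: (@cont_comp _ _ _ (fun p : 'rV[R]_n * R => (p.2, p.1))
       (fun p : R * 'rV[R]_n => rcons0 p.1 p.2)); last exact: rcons0_continuous.
  by apply: cont_pair; [exact: contsnd | exact: contfst].
- apply: filterE => t' x; apply: le_trans (FC (rcons0 t' x)).
  rewrite ler_wpM2l// nW_rcons0 exprMn ler_peMl ?exprn_ge0 ?(ltW (nW_gt0 _))//.
  exact/exprn_ege1/onesq_ge1.
Qed.

End ShiftN.

(** * Differentiation under the integral sign *)

Section DerivativeHelpers.
Context {R : realType}.

Lemma is_derive_eps (f : R -> R) (a l : R) :
  (forall e, 0 < e -> \forall h \near (0 : R), h != 0 -> `|(f (a + h) - f a) / h - l| <= e) ->
  is_derive a 1 f l.
Proof.
move=> H.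
have cv : h^-1 *: (f (h *: (1 : R) + a) - f a) @[h --> 0^'] --> l.
  apply/cvgrPdist_le => e e0; have := H e e0.
  rewrite near_withinE; apply: nearS => h + h0.
  by rewrite distrC => /(_ h0); rewrite /GRing.scale/= mulr1 [h + a]addrC [h^-1 * _]mulrC.
apply: DeriveDef; first by apply/cvg_ex; exists l.
exact: cvg_lim.
Qed.

Lemma mvt_from0 (f f' : R -> R) (h : R) : (forall t : R, `|t| <= `|h| -> is_derive t 1 f (f' t)) ->
  exists2 c, `|c| <= `|h| & f h - f 0 = f' c * h.
Proof.
move=> df.
have cf : {in [pred t : R | `|t| <= `|h|], forall t, {for t, continuous f}}.
  move=> t th; apply/differentiable_continuous/derivable1_diffP.
  by have [] := df t th.
have [h0|h0|<-] := ltgtP 0 h; last by exists 0; rewrite ?subrr ?mulr0.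
  have [c ch E] : exists2 c, c \in `]0, h[%R & f h - f 0 = f' c * (h - 0).
    apply: MVT => //.
      move=> x; rewrite in_itv/= => /andP[x0 xh]; apply: df.
      by rewrite !gtr0_norm ?(ltW xh)// (lt_trans x0).
    apply: continuous_in_subspaceT => x /set_mem/=; rewrite in_itv/= => /andP[x0 xh].
    by apply: cf; rewrite inE !ger0_norm// (le_trans x0).
  exists c; last by rewrite E subr0.
  by move: ch; rewrite in_itv/= => /andP[c0 ch]; rewrite !gtr0_norm// ltW.
have [c ch E] : exists2 c, c \in `]h, 0[%R & f 0 - f h = f' c * (0 - h).
  apply: MVT => //.
    move=> x; rewrite in_itv/= => /andP[x0 xh]; apply: df.
    by rewrite !ltr0_norm// lerN2 ltW.
  apply: continuous_in_subspaceT => x /set_mem/=; rewrite in_itv/= => /andP[x0 xh].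
  by apply: cf; rewrite inE !ler0_norm ?lerN2// (le_trans x0).
exists c; last by rewrite -opprB E sub0r mulrN opprK.
by move: ch; rewrite in_itv/= => /andP[c0 ch]; rewrite !ltr0_norm// lerN2 ltW.
Qed.

End DerivativeHelpers.

Section DerivativeUnderIntegral.
Context {R : realType}.

Lemma near0_lt (V : normedModType R) (d : R) : 0 < d -> \forall h \near (0 : V), `|h| < d.
Proof.
move=> d0; apply/nbhs_ballP; exists d => //= h.
by rewrite -ball_normE /ball_/= sub0r normrN.
Qed.

Lemma near0_le (V : normedModType R) (d : R) : 0 < d -> \forall h \near (0 : V), `|h| <= d.
Proof.
move=> d0; apply/nbhs_ballP; exists d => //= h.
by rewrite -ball_normE /ball_/= sub0r normrN => /ltW.
Qed.

Lemma is_derive_epsP (f : R -> R) (a l : R) : is_derive a 1 f l ->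
  forall e, 0 < e -> \forall h \near (0 : R), h != 0 -> `|(f (a + h) - f a) / h - l| <= e.
Proof.
move=> [/cvg_ex[l' cl'] dl] e e0.
have E : l' = l by rewrite -dl; apply/esym/cvg_lim.
have H : \forall h \near (0 : R), h != 0 ->
    `|l' - h^-1 *: (f (h *: (1 : R) + a) - f a)| <= e.
  by move/cvgrPdist_le : cl' => /(_ e e0); rewrite near_withinE.
apply: nearS H => h + h0.
by move=> /(_ h0); rewrite distrC E /GRing.scale/= mulr1 [h + a]addrC [h^-1 * _]mulrC.
Qed.

Lemma is_derive_recenter (f : R -> R) (h l : R) :
  is_derive (0 : R) 1 (fun t : R => f (h + t)) l <-> is_derive h 1 f l.
Proof.
split=> /is_derive_epsP H; apply: is_derive_eps => e /H; apply: nearS => t /[apply].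
  by rewrite add0r addr0.
by rewrite add0r addr0.
Qed.

Lemma is_derive_line n (F G : 'rV[R]_n -> R) (v : 'rV[R]_n) :
  (forall x, is_derive (0 : R) 1 (fun t : R => F (x + t *: v)) (G x)) ->
  forall x (h : R), is_derive h 1 (fun t : R => F (x + t *: v)) (G (x + h *: v)).
Proof.
move=> dF x h; apply/is_derive_recenter.
have := dF (x + h *: v); congr is_derive; apply/funext => t.
by rewrite scalerDl addrA.
Qed.

(** By the mean value theorem the difference quotient is [F'] at some intermediate parameter, and
    [dominated_unif] makes [F'] close to [F' 0] uniformly in [x] with an integrable weight. *)
Lemma intRn_derive n (F F' : R -> 'rV[R]_n -> R) C :
  (forall h, dec (F h)) ->
  (forall (h : R) x, `|h| <= 1 -> is_derive h 1 (F ^~ x) (F' h x)) ->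
  (forall x, {for (x, 0 : R), continuous (fun p : 'rV[R]_n * R => F' p.2 p.1)}) ->
  (forall (h : R) x, `|h| <= 1 -> `|F' h x| * nW x ^+ 2 <= C) ->
  dec (F' 0) /\ is_derive (0 : R) 1 (fun h => intRn (F h)) (intRn (F' 0)).
Proof.
move=> decF dF cF' bF'.
have decF' : dec (F' 0).
  split; last by exists C => x; apply: bF'; rewrite normr0.
  apply: contP => x.
  apply: (@cont_comp _ _ _ (fun x : 'rV[R]_n => (x, 0 : R)) (fun p : 'rV[R]_n * R => F' p.2 p.1)).
    by apply: cont_pair; [exact: contid | exact: contC].
  exact: cF'.
split=> //; apply: is_derive_eps => e e0.
have near1 : \forall h \near (0 : R), `|h| <= 1 by exact: near0_le.
have e1 : 0 < e / (InW n + 1) by rewrite divr_gt0// ltr_wpDl// InW_ge0.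
have : \forall h \near (0 : R), forall x, `|F' h x - F' 0 x| * nW x <= e / (InW n + 1).
  apply: (@dominated_unif _ _ _ (fun x h => F' h x) 0 C) => //.
  by apply: nearS near1 => h h1 x; exact: bF'.
move=> /nbhs_ballP[d /= d0 Hd].
have := @near0_lt R^o _ d0.
apply: filterS2 near1 => h h1 hd h0.
rewrite add0r.
have iF := dec_intble (decF h).
have iF0 := dec_intble (decF 0).
have iF' := dec_intble decF'.
have iFN := intbleN iF0.
have iFN' := intbleN iF'.
have iD := intbleD iF iFN.
have -> : (intRn (F h) - intRn (F 0)) / h - intRn (F' 0) =
    intRn (fun x => h^-1 * (F h x + - F 0 x) + - F' 0 x).
  rewrite intRnD//; last exact: intbleZ.
  by rewrite intRnN// intRnZ// intRnD// intRnN// mulrC.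
apply: (@le_trans _ _ (e / (InW n + 1) * InW n)).
  apply: intRn_small; first by apply: intbleD => //; exact: intbleZ.
  move=> x.
  have [c ch E] : exists2 c, `|c| <= `|h| & F h x - F 0 x = F' c x * h.
    by apply: (@mvt_from0 _ (F ^~ x)) => t th; apply: dF; exact: le_trans th h1.
  rewrite E [h^-1 * _]mulrC mulfK//; apply: Hd.
  by rewrite /ball/= sub0r normrN; exact: le_lt_trans ch hd.
rewrite mulrAC ler_pdivrMr ?ltr_wpDl ?InW_ge0// ler_wpM2l ?(ltW e0)//.
by rewrite lerDl.
Qed.

Lemma nW_shift_small n (i : 'I_n) (x : 'rV[R]_n) (h : R) : `|h| <= 1 ->
  nW x <= 2 ^+ n * 2 * nW (x + h *: evec i).
Proof.
move=> h1; apply: le_trans (nW_shift (h *: evec i) x) _.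
rewrite ler_wpM2r ?(ltW (nW_gt0 _))// ler_wpM2l ?exprn_ge0//.
rewrite /nW (bigD1 i)//= big1 ?mulr1 => [|j ji].
  rewrite !mxE !eqxx mulr1 -[2]/(1 + 1) lerD2l -real_normK ?num_real//.
  by rewrite exprn_ile1.
by rewrite !mxE (negbTE ji) andbF mulr0 expr0n addr0.
Qed.

Lemma line_continuous n (G : 'rV[R]_n -> R) v : continuous G ->
  continuous (fun p : 'rV[R]_n * R => G (p.1 + p.2 *: v)).
Proof.
move=> cG; apply: contP => p.
apply: (@cont_comp _ _ _ (fun p : 'rV[R]_n * R => p.1 + p.2 *: v) G); last exact: cG.
apply: contDV; first exact: contfst.
by apply: contZV; [exact: contsnd | exact: contC].
Qed.

(** The integral of the translates of [F] along axis [i] does not depend on the translation, and its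
    derivative is the integral of [G]. In this way the order of the iterated integrals never matters
    for integration by parts. *)
Lemma intRn_partial0 n (i : 'I_n) (F G : 'rV[R]_n -> R) : dec F -> dec G ->
  (forall x, is_derive (0 : R) 1 (fun t : R => F (x + t *: evec i)) (G x)) ->
  intRn G = 0.
Proof.
move=> decF [cG [C GC]] dF.
have dFh h : dec (fun x => F (x + h *: evec i)) by exact: dec_shift.
have bG (h : R) x : `|h| <= 1 ->
    `|G (x + h *: evec i)| * nW x ^+ 2 <= (2 ^+ n * 2) ^+ 2 * C.
  move=> h1.
  apply: (@le_trans _ _ (`|G (x + h *: evec i)| * (2 ^+ n * 2 * nW (x + h *: evec i)) ^+ 2)).
    rewrite ler_wpM2l// ler_pXn2r ?nnegrE ?nW_shift_small ?(ltW (nW_gt0 _))//.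
    by rewrite mulr_ge0 ?mulr_ge0 ?exprn_ge0 ?(ltW (nW_gt0 _)).
  by rewrite exprMn mulrCA ler_wpM2l// exprn_ge0 // mulr_ge0 ?exprn_ge0.
have [_ [_ D]] := @intRn_derive n (fun h x => F (x + h *: evec i))
  (fun h x => G (x + h *: evec i)) ((2 ^+ n * 2) ^+ 2 * C) dFh
  (fun h x _ => is_derive_line dF x h)
  (fun x => @line_continuous n G (evec i) cG (x, 0)) bG.
have E : (fun h : R => intRn (fun x => F (x + h *: evec i))) = cst (intRn F).
  by apply/funext => h; exact: intRn_shift.
move: D; rewrite E derive_cst => ->; congr intRn; apply/funext => x.
by rewrite scale0r addr0.
Qed.

End DerivativeUnderIntegral.

(** * Smooth functions *)

Section SmoothFunctions.
Context {R : realType} {n : nat}.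
Implicit Types (f g : 'rV[R]_n -> R) (i j : 'I_n) (s : seq 'I_n) (x : 'rV[R]_n).

Definition has_pd i g (g' : 'rV[R]_n -> R) : Prop :=
  forall x, is_derive (0 : R) 1 (fun h : R => g (x + h *: evec i)) (g' x).

Lemma has_pdE i g g' : has_pd i g g' -> pd i g = g'.
Proof. by move=> H; apply/funext => x; rewrite /pd derive1E; have [_ ->] := H x. Qed.

Lemma pd_has_pd i g :
  (forall x, derivable (fun h : R => g (x + h *: evec i)) 0 1) -> has_pd i g (pd i g).
Proof. by move=> H x; rewrite /pd derive1E; exact: DeriveDef. Qed.

Lemma iter_pd_cons i s g : iter_pd (i :: s) g = pd i (iter_pd s g). Proof. by []. Qed.

Lemma iter_pd_cat s t g : iter_pd (s ++ t) g = iter_pd s (iter_pd t g).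
Proof. by rewrite /iter_pd foldr_cat. Qed.

(** Smoothness by coinduction: a class of continuous functions that is stable under partial
    derivatives consists of smooth functions. *)
Lemma smooth_coind (P : ('rV[R]_n -> R) -> Prop) :
  (forall g, P g -> continuous g /\ forall i, exists2 g', P g' & has_pd i g g') ->
  forall g, P g -> smooth g.
Proof.
move=> H g Pg s; have Ps : P (iter_pd s g).
  elim: s => [//|i s IH]; have [_ /(_ i)[g' Pg' /has_pdE E]] := H _ IH.
  by rewrite iter_pd_cons E.
have [cs ds] := H _ Ps; split=> // i x.
by have [g' _ /(_ x)[]] := ds i.
Qed.

Lemma smooth_continuous g : smooth g -> continuous g.
Proof. by move=> /(_ [::])[]. Qed.

Lemma smooth_has_pd i g : smooth g -> has_pd i g (pd i g).
Proof. by move=> /(_ [::])[_ H]; apply: pd_has_pd; exact: H. Qed.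

Lemma smooth_iter_pd s g : smooth g -> smooth (iter_pd s g).
Proof. by move=> sg t; have := sg (t ++ s); rewrite iter_pd_cat. Qed.

Lemma smooth_pd i g : smooth g -> smooth (pd i g).
Proof. exact: (@smooth_iter_pd [:: i]). Qed.

Lemma has_pdD i f g f' g' : has_pd i f f' -> has_pd i g g' ->
  has_pd i (fun x => f x + g x) (fun x => f' x + g' x).
Proof. by move=> F G x; apply: is_deriveD. Qed.

Lemma has_pdM i f g f' g' : has_pd i f f' -> has_pd i g g' ->
  has_pd i (fun x => f x * g x) (fun x => f' x * g x + f x * g' x).
Proof.
move=> F G x.
have := @is_deriveM _ _ (fun h : R => f (x + h *: evec i)) (fun h : R => g (x + h *: evec i))
  0 1 _ _ (F x) (G x).
by rewrite scale0r addr0 /GRing.scale/= [X in is_derive _ _ _ X]addrC [g x * _]mulrC.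
Qed.

Lemma has_pd_cst i (c : R) : has_pd i (fun=> c) (fun=> 0).
Proof. by move=> x; exact: is_derive_cst. Qed.

Lemma has_pd_comp i (u u' : R -> R) g g' : (forall t : R, is_derive t 1 u (u' t)) ->
  has_pd i g g' -> has_pd i (fun x => u (g x)) (fun x => u' (g x) * g' x).
Proof.
move=> du G x.
have := @is_derive1_comp _ u (fun h : R => g (x + h *: evec i)) 0 (u' (g x)) (g' x) _ (G x).
by apply; rewrite scale0r addr0.
Qed.

(** The algebra generated by [P] and the smooth functions. Derivatives of generators usually land
    here and not in [P], by the chain and product rules; [smooth_coind_alg] shows that this is
    enough. *)
Inductive alg (P : ('rV[R]_n -> R) -> Prop) : ('rV[R]_n -> R) -> Prop :=
| alg_gen g : P g -> alg P g
| alg_smooth g : smooth g -> alg P g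
| alg_add f g : alg P f -> alg P g -> alg P (fun x => f x + g x)
| alg_mul f g : alg P f -> alg P g -> alg P (fun x => f x * g x).

Lemma smooth_coind_alg (P : ('rV[R]_n -> R) -> Prop) :
  (forall g, P g -> continuous g /\ forall i, exists2 g', alg P g' & has_pd i g g') ->
  forall g, alg P g -> smooth g.
Proof.
move=> H; apply: smooth_coind => g; elim => {g}.
- by move=> g /H.
- move=> g sg; split; first exact: smooth_continuous.
  move=> i; exists (pd i g); last exact: smooth_has_pd.
  exact/alg_smooth/smooth_pd.
- move=> f g _ [cf df] _ [cg dg]; split.
    by apply: contP => x; apply: contD; [exact: cf | exact: cg].
  move=> i; have [f' Pf F] := df i; have [g' Pg G] := dg i.
  by exists (fun x => f' x + g' x); [exact: alg_add | exact: has_pdD].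
- move=> f g af [cf df] ag [cg dg]; split.
    by apply: contP => x; apply: contM; [exact: cf | exact: cg].
  move=> i; have [f' Pf F] := df i; have [g' Pg G] := dg i.
  exists (fun x => f' x * g x + f x * g' x); last exact: has_pdM.
  by apply: alg_add; apply: alg_mul.
Qed.

Lemma smoothD f g : smooth f -> smooth g -> smooth (fun x => f x + g x).
Proof.
by move=> sf sg; apply: (@smooth_coind_alg (fun=> False)) => //; apply: alg_add; exact: alg_smooth.
Qed.

Lemma smoothM f g : smooth f -> smooth g -> smooth (fun x => f x * g x).
Proof.
by move=> sf sg; apply: (@smooth_coind_alg (fun=> False)) => //; apply: alg_mul; exact: alg_smooth.
Qed.

Lemma smooth_cst (c : R) : smooth (fun _ : 'rV[R]_n => c).
Proof.
apply: (@smooth_coind (fun g => exists c, g = fun=> c)); last by exists c.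
move=> _ [{}c ->]; split; first by apply: contP => x; exact: contC.
by move=> i; exists (fun=> 0); [exists 0 | exact: has_pd_cst].
Qed.

Lemma smoothZ (c : R) g : smooth g -> smooth (fun x => c * g x).
Proof. by move=> sg; apply: smoothM => //; exact: smooth_cst. Qed.

Lemma smoothN g : smooth g -> smooth (fun x => - g x).
Proof.
move=> sg; have -> : (fun x => - g x) = (fun x => -1 * g x).
  by apply/funext => x; rewrite mulN1r.
exact: smoothZ.
Qed.

Lemma smoothB f g : smooth f -> smooth g -> smooth (fun x => f x - g x).
Proof. by move=> sf sg; apply: smoothD => //; exact: smoothN. Qed.

Lemma smooth_sum (I : Type) (r : seq I) (F : I -> 'rV[R]_n -> R) :
  (forall k, smooth (F k)) -> smooth (fun x => \sum_(k <- r) F k x).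
Proof.
move=> sF; elim: r => [|k r IH].
  have -> : (fun x => \sum_(k <- [::]) F k x) = fun=> 0 by apply/funext => x; rewrite big_nil.
  exact: smooth_cst.
have -> : (fun x => \sum_(k <- k :: r) F k x) = (fun x => F k x + \sum_(k <- r) F k x).
  by apply/funext => x; rewrite big_cons.
exact: smoothD.
Qed.

Lemma smooth_prod (I : Type) (r : seq I) (F : I -> 'rV[R]_n -> R) :
  (forall k, smooth (F k)) -> smooth (fun x => \prod_(k <- r) F k x).
Proof.
move=> sF; elim: r => [|k r IH].
  have -> : (fun x => \prod_(k <- [::]) F k x) = fun=> 1 by apply/funext => x; rewrite big_nil.
  exact: smooth_cst.
have -> : (fun x => \prod_(k <- k :: r) F k x) = (fun x => F k x * \prod_(k <- r) F k x).
  by apply/funext => x; rewrite big_cons.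
exact: smoothM.
Qed.

Lemma smoothX g k : smooth g -> smooth (fun x => g x ^+ k).
Proof.
move=> sg; elim: k => [|k IH].
  have -> : (fun x => g x ^+ 0) = fun=> 1 by apply/funext => x; rewrite expr0.
  exact: smooth_cst.
have -> : (fun x => g x ^+ k.+1) = (fun x => g x * g x ^+ k).
  by apply/funext => x; rewrite exprS.
exact: smoothM.
Qed.

Lemma has_pd_coord i j : has_pd i (fun x => x ord0 j) (fun=> (i == j)%:R).
Proof.
move=> x; have -> : (fun h : R => (x + h *: evec i) ord0 j) = (fun h : R => x ord0 j + (i == j)%:R * h).
  by apply/funext => h; rewrite !mxE eqxx/= mulrC [j == i]eq_sym.
apply: is_derive_eps => e e0; near=> h => h0.
by rewrite add0r mulr0 addr0 [_ + _ - _]addrAC subrr add0r mulfK// subrr normr0 ltW.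
Unshelve. all: by end_near. Qed.

Lemma smooth_coord j : smooth (fun x => x ord0 j).
Proof.
apply: (@smooth_coind_alg (fun g => g = fun x => x ord0 j)); last exact: alg_gen.
move=> _ ->; split; first by apply: contP => x; exact: coordc.
move=> i; exists (fun=> (i == j)%:R); last exact: has_pd_coord.
exact/alg_smooth/smooth_cst.
Qed.

Lemma pdD i f g : smooth f -> smooth g ->
  pd i (fun x => f x + g x) = (fun x => pd i f x + pd i g x).
Proof. by move=> sf sg; apply: has_pdE; apply: has_pdD; exact: smooth_has_pd. Qed.

Lemma pdM i f g : smooth f -> smooth g ->
  pd i (fun x => f x * g x) = (fun x => pd i f x * g x + f x * pd i g x).
Proof. by move=> sf sg; apply: has_pdE; apply: has_pdM; exact: smooth_has_pd. Qed.

Lemma pd_cst i (c : R) : pd i (fun _ : 'rV[R]_n => c) = fun=> 0.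
Proof. exact/has_pdE/has_pd_cst. Qed.

Lemma pdZ i (c : R) g : smooth g -> pd i (fun x => c * g x) = (fun x => c * pd i g x).
Proof.
move=> sg; rewrite pdM//; last exact: smooth_cst.
by apply/funext => x; rewrite pd_cst mul0r add0r.
Qed.

Lemma iter_pd0 s : iter_pd s (fun _ : 'rV[R]_n => 0 : R) = fun=> 0.
Proof. by elim: s => [//|i s IH]; rewrite iter_pd_cons IH pd_cst. Qed.

Lemma iter_pdD s f g : smooth f -> smooth g ->
  iter_pd s (fun x => f x + g x) = (fun x => iter_pd s f x + iter_pd s g x).
Proof.
by move=> sf sg; elim: s => [//|i s IH]; rewrite !iter_pd_cons IH pdD//; exact: smooth_iter_pd.
Qed.

Lemma iter_pdZ s (c : R) g : smooth g ->
  iter_pd s (fun x => c * g x) = (fun x => c * iter_pd s g x).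
Proof.
by move=> sg; elim: s => [//|i s IH]; rewrite !iter_pd_cons IH pdZ//; exact: smooth_iter_pd.
Qed.

Lemma iter_pdN s g : smooth g ->
  iter_pd s (fun x => - g x) = (fun x => - iter_pd s g x).
Proof.
move=> sg; have -> : (fun x => - g x) = (fun x => -1 * g x).
  by apply/funext => x; rewrite mulN1r.
by rewrite iter_pdZ//; apply/funext => x; rewrite mulN1r.
Qed.

Lemma iter_pd_sum s (I : Type) (r : seq I) (F : I -> 'rV[R]_n -> R) :
  (forall k, smooth (F k)) ->
  iter_pd s (fun x => \sum_(k <- r) F k x) = (fun x => \sum_(k <- r) iter_pd s (F k) x).
Proof.
move=> sF; elim: r => [|k r IH].
  have -> : (fun x => \sum_(k <- [::]) F k x) = fun=> 0 by apply/funext => x; rewrite big_nil.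
  by rewrite iter_pd0; apply/funext => x; rewrite big_nil.
have -> : (fun x => \sum_(k <- k :: r) F k x) = (fun x => F k x + \sum_(k <- r) F k x).
  by apply/funext => x; rewrite big_cons.
rewrite iter_pdD//; last exact: smooth_sum.
by rewrite IH; apply/funext => x; rewrite big_cons.
Qed.

End SmoothFunctions.

(** * Flat functions and smooth composition *)

Section FlatFunction.
Context {R : realType}.

(** The usual exp(-1/t) is the case [k = 0]; the index [k] makes the derivative of [flat k] a
    combination of [flat k.+1] and [flat k.+2], so that coinduction applies. *)
Definition flat (k : nat) (t : R) : R := if 0 < t then t ^- k * expR (- t^-1) else 0.

Lemma flat_ge0 k t : 0 <= flat k t.
Proof.
rewrite /flat; case: ifPn => // t0; rewrite mulr_ge0 ?expR_ge0// invr_ge0 exprn_ge0//.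
exact: ltW.
Qed.

Lemma flat_gt0 k t : 0 < t -> 0 < flat k t.
Proof. by move=> t0; rewrite /flat t0 mulr_gt0 ?expR_gt0// invr_gt0 exprn_gt0. Qed.

Lemma flat_le0 k t : t <= 0 -> flat k t = 0.
Proof. by rewrite /flat leNgt => /negbTE ->. Qed.

(** Inverse of exp((m+1) u) = exp(u)^(m+1) >= u^(m+1) at u = 1 / ((m+1) t). *)
Lemma expRN_inv_le m (t : R) : 0 < t -> expR (- t^-1) <= (m.+1%:R * t) ^+ m.+1.
Proof.
move=> t0; rewrite expRN -[leRHS]invrK lef_pV2 ?posrE ?expR_gt0 ?invr_gt0 ?exprn_gt0 ?mulr_gt0//.
have -> : t^-1 = m.+1%:R * (m.+1%:R * t)^-1.
  by rewrite invfM mulrA divff ?mul1r// pnatr_eq0.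
rewrite expRM_natl -exprVn lerXn2r// ?nnegrE ?expR_ge0 ?invr_ge0 ?mulr_ge0 ?(ltW t0)//.
by apply: le_trans (expR_ge1Dx _); rewrite lerDr.
Qed.

(** Exponent k + 2 in the previous bound leaves t^2 after division by t^k, which makes the
    derivative at the origin vanish. *)
Lemma flat_le_sqr k (t : R) : flat k t <= (k.+2)%:R ^+ k.+2 * t ^+ 2.
Proof.
rewrite /flat; case: ifPn => [t0|_]; last by rewrite mulr_ge0 ?sqr_ge0// exprn_ge0.
have := expRN_inv_le k.+1 t0; rewrite exprMn.
rewrite -(ler_pM2l (_ : 0 < t ^- k)) ?invr_gt0 ?exprn_gt0// => /le_trans; apply.
rewrite mulrCA ler_wpM2l ?exprn_ge0// -addn2 exprD mulKf//.
by rewrite gt_eqF// exprn_gt0.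
Qed.

Lemma flat_derive k (t : R) :
  is_derive t 1 (flat k) (- k%:R * flat k.+1 t + flat k.+2 t).
Proof.
have [t0|t0|<-] := ltgtP 0 t.
- have D : is_derive t 1 (fun u : R => u ^- k * expR (- u^-1))
      (- k%:R * flat k.+1 t + flat k.+2 t).
    have tn0 : t != 0 by rewrite gt_eqF.
    have D1 : is_derive t 1 (fun u : R => u^-1) (- t ^- 2).
      by have := @is_deriveV _ id t 1 1 tn0 _; rewrite /GRing.scale/= mulr1; apply.
    have D2 : is_derive t 1 (fun u : R => u^-1 ^+ k) (k%:R * t^-1 ^+ k.-1 * - t ^- 2).
      have := @is_deriveX _ _ (fun u : R => u^-1) k t 1 (- t ^- 2) D1.
      by rewrite /GRing.scale/= exprfctE.
    have D3 : is_derive t 1 (fun u : R => expR (- u^-1)) (expR (- t^-1) * t ^- 2).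
      have D4 : is_derive t 1 (fun u : R => - u^-1) (t ^- 2).
        by have := is_deriveN D1; rewrite opprK.
      exact: (@is_derive1_comp _ expR (fun u : R => - u^-1) t _ _ (is_derive_expR _) D4).
    have := is_deriveM D2 D3; rewrite /GRing.scale/= => D.
    have E : (fun u : R => u ^- k * expR (- u^-1)) = (fun u => u^-1 ^+ k) * (fun u => expR (- u^-1)).
      by apply/funext => u; rewrite /GRing.mul/= exprVn.
    rewrite E; apply: is_derive_eq; rewrite /flat t0 -!exprVn.
    case: k {D D2 E} => [|k]; first by rewrite !expr0; ring.
    by rewrite [k.+1.-1]/= !exprS; ring.
  apply: near_eq_is_derive D; near=> u; rewrite /flat ifT//.
  by near: u; exact: lt_nbhsr.
- rewrite !flat_le0 ?(ltW t0)// mulr0 addr0.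
  apply: near_eq_is_derive (is_derive_cst 0 _ _); near=> u; rewrite flat_le0// ltW//.
  by near: u; exact: lt_nbhsl.
- rewrite !flat_le0// mulr0 addr0; apply: is_derive_eps => e e0.
  have c0 : 0 < (k.+2)%:R ^+ k.+2 :> R by rewrite exprn_gt0.
  have d0 : 0 < e / (k.+2)%:R ^+ k.+2 by rewrite divr_gt0.
  have := @near0_le R R^o _ d0; apply: filterS => h hd h0.
  rewrite add0r (flat_le0 k (lexx 0)) !subr0 normrM normfV ger0_norm ?flat_ge0//.
  rewrite ler_pdivrMr ?normr_gt0//; apply: le_trans (flat_le_sqr k h) _.
  rewrite -real_normK ?num_real// expr2 mulrA ler_wpM2r//.
  by rewrite mulrC -ler_pdivlMr.
Unshelve. all: by end_near. Qed.

Lemma flat_continuous k : continuous (flat k).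
Proof.
move=> t; apply/differentiable_continuous/derivable1_diffP.
by have [] := flat_derive k t.
Qed.

Lemma smooth_flat n k (g : 'rV[R]_n -> R) : smooth g -> smooth (fun x => flat k (g x)).
Proof.
move=> sg.
apply: (@smooth_coind_alg _ _ (fun f => exists k, f = fun x => flat k (g x)));
  last by apply: alg_gen; exists k.
move=> _ [{}k ->]; split.
  apply: contP => x; apply: (@cont_comp _ _ _ g (flat k)); last exact: flat_continuous.
  exact: smooth_continuous.
move=> i; exists (fun x => (- k%:R * flat k.+1 (g x) + flat k.+2 (g x)) * pd i g x).
  apply: alg_mul; last exact/alg_smooth/smooth_pd.
  apply: alg_add; last by apply: alg_gen; exists k.+2.
  by apply: alg_mul; [exact/alg_smooth/smooth_cst | apply: alg_gen; exists k.+1].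
apply: (has_pd_comp (u := flat k) (u' := fun t => - k%:R * flat k.+1 t + flat k.+2 t)).
  exact: flat_derive.
exact: smooth_has_pd.
Qed.

End FlatFunction.

Section SmoothComposition.
Context {R : realType}.

Lemma smooth_cos n (g : 'rV[R]_n -> R) : smooth g -> smooth (fun x => cos (g x)).
Proof.
move=> sg.
apply: (@smooth_coind_alg _ _ (fun f => f = (fun x => cos (g x)) \/ f = fun x => sin (g x)));
  last by apply: alg_gen; left.
move=> _ [->|->]; split.
- apply: contP => x; apply: (@cont_comp _ _ _ g cos); last exact: continuous_cos.
  exact: smooth_continuous.
- move=> i; exists (fun x => - 1 * sin (g x) * pd i g x).
    apply: alg_mul; last exact/alg_smooth/smooth_pd.
    by apply: alg_mul; [exact/alg_smooth/smooth_cst | apply: alg_gen; right].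
  apply: (has_pd_comp (u := cos) (u' := fun t => - 1 * sin t)); last exact: smooth_has_pd.
  by move=> t; rewrite mulN1r; exact: is_derive_cos.
- apply: contP => x; apply: (@cont_comp _ _ _ g sin); last exact: continuous_sin.
  exact: smooth_continuous.
- move=> i; exists (fun x => cos (g x) * pd i g x).
    by apply: alg_mul; [apply: alg_gen; left | exact/alg_smooth/smooth_pd].
  by apply: (has_pd_comp (u := sin) (u' := cos)); exact: smooth_has_pd.
Qed.

Lemma pd_cos n i (g : 'rV[R]_n -> R) : smooth g ->
  pd i (fun x => cos (g x)) = (fun x => - sin (g x) * pd i g x).
Proof.
move=> sg; apply: has_pdE; apply: (has_pd_comp (u := cos) (u' := fun t => - sin t)).
exact: smooth_has_pd.
Qed.

Lemma smooth_inv n (g : 'rV[R]_n -> R) : smooth g -> (forall x, g x != 0) ->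
  smooth (fun x => (g x)^-1).
Proof.
move=> sg g0.
apply: (@smooth_coind_alg _ _ (fun f => f = fun x => (g x)^-1)); last exact: alg_gen.
move=> _ ->; split.
  by apply: contP => x; apply: continuousV => //; exact: smooth_continuous.
move=> i; exists (fun x => - 1 * (g x)^-1 * (g x)^-1 * pd i g x).
  apply: alg_mul; last exact/alg_smooth/smooth_pd.
  by do 2 (apply: alg_mul; last exact: alg_gen); exact/alg_smooth/smooth_cst.
move=> x; have gx : (fun h : R => g (x + h *: evec i)) 0 != 0 by exact: g0.
have := @is_deriveV _ (fun h : R => g (x + h *: evec i)) 0 _ 1 gx (smooth_has_pd i sg x).
by rewrite scale0r addr0 /GRing.scale/= mulN1r expr2 invfM !mulNr.
Qed.

Lemma has_pd_affine n i (a : R) (b : 'rV[R]_n) (g : 'rV[R]_n -> R) : smooth g ->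
  has_pd i (fun x => g (a *: x + b)) (fun x => a * pd i g (a *: x + b)).
Proof.
move=> sg x.
have D0 : is_derive (0 : R) 1 (fun h : R => a * h) a.
  have := @is_deriveZ _ _ _ (fun h : R => h) a 0 1 1 (is_derive_id _ _).
  by rewrite /GRing.scale/= mulr1.
have D1 : is_derive (a * 0) 1 (fun h : R => g (a *: x + b + h *: evec i)) (pd i g (a *: x + b)).
  by rewrite mulr0; exact: smooth_has_pd.
have := @is_derive1_comp _ (fun h : R => g (a *: x + b + h *: evec i)) (fun h : R => a * h) 0 _ _ D1 D0.
rewrite mulrC; congr is_derive; apply/funext => h /=.
by rewrite scalerDr scalerA addrAC.
Qed.

Lemma smooth_affine n (a : R) (b : 'rV[R]_n) (g : 'rV[R]_n -> R) : smooth g ->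
  smooth (fun x => g (a *: x + b)).
Proof.
move=> sg.
apply: (@smooth_coind_alg _ _ (fun f => exists2 g, smooth g & f = fun x => g (a *: x + b)));
  last by apply: alg_gen; exists g.
move=> _ [{sg}g sg ->]; split.
  apply: contP => x.
  apply: (@cont_comp _ _ _ (fun x : 'rV[R]_n => a *: x + b) g); last exact: smooth_continuous.
  by apply: contDV; [apply: contZV; [exact: contC | exact: contid] | exact: contC].
move=> i; exists (fun x => a * pd i g (a *: x + b)); last exact: has_pd_affine.
apply: alg_mul; first exact/alg_smooth/smooth_cst.
by apply: alg_gen; exists (pd i g) => //; exact: smooth_pd.
Qed.

Lemma pd_affine n i (a : R) (b : 'rV[R]_n) (g : 'rV[R]_n -> R) : smooth g ->
  pd i (fun x => g (a *: x + b)) = (fun x => a * pd i g (a *: x + b)).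
Proof. by move=> sg; apply: has_pdE; exact: has_pd_affine. Qed.

Lemma iter_pd_affine n s (a : R) (b : 'rV[R]_n) (g : 'rV[R]_n -> R) : smooth g ->
  iter_pd s (fun x => g (a *: x + b)) = (fun x => a ^+ size s * iter_pd s g (a *: x + b)).
Proof.
move=> sg; elim: s => [|i s IH]; first by apply/funext => x; rewrite expr0 mul1r.
rewrite iter_pd_cons IH pdZ; last exact/smooth_affine/smooth_iter_pd.
rewrite (@pd_affine _ i a b (iter_pd s g)); last exact: smooth_iter_pd.
by apply/funext => x; rewrite /= exprS mulrCA mulrA.
Qed.

End SmoothComposition.

Section SmoothBlocks.
Context {R : realType} {N M : nat}.
Implicit Types (z : 'rV[R]_(N + M)) (y : 'rV[R]_N) (x : 'rV[R]_M).

Lemma lsubmx_line z (h : R) (i : 'I_N) :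
  lsubmx (z + h *: evec (lshift M i)) = lsubmx z + h *: evec i.
Proof. by apply/rowP => j; rewrite !mxE eq_lshift. Qed.

Lemma lsubmx_line_r z (h : R) (i : 'I_M) :
  lsubmx (z + h *: evec (rshift N i)) = lsubmx z.
Proof. by apply/rowP => j; rewrite !mxE eq_lrshift andbF mulr0 addr0. Qed.

Lemma rsubmx_line z (h : R) (i : 'I_M) :
  rsubmx (z + h *: evec (rshift N i)) = rsubmx z + h *: evec i.
Proof. by apply/rowP => j; rewrite !mxE eq_rshift. Qed.

Lemma rsubmx_line_l z (h : R) (i : 'I_N) :
  rsubmx (z + h *: evec (lshift M i)) = rsubmx z.
Proof. by apply/rowP => j; rewrite !mxE eq_rlshift andbF mulr0 addr0. Qed.

Lemma lsubmx_continuous : continuous (fun z => lsubmx z).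
Proof.
apply: contP => z; apply: rV_continuousP => i.
have -> : (fun z => lsubmx z ord0 i) = (fun z => z ord0 (lshift M i)).
  by apply/funext => w; rewrite mxE.
exact: coordc.
Qed.

Lemma rsubmx_continuous : continuous (fun z => rsubmx z).
Proof.
apply: contP => z; apply: rV_continuousP => i.
have -> : (fun z => rsubmx z ord0 i) = (fun z => z ord0 (rshift N i)).
  by apply/funext => w; rewrite mxE.
exact: coordc.
Qed.

Lemma row_mx_continuous : continuous (fun p : 'rV[R]_N * 'rV[R]_M => row_mx p.1 p.2).
Proof.
apply: contP => p; apply: rV_continuousP => i; case: (split_ordP i) => k ->.
  have -> : (fun p : 'rV[R]_N * 'rV[R]_M => row_mx p.1 p.2 ord0 (lshift M k)) = (fun p => p.1 ord0 k).
    by apply/funext => w; rewrite row_mxEl.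
  apply: (@cont_comp _ _ _ fst (fun v : 'rV[R]_N => v ord0 k)); [exact: contfst | exact: coordc].
have -> : (fun p : 'rV[R]_N * 'rV[R]_M => row_mx p.1 p.2 ord0 (rshift N k)) = (fun p => p.2 ord0 k).
  by apply/funext => w; rewrite row_mxEr.
apply: (@cont_comp _ _ _ snd (fun v : 'rV[R]_M => v ord0 k)); [exact: contsnd | exact: coordc].
Qed.

Lemma has_pd_lsubmx (g : 'rV[R]_N -> R) i : smooth g ->
  has_pd (lshift M i) (fun z => g (lsubmx z)) (fun z => pd i g (lsubmx z)).
Proof.
move=> sg z; have := smooth_has_pd i sg (lsubmx z).
have -> // : (fun h : R => g (lsubmx (z + h *: evec (lshift M i)))) =
   (fun h : R => g (lsubmx z + h *: evec i)).
by apply/funext => h; rewrite lsubmx_line.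
Qed.

Lemma has_pd_lsubmx0 (g : 'rV[R]_N -> R) i :
  has_pd (rshift N i) (fun z : 'rV[R]_(N + M) => g (lsubmx z)) (fun=> 0).
Proof.
move=> z; have -> : (fun h : R => g (lsubmx (z + h *: evec (rshift N i)))) = cst (g (lsubmx z)).
  by apply/funext => h; rewrite lsubmx_line_r.
exact: is_derive_cst.
Qed.

Lemma has_pd_rsubmx (g : 'rV[R]_M -> R) i : smooth g ->
  has_pd (rshift N i) (fun z => g (rsubmx z)) (fun z => pd i g (rsubmx z)).
Proof.
move=> sg z; have := smooth_has_pd i sg (rsubmx z).
have -> // : (fun h : R => g (rsubmx (z + h *: evec (rshift N i)))) =
   (fun h : R => g (rsubmx z + h *: evec i)).
by apply/funext => h; rewrite rsubmx_line.
Qed.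

Lemma has_pd_rsubmx0 (g : 'rV[R]_M -> R) i :
  has_pd (lshift M i) (fun z : 'rV[R]_(N + M) => g (rsubmx z)) (fun=> 0).
Proof.
move=> z; have -> : (fun h : R => g (rsubmx (z + h *: evec (lshift M i)))) = cst (g (rsubmx z)).
  by apply/funext => h; rewrite rsubmx_line_l.
exact: is_derive_cst.
Qed.

Lemma smooth_lsubmx (g : 'rV[R]_N -> R) : smooth g ->
  smooth (fun z : 'rV[R]_(N + M) => g (lsubmx z)).
Proof.
move=> sg.
apply: (@smooth_coind_alg _ _ (fun f => exists2 g, smooth g & f = fun z => g (lsubmx z)));
  last by apply: alg_gen; exists g.
move=> _ [{sg}g sg ->]; split.
  apply: contP => x; apply: (@cont_comp _ _ _ (fun z => lsubmx z) g).
    exact: lsubmx_continuous.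
  exact: smooth_continuous.
move=> j; case: (split_ordP j) => k ->.
  exists (fun z => pd k g (lsubmx z)); last exact: has_pd_lsubmx.
  by apply: alg_gen; exists (pd k g) => //; exact: smooth_pd.
exists (fun=> 0); last exact: has_pd_lsubmx0.
exact/alg_smooth/smooth_cst.
Qed.

Lemma smooth_rsubmx (g : 'rV[R]_M -> R) : smooth g ->
  smooth (fun z : 'rV[R]_(N + M) => g (rsubmx z)).
Proof.
move=> sg.
apply: (@smooth_coind_alg _ _ (fun f => exists2 g, smooth g & f = fun z => g (rsubmx z)));
  last by apply: alg_gen; exists g.
move=> _ [{sg}g sg ->]; split.
  apply: contP => x; apply: (@cont_comp _ _ _ (fun z => rsubmx z) g).
    exact: rsubmx_continuous.
  exact: smooth_continuous.
move=> j; case: (split_ordP j) => k ->.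
  exists (fun=> 0); last exact: has_pd_rsubmx0.
  exact/alg_smooth/smooth_cst.
exists (fun z => pd k g (rsubmx z)); last exact: has_pd_rsubmx.
by apply: alg_gen; exists (pd k g) => //; exact: smooth_pd.
Qed.

End SmoothBlocks.

Section Locality.
Context {R : realType} {n : nat}.

Lemma line0_near (x : 'rV[R]_n) (v : 'rV[R]_n) (U : set 'rV[R]_n) : open U -> U x ->
  \forall h \near (0 : R), U (x + h *: v).
Proof.
move=> oU Ux; have : {for (0 : R), continuous (fun h : R => x + h *: v)}.
  apply: contDV; first exact: contC.
  by apply: contZV; [exact: contid | exact: contC].
move=> /(_ U); apply; apply: open_nbhs_nbhs; split=> //.
by rewrite scale0r addr0.
Qed.

Lemma iter_pd_local (U : set 'rV[R]_n) (f g : 'rV[R]_n -> R) s : open U ->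
  (forall x, U x -> f x = g x) -> forall x, U x -> iter_pd s f x = iter_pd s g x.
Proof.
move=> oU fg; elim: s => [//|i s IH] x Ux; rewrite !iter_pd_cons /pd !derive1E.
apply: near_eq_derive.
by apply: filterS (line0_near (evec i) oU Ux) => h /IH.
Qed.

Lemma iter_pd_support (K : set 'rV[R]_n) (f : 'rV[R]_n -> R) s : closed K ->
  (forall x, ~ K x -> f x = 0) -> forall x, ~ K x -> iter_pd s f x = 0.
Proof.
move=> cK f0 x nKx.
by rewrite (@iter_pd_local (~` K) f (fun=> 0)) ?iter_pd0//; exact: closed_openC.
Qed.

End Locality.

(** * Symmetry of mixed partial derivatives *)

Section MixedPartials.
Context {R : realType} {n : nat}.
Implicit Types (g : 'rV[R]_n -> R) (i j : 'I_n) (x : 'rV[R]_n).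

Lemma norm_line_le (h : R) i : `|h *: evec i : 'rV[R]_n| <= `|h|.
Proof.
rewrite [leLHS]/Num.norm /= mx_normrE; apply/bigmax_leP; split=> [//|[a b] _ /=].
by rewrite !mxE normrM ler_piMr// normr_nat; case: (_ && _).
Qed.

(** The mean value theorem twice, first along [i] for the difference in direction [j], then along
    [j] for the derivative just obtained. *)
Lemma mixed_difference g i j x (h k : R) : smooth g -> exists c d : R,
  [/\ `|c| <= `|h|, `|d| <= `|k| &
   g (x + h *: evec i + k *: evec j) - g (x + h *: evec i) - (g (x + k *: evec j) - g x)
   = pd j (pd i g) (x + c *: evec i + d *: evec j) * k * h].
Proof.
move=> sg.
pose u (t : R) := g (x + t *: evec i + k *: evec j) - g (x + t *: evec i).
pose u' (t : R) := pd i g (x + t *: evec i + k *: evec j) - pd i g (x + t *: evec i).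
have du (t : R) : is_derive t 1 u (u' t).
  apply: is_deriveB.
    have -> : (fun t : R => g (x + t *: evec i + k *: evec j)) =
        (fun t : R => g (x + k *: evec j + t *: evec i)).
      by apply/funext => v; rewrite addrAC.
    rewrite addrAC; exact: (is_derive_line (smooth_has_pd i sg)).
  exact: (is_derive_line (smooth_has_pd i sg)).
have [c ch Ec] := @mvt_from0 R u u' h (fun t _ => du t).
pose w (t : R) := pd i g (x + c *: evec i + t *: evec j).
have dw (t : R) : is_derive t 1 w (pd j (pd i g) (x + c *: evec i + t *: evec j)).
  exact: (is_derive_line (smooth_has_pd j (smooth_pd i sg))).
have [d dk Ed] := @mvt_from0 R w _ k (fun t _ => dw t).
exists c, d; split=> //.
rewrite -Ed /w scale0r addr0; move: Ec; rewrite /u /u' => <-.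
by rewrite scale0r addr0.
Qed.

Lemma smooth_eps g x e : smooth g -> 0 < e ->
  exists2 r : R, 0 < r & forall z, `|z - x| < r -> `|g z - g x| <= e.
Proof.
move=> /smooth_continuous cg e0; have cx : {for x, continuous g} by exact: cg.
have /nbhs_ballP[r r0 rP] := cont_near cx e0.
exists r => // z zx; apply: rP.
by rewrite -ball_normE /ball_/= distrC.
Qed.

(** The second difference is symmetric in [i] and [j], so the two mixed derivatives agree at two
    points arbitrarily close to [x]; continuity does the rest. *)
Lemma pd_comm i j g : smooth g -> pd i (pd j g) = pd j (pd i g).
Proof.
move=> sg; apply/funext => x.
apply/eqP; rewrite -subr_eq0 -normr_eq0 eq_le normr_ge0 andbT.
apply/ler_addgt0Pr => e e0; rewrite add0r.
have e2 : 0 < e / 2 by rewrite divr_gt0.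
have [r r0 Hr] := smooth_eps x (smooth_pd i (smooth_pd j sg)) e2.
have [q q0 Hq] := smooth_eps x (smooth_pd j (smooth_pd i sg)) e2.
have [h h0 h3] : exists2 h : R, 0 < h & h + h < Num.min r q.
  have m0 : 0 < Num.min r q by rewrite lt_min r0.
  by exists (Num.min r q / 3); [rewrite divr_gt0 | lra].
have [c [d [ch dh Ecd]]] := mixed_difference i j x h h sg.
have [c' [d' [ch' dh' Ecd']]] := mixed_difference j i x h h sg.
have E : pd j (pd i g) (x + c *: evec i + d *: evec j) =
         pd i (pd j g) (x + c' *: evec j + d' *: evec i).
  have hn0 : h != 0 by rewrite gt_eqF.
  apply: (mulIf hn0); apply: (mulIf hn0).
  have R4 (p u v w : R) : p - u - (v - w) = p - v - (u - w) by ring.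
  apply: (etrans (esym Ecd)); apply: (etrans _ Ecd'); rewrite R4.
  by congr (g _ - _ - _); rewrite addrAC.
have close (a b : R) k l : `|a| <= `|h| -> `|b| <= `|h| ->
    `|x + a *: evec k + b *: evec l - x| < Num.min r q.
  move=> ah bh.
  have -> : x + a *: evec k + b *: evec l - x = a *: evec k + b *: evec l.
    by apply/rowP => o; rewrite !mxE; ring.
  apply: (le_lt_trans (ler_normD _ _)).
  apply: (le_lt_trans (lerD (norm_line_le a k) (norm_line_le b l))).
  by apply: (le_lt_trans (lerD ah bh)); rewrite (gtr0_norm h0).
rewrite [e](splitr e).
apply: le_trans (ler_distD (pd i (pd j g) (x + c' *: evec j + d' *: evec i)) _ _) _.
apply: lerD.
  rewrite distrC; apply: Hr; have := close c' d' j i ch' dh'.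
  by rewrite lt_min => /andP[].
rewrite -E; apply: Hq; have := close c d i j ch dh.
by rewrite lt_min => /andP[].
Qed.

(** The bridge between words, used throughout the proof, and the multi-indices of the statement. *)
Lemma iter_pd_perm (s t : seq 'I_n) g : smooth g -> perm_eq s t -> iter_pd s g = iter_pd t g.
Proof.
move=> sg /permP; have swap i j u : iter_pd [:: i, j & u] g = iter_pd [:: j, i & u] g.
  by rewrite !iter_pd_cons; apply: pd_comm; exact: smooth_iter_pd.
have front i u v : iter_pd (u ++ i :: v) g = iter_pd (i :: u ++ v) g.
  elim: u => [//|k u IH]; rewrite cat_cons iter_pd_cons IH -iter_pd_cons.
  exact: swap.
elim: s t => [|i s IH] t st.
  have : perm_eq [::] t by apply/permP.
  by rewrite perm_sym => /perm_nilP ->.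
have it : i \in t.
  have : perm_eq (i :: s) t by apply/permP.
  by move/perm_mem => /(_ i); rewrite inE eqxx.
case/splitPr: it st => u v st.
rewrite front !iter_pd_cons (IH (u ++ v))//.
have : perm_eq (i :: s) (u ++ i :: v) by apply/permP.
by rewrite -[i :: v]cat1s perm_sym perm_catCA /= perm_cons perm_sym => /permP.
Qed.

End MixedPartials.

(** * Taylor expansion *)

Section DirectionalDerivative.
Context {R : realType} {n : nat}.

(** One coordinate is added at a time: the mean value theorem treats the new direction at a
    displaced point, and continuity of [pd j g] absorbs the displacement. *)
Lemma is_derive_dir_seq (g : 'rV[R]_n -> R) (v : 'rV[R]_n) (l : seq 'I_n) : smooth g -> forall x : 'rV[R]_n,
  is_derive (0 : R) 1 (fun t : R => g (x + t *: \sum_(j <- l) v ord0 j *: evec j))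
    (\sum_(j <- l) v ord0 j * pd j g x).
Proof.
move=> sg; elim: l => [|j l IH] x.
  rewrite !big_nil; have -> : (fun t : R => g (x + t *: 0)) = cst (g x).
    by apply/funext => t; rewrite scaler0 addr0.
  exact: is_derive_cst.
rewrite !big_cons; set w := \sum_(j <- l) v ord0 j *: evec j.
apply: is_derive_eps => e e0.
have e2 : 0 < e / 2 by rewrite divr_gt0.
have IHx := is_derive_epsP (IH x) e2.
pose a := v ord0 j.
have ea : 0 < e / 2 / (`|a| + 1) by rewrite divr_gt0// ltr_wpDl.
have [r r0 rP] := smooth_eps x (smooth_pd j sg) ea.
(* For |t| below this number the total displacement, at most |t| (|w| + |a|), stays under [r]. *)
have r1 : 0 < r / (`|w| + `|a| + 1).
  by rewrite divr_gt0// ltr_wpDl// addr_ge0.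
have near_r := @near0_lt R R^o _ r1.
apply: filterS2 IHx near_r => t IHt tr t0.
have IHt' := IHt t0; rewrite !add0r scale0r addr0 in IHt'.
rewrite add0r scale0r addr0 -/a.
have [c ct E] : exists2 c, `|c| <= `|a * t| &
    g (x + t *: (a *: evec j + w)) - g (x + t *: w) = pd j g (x + t *: w + c *: evec j) * (a * t).
  have := @mvt_from0 R (fun u : R => g (x + t *: w + u *: evec j))
    (fun u => pd j g (x + t *: w + u *: evec j)) (a * t)
    (fun u _ => is_derive_line (smooth_has_pd j sg) _ u).
  case=> c ct; rewrite scale0r addr0 => E; exists c => //; rewrite -E; congr (g _ - _).
  by rewrite scalerDr scalerA [a * t]mulrC addrA addrAC.
have B : `|pd j g (x + t *: w + c *: evec j) - pd j g x| <= e / 2 / (`|a| + 1).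
  apply: rP; have -> : x + t *: w + c *: evec j - x = t *: w + c *: evec j.
    by apply/rowP => o; rewrite !mxE; ring.
  apply: (le_lt_trans (ler_normD _ _)).
  apply: (le_lt_trans (lerD (lexx _) (norm_line_le c j))).
  apply: (le_lt_trans (lerD (lexx _) ct)); rewrite normrM normrZ.
  rewrite [`|a| * _]mulrC -mulrDr.
  apply: (@le_lt_trans _ _ (`|t| * (`|w| + `|a| + 1))); first by rewrite ler_wpM2l// lerDl.
  by rewrite -ltr_pdivlMr// ltr_wpDl// addr_ge0.
rewrite (_ : _ - _ = a * (pd j g (x + t *: w + c *: evec j) - pd j g x) +
   ((g (x + t *: w) - g x) / t - \sum_(j <- l) v ord0 j * pd j g x)); last first.
  have -> : g (x + t *: (a *: evec j + w)) =
     pd j g (x + t *: w + c *: evec j) * (a * t) + g (x + t *: w) by rewrite -E subrK.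
  by field.
apply: (le_trans (ler_normD _ _)); rewrite [e](splitr e); apply: lerD => //.
rewrite normrM; apply: (le_trans (ler_wpM2l (normr_ge0 a) B)).
by rewrite mulrCA ger_pMr// ler_pdivrMr ?ltr_wpDl// mul1r lerDl.
Qed.

Lemma is_derive_dir (g : 'rV[R]_n -> R) (v : 'rV[R]_n) : smooth g -> forall x (t : R),
  is_derive t 1 (fun t : R => g (x + t *: v)) (\sum_j v ord0 j * pd j g (x + t *: v)).
Proof.
move=> sg x t; apply: (@is_derive_line _ _ g (fun x => \sum_j v ord0 j * pd j g x)) => {}x.
have := @is_derive_dir_seq g v (index_enum 'I_n) sg x.
have -> // : \sum_j v ord0 j *: evec j = v.
by rewrite [RHS]row_sum_delta.
Qed.

End DirectionalDerivative.

Section Taylor.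
Context {R : realType} {n : nat}.

(** Summing over all words of a given length, not over multi-indices, makes the l-th directional
    derivative a plain sum; multinomial coefficients are hidden in repetitions. *)
Fixpoint words (l : nat) : seq (seq 'I_n) :=
  if l is l'.+1 then [seq j :: s | s <- words l', j <- index_enum 'I_n] else [:: [::]].

Lemma sum_words (V : nmodType) l (F : seq 'I_n -> V) :
  \sum_(s <- words l.+1) F s = \sum_(s <- words l) \sum_j F (j :: s).
Proof. by rewrite /= big_allpairs_dep. Qed.

Lemma size_words l s : s \in words l -> size s = l.
Proof.
elim: l s => [|l IH] s /=; first by rewrite inE => /eqP ->.
by move=> /allpairsP[[u j] /= [/IH <- _ ->]].
Qed.

Definition qmon (s : seq 'I_n) (Q : 'rV[R]_n) : R := \prod_(j <- s) Q ord0 j.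

Definition n1 (x : 'rV[R]_n) : R := \sum_i `|x ord0 i|.

Lemma n1_ge0 x : 0 <= n1 x. Proof. by apply: sumr_ge0. Qed.

Lemma qmon_cons j s Q : qmon (j :: s) Q = Q ord0 j * qmon s Q.
Proof. by rewrite /qmon big_cons. Qed.

Lemma sum_words_norm l Q : \sum_(s <- words l) `|qmon s Q| = n1 Q ^+ l.
Proof.
elim: l => [|l IH]; first by rewrite big_seq1 /qmon big_nil normr1.
rewrite sum_words exprS -IH mulr_sumr; apply: eq_bigr => s _.
by rewrite /n1 mulr_suml; apply: eq_bigr => j _; rewrite qmon_cons normrM.
Qed.

(** The remainder for [F 0] has as derivative the remainder of one order less for [F 1], so
    induction and the mean value theorem suffice. The price is the loss of the factor 1 / m! in the
    bound. *)
Lemma taylor1 (m : nat) (F : nat -> R -> R) (B : R) :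
  (forall l (t : R), is_derive t 1 (F l) (F l.+1 t)) ->
  (forall t, `|t| <= 1 -> `|F m t| <= B) ->
  forall t, `|t| <= 1 -> `|F 0 t - \sum_(l < m) t ^+ l / (l`!)%:R * F l 0| <= B * `|t| ^+ m.
Proof.
elim: m F => [|m IH] F dF FB t t1; first by rewrite big_ord0 subr0 expr0 mulr1 FB.
pose E (u : R) := F 0 u - \sum_(l < m.+1) u ^+ l / (l`!)%:R * F l 0.
pose E' (u : R) := F 1 u - \sum_(l < m) u ^+ l / (l`!)%:R * F l.+1 0.
have dE (u : R) : is_derive u 1 E (E' u).
  have dterm (l : 'I_m) : is_derive u 1 (fun u : R => u ^+ l.+1 / ((l.+1)`!)%:R * F l.+1 0)
      (u ^+ l / (l`!)%:R * F l.+1 0).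
    have D := @is_deriveX _ _ (fun u : R => u) l.+1 u 1 1 (is_derive_id _ _).
    have D2 := @is_deriveZ _ _ _ _ (F l.+1 0 / ((l.+1)`!)%:R) u 1 _ D.
    have -> : (fun u : R => u ^+ l.+1 / (l.+1)`!%:R * F l.+1 0) =
        (F l.+1 0 / (l.+1)`!%:R) *: (fun u : R => u) ^+ l.+1.
      by apply/funext => w; rewrite exprfctE /GRing.scale/= mulrC mulrCA mulrC.
    apply: is_derive_eq; rewrite /GRing.scale/= mulr1 factS natrM.
    have f0 : (l`!)%:R != 0 :> R by rewrite pnatr_eq0 -lt0n fact_gt0.
    rewrite /= -mulr_natl.
    by field; rewrite f0/= nat1r pnatr_eq0.
  apply: is_deriveB.
  have -> : (fun u : R => \sum_(l < m.+1) u ^+ l / (l`!)%:R * F l 0) =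
     cst (F 0 0) + (fun u : R => \sum_(l < m) u ^+ l.+1 / ((l.+1)`!)%:R * F l.+1 0).
    apply/funext => w; rewrite big_ord_recl /= expr0 fact0 divr1 mul1r.
    by congr (_ + _).
  rewrite -[X in is_derive _ _ _ X]add0r; apply: is_deriveD.
  have := @is_derive_sum _ _ _ m (fun l (u : R) => u ^+ l.+1 / ((l.+1)`!)%:R * F l.+1 0) u 1
    (fun l => u ^+ l / (l`!)%:R * F l.+1 0) dterm.
  by congr is_derive; apply/funext => w; rewrite fct_sumE.
have E0 : E 0 = 0.
  rewrite /E big_ord_recl expr0 fact0 divr1 mul1r big1 ?addr0 ?subrr// => i _.
  by rewrite expr0n /= !mul0r.
have [c ct] := @mvt_from0 R E E' t (fun u _ => dE u).
rewrite E0 subr0 -/(E t) => ->.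
have := IH (fun l => F l.+1) (fun l => dF l.+1) FB c (le_trans ct t1).
move=> h; rewrite normrM exprSr mulrA; apply: ler_pM => //.
apply: le_trans h _; rewrite ler_wpM2l ?lerXn2r ?nnegrE//.
by apply: le_trans (FB 0 _); rewrite ?normr0.
Qed.

Lemma taylor (g : 'rV[R]_n -> R) (m : nat) (x Q : 'rV[R]_n) (B : R) : smooth g ->
  (forall t : R, `|t| <= 1 -> forall s, size s = m -> `|iter_pd s g (x + t *: Q)| <= B) ->
  `|g (x + Q) - \sum_(l < m) (l`!)%:R^-1 * \sum_(s <- words l) qmon s Q * iter_pd s g x|
     <= B * n1 Q ^+ m.
Proof.
move=> sg gB.
pose F l (t : R) := \sum_(s <- words l) qmon s Q * iter_pd s g (x + t *: Q).
have dF l (t : R) : is_derive t 1 (F l) (F l.+1 t).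
  rewrite /F sum_words.
  have -> : (fun t : R => \sum_(s <- words l) qmon s Q * iter_pd s g (x + t *: Q)) =
    \sum_(k < size (words l)) (fun t : R => qmon (nth [::] (words l) k) Q *
        iter_pd (nth [::] (words l) k) g (x + t *: Q)).
    by apply/funext => u; rewrite fct_sumE (big_nth [::]) big_mkord.
  rewrite (big_nth [::]) big_mkord; apply: is_derive_sum => k.
  set s := nth _ _ _.
  have := @is_deriveZ _ _ _ _ (qmon s Q) t 1 _ (is_derive_dir Q (smooth_iter_pd s sg) x t).
  congr is_derive; rewrite /GRing.scale/= mulr_sumr; apply: eq_bigr => j _.
  by rewrite qmon_cons mulrA [qmon s Q * _]mulrC.
have := @taylor1 m F (B * n1 Q ^+ m) dF _ 1.
rewrite normr1 expr1n mulr1 => H.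
have E0 : F 0 1 = g (x + Q) by rewrite /F big_seq1 /qmon big_nil mul1r scale1r.
rewrite -E0; apply: le_trans (H _ (lexx _)); last first.
  move=> t t1; rewrite -sum_words_norm mulr_sumr.
  apply: le_trans (ler_norm_sum _ _ _) _.
  rewrite [leLHS]big_seq [leRHS]big_seq; apply: ler_sum => s /size_words ss.
  by rewrite normrM mulrC ler_wpM2r// gB.
rewrite le_eqVlt; apply/orP; left; apply/eqP; congr (`|_ - _|).
apply: eq_bigr => l _; rewrite expr1n mul1r; congr (_ * _).
by apply: eq_bigr => s _; rewrite scale0r addr0.
Qed.

End Taylor.

(** * Bump functions and rapidly decreasing families *)

Section Bump.
Context {R : realType}.

(** A quotient A / (A + Z), where A is positive exactly for |t| < 2r and Z exactly for |t| > r.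
    Hence the value is 1 up to radius r and 0 from radius 2r on. *)
Definition bump1 (r t : R) : R :=
  flat 0 (2 * r - t) * flat 0 (2 * r + t) /
  (flat 0 (2 * r - t) * flat 0 (2 * r + t) + (flat 0 (t - r) + flat 0 (- t - r))).

Lemma bump1_den (r t : R) : 0 < r ->
  0 < flat 0 (2 * r - t) * flat 0 (2 * r + t) + (flat 0 (t - r) + flat 0 (- t - r)).
Proof.
move=> r0; have A0 : 0 <= flat 0 (2 * r - t) * flat 0 (2 * r + t) by rewrite mulr_ge0 ?flat_ge0.
have Z0 : 0 <= flat 0 (t - r) + flat 0 (- t - r) by rewrite addr_ge0 ?flat_ge0.
have [tr|tr] := ltP r t.
  by apply: ltr_wpDl => //; apply: ltr_pwDl; rewrite ?flat_ge0// flat_gt0// subr_gt0.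
have [tr'|tr'] := ltP t (- r).
  apply: ltr_wpDl => //; apply: ltr_wpDl; rewrite ?flat_ge0// flat_gt0// subr_gt0.
  by rewrite ltrNr.
by apply: ltr_pwDl => //; rewrite mulr_gt0// flat_gt0//; lra.
Qed.

Lemma bump1_eq1 (r t : R) : 0 < r -> `|t| <= r -> bump1 r t = 1.
Proof.
move=> r0; rewrite ler_norml => /andP[tr rt]; have := bump1_den t r0; rewrite /bump1.
rewrite (flat_le0 0 (_ : t - r <= 0)) ?subr_le0// (flat_le0 0 (_ : - t - r <= 0)); last by lra.
by rewrite !addr0 => h; rewrite divff// gt_eqF.
Qed.

Lemma bump1_eq0 (r t : R) : 2 * r <= `|t| -> bump1 r t = 0.
Proof.
rewrite ler_normr /bump1 => /orP[h|h].
  by rewrite (flat_le0 0 (_ : 2 * r - t <= 0)) ?subr_le0// !mul0r.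
by rewrite (flat_le0 0 (_ : 2 * r + t <= 0)) ?mulr0 ?mul0r//; lra.
Qed.

Lemma bump1_ge0 (r t : R) : 0 < r -> 0 <= bump1 r t.
Proof. by move=> r0; rewrite divr_ge0 ?mulr_ge0 ?flat_ge0// ltW// bump1_den. Qed.

Definition chi {n} (r : R) (x : 'rV[R]_n) : R := \prod_i bump1 r (x ord0 i).

Lemma chi_eq1 n (r : R) (x : 'rV[R]_n) : 0 < r -> (forall i, `|x ord0 i| <= r) -> chi r x = 1.
Proof. by move=> r0 xr; rewrite /chi big1// => i _; exact: bump1_eq1. Qed.

Lemma chi_eq0 n (r : R) (x : 'rV[R]_n) i : 2 * r <= `|x ord0 i| -> chi r x = 0.
Proof. by move=> xi; rewrite /chi (bigD1 i)//= bump1_eq0// mul0r. Qed.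

Lemma chi_ge0 n (r : R) (x : 'rV[R]_n) : 0 < r -> 0 <= chi r x.
Proof. by move=> r0; apply: prodr_ge0 => i _; exact: bump1_ge0. Qed.

Lemma smooth_chi n (r : R) : 0 < r -> smooth (@chi n r).
Proof.
move=> r0; apply: smooth_prod => i; have sx := @smooth_coord R n i.
have sC c := @smooth_cst R n c.
have fA := smooth_flat 0 (smoothB (sC (2 * r)) sx).
have fB := smooth_flat 0 (smoothD (sC (2 * r)) sx).
have fC := smooth_flat 0 (smoothB sx (sC r)).
have fD := smooth_flat 0 (smoothB (smoothN sx) (sC r)).
have sA := smoothM fA fB.
apply: (smoothM sA (smooth_inv (smoothD sA (smoothD fC fD)) _)) => x.
by rewrite gt_eqF// bump1_den.
Qed.

Lemma box_compact n (r : R) : compact [set x : 'rV[R]_n | forall i, `|x ord0 i| <= r].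
Proof.
have := @rV_compact R n (fun=> [set t : R | `|t| <= r]); apply => _.
have -> : [set t : R | `|t| <= r] = `[- r, r]%classic.
  by apply/seteqP; split => t /=; rewrite in_itv/= ler_norml.
exact: segment_compact.
Qed.

Lemma box_closed n (r : R) : closed [set x : 'rV[R]_n | forall i, `|x ord0 i| <= r].
Proof. by apply: compact_closed; [exact: norm_hausdorff | exact: box_compact]. Qed.

Lemma compact_support_bound n (g : 'rV[R]_n -> R) (K : set 'rV[R]_n) s L : smooth g -> compact K ->
  (forall x, ~ K x -> g x = 0) -> exists C, forall x, `|iter_pd s g x| * nW x ^+ L <= C.
Proof.
move=> sg cK g0.
have clK : closed K by apply: compact_closed => //; exact: norm_hausdorff.
have [_ [C HC]] : dec (fun x => iter_pd s g x * nW x ^+ L).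
  apply: (dec_compact (K := K)) => //.
    apply: contP => x; apply: contM; first exact/smooth_continuous/smooth_iter_pd.
    by apply: contX; exact: nW_continuous.
  by move=> x nKx; rewrite (iter_pd_support s clK g0 nKx) mul0r.
exists C => x; apply: le_trans (HC x).
rewrite normrM [`|nW x ^+ L|]ger0_norm ?exprn_ge0 ?(ltW (nW_gt0 x))//.
rewrite ler_peMr ?mulr_ge0 ?exprn_ge0 ?(ltW (nW_gt0 x))//.
exact/exprn_ege1/nW_ge1.
Qed.

End Bump.

Section Families.
Context {R : realType} {n : nat}.

(** Bounded families of Schwartz functions; [utemp] below is the analogue for multipliers of
    polynomial growth. Keeping the index in the definition delivers the bounds uniform in the dyadic
    scale that the series need. *)
Definition urapid (I : Type) (g : I -> 'rV[R]_n -> R) : Prop :=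
  (forall i, smooth (g i)) /\
  forall s L, exists C, forall i x, `|iter_pd s (g i) x| * nW x ^+ L <= C.

Definition utemp (I : Type) (g : I -> 'rV[R]_n -> R) : Prop :=
  (forall i, smooth (g i)) /\
  forall s, exists L C, forall i x, `|iter_pd s (g i) x| <= C * nW x ^+ L.

Definition rapid (g : 'rV[R]_n -> R) := urapid (fun _ : unit => g).

Lemma urapid_temp (I : Type) (g : I -> 'rV[R]_n -> R) : urapid g -> utemp g.
Proof.
move=> [sg gC]; split=> // s; have [C HC] := gC s 0; exists 0%N, C => i x.
by have := HC i x; rewrite expr0 !mulr1.
Qed.

Lemma urapid_reindex (I J : Type) (f : J -> I) (g : I -> 'rV[R]_n -> R) :
  urapid g -> urapid (fun j => g (f j)).
Proof.
move=> [sg gC]; split=> [j|s L]; first exact: sg.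
by have [C HC] := gC s L; exists C => j x; exact: HC.
Qed.

Lemma utemp_reindex (I J : Type) (f : J -> I) (g : I -> 'rV[R]_n -> R) :
  utemp g -> utemp (fun j => g (f j)).
Proof.
move=> [sg gC]; split=> [j|s]; first exact: sg.
by have [L [C HC]] := gC s; exists L, C => j x; exact: HC.
Qed.

Lemma urapid_rapid (I : Type) (g : I -> 'rV[R]_n -> R) i : urapid g -> rapid (g i).
Proof. exact: (@urapid_reindex I unit (fun=> i)). Qed.

Lemma urapid_pd (I : Type) (g : I -> 'rV[R]_n -> R) j : urapid g -> urapid (fun i => pd j (g i)).
Proof.
move=> [sg gC]; split=> [i|s L]; first exact: smooth_pd.
have [C HC] := gC (s ++ [:: j]) L; exists C => i x.
by have := HC i x; rewrite iter_pd_cat.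
Qed.

Lemma utemp_pd (I : Type) (g : I -> 'rV[R]_n -> R) j : utemp g -> utemp (fun i => pd j (g i)).
Proof.
move=> [sg gC]; split=> [i|s]; first exact: smooth_pd.
have [L [C HC]] := gC (s ++ [:: j]); exists L, C => i x.
by have := HC i x; rewrite iter_pd_cat.
Qed.

Lemma urapid_iter_pd (I : Type) (g : I -> 'rV[R]_n -> R) s :
  urapid g -> urapid (fun i => iter_pd s (g i)).
Proof. by move=> ug; elim: s => [//|j s IH]; exact: urapid_pd. Qed.

Lemma urapidD (I : Type) (f g : I -> 'rV[R]_n -> R) : urapid f -> urapid g ->
  urapid (fun i x => f i x + g i x).
Proof.
move=> [sf fC] [sg gC]; split=> [i|s L]; first exact: smoothD.
have [C HC] := fC s L; have [D HD] := gC s L; exists (C + D) => i x.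
rewrite iter_pdD//; apply: le_trans (lerD (HC i x) (HD i x)).
by rewrite -mulrDl ler_wpM2r ?exprn_ge0 ?(ltW (nW_gt0 x))// ler_normD.
Qed.

Lemma nW_pow_bound (x : 'rV[R]_n) (k l : nat) (C : R) : (k <= l)%N ->
  C * nW x ^+ k <= `|C| * nW x ^+ l.
Proof.
move=> kl; apply: (@le_trans _ _ (`|C| * nW x ^+ k)).
  by rewrite ler_wpM2r ?exprn_ge0 ?(ltW (nW_gt0 x))// ler_norm.
by rewrite ler_wpM2l// ler_nWX.
Qed.

Lemma utempD (I : Type) (f g : I -> 'rV[R]_n -> R) : utemp f -> utemp g ->
  utemp (fun i x => f i x + g i x).
Proof.
move=> [sf fC] [sg gC]; split=> [i|s]; first exact: smoothD.
have [L [C HC]] := fC s; have [M [D HD]] := gC s.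
exists (maxn L M), (`|C| + `|D|) => i x; rewrite iter_pdD//.
apply: le_trans (ler_normD _ _) _; rewrite mulrDl; apply: lerD.
  by apply: le_trans (HC i x) _; apply: nW_pow_bound; exact: leq_maxl.
by apply: le_trans (HD i x) _; apply: nW_pow_bound; exact: leq_maxr.
Qed.

Lemma urapidM (I : Type) (f g : I -> 'rV[R]_n -> R) : urapid f -> utemp g ->
  urapid (fun i x => f i x * g i x).
Proof.
move=> uf ug; split=> [i|s]; first by apply: smoothM; [exact: (proj1 uf) | exact: (proj1 ug)].
(* The last letter is the derivative applied first, so the Leibniz rule acts on the product itself
   and both resulting products fall under the induction hypothesis. *)
elim/last_ind: s f g uf ug => [|s j IH] f g uf ug L.
  have [M [D HD]] := proj2 ug [::]; have [C HC] := proj2 uf [::] (M + L)%N.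
  exists (C * `|D|) => i x; rewrite /= normrM.
  apply: (@le_trans _ _ (`|f i x| * (`|D| * nW x ^+ M) * nW x ^+ L)).
    rewrite ler_wpM2r ?exprn_ge0 ?(ltW (nW_gt0 x))// ler_wpM2l//.
    by apply: le_trans (HD i x) _; exact: nW_pow_bound.
  rewrite (_ : _ * _ * _ = `|f i x| * nW x ^+ (M + L) * `|D|); last by rewrite exprD; ring.
  by rewrite ler_wpM2r//; exact: HC.
have [C HC] := IH _ _ (urapid_pd j uf) ug L.
have [D HD] := IH _ _ uf (utemp_pd j ug) L.
exists (C + D) => i x; rewrite -cats1 iter_pd_cat /= pdM; [|exact: (proj1 uf)|exact: (proj1 ug)].
rewrite iter_pdD; last 2 first.
- by apply: smoothM; [exact/smooth_pd/(proj1 uf) | exact: (proj1 ug)].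
- by apply: smoothM; [exact: (proj1 uf) | exact/smooth_pd/(proj1 ug)].
apply: le_trans (lerD (HC i x) (HD i x)).
by rewrite -mulrDl ler_wpM2r ?exprn_ge0 ?(ltW (nW_gt0 x))// ler_normD.
Qed.

Lemma utempM (I : Type) (f g : I -> 'rV[R]_n -> R) : utemp f -> utemp g ->
  utemp (fun i x => f i x * g i x).
Proof.
move=> uf ug; split=> [i|s]; first by apply: smoothM; [exact: (proj1 uf) | exact: (proj1 ug)].
elim/last_ind: s f g uf ug => [|s j IH] f g uf ug.
  have [M [D HD]] := proj2 ug [::]; have [L [C HC]] := proj2 uf [::].
  exists (L + M)%N, (`|C| * `|D|) => i x; rewrite /= normrM exprD mulrACA.
  apply: ler_pM => //; last by apply: le_trans (HD i x) _; exact: nW_pow_bound.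
  by apply: le_trans (HC i x) _; exact: nW_pow_bound.
have [L [C HC]] := IH _ _ (utemp_pd j uf) ug.
have [M [D HD]] := IH _ _ uf (utemp_pd j ug).
exists (maxn L M), (`|C| + `|D|) => i x.
rewrite -cats1 iter_pd_cat /= pdM; [|exact: (proj1 uf)|exact: (proj1 ug)].
rewrite iter_pdD; last 2 first.
- by apply: smoothM; [exact/smooth_pd/(proj1 uf) | exact: (proj1 ug)].
- by apply: smoothM; [exact: (proj1 uf) | exact/smooth_pd/(proj1 ug)].
apply: le_trans (ler_normD _ _) _; rewrite mulrDl; apply: lerD.
  by apply: le_trans (HC i x) _; apply: nW_pow_bound; exact: leq_maxl.
by apply: le_trans (HD i x) _; apply: nW_pow_bound; exact: leq_maxr.
Qed.

Lemma utemp_cst (I : Type) (c : I -> R) (C : R) : (forall i, `|c i| <= C) ->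
  utemp (fun i (_ : 'rV[R]_n) => c i).
Proof.
move=> cC; split=> [i|s]; first exact: smooth_cst.
exists 0%N, C => i x; rewrite expr0 mulr1.
case/lastP: s => [|s j]; first exact: cC.
by rewrite -cats1 iter_pd_cat /= pd_cst iter_pd0 normr0 (le_trans _ (cC i)).
Qed.

Lemma utemp_coord (I : Type) (j : 'I_n) : utemp (fun (_ : I) (x : 'rV[R]_n) => x ord0 j).
Proof.
split=> [i|s]; first exact: smooth_coord.
exists 1%N, 1 => i x; rewrite mul1r expr1; case/lastP: s => [|s k]; first exact: coord_le_nW.
rewrite -cats1 iter_pd_cat /= (has_pdE (@has_pd_coord _ _ k j)).
apply: le_trans (nW_ge1 x); case/lastP: s => [|s l]; first by rewrite /= normr_nat; case: (_ == _).
by rewrite -cats1 iter_pd_cat /= pd_cst iter_pd0 normr0.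
Qed.

Lemma urapidZ (I : Type) (c : R) (g : I -> 'rV[R]_n -> R) : urapid g ->
  urapid (fun i x => c * g i x).
Proof.
move=> ug; have -> : (fun i x => c * g i x) = (fun i x => g i x * c).
  by apply/funext => i; apply/funext => x; rewrite mulrC.
by apply: urapidM => //; exact: (@utemp_cst _ (fun=> c) `|c|).
Qed.

Lemma compact_support_rapid (g : 'rV[R]_n -> R) (K : set 'rV[R]_n) : smooth g -> compact K ->
  (forall x, ~ K x -> g x = 0) -> rapid g.
Proof.
move=> sg cK g0; split=> // s L; have [C HC] := compact_support_bound s L sg cK g0.
by exists C => _ x; exact: HC.
Qed.

Lemma rapid_dec (g : 'rV[R]_n -> R) : rapid g -> dec g.
Proof.
move=> [sg gC]; split; first exact/smooth_continuous/(sg tt).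
by have [C HC] := gC [::] 2; exists C => x; exact: (HC tt x).
Qed.

End Families.

(** * Oscillatory integrals and Fourier inversion *)

Section Oscillation.
Context {R : realType} {n : nat}.
Implicit Types (k y : 'rV[R]_n) (c : R).

(** The free phase [c] handles cosine and sine at once: phase 0 is the real part of the exponential,
    phase -pi / 2 its imaginary part, and each derivative adds pi / 2. *)
Definition osc k c y : R := cos (dotp k y + c).

Lemma dotpC k y : dotp k y = dotp y k.
Proof. by apply: eq_bigr => i _; rewrite mulrC. Qed.

Lemma dotpDl k l y : dotp (k + l) y = dotp k y + dotp l y.
Proof. by rewrite /dotp -big_split; apply: eq_bigr => i _; rewrite mxE mulrDl. Qed.

Lemma oscC k c y : osc k c y = osc y c k. Proof. by rewrite /osc dotpC. Qed.

Lemma osc_le1 k c y : `|osc k c y| <= 1.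
Proof. by rewrite ler_norml cos_geN1 cos_le1. Qed.

Lemma smooth_dotp k : smooth (dotp k).
Proof. by apply: smooth_sum => i; apply: smoothZ; exact: smooth_coord. Qed.

Lemma pd_dotp k j : pd j (dotp k) = fun=> k ord0 j.
Proof.
have := @iter_pd_sum _ _ [:: j] _ (index_enum 'I_n) (fun i y => k ord0 i * y ord0 i).
rewrite /= => -> => [|i]; last by apply: smoothZ; exact: smooth_coord.
apply/funext => y; rewrite (bigD1 j)//= big1 => [|i ij].
  by rewrite pdZ ?(has_pdE (@has_pd_coord _ _ j j)) ?eqxx ?mulr1 ?addr0//; exact: smooth_coord.
rewrite pdZ ?(has_pdE (@has_pd_coord _ _ j i)); last exact: smooth_coord.
by rewrite eq_sym (negbTE ij) mulr0.
Qed.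

Lemma smooth_osc k c : smooth (osc k c).
Proof. by apply: smooth_cos; apply: smoothD; [exact: smooth_dotp | exact: smooth_cst]. Qed.

Lemma pd_osc k c j : pd j (osc k c) = fun y => k ord0 j * osc k (c + pi / 2) y.
Proof.
rewrite /osc pd_cos; last by apply: smoothD; [exact: smooth_dotp | exact: smooth_cst].
apply/funext => y; rewrite pdD; [|exact: smooth_dotp|exact: smooth_cst].
by rewrite pd_dotp pd_cst addr0 addrA cosDpihalf mulrC.
Qed.

Lemma iter_pd_osc k c s :
  iter_pd s (osc k c) = fun y => qmon s k * osc k (c + (size s)%:R * (pi / 2)) y.
Proof.
elim: s => [|j s IH].
  by apply/funext => y; rewrite /qmon big_nil mul1r mul0r addr0.
rewrite iter_pd_cons IH pdZ; last exact: smooth_osc.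
apply/funext => y; rewrite pd_osc qmon_cons mulrCA mulrA; congr (_ * osc k _ y).
by rewrite /= -[(size s).+1%:R]natr1 [(_ + 1) * _]mulrDl mul1r addrA.
Qed.

Lemma utemp_osc (I : Type) (k : I -> 'rV[R]_n) (c : I -> R) (K : R) :
  (forall i j, `|k i ord0 j| <= K) -> utemp (fun i => osc (k i) (c i)).
Proof.
move=> kK; split=> [i|s]; first exact: smooth_osc.
exists 0%N, (`|K| ^+ size s) => i x; rewrite iter_pd_osc expr0 mulr1 normrM.
rewrite -[leRHS]mulr1; apply: ler_pM => //; last exact: osc_le1.
elim: s => [|j s IH]; first by rewrite /qmon big_nil normr1.
rewrite qmon_cons normrM exprS; apply: ler_pM => //.
exact: le_trans (kK i j) (ler_norm _).
Qed.

Lemma osc_continuous c : continuous (fun p : 'rV[R]_n * 'rV[R]_n => osc p.1 c p.2).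
Proof.
apply: contP => p.
apply: (@cont_comp _ _ _ (fun p : 'rV[R]_n * 'rV[R]_n => dotp p.1 p.2 + c) cos);
  last exact: continuous_cos.
apply: contD; last exact: contC.
apply: sum_continuous => i; apply: contM.
  by apply: (@cont_comp _ _ _ fst (fun v : 'rV[R]_n => v ord0 i)); [exact: contfst | exact: coordc].
by apply: (@cont_comp _ _ _ snd (fun v : 'rV[R]_n => v ord0 i)); [exact: contsnd | exact: coordc].
Qed.

End Oscillation.

Section RealFourier.
Context {R : realType} {n : nat}.
Implicit Types (k y : 'rV[R]_n) (c : R) (g : 'rV[R]_n -> R).

Definition oscint c g k : R := intRn (fun y => osc k c y * g y).

Lemma rapid_osc k c g : rapid g -> rapid (fun y => osc k c y * g y).
Proof.
move=> rg; have -> : (fun y => osc k c y * g y) = (fun y => g y * osc k c y).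
  by apply/funext => y; rewrite mulrC.
apply: urapidM => //; apply: (@utemp_osc _ _ _ (fun=> k) (fun=> c) (n1 k)) => _ j.
by rewrite /n1 (bigD1 j)//= lerDl sumr_ge0.
Qed.

Lemma rapid_coord j g : rapid g -> rapid (fun y => y ord0 j * g y).
Proof.
move=> rg; have -> : (fun y => y ord0 j * g y) = (fun y => g y * y ord0 j).
  by apply/funext => y; rewrite mulrC.
by apply: urapidM => //; exact: utemp_coord.
Qed.

Lemma osc_cont2 c g k : rapid g -> forall y (h : R) (v : 'rV[R]_n),
  {for (y, h), continuous (fun p : 'rV[R]_n * R => osc (k + p.2 *: v) c p.1 * g p.1)}.
Proof.
move=> rg y h v; apply: contM.
  apply: (@cont_comp _ _ _ (fun p : 'rV[R]_n * R => (k + p.2 *: v, p.1))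
    (fun p : 'rV[R]_n * 'rV[R]_n => osc p.1 c p.2)); last exact: osc_continuous.
  apply: cont_pair; last exact: contfst.
  apply: contDV; first exact: contC.
  by apply: contZV; [exact: contsnd | exact: contC].
apply: (@cont_comp _ _ _ fst g); first exact: contfst.
exact: (smooth_continuous (proj1 rg tt)).
Qed.

Lemma has_pd_oscint c g j : rapid g ->
  has_pd j (oscint c g) (oscint (c + pi / 2) (fun y => y ord0 j * g y)).
Proof.
move=> rg k.
have rg' := rapid_coord j rg.
have [C HC] := (proj2 rg' [::] 2%N).
have H1 (h : R) y : `|h| <= 1 -> is_derive h 1 (fun h : R => osc (k + h *: evec j) c y * g y)
    (osc (k + h *: evec j) (c + pi / 2) y * (y ord0 j * g y)).
  move=> _.
  have H : has_pd j (fun k => osc k c y) (fun k => y ord0 j * osc k (c + pi / 2) y).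
    have -> : (fun k => osc k c y) = osc y c by apply/funext => l; exact: oscC.
    move=> x; have := smooth_has_pd j (smooth_osc y c) x.
    by rewrite pd_osc [osc x _ y]oscC.
  have D := is_derive_line H k h.
  have := @is_deriveZ _ _ _ _ (g y) h 1 _ D.
  rewrite /GRing.scale/=.
  have R3 (a b d : R) : a * (b * d) = d * (b * a) by ring.
  rewrite R3; congr is_derive; apply/funext => t /=; exact: mulrC.
have H2 (h : R) y : `|h| <= 1 ->
    `|osc (k + h *: evec j) (c + pi / 2) y * (y ord0 j * g y)| * nW y ^+ 2 <= C.
  move=> _; apply: le_trans (HC tt y); rewrite /= normrM.
  rewrite ler_wpM2r ?exprn_ge0 ?(ltW (nW_gt0 y))//.
  by rewrite ler_piMl// osc_le1.
have [_] := @intRn_derive _ n (fun h y => osc (k + h *: evec j) c y * g y)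
  (fun h y => osc (k + h *: evec j) (c + pi / 2) y * (y ord0 j * g y)) C
  (fun h => rapid_dec (rapid_osc (k + h *: evec j) c rg)) H1
  (fun y => @osc_cont2 (c + pi / 2) _ k rg' y 0 (evec j)) H2.
by rewrite /oscint scale0r addr0.
Qed.

Lemma smooth_oscint c g : rapid g -> smooth (oscint c g).
Proof.
move=> rg; apply: (@smooth_coind _ _ (fun f => exists c g, rapid g /\ f = oscint c g));
  last by exists c, g.
move=> _ [{}c [{rg}g [rg ->]]]; split.
  apply: contP => k; have [C HC] := proj2 rg [::] 2%N.
  apply: (@intRn_continuous_param _ _ _ (fun y k => osc k c y * g y) k C).
  - by move=> l; exact/dec_intble/rapid_dec/rapid_osc.
  - move=> y; apply: contM.
      apply: (@cont_comp _ _ _ (fun p : 'rV[R]_n * 'rV[R]_n => (p.2, p.1))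
        (fun p : 'rV[R]_n * 'rV[R]_n => osc p.1 c p.2)); last exact: osc_continuous.
      by apply: cont_pair; [exact: contsnd | exact: contfst].
    apply: (@cont_comp _ _ _ fst g); first exact: contfst.
    exact: (smooth_continuous (proj1 rg tt)).
  - apply: filterE => l y; apply: le_trans (HC tt y); rewrite normrM.
    rewrite ler_wpM2r ?exprn_ge0 ?(ltW (nW_gt0 y))//.
    by rewrite ler_piMl// osc_le1.
move=> j; exists (oscint (c + pi / 2) (fun y => y ord0 j * g y)); last exact: has_pd_oscint.
by exists (c + pi / 2), (fun y => y ord0 j * g y); split=> //; exact: rapid_coord.
Qed.

(** Integration by parts: k_j [osc k c] is a derivative of [osc k (c - pi / 2)], and the minus sign
    turns the phase c - pi / 2 into c + pi / 2. *)
Lemma oscint_coord c g j k : rapid g ->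
  k ord0 j * oscint c g k = oscint (c + pi / 2) (pd j g) k.
Proof.
move=> rg; have sg := proj1 rg tt; have rpg := urapid_pd j rg.
have ro := rapid_osc k (c - pi / 2) rg.
have : intRn (pd j (fun y => osc k (c - pi / 2) y * g y)) = 0.
  apply: (@intRn_partial0 _ _ j _ _ (rapid_dec ro)); first exact/rapid_dec/urapid_pd.
  exact: (smooth_has_pd j (proj1 ro tt)).
rewrite pdM//; last exact: smooth_osc.
rewrite pd_osc subrK intRnD; last 2 first.
- have -> : (fun y => k ord0 j * osc k c y * g y) = (fun y => k ord0 j * (osc k c y * g y)).
    by apply/funext => y; rewrite mulrA.
  exact/intbleZ/dec_intble/rapid_dec/rapid_osc.
- exact/dec_intble/rapid_dec/rapid_osc.
have -> : (fun y => k ord0 j * osc k c y * g y) = (fun y => k ord0 j * (osc k c y * g y)).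
  by apply/funext => y; rewrite mulrA.
rewrite intRnZ; last exact/dec_intble/rapid_dec/rapid_osc.
move/eqP; rewrite addr_eq0 => /eqP E; rewrite /oscint E -intRnN; last exact/dec_intble/rapid_dec/rapid_osc.
congr intRn; apply/funext => y; rewrite -mulNr; congr (_ * _).
have -> : c + pi / 2 = c - pi / 2 + pi by field.
by rewrite /osc [_ + (_ + pi)]addrA cosDpi.
Qed.

Lemma oscintD c f g : rapid f -> rapid g ->
  oscint c (fun y => f y + g y) = (fun k => oscint c f k + oscint c g k).
Proof.
move=> rf rg; apply/funext => k; rewrite /oscint -intRnD; last 2 first.
- exact/dec_intble/rapid_dec/rapid_osc.
- exact/dec_intble/rapid_dec/rapid_osc.
by congr intRn; apply/funext => y; rewrite mulrDr.
Qed.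

Lemma oscintZ c (a : R) g : rapid g -> oscint c (fun y => a * g y) = (fun k => a * oscint c g k).
Proof.
move=> rg; apply/funext => k; rewrite /oscint -intRnZ; last first.
  exact/dec_intble/rapid_dec/rapid_osc.
by congr intRn; apply/funext => y; rewrite mulrCA.
Qed.

(** The operator 1 - d^2/dy_j^2. The product of these over all [j] corresponds to multiplication of
    the transform by [nW]. *)
Definition bessel1 (j : 'I_n) g y : R := g y + - 1 * pd j (pd j g) y.

Definition bessel g := foldr bessel1 g (index_enum 'I_n).

Lemma urapid_bessel1 (I : Type) (g : I -> 'rV[R]_n -> R) j : urapid g ->
  urapid (fun i => bessel1 j (g i)).
Proof. by move=> ug; exact: (urapidD ug (urapidZ (- 1) (urapid_pd j (urapid_pd j ug)))). Qed.

Lemma urapid_bessel (I : Type) (g : I -> 'rV[R]_n -> R) : urapid g -> urapid (fun i => bessel (g i)).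
Proof.
rewrite /bessel; elim: (index_enum 'I_n) => [//|j l IH] ug /=.
by apply: urapid_bessel1; exact: IH.
Qed.

Lemma oscint_bessel1 c g j k : rapid g ->
  (1 + k ord0 j ^+ 2) * oscint c g k = oscint c (bessel1 j g) k.
Proof.
move=> rg; have rp := urapid_pd j rg; have rpp := urapid_pd j rp.
rewrite /bessel1 oscintD//; last exact: urapidZ.
rewrite oscintZ// mulrDl mul1r expr2 -mulrA oscint_coord// oscint_coord//.
congr (_ + _); rewrite mulN1r /oscint -intRnN; last exact/dec_intble/rapid_dec/rapid_osc.
congr intRn; apply/funext => y; rewrite -mulNr; congr (_ * _).
have -> : c + pi / 2 + pi / 2 = c + pi by field.
by rewrite /osc [_ + (_ + pi)]addrA cosDpi.
Qed.

Lemma oscint_bessel c g k : rapid g -> nW k * oscint c g k = oscint c (bessel g) k.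
Proof.
rewrite /nW /bessel; elim: (index_enum 'I_n) g => [|j l IH] g rg.
  by rewrite big_nil mul1r.
rewrite big_cons -mulrA IH//= oscint_bessel1//.
by elim: l {IH} => [//|i l IH] /=; exact: urapid_bessel1.
Qed.

Lemma oscint_besselX c g k L : rapid g -> nW k ^+ L * oscint c g k = oscint c (iter L bessel g) k.
Proof.
move=> rg; elim: L => [|L IH]; first by rewrite expr0 mul1r.
rewrite exprS -mulrA IH oscint_bessel//.
by elim: L {IH} => [//|L IH] /=; exact: urapid_bessel.
Qed.

Lemma iter_pd_oscint c g s : rapid g ->
  iter_pd s (oscint c g) = oscint (c + (size s)%:R * (pi / 2)) (fun y => qmon s y * g y) /\
  rapid (fun y => qmon s y * g y).
Proof.
move=> rg; elim: s => [|j s [IH rs]].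
  rewrite mul0r addr0; have -> // : (fun y => qmon [::] y * g y) = g.
  by apply/funext => y; rewrite /qmon big_nil mul1r.
have -> : (fun y => qmon (j :: s) y * g y) = (fun y => y ord0 j * (qmon s y * g y)).
  by apply/funext => y; rewrite qmon_cons mulrA.
split; last exact: rapid_coord.
rewrite iter_pd_cons IH (has_pdE (has_pd_oscint _ j rs)); congr oscint.
by rewrite /= -[(size s).+1%:R]natr1 [(_ + 1) * _]mulrDl mul1r addrA.
Qed.

Lemma urapid_qmon (I : Type) (g : I -> 'rV[R]_n -> R) s : urapid g ->
  urapid (fun i y => qmon s y * g i y).
Proof.
move=> ug; elim: s => [|j s IH].
  have -> // : (fun i y => qmon [::] y * g i y) = g.
  by apply/funext => i; apply/funext => y; rewrite /qmon big_nil mul1r.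
have -> : (fun i y => qmon (j :: s) y * g i y) = (fun i y => qmon s y * g i y * y ord0 j).
  by apply/funext => i; apply/funext => y; rewrite qmon_cons; ring.
by apply: urapidM => //; exact: utemp_coord.
Qed.

(** Derivatives of the transform become monomials under the integral, and powers of [nW] become
    powers of [bessel]; both keep the family rapidly decreasing. *)
Lemma urapid_oscint (I : Type) (c : R) (g : I -> 'rV[R]_n -> R) : urapid g ->
  urapid (fun i => oscint c (g i)).
Proof.
move=> ug; split=> [i|s L]; first exact/smooth_oscint/urapid_rapid.
have ub : urapid (fun i => iter L bessel (fun y => qmon s y * g i y)).
  by elim: L => [|L IH]; [exact: urapid_qmon | exact: urapid_bessel].
have [C HC] := proj2 ub [::] 2%N.
exists (C * InW n) => i k.
have [-> rq] := iter_pd_oscint c s (urapid_rapid i ug).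
rewrite mulrC -[X in X * _]ger0_norm; last by rewrite exprn_ge0// (ltW (nW_gt0 k)).
rewrite -normrM oscint_besselX//.
apply: intRn_small.
  exact/dec_intble/rapid_dec/rapid_osc/(urapid_rapid i ub).
move=> y; apply: le_trans (dec_bound1 (HC i) y); rewrite normrM.
by rewrite ler_wpM2r ?(ltW (nW_gt0 y))// ler_piMl// osc_le1.
Qed.

End RealFourier.

Section Positivity.
Context {R : realType}.
Local Notation mu := (@lebesgue_measure R).

Lemma Rintegral_gt0 (f : R -> R) (t0 : R) : continuous f -> lint f -> (forall t, 0 <= f t) ->
  0 < f t0 -> 0 < Rintegral mu setT f.
Proof.
move=> cf lf f0 ft0; pose e := f t0 / 2.
have e0 : 0 < e by rewrite divr_gt0.
have /nbhs_ballP[d /= d0 dP] := cont_near (cf t0) e0.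
pose I := `[t0, t0 + d / 2]%classic.
have mI : measurable I by exact: measurable_itv.
pose g t := e * \1_I t.
have gf t : g t <= f t.
  rewrite /g indicE; case: (boolP (t \in I)) => [|_]; last by rewrite mulr0 f0.
  rewrite mulr1 inE /I /= in_itv/= => /andP[ta tb].
  have : `|f t - f t0| <= e.
    apply: dP; rewrite -ball_normE /ball_/= distrC ger0_norm ?subr_ge0//.
    by rewrite ltrBlDl (le_lt_trans tb)// ltrD2l; lra.
  by rewrite ler_norml => /andP[+ _]; rewrite /e; lra.
have muI : mu I = (d / 2)%:E.
  rewrite /I lebesgue_measure_itv/= lte_fin ltrDl divr_gt0//.
  by rewrite -EFinB addrC addKr.
have l1 : lint (\1_I : R -> R) by exact: integrable_indic_itv.
have lg : lint g by exact: lintZ.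
apply: (@lt_le_trans _ _ (Rintegral mu setT g)); last by apply: le_Rintegral => // t _; exact: gf.
rewrite /g RintegralZl// mulr_gt0// /Rintegral integral_indic// setIT.
by rewrite (_ : fine _ = d / 2) ?divr_gt0//; exact: (congr1 fine muI).
Qed.

Lemma intRn_ge0 n (F : 'rV[R]_n -> R) : dec F -> (forall x, 0 <= F x) -> 0 <= intRn F.
Proof.
move=> dF F0; rewrite -(@intRn0 R n).
by apply: intRn_le => //; [exact/dec_intble/dec0 | exact: dec_intble].
Qed.

Lemma intRn_gt0 n (F : 'rV[R]_n -> R) x0 : dec F -> (forall x, 0 <= F x) -> 0 < F x0 ->
  0 < intRn F.
Proof.
elim: n F x0 => [F x0 _ _|n IH F x0 dF F0 Fx0].
  by rewrite /= (_ : x0 = 0)//; apply/rowP => -[].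
rewrite intRnS; apply: (@Rintegral_gt0 _ (x0 ord0 ord0)).
- have [cF [C FC]] := dF.
  apply: contP => t; apply: (@intRn_continuous_param R _ _ (fun v t => F (rcons0 t v)) t C).
  + by move=> t'; exact/dec_intble/dec_rcons0.
  + move=> v; apply: (@cont_comp _ _ _ (fun p : 'rV[R]_n * R => rcons0 p.2 p.1) F);
      last exact: cF.
    apply: (@cont_comp _ _ _ (fun p : 'rV[R]_n * R => (p.2, p.1))
       (fun p : R * 'rV[R]_n => rcons0 p.1 p.2)); last exact: rcons0_continuous.
    by apply: cont_pair; [exact: contsnd | exact: contfst].
  + apply: filterE => t' x; apply: le_trans (FC (rcons0 t' x)).
    rewrite ler_wpM2l// nW_rcons0 exprMn ler_peMl ?exprn_ge0 ?(ltW (nW_gt0 _))//.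
    exact/exprn_ege1/onesq_ge1.
- by have /dec_intble/intbleS[] := dF.
- by move=> t; apply: intRn_ge0 => //; exact: dec_rcons0.
- apply: (IH _ (rbehead x0)) => //; first exact: dec_rcons0.
  by rewrite rcons0K.
Qed.

End Positivity.

Section Parseval.
Context {R : realType} {n : nat}.
Implicit Types (f g psi : 'rV[R]_n -> R).

Lemma rapidM f g : rapid f -> rapid g -> rapid (fun y => f y * g y).
Proof. by move=> rf rg; apply: urapidM => //; exact: urapid_temp. Qed.

(** The multiplication formula for the Fourier transform, an instance of Fubini since [osc] is
    symmetric in its two vectors. *)
Lemma oscint_exchange f g c : rapid f -> rapid g ->
  intRn (fun y => f y * oscint c g y) = intRn (fun q => oscint c f q * g q).
Proof.
move=> rf rg.
have [C HC] := proj2 rf [::] 2%N; have [D HD] := proj2 rg [::] 2%N.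
pose F (y q : 'rV[R]_n) := osc y c q * (f y * g q).
have cF : continuous (fun p : 'rV[R]_n * 'rV[R]_n => F p.1 p.2).
  apply: contP => p; apply: contM; first exact: osc_continuous.
  apply: contM.
    by apply: (@cont_comp _ _ _ fst f); [exact: contfst | exact: (smooth_continuous (proj1 rf tt))].
  by apply: (@cont_comp _ _ _ snd g); [exact: contsnd | exact: (smooth_continuous (proj1 rg tt))].
have dF y q : `|F y q| * nW y ^+ 2 * nW q ^+ 2 <= C * D.
  rewrite /F !normrM.
  apply: (@le_trans _ _ ((`|f y| * nW y ^+ 2) * (`|g q| * nW q ^+ 2))).
    rewrite [leRHS](_ : _ = `|f y| * `|g q| * nW y ^+ 2 * nW q ^+ 2); last by ring.
    rewrite !ler_wpM2r ?exprn_ge0 ?(ltW (nW_gt0 _))//.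
    by rewrite ler_piMl ?mulr_ge0// osc_le1.
  by apply: ler_pM; rewrite ?mulr_ge0 ?exprn_ge0 ?(ltW (nW_gt0 _))//; [exact: (HC tt) | exact: (HD tt)].
have [_] := intRn_Fubini cF dF.
have -> : (fun y => intRn (F y)) = (fun y => f y * oscint c g y).
  apply/funext => y; rewrite /oscint -intRnZ; last exact/dec_intble/rapid_dec/rapid_osc.
  by congr intRn; apply/funext => q; rewrite /F mulrCA.
have -> // : (fun q => intRn (F ^~ q)) = (fun q => oscint c f q * g q).
apply/funext => q; rewrite /oscint mulrC -intRnZ; last exact/dec_intble/rapid_dec/rapid_osc.
by congr intRn; apply/funext => y; rewrite /F oscC; ring.
Qed.

Lemma rapid_oscint c g : rapid g -> rapid (oscint c g).
Proof. by move=> rg; exact: (urapid_oscint c rg). Qed.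

(** By inversion this should be a multiple of [psi 0]; [oscmass_eq] proves so, and inversion is
    deduced from it. *)
Definition oscmass c psi : R := intRn (oscint c psi).

(** The transform of y_j [psi] is a partial derivative, hence integrates to zero. *)
Lemma oscmass_coord c j psi : rapid psi -> oscmass c (fun y => y ord0 j * psi y) = 0.
Proof.
move=> rp; apply: (@intRn_partial0 _ _ j (oscint (c - pi / 2) psi)).
- exact/rapid_dec/rapid_oscint.
- exact/rapid_dec/rapid_oscint/rapid_coord.
- by have := has_pd_oscint (c - pi / 2) j rp; rewrite subrK.
Qed.

Lemma oscmassD c f g : rapid f -> rapid g ->
  oscmass c (fun y => f y + g y) = oscmass c f + oscmass c g.
Proof.
move=> rf rg; rewrite /oscmass oscintD// intRnD//; exact/dec_intble/rapid_dec/rapid_oscint.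
Qed.

Lemma oscmassZ c (a : R) g : rapid g -> oscmass c (fun y => a * g y) = a * oscmass c g.
Proof.
by move=> rg; rewrite /oscmass oscintZ// intRnZ//; exact/dec_intble/rapid_dec/rapid_oscint.
Qed.

Lemma rapid_sum (I : Type) (r : seq I) (f : I -> 'rV[R]_n -> R) :
  (forall i, rapid (f i)) -> rapid (fun y => \sum_(i <- r) f i y).
Proof.
move=> rf; elim: r => [|i r IH].
  have -> : (fun y => \sum_(i <- [::]) f i y) = (fun=> 0).
    by apply/funext => y; rewrite big_nil.
  split=> [_|s L]; first exact: smooth_cst.
  by exists 0 => _ x; rewrite iter_pd0 normr0 mul0r.
have -> : (fun y => \sum_(j <- i :: r) f j y) = (fun y => f i y + \sum_(j <- r) f j y).
  by apply/funext => y; rewrite big_cons.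
exact: (urapidD (rf i) IH).
Qed.

Lemma oscmass_sum c (I : Type) (r : seq I) (f : I -> 'rV[R]_n -> R) :
  (forall i, rapid (f i)) ->
  oscmass c (fun y => \sum_(i <- r) f i y) = \sum_(i <- r) oscmass c (f i).
Proof.
move=> rf; elim: r => [|i r IH].
  have -> : (fun y => \sum_(i <- [::]) f i y) = (fun y => 0 * \sum_(i <- [::]) f i y).
    by apply/funext => y; rewrite big_nil mulr0.
  rewrite oscmassZ; last exact: rapid_sum.
  by rewrite mul0r big_nil.
have -> : (fun y => \sum_(j <- i :: r) f j y) = (fun y => f i y + \sum_(j <- r) f j y).
  by apply/funext => y; rewrite big_cons.
by rewrite oscmassD ?IH ?big_cons//; exact: rapid_sum.
Qed.

End Parseval.

(** * Hadamard's lemma and Fourier inversion *)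

Section Hadamard.
Context {R : realType} {n : nat}.

(** A smooth step from 0 to 1. Running along t -> [ramp t *: y] over the whole line replaces the
    segment [0, 1] of the usual proof, so that the weights are continuous with compact support and
    the results on [dec] apply. *)
Definition ramp (t : 'rV[R]_1) : R :=
  flat 0 (t ord0 ord0) / (flat 0 (t ord0 ord0) + flat 0 (1 - t ord0 ord0)).

Lemma ramp_den (u : R) : 0 < flat 0 u + flat 0 (1 - u).
Proof.
have [u0|u0] := ltP 0 u; first by apply: ltr_pwDl; rewrite ?flat_gt0 ?flat_ge0.
by apply: ltr_wpDl; rewrite ?flat_ge0// flat_gt0//; lra.
Qed.

Lemma smooth_ramp : smooth ramp.
Proof.
have s0 := smooth_flat 0 (@smooth_coord R 1 ord0).
have s1 := smooth_flat 0 (smoothB (@smooth_cst R 1 1) (@smooth_coord R 1 ord0)).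
apply: (smoothM s0 (smooth_inv (smoothD s0 s1) _)) => t.
by rewrite gt_eqF// ramp_den.
Qed.

Lemma ramp_le0 (t : 'rV[R]_1) : t ord0 ord0 <= 0 -> ramp t = 0.
Proof. by move=> t0; rewrite /ramp flat_le0// mul0r. Qed.

Lemma ramp_ge1 (t : 'rV[R]_1) : 1 <= t ord0 ord0 -> ramp t = 1.
Proof.
move=> t1; rewrite /ramp (flat_le0 0 (_ : 1 - t ord0 ord0 <= 0)) ?subr_le0//.
by rewrite addr0 divff// gt_eqF// flat_gt0// (lt_le_trans ltr01).
Qed.

Lemma pd_ramp_out (t : 'rV[R]_1) : ~ `|t ord0 ord0| <= 1 -> pd ord0 ramp t = 0.
Proof.
move=> /negP; rewrite -ltNge => h1.
have cc := @coordc R 1 ord0.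
have [t1|t1] := ltP 1 (t ord0 ord0).
  have oU : open [set t : 'rV[R]_1 | 1 < t ord0 ord0].
    by apply: (@open_comp _ _ (fun t : 'rV[R]_1 => t ord0 ord0) [set u | 1 < u]) => //; exact: open_gt.
  have := @iter_pd_local _ _ _ ramp (fun=> 1) [:: ord0] oU (fun t t1 => ramp_ge1 (ltW t1)) t t1.
  by rewrite /= pd_cst.
have t0 : t ord0 ord0 < 0.
  by move: h1; rewrite ltNge ler_norml t1 andbT -ltNge => h; exact: lt_le_trans h (lerN10 _).
have oU : open [set t : 'rV[R]_1 | t ord0 ord0 < 0].
  by apply: (@open_comp _ _ (fun t : 'rV[R]_1 => t ord0 ord0) [set u | u < 0]) => //; exact: open_lt.
have := @iter_pd_local _ _ _ ramp (fun=> 0) [:: ord0] oU (fun t t1 => ramp_le0 (ltW t1)) t t0.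
by rewrite /= pd_cst.
Qed.

(** The weight [k] is kept general because a derivative in [y] multiplies it by [ramp]; the class of
    these integrals is then stable under derivatives. *)
Definition rampint (k : 'rV[R]_1 -> R) (g : 'rV[R]_n -> R) (y : 'rV[R]_n) : R :=
  intRn (fun t : 'rV[R]_1 => k t * g (ramp t *: y)).

Lemma ramp_line_continuous (g : 'rV[R]_n -> R) (y v : 'rV[R]_n) : continuous g ->
  continuous (fun p : 'rV[R]_1 * R => g (ramp p.1 *: (y + p.2 *: v))).
Proof.
move=> cg; apply: contP => p.
apply: (@cont_comp _ _ _ (fun p : 'rV[R]_1 * R => ramp p.1 *: (y + p.2 *: v)) g); last exact: cg.
apply: contZV.
  by apply: (@cont_comp _ _ _ fst ramp); [exact: contfst | exact: (smooth_continuous smooth_ramp)].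
apply: contDV; first exact: contC.
by apply: contZV; [exact: contsnd | exact: contC].
Qed.

Lemma has_pd_rampint k g i : dec k -> rapid g ->
  has_pd i (rampint k g) (rampint (fun t => k t * ramp t) (pd i g)).
Proof.
have ramp1 t : `|ramp t| <= 1.
  rewrite ger0_norm ?divr_ge0 ?addr_ge0 ?flat_ge0//.
  by rewrite ler_pdivrMr ?ramp_den// mul1r lerDl flat_ge0.
move=> dk rg y; have rp := urapid_pd i rg.
have [ck [A HA]] := dk.
have cg := smooth_continuous (proj1 rg tt); have cp := smooth_continuous (proj1 rp tt).
have cr := smooth_continuous smooth_ramp.
have [C HC] := proj2 rg [::] 0%N; have [D HD] := proj2 rp [::] 0%N.
have dkr : dec (fun t => k t * ramp t).
  apply: (dec_dom _ dk) => [|t]; first by apply: contP => t; apply: contM; [exact: ck | exact: cr].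
  by rewrite normrM ler_piMr.
have dF (h : R) : dec (fun t => k t * g (ramp t *: (y + h *: evec i))).
  split.
    apply: contP => t; apply: contM; first exact: ck.
    apply: (@cont_comp _ _ _ (fun t => (t, h)) (fun p : 'rV[R]_1 * R => g (ramp p.1 *: (y + p.2 *: evec i)))).
      by apply: cont_pair; [exact: contid | exact: contC].
    exact: (@ramp_line_continuous g y (evec i) cg (t, h)).
  exists (A * C) => t; rewrite normrM mulrAC; apply: ler_pM => //.
    by rewrite mulr_ge0// exprn_ge0// (ltW (nW_gt0 t)).
  by have := HC tt (ramp t *: (y + h *: evec i)); rewrite expr0 mulr1.
have H1 (h : R) t : `|h| <= 1 -> is_derive h 1 (fun h : R => k t * g (ramp t *: (y + h *: evec i)))
    (k t * ramp t * pd i g (ramp t *: (y + h *: evec i))).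
  move=> _; have H := @has_pd_affine R n i (ramp t) 0 g (proj1 rg tt).
  have D1 := is_derive_line H y h.
  have := @is_deriveZ _ _ _ _ (k t) h 1 _ D1.
  rewrite /GRing.scale/= !addr0 mulrA; congr is_derive.
  by apply/funext => u /=; rewrite addr0.
have H2 (h : R) t : `|h| <= 1 ->
    `|k t * ramp t * pd i g (ramp t *: (y + h *: evec i))| * nW t ^+ 2 <= A * D.
  move=> _; rewrite normrM mulrAC; apply: ler_pM => //.
  - by rewrite mulr_ge0// exprn_ge0// (ltW (nW_gt0 t)).
  - apply: le_trans (HA t); rewrite ler_wpM2r ?exprn_ge0 ?(ltW (nW_gt0 t))//.
    by rewrite normrM ler_piMr.
  - by have := HD tt (ramp t *: (y + h *: evec i)); rewrite expr0 mulr1.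
have H3 t : {for (t, 0 : R), continuous (fun p : 'rV[R]_1 * R =>
    k p.1 * ramp p.1 * pd i g (ramp p.1 *: (y + p.2 *: evec i)))}.
  apply: contM; last exact: (@ramp_line_continuous (pd i g) y (evec i) cp (t, 0)).
  apply: (@cont_comp _ _ _ fst (fun t => k t * ramp t)); first exact: contfst.
  by apply: contM; [exact: ck | exact: cr].
have [_] := @intRn_derive _ 1 (fun h t => k t * g (ramp t *: (y + h *: evec i)))
  (fun h t => k t * ramp t * pd i g (ramp t *: (y + h *: evec i))) (A * D) dF H1 H3 H2.
by rewrite /rampint scale0r addr0.
Qed.

Lemma rampint_continuous k g : dec k -> rapid g -> continuous (rampint k g).
Proof.
move=> [ck [A HA]] rg; have [C HC] := proj2 rg [::] 0%N.
have cg := smooth_continuous (proj1 rg tt).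
have cr := smooth_continuous smooth_ramp.
have cF : continuous (fun p : 'rV[R]_1 * 'rV[R]_n => k p.1 * g (ramp p.1 *: p.2)).
  apply: contP => p; apply: contM.
    by apply: (@cont_comp _ _ _ fst k); [exact: contfst | exact: ck].
  apply: (@cont_comp _ _ _ (fun p : 'rV[R]_1 * 'rV[R]_n => ramp p.1 *: p.2) g); last exact: cg.
  apply: contZV; last exact: contsnd.
  by apply: (@cont_comp _ _ _ fst ramp); [exact: contfst | exact: cr].
have bF t y : `|k t * g (ramp t *: y)| * nW t ^+ 2 <= A * C.
  rewrite normrM mulrAC; apply: ler_pM => //.
    by rewrite mulr_ge0// exprn_ge0// (ltW (nW_gt0 t)).
  by have := HC tt (ramp t *: y); rewrite expr0 mulr1.
apply: contP => y.
have := @intRn_continuous_param R 'rV[R]_n 1 (fun (t : 'rV[R]_1) (y : 'rV[R]_n) => k t * g (ramp t *: y)) y (A * C).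
apply.
- move=> y'; apply: dec_intble; split; last by exists (A * C) => t.
  apply: contP => t; apply: (@cont_comp _ _ _ (fun t => (t, y'))
    (fun p : 'rV[R]_1 * 'rV[R]_n => k p.1 * g (ramp p.1 *: p.2))); last exact: cF.
  by apply: cont_pair; [exact: contid | exact: contC].
- by move=> t; exact: cF.
- by apply: filterE => y' t.
Qed.

Lemma smooth_rampint k g : dec k -> rapid g -> smooth (rampint k g).
Proof.
move=> dk rg.
apply: (@smooth_coind _ _ (fun f => exists k g, [/\ dec k, rapid g & f = rampint k g]));
  last by exists k, g.
move=> _ [{dk}k [{rg}g [dk rg ->]]]; split; first exact: rampint_continuous.
move=> i; exists (rampint (fun t => k t * ramp t) (pd i g)); last exact: has_pd_rampint.
exists (fun t => k t * ramp t), (pd i g); split=> //; last exact: urapid_pd.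
apply: (dec_dom _ dk) => [|t].
  by apply: contP => t; apply: contM; [exact: (proj1 dk) | exact: (smooth_continuous smooth_ramp)].
rewrite normrM ler_piMr// ger0_norm ?divr_ge0 ?addr_ge0 ?flat_ge0//.
by rewrite ler_pdivrMr ?ramp_den// mul1r lerDl flat_ge0.
Qed.

Lemma dec_pd_ramp : dec (pd ord0 ramp).
Proof.
apply: (@dec_compact _ _ _ [set t | forall i, `|t ord0 i| <= 1]).
- exact: (smooth_continuous (smooth_pd ord0 smooth_ramp)).
- exact: box_compact.
- by move=> t nt; apply: pd_ramp_out => h; apply: nt => i; rewrite (ord1 i).
Qed.

Lemma rcons0_line (u : R) : rcons0 u 0 = u *: evec ord0 :> 'rV[R]_1.
Proof. by apply/rowP => i; rewrite (ord1 i) rcons0_0 !mxE eqxx mulr1. Qed.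

(** The sum is the integral of the derivative of t -> psi(ramp(t) y); outside [-1, 1] that
    derivative vanishes, and the fundamental theorem applies on the segment. *)
Lemma rampint_total (psi : 'rV[R]_n -> R) (y : 'rV[R]_n) : rapid psi ->
  \sum_j y ord0 j * rampint (pd ord0 ramp) (pd j psi) y = psi y - psi 0.
Proof.
move=> rp; have sp := proj1 rp tt.
pose G (t : 'rV[R]_1) := pd ord0 ramp t * \sum_j y ord0 j * pd j psi (ramp t *: y).
have dterm j : dec (fun t : 'rV[R]_1 => y ord0 j * (pd ord0 ramp t * pd j psi (ramp t *: y))).
  apply: decZ; have [C HC] := proj2 (urapid_pd j rp) [::] 0%N.
  have [A HA] := proj2 dec_pd_ramp.
  split; last first.
    exists (A * C) => t; rewrite normrM mulrAC; apply: ler_pM => //.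
      by rewrite mulr_ge0// exprn_ge0// (ltW (nW_gt0 t)).
    by have := HC tt (ramp t *: y); rewrite expr0 mulr1.
  apply: contP => t; apply: contM; first exact: (proj1 dec_pd_ramp).
  apply: (@cont_comp _ _ _ (fun t : 'rV[R]_1 => ramp t *: y) (pd j psi)).
    by apply: contZV; [exact: (smooth_continuous smooth_ramp) | exact: contC].
  exact: (smooth_continuous (smooth_pd j sp)).
have GE : G = fun t => \sum_j y ord0 j * (pd ord0 ramp t * pd j psi (ramp t *: y)).
  apply/funext => t; rewrite /G mulr_sumr; apply: eq_bigr => j _; exact: mulrCA.
have dG : dec G by rewrite GE; exact: dec_sum.
transitivity (intRn G).
  rewrite GE intRn_sum//; apply: eq_bigr => j _.
  rewrite /rampint -intRnZ//; apply: dec_intble.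
  have [C HC] := proj2 (urapid_pd j rp) [::] 0%N.
  have [A HA] := proj2 dec_pd_ramp.
  split; last first.
    exists (A * C) => t; rewrite normrM mulrAC; apply: ler_pM => //.
      by rewrite mulr_ge0// exprn_ge0// (ltW (nW_gt0 t)).
    by have := HC tt (ramp t *: y); rewrite expr0 mulr1.
  apply: contP => t; apply: contM; first exact: (proj1 dec_pd_ramp).
  apply: (@cont_comp _ _ _ (fun t : 'rV[R]_1 => ramp t *: y) (pd j psi)).
    by apply: contZV; [exact: (smooth_continuous smooth_ramp) | exact: contC].
  exact: (smooth_continuous (smooth_pd j sp)).
pose F (u : R) := psi (ramp (u *: evec ord0) *: y).
have dF (u : R) : is_derive u 1 F (G (u *: evec ord0)).
  have D0 := is_derive_line (smooth_has_pd ord0 smooth_ramp) 0 u; rewrite add0r in D0.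
  have D1 := is_derive_dir y sp 0 (ramp (u *: evec ord0)).
  have D2 : is_derive (ramp (0 + u *: evec ord0)) 1 (fun t : R => psi (0 + t *: y))
     (\sum_j y ord0 j * pd j psi (0 + ramp (u *: evec ord0) *: y)) by rewrite [0 + u *: _]add0r.
  have := @is_derive1_comp _ (fun t : R => psi (0 + t *: y)) (fun t : R => ramp (0 + t *: evec ord0)) u _ _ D2 D0.
  rewrite add0r mulrC; congr is_derive.
  by apply/funext => t; rewrite /= !add0r.
rewrite intRnS /=; have -> : (fun t : R => G (rcons0 t 0)) = (fun t => G (t *: evec ord0)).
  by apply/funext => t; rewrite rcons0_line.
have cG : continuous (fun t : R => G (t *: evec ord0)).
  apply: contP => t; apply: (@cont_comp _ _ _ (fun t : R => t *: (evec ord0 : 'rV[R]_1)) G).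
    by apply: contZV; [exact: contid | exact: contC].
  exact: (proj1 dG).
have -> : (fun t : R => G (t *: evec ord0)) = (fun t : R => G (t *: evec ord0)) \_ `[(-1), 1]%classic.
  apply/funext => t; rewrite patchE; case: ifPn => // /negP nt.
  rewrite /G pd_ramp_out ?mul0r// !mxE eqxx mulr1 => t1; apply: nt.
  by rewrite inE/= in_itv/= -ler_norml.
rewrite -Rintegral_mkcond /Rintegral.
rewrite (@continuous_FTC2 _ _ F).
- rewrite -EFinB/= /F ramp_ge1 ?ramp_le0.
  + by rewrite scale1r scale0r.
  + by rewrite !mxE eqxx mulr1 lerN10.
  + by rewrite !mxE eqxx mulr1.
- by rewrite gtrN.
- exact: continuous_subspaceT.
- have cF t : {for t, continuous F}.
    by apply/differentiable_continuous/derivable1_diffP; have [] := dF t.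
  split; first by move=> t _; have [] := dF t.
    by apply: cvg_at_right_filter; exact: cF.
  by apply: cvg_at_left_filter; exact: cF.
- by move=> t _; rewrite derive1E; have [_ ->] := dF t.
Qed.

End Hadamard.

Section FourierInversion.
Context {R : realType} {n : nat}.
Implicit Types (psi : 'rV[R]_n -> R).

Definition compactly_supported (T : nmodType) (psi : 'rV[R]_n -> T) : Prop :=
  exists r : R, 0 < r /\ forall (x : 'rV[R]_n) i, r < `|x ord0 i| -> psi x = 0.

Lemma supp_rapid psi : smooth psi -> compactly_supported psi -> rapid psi.
Proof.
move=> sp [r [r0 pr]]; apply: (compact_support_rapid sp (@box_compact R n r)) => x /= nx.
have /existsNP[i /negP] := nx.
by rewrite -ltNge; exact: pr.
Qed.

(* Hadamard: [psi = \sum_j y_j H_j] when [psi 0 = 0], and each multiple of [y_j] has mass zero. *)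
Lemma oscmass_vanish c psi : smooth psi -> compactly_supported psi -> psi 0 = 0 -> oscmass c psi = 0.
Proof.
move=> sp cp p0; have rp := supp_rapid sp cp; have [r [r0 pr]] := cp.
have rchi : rapid (@chi R n r).
  apply: supp_rapid; first exact: smooth_chi.
  exists (2 * r); split; first by rewrite mulr_gt0.
  by move=> x i h; apply: chi_eq0; exact: ltW h.
pose H j (y : 'rV[R]_n) := chi r y * rampint (pd ord0 ramp) (pd j psi) y.
have cH j : rapid (H j).
  apply: supp_rapid.
    apply: smoothM; first exact: smooth_chi.
    by apply: smooth_rampint; [exact: dec_pd_ramp | exact: urapid_pd].
  exists (2 * r); split; first by rewrite mulr_gt0.
  by move=> x i h; rewrite /H (chi_eq0 (ltW h)) mul0r.
have -> : psi = fun y => \sum_j y ord0 j * H j y.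
  apply/funext => y.
  have -> : \sum_j y ord0 j * H j y = chi r y * psi y.
    have := rampint_total y rp; rewrite p0 subr0 => <-.
    by rewrite mulr_sumr; apply: eq_bigr => j _; rewrite /H mulrCA.
  have [Hy|/existsNP[i /negP]] := pselect (forall i, `|y ord0 i| <= r).
    by rewrite chi_eq1// mul1r.
  by rewrite -ltNge => /pr ->; rewrite mulr0.
rewrite oscmass_sum => [|j]; last exact: rapid_coord.
by rewrite big1// => j _; exact: oscmass_coord.
Qed.

(** For [c = 0] this is the classical constant (2 pi)^n. Only its nonvanishing is established. *)
Definition invmass (c : R) : R := oscmass c (@chi R n 1).

(** The difference of [psi] and psi(0) times the bump vanishes at the origin, so [oscmass_vanish]
    applies to it. *)
Lemma oscmass_eq c psi : smooth psi -> compactly_supported psi ->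
  oscmass c psi = invmass c * psi 0.
Proof.
move=> sp cp; have rp := supp_rapid sp cp.
have [eta [seta ceta eta0 etaE]] : exists eta : 'rV[R]_n -> R,
    [/\ smooth eta, compactly_supported eta, eta 0 = 1 & chi 1 = eta].
  exists (chi 1); split; [exact: smooth_chi | | | by []].
    exists (2 * 1); split; first by rewrite mulr_gt0.
    by move=> x i h; apply: chi_eq0; exact: ltW h.
  by rewrite chi_eq1// => i; rewrite mxE normr0.
have reta := supp_rapid seta ceta.
have H := @oscmass_vanish c (fun y => psi y + - psi 0 * eta y).
rewrite (oscmassD c rp (urapidZ (- psi 0) reta)) (oscmassZ c (- psi 0) reta) in H.
rewrite /invmass etaE mulrC; apply/eqP; rewrite -subr_eq0 -mulNr; apply/eqP; apply: H.
- exact: (smoothD sp (smoothZ (- psi 0) seta)).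
- have [r [r0 pr]] := cp; have [q [q0 qr]] := ceta.
  exists (Num.max r q); split; first by rewrite lt_max r0.
  move=> x i; rewrite gt_max => /andP[h1 h2].
  by rewrite (pr x i h1) (qr x i h2) mulr0 addr0.
- by rewrite eta0 mulr1 subrr.
Qed.

Lemma oscint_shift c psi (a k : 'rV[R]_n) : rapid psi ->
  oscint c (fun y => psi (y + a)) k = oscint (c - dotp k a) psi k.
Proof.
move=> rp; rewrite /oscint -(intRn_shift a (rapid_dec (rapid_osc k (c - dotp k a) rp))).
congr intRn; apply/funext => y; rewrite /osc; congr (cos _ * _).
by rewrite [dotp k (y + a)]dotpC dotpDl !(dotpC _ k); ring.
Qed.


Lemma cosBpihalf (t : R) : cos (t - pi / 2) = sin t.
Proof. by rewrite -{2}[t](subrK (pi / 2)) sinDpihalf. Qed.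

Lemma sinBpihalf (t : R) : sin (t - pi / 2) = - cos t.
Proof. by rewrite sinB cos_pihalf sin_pihalf mulr0 mulr1 sub0r. Qed.

Lemma oscint_phase d psi k c : rapid psi ->
  oscint (c - d) psi k = cos d * oscint c psi k + sin d * oscint (c - pi / 2) psi k.
Proof.
move=> rp; rewrite /oscint -!intRnZ; try exact/dec_intble/rapid_dec/rapid_osc.
rewrite -intRnD; try exact/intbleZ/dec_intble/rapid_dec/rapid_osc.
congr intRn; apply/funext => y; rewrite /osc ![dotp k y + (_ - _)]addrA cosBpihalf cosB.
by ring.
Qed.

Local Notation h := (- (pi / 2) : R).

(** The translate of [psi] by [y0] takes the value [psi y0] at the origin, and translation only
    turns the phase of the transform; the two identities come from the phases 0 and -pi / 2. *)
Lemma inversion_eqs psi (y0 : 'rV[R]_n) : smooth psi -> compactly_supported psi ->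
  invmass 0 * psi y0 = oscint 0 (oscint 0 psi) y0 + oscint h (oscint h psi) y0 /\
  invmass h * psi y0 = oscint 0 (oscint h psi) y0 - oscint h (oscint 0 psi) y0.
Proof.
move=> sp cp; have rp := supp_rapid sp cp.
have ss : smooth (fun y => psi (y + y0)).
  by have := smooth_affine 1 y0 sp; under eq_fun do rewrite scale1r.
have cs : compactly_supported (fun y => psi (y + y0)).
  have [r [r0 pr]] := cp; exists (r + n1 y0); split; first by rewrite ltr_wpDr// n1_ge0.
  move=> x i hx; apply: (pr _ i); rewrite mxE.
  have : `|y0 ord0 i| <= n1 y0 by rewrite /n1 (bigD1 i)//= lerDl sumr_ge0.
  have := ler_normD (x ord0 i + y0 ord0 i) (- y0 ord0 i); rewrite addrK normrN.
  by move: hx; lra.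
have E c : invmass c * psi y0 =
    intRn (fun k => cos (dotp k y0) * oscint c psi k + sin (dotp k y0) * oscint (c - pi / 2) psi k).
  have := oscmass_eq c ss cs; rewrite add0r => <-.
  by congr intRn; apply/funext => k; rewrite oscint_shift// oscint_phase.
have I c d : intble (fun k => osc y0 c k * oscint d psi k).
  exact/dec_intble/rapid_dec/rapid_osc/rapid_oscint.
have cE k : cos (dotp k y0) = osc y0 0 k by rewrite /osc addr0 dotpC.
have sE k : sin (dotp k y0) = osc y0 h k by rewrite /osc cosBpihalf dotpC.
split; rewrite E.
  have -> : oscint 0 (oscint 0 psi) y0 + oscint h (oscint h psi) y0 =
      intRn (fun k => osc y0 0 k * oscint 0 psi k + osc y0 h k * oscint h psi k).
    by rewrite (intRnD (I 0 0) (I h h)).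
  by congr intRn; apply/funext => k; rewrite cE sE sub0r.
have cosph (k y : 'rV[R]_n) : osc k (h - pi / 2) y = - osc k 0 y.
  rewrite /osc [X in cos X = _](_ : _ = dotp k y - pi / 2 - pi / 2); last by rewrite addrA.
  by rewrite cosBpihalf sinBpihalf addr0.
have F : oscint (h - pi / 2) psi = fun k => - oscint 0 psi k.
  apply/funext => k; rewrite /oscint -intRnN; last exact/dec_intble/rapid_dec/rapid_osc.
  congr intRn; apply/funext => y.
  by rewrite (cosph k y) mulNr.
have -> : oscint 0 (oscint h psi) y0 - oscint h (oscint 0 psi) y0 =
    intRn (fun k => osc y0 0 k * oscint h psi k + - (osc y0 h k * oscint 0 psi k)).
  by rewrite (intRnD (I 0 h) (intbleN (I h 0))) (intRnN (I h 0)).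
by rewrite F; congr intRn; apply/funext => k; rewrite cE sE mulrN.
Qed.

(* Nonvanishing comes from positivity: the pairing of a bump with its double transform is a sum of
   squares. *)
Lemma invmass_spec : invmass 0 != 0 /\ invmass h = 0.
Proof.
have [psi [sp cp psi0 psi_ge0]] : exists psi : 'rV[R]_n -> R,
    [/\ smooth psi, compactly_supported psi, psi 0 = 1 & forall x, 0 <= psi x].
  exists (chi 1); split; first exact: smooth_chi.
  - exists (2 * 1); split; first by rewrite mulr_gt0.
    by move=> x i hx; apply: chi_eq0; exact: ltW hx.
  - by rewrite chi_eq1// => i; rewrite mxE normr0.
  - by move=> x; exact: chi_ge0.
have rp := supp_rapid sp cp.
have r2 := rapidM rp rp.
have P : 0 < intRn (fun y => psi y * psi y).
  apply: (@intRn_gt0 _ _ _ 0) => [|x|]; [exact: rapid_dec | exact: mulr_ge0 |].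
  by rewrite psi0 mulr1.
set p1 := oscint 0 psi; set p2 := oscint h psi.
have rp1 : rapid p1 by exact: rapid_oscint.
have rp2 : rapid p2 by exact: rapid_oscint.
have Q (f : 'rV[R]_n -> R) c : rapid f -> intRn (fun y => psi y * oscint c f y) = intRn (fun q => oscint c psi q * f q).
  by move=> rf; exact: oscint_exchange.
have Iosc (f : 'rV[R]_n -> R) c : rapid f -> intble (fun y => psi y * oscint c f y).
  by move=> rf; apply/dec_intble/rapid_dec/rapidM => //; exact: rapid_oscint.
have E0 : invmass 0 * intRn (fun y => psi y * psi y) = intRn (fun q => p1 q * p1 q + p2 q * p2 q).
  rewrite intRnD; try exact/dec_intble/rapid_dec/rapidM.
  rewrite -(Q _ 0 rp1) -(Q _ h rp2) -intRnD//; try exact: Iosc.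
  rewrite -intRnZ; last exact/dec_intble/rapid_dec.
  congr intRn; apply/funext => y; have [E _] := inversion_eqs y sp cp.
  by rewrite mulrCA E mulrDr.
have Eh : invmass h * intRn (fun y => psi y * psi y) = 0.
  transitivity (intRn (fun q => p1 q * p2 q) - intRn (fun q => p2 q * p1 q)); last first.
    by apply/eqP; rewrite subr_eq0; apply/eqP; congr intRn; apply/funext => q; rewrite mulrC.
  rewrite -(Q _ 0 rp2) -(Q _ h rp1) -intRnN; last exact: Iosc.
  rewrite -intRnD; [|exact: Iosc|exact/intbleN/Iosc].
  rewrite -intRnZ; last exact/dec_intble/rapid_dec.
  congr intRn; apply/funext => y; have [_ E] := inversion_eqs y sp cp.
  by rewrite mulrCA E mulrDr mulrN.
split; last by apply/eqP; move/eqP: Eh; rewrite mulf_eq0 (gt_eqF P) orbF.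
suff : 0 < invmass 0 * intRn (fun y => psi y * psi y).
  by apply: contraTneq => ->; rewrite mul0r ltxx.
rewrite E0; apply: (@intRn_gt0 _ _ _ 0).
- by apply: decD; exact/rapid_dec/rapidM.
- by move=> x; rewrite addr_ge0// -expr2 sqr_ge0.
- apply: ltr_pwDl; last by rewrite -expr2 sqr_ge0.
  have p10 : 0 < p1 0.
    apply: (@intRn_gt0 _ _ _ 0); first exact/rapid_dec/rapid_osc.
      by move=> x; rewrite /osc /dotp big1 ?addr0 ?cos0 ?mul1r// => i _; rewrite mxE mul0r.
    by rewrite psi0 /osc /dotp big1 ?addr0 ?cos0 ?mul1r// => i _; rewrite mxE mul0r.
  by rewrite mulr_gt0.
Qed.

(** The pair is the real and imaginary part of one complex kernel, and the two equations are the
    real and imaginary part of the statement that its transform is the real function [psi]. *)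
Lemma fourier_inversion psi : smooth psi -> compactly_supported psi ->
  exists p1 p2 : 'rV[R]_n -> R, [/\ rapid p1, rapid p2 & forall y,
    psi y = oscint 0 p1 y - oscint h p2 y /\ 0 = oscint h p1 y + oscint 0 p2 y].
Proof.
move=> sp cp; have rp := supp_rapid sp cp; have [c0 c1] := invmass_spec.
pose a := (invmass 0)^-1.
have rp1 : rapid (oscint 0 psi) by exact: rapid_oscint.
have rp2 : rapid (oscint h psi) by exact: rapid_oscint.
exists (fun q => a * oscint 0 psi q), (fun q => - a * oscint h psi q).
split; [exact: urapidZ | exact: urapidZ |] => y.
have [E0 Eh] := inversion_eqs y sp cp.
rewrite !oscintZ//; split.
  by rewrite mulNr opprK -mulrDr -E0 /a mulKf.
by rewrite mulNr -mulrBr -opprB -Eh c1 mul0r oppr0 mulr0.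
Qed.

End FourierInversion.

(** * Tempered distributions *)

Section ComplexParts.
Context {R : realType}.
Implicit Types z w : R[i].

Lemma cabs_real (a : R) : cabs (cR a) = `|a|.
Proof. by rewrite /cabs /= expr0n/= addr0 sqrtr_sqr. Qed.

Lemma Re_le_cabs z : `|complex.Re z| <= cabs z.
Proof. by rewrite /cabs -sqrtr_sqr ler_sqrt ?addr_ge0 ?sqr_ge0// lerDl sqr_ge0. Qed.

Lemma Im_le_cabs z : `|complex.Im z| <= cabs z.
Proof. by rewrite /cabs -sqrtr_sqr ler_sqrt ?addr_ge0 ?sqr_ge0// lerDr sqr_ge0. Qed.

Lemma cabs_le z : cabs z <= `|complex.Re z| + `|complex.Im z|.
Proof.
have h : 0 <= `|complex.Re z| + `|complex.Im z| by rewrite addr_ge0.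
rewrite /cabs -[leRHS](ger0_norm h) -sqrtr_sqr ler_sqrt ?sqr_ge0//.
rewrite -[complex.Re z ^+ 2]real_normK ?num_real// -[complex.Im z ^+ 2]real_normK ?num_real//.
rewrite sqrrD -addrA [`|complex.Re z| * _ *+ 2 + _]addrC addrA lerDl.
by rewrite mulrn_wge0// mulr_ge0.
Qed.

Lemma ReDc z w : complex.Re (z + w) = complex.Re z + complex.Re w.
Proof. by case: z; case: w. Qed.

Lemma ImDc z w : complex.Im (z + w) = complex.Im z + complex.Im w.
Proof. by case: z; case: w. Qed.

Lemma ReMc z w : complex.Re (z * w) = complex.Re z * complex.Re w - complex.Im z * complex.Im w.
Proof. by case: z; case: w. Qed.

Lemma ImMc z w : complex.Im (z * w) = complex.Re z * complex.Im w + complex.Im z * complex.Re w.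
Proof. by case: z => a b; case: w => c d /=; rewrite [b * c]mulrC. Qed.

Lemma complex_ext z w : complex.Re z = complex.Re w -> complex.Im z = complex.Im w -> z = w.
Proof. by case: z => a b; case: w => c d /= -> ->. Qed.

Lemma cRM (a b : R) : cR (a * b) = cR a * cR b.
Proof. by apply: complex_ext; rewrite ?ReMc ?ImMc /= ?mulr0 ?mul0r ?subr0 ?addr0. Qed.

Lemma cRD (a b : R) : cR (a + b) = cR a + cR b.
Proof. by apply: complex_ext; rewrite ?ReDc ?ImDc /= ?addr0. Qed.

Lemma complex_split z : z = cR (complex.Re z) + 'i%C * cR (complex.Im z).
Proof.
by apply: complex_ext; rewrite ?ReDc ?ImDc ?ReMc ?ImMc /=; ring.
Qed.

End ComplexParts.

Section SchwartzRapid.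
Context {R : realType} {n : nat}.
Implicit Types (F : 'rV[R]_n -> R) (g : 'rV[R]_n -> R[i]).

Lemma size_mseq (a : 'I_n -> nat) : size (mseq a) = mabs a.
Proof.
rewrite /mseq size_flatten /shape -map_comp sumnE big_map /mabs big_enum /=.
by apply: eq_bigr => i _; rewrite size_nseq.
Qed.

Lemma count_mseq (a : 'I_n -> nat) i : count_mem i (mseq a) = a i.
Proof.
rewrite /mseq count_flatten -map_comp sumnE big_map big_enum /= (bigD1 i)//=.
rewrite count_nseq /= eqxx mul1n big1 ?addn0// => j ji.
by rewrite count_nseq /= (negbTE ji) mul0n.
Qed.

Lemma perm_mseq (s : seq 'I_n) : perm_eq s (mseq (fun i => count_mem i s)).
Proof. by apply/allP => i _ /=; rewrite count_mseq. Qed.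

Lemma iter_pd_Dr s F : smooth F -> iter_pd s F = Dr (fun i => count_mem i s) F.
Proof. by move=> sF; apply: iter_pd_perm => //; exact: perm_mseq. Qed.

Lemma xpow_le_nW (x : 'rV[R]_n) (a : 'I_n -> nat) : `|xpow x a| <= nW x ^+ mabs a.
Proof.
rewrite /xpow normr_prod /mabs -prodrXr; apply: ler_prod => i _.
by rewrite normr_ge0 normrX lerXn2r ?nnegrE ?(ltW (nW_gt0 x))//; exact: coord_le_nW.
Qed.

Definition polybd F := forall a : 'I_n -> nat, exists C, forall x, `|xpow x a * F x| <= C.

Lemma polybd_onesq F i : polybd F -> polybd (fun x => (1 + x ord0 i ^+ 2) * F x).
Proof.
move=> pF a; have [C HC] := pF a.
have [D HD] := pF (fun j => (a j + (i == j).*2)%N).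
exists (C + D) => x; rewrite mulrDl mul1r mulrDr.
apply: (le_trans (ler_normD _ _)); apply: lerD => //.
rewrite mulrA; apply: le_trans (HD x); rewrite le_eqVlt; apply/orP; left; apply/eqP.
congr (`|_ * _|); rewrite /xpow (bigD1 i)// [RHS](bigD1 i)//= mulrAC -exprD eqxx.
congr (_ * _); apply: eq_bigr => j ji; rewrite (_ : (i == j) = false) ?addn0//.
by rewrite eq_sym (negbTE ji).
Qed.

(** The weight is a polynomial, and its factors 1 + x_i^2 can be multiplied in one by one. *)
Lemma polybd_nW F L : polybd F -> exists C, forall x, `|F x| * nW x ^+ L <= C.
Proof.
move=> pF; have {pF} : polybd (fun x : 'rV[R]_n => nW x ^+ L * F x).
  elim: L => [|L IH].
    by have -> : (fun x : 'rV[R]_n => nW x ^+ 0 * F x) = F by apply/funext => x; rewrite mul1r.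
  have -> : (fun x : 'rV[R]_n => nW x ^+ L.+1 * F x) =
      (fun x : 'rV[R]_n => (\prod_i (1 + x ord0 i ^+ 2)) * (nW x ^+ L * F x)).
    by apply/funext => x; rewrite exprS -mulrA.
  elim: (index_enum 'I_n) => [|i l IHl].
    have -> : (fun x : 'rV[R]_n => \prod_(i <- [::]) (1 + x ord0 i ^+ 2) * (nW x ^+ L * F x)) =
        (fun x : 'rV[R]_n => nW x ^+ L * F x).
      by apply/funext => x; rewrite big_nil mul1r.
    exact: IH.
  have -> : (fun x : 'rV[R]_n => \prod_(j <- i :: l) (1 + x ord0 j ^+ 2) * (nW x ^+ L * F x)) =
        (fun x : 'rV[R]_n => (1 + x ord0 i ^+ 2) * (\prod_(j <- l) (1 + x ord0 j ^+ 2) * (nW x ^+ L * F x))).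
      by apply/funext => x; rewrite big_cons -mulrA.
  exact: (polybd_onesq i IHl).
move=> /(_ (fun=> 0%N)) [C HC]; exists C => x; have := HC x.
rewrite /xpow big1 ?mul1r; last by move=> i _; rewrite expr0.
by rewrite normrM mulrC (ger0_norm (exprn_ge0 _ (ltW (nW_gt0 x)))).
Qed.

Lemma schwartz_rapid g : schwartz g -> rapid (cRe g) /\ rapid (cIm g).
Proof.
move=> [[sr si] gC].
have H b : polybd (Dr b (cRe g)) /\ polybd (Dr b (cIm g)).
  by split=> a; have [C HC] := gC a b; exists C => x; apply: le_trans (HC x);
    [apply: le_trans (Re_le_cabs _) | apply: le_trans (Im_le_cabs _)];
    rewrite ?ReMc ?ImMc /= mul0r ?subr0 ?addr0.
have K F : smooth F -> (forall b, polybd (Dr b F)) -> rapid F.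
  move=> sF pF; split=> // s L; rewrite iter_pd_Dr//.
  by have [C HC] := polybd_nW L (pF (fun i => count_mem i s)); exists C => _ x; exact: HC.
by split; apply: K => // b; have [h1 h2] := H b.
Qed.

Lemma rapid_schwartz g : rapid (cRe g) -> rapid (cIm g) -> schwartz g.
Proof.
move=> [sr rC] [si iC]; split; first by split; [exact: sr tt | exact: si tt].
move=> a b; have [C HC] := rC (mseq b) (mabs a); have [D HD] := iC (mseq b) (mabs a).
exists (C + D) => x; apply: (le_trans (cabs_le _)).
rewrite ReMc ImMc /= !mul0r subr0 addr0 !normrM.
by apply: lerD; [apply: le_trans (HC tt x) | apply: le_trans (HD tt x)];
  rewrite mulrC ler_wpM2l//; exact: xpow_le_nW.
Qed.

Lemma rapid0 : rapid (fun _ : 'rV[R]_n => 0 : R).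
Proof.
split=> [_|s L]; first exact: smooth_cst.
by exists 0 => _ x; rewrite iter_pd0 normr0 mul0r.
Qed.

End SchwartzRapid.

(* The seminorms are attached to a predicate on smooth functions only, since [iter_pd] is not
   additive outside of them. *)
Section TemperedReal.
Context {R : realType} {n : nat}.
Implicit Types (F : 'rV[R]_n -> R).

Lemma mem_words (s : seq 'I_n) : s \in words (size s).
Proof.
elim: s => [|j s IH] /=; first by rewrite inE.
by apply/allpairsP; exists (s, j); rewrite mem_index_enum.
Qed.

Definition sbd (k : nat) F (B : R) : Prop :=
  smooth F /\ forall s, (size s <= k)%N -> forall x, `|iter_pd s F x| * nW x ^+ k <= B.

Definition rtempered (tau : ('rV[R]_n -> R) -> R) : Prop :=
  (forall a f g, rapid f -> rapid g -> tau (fun x => a * f x + g x) = a * tau f + tau g) /\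
  exists (k : nat) (C : R), 0 <= C /\
    forall F B, rapid F -> sbd k F B -> `|tau F| <= C * B.

(** Only finitely many words have length at most [k], so the separate bounds can be added up. *)
Lemma urapid_sbd (I : Type) (F : I -> 'rV[R]_n -> R) k : urapid F ->
  exists B, 0 <= B /\ forall i, sbd k (F i) B.
Proof.
move=> [sF FC].
suff [B [B0 HB]] : exists B, 0 <= B /\ forall s, (size s <= k)%N -> forall i x,
    `|iter_pd s (F i) x| * nW x ^+ k <= B.
  by exists B; split=> // i; split=> // s sk x; exact: HB.
have P l : exists B, 0 <= B /\ forall s, s \in words l -> forall i x,
    `|iter_pd s (F i) x| * nW x ^+ k <= B.
  elim: (words l) => [|s L [B [B0 HB]]]; first by exists 0.
  have [C HC] := FC s k; exists (B + `|C|); split; first by rewrite addr_ge0.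
  move=> t; rewrite inE => /orP[/eqP ->|/HB H] i x.
    by apply: (le_trans (HC i x)); rewrite (le_trans (ler_norm _))// lerDr.
  by apply: (le_trans (H i x)); rewrite lerDl.
have {P} P l : exists B, 0 <= B /\ forall s, (size s < l)%N -> forall i x,
    `|iter_pd s (F i) x| * nW x ^+ k <= B.
  elim: l => [|l [B [B0 HB]]]; first by exists 0.
  have [C [C0 HC]] := P l; exists (B + C); split; first by rewrite addr_ge0.
  move=> s; rewrite ltnS leq_eqVlt => /orP[/eqP sl|/HB H] i x.
    by rewrite (le_trans (HC s _ i x)) ?lerDr// -sl mem_words.
  by apply: (le_trans (H i x)); rewrite lerDl.
by have [B HB] := P k.+1; exists B.
Qed.

Lemma rtempered_urapid (tau : ('rV[R]_n -> R) -> R) (I : Type) (F : I -> 'rV[R]_n -> R) :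
  rtempered tau -> urapid F -> exists B, 0 <= B /\ forall i, `|tau (F i)| <= B.
Proof.
move=> [_ [k [C [C0 HC]]]] uF; have [B [B0 HB]] := urapid_sbd k uF.
exists (C * B); split=> [|i]; first exact: mulr_ge0.
by apply: HC; [exact: urapid_rapid uF | exact: HB].
Qed.

Lemma rtempered0 tau : rtempered tau -> tau (fun=> 0) = 0.
Proof.
move=> [tl _]; have := tl (- 1) _ _ rapid0 rapid0.
have -> : (fun _ : 'rV[R]_n => -1 * 0 + 0 : R) = fun=> 0 by apply/funext => x; rewrite mulr0 addr0.
by rewrite mulN1r addNr.
Qed.

Lemma rtemperedZ tau a F : rtempered tau -> rapid F -> tau (fun x => a * F x) = a * tau F.
Proof.
move=> tt' rF; have [tl _] := tt'; have := tl a _ _ rF rapid0.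
rewrite rtempered0// addr0 => <-.
by congr tau; apply/funext => x; rewrite addr0.
Qed.

Lemma rtemperedD tau F G : rtempered tau -> rapid F -> rapid G ->
  tau (fun x => F x + G x) = tau F + tau G.
Proof.
move=> [tl _] rF rG; have := tl 1 _ _ rF rG; rewrite mul1r => <-.
by congr tau; apply/funext => x; rewrite mul1r.
Qed.

End TemperedReal.

Section TemperedParts.
Context {R : realType} {n : nat}.
Variable s : distr R n.
Hypothesis ts : tempered s.

(** A complex linear functional is determined by its values on real functions, so all estimates can
    be made on the two real functionals [tauRe] and [tauIm]. *)
Definition tauRe (F : 'rV[R]_n -> R) : R := complex.Re (s (fun x => cR (F x))).
Definition tauIm (F : 'rV[R]_n -> R) : R := complex.Im (s (fun x => cR (F x))).

Lemma rapid_cR F : rapid F -> schwartz (fun x : 'rV[R]_n => cR (F x)).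
Proof. by move=> rF; apply: rapid_schwartz => //; exact: rapid0. Qed.

Let cR_lin a F G : rapid F -> rapid G ->
  s (fun x => cR (a * F x + G x)) = cR a * s (fun x => cR (F x)) + s (fun x => cR (G x)).
Proof.
move=> rF rG; have [sl _] := ts; rewrite -sl; [|exact: rapid_cR|exact: rapid_cR].
by congr s; apply/funext => x; rewrite cRD cRM.
Qed.

Let cR_bd : exists (k : nat) (C : R), 0 <= C /\ forall F B, rapid F -> sbd k F B ->
  cabs (s (fun x => cR (F x))) <= C * B.
Proof.
have [_ [k [C HC]]] := ts; exists k, `|C|; split=> // F B rF [sF FB].
have B0 : 0 <= B.
  by apply: le_trans (FB [::] _ 0) => //; rewrite mulr_ge0 ?exprn_ge0 ?(ltW (nW_gt0 _)).
apply: (@le_trans _ _ (C * B)); last by rewrite ler_wpM2r// ler_norm.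
apply: HC; first exact: rapid_cR.
move=> a b x ak bk.
have -> : Dc b (fun x => cR (F x)) x = cR (Dr b F x).
  by apply: complex_ext => //=; rewrite /Dr /cIm /= iter_pd0.
rewrite -cRM cabs_real normrM mulrC; apply: le_trans (FB (mseq b) _ x); last by rewrite size_mseq.
rewrite ler_wpM2l// (le_trans (xpow_le_nW _ _))//.
by rewrite ler_weXn2l// nW_ge1.
Qed.

Lemma rtempered_Re : rtempered tauRe.
Proof.
split=> [a f g rf rg|]; first by rewrite /tauRe cR_lin// ReDc ReMc /= mul0r subr0.
have [k [C [C0 HC]]] := cR_bd; exists k, C; split=> // F B rF bF.
exact: le_trans (Re_le_cabs _) (HC _ _ rF bF).
Qed.

Lemma rtempered_Im : rtempered tauIm.
Proof.
split=> [a f g rf rg|]; first by rewrite /tauIm cR_lin// ImDc ImMc /= mul0r addr0.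
have [k [C [C0 HC]]] := cR_bd; exists k, C; split=> // F B rF bF.
exact: le_trans (Im_le_cabs _) (HC _ _ rF bF).
Qed.

Lemma tempered_split g : schwartz g ->
  s g = Complex (tauRe (cRe g) - tauIm (cIm g)) (tauIm (cRe g) + tauRe (cIm g)).
Proof.
move=> sg; have [rr ri] := schwartz_rapid sg; have [sl _] := ts.
have -> : g = fun x => 'i%C * cR (cIm g x) + cR (cRe g x).
  by apply/funext => x; rewrite [LHS]complex_split addrC.
rewrite sl; [|exact: rapid_cR|exact: rapid_cR].
have -> : cRe (fun x => 'i%C * cR (cIm g x) + cR (cRe g x)) = cRe g.
  by apply/funext => x; rewrite /cRe ReDc ReMc /=; ring.
have -> : cIm (fun x => 'i%C * cR (cIm g x) + cR (cRe g x)) = cIm g.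
  by apply/funext => x; rewrite /cIm ImDc ImMc /=; ring.
by apply: complex_ext; rewrite ?ReDc ?ImDc ?ReMc ?ImMc /= /tauRe /tauIm; ring.
Qed.

End TemperedParts.

(** * The transform of a localized tempered functional *)

Section OscTaylor.
Context {R : realType} {n : nat}.
Implicit Types (z v y : 'rV[R]_n) (c : R).

(** Taylor remainder of order [m] of the wave at frequency z + v around frequency z; the l-th
    derivative of the cosine appears as the phase shift l pi / 2. *)
Definition oscrem (m : nat) z v c y : R :=
  osc (z + v) c y - \sum_(l < m) dotp v y ^+ l / (l`!)%:R * osc z (c + l%:R * (pi / 2)) y.

Lemma oscrem0 z v c y : oscrem 0 z v c y = osc (z + v) c y.
Proof. by rewrite /oscrem big_ord0 subr0. Qed.

Lemma oscremS m z v c y : oscrem m.+1 z v c y =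
  oscrem m z v c y - dotp v y ^+ m / (m`!)%:R * osc z (c + m%:R * (pi / 2)) y.
Proof. by rewrite /oscrem big_ord_recr/= opprD addrA. Qed.

Lemma dotp_le v y : `|dotp v y| <= n1 v * nW y.
Proof.
rewrite /dotp /n1 mulr_suml (le_trans (ler_norm_sum _ _ _))//; apply: ler_sum => i _.
by rewrite normrM ler_wpM2l//; exact: coord_le_nW.
Qed.

Lemma oscrem_le m z v c y : `|oscrem m z v c y| <= `|dotp v y| ^+ m.
Proof.
pose F (l : nat) (t : R) : R := dotp v y ^+ l * cos (dotp z y + c + l%:R * (pi / 2) + t * dotp v y).
have dF l (t : R) : is_derive t 1 (F l) (F l.+1 t).
  rewrite /F; set b := dotp z y + c + _; set a := dotp v y ^+ l; set d := dotp v y.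
  have D : is_derive t 1 (fun t : R => b + t * d) d.
    by apply: is_derive_eq; rewrite add0r scaler0 mul1r add0r /GRing.scale/= mulr1.
  have DC : is_derive (b + t * d) 1 cos (- sin (b + t * d)) by exact: is_derive_cos.
  have := @is_derive1_comp _ cos (fun t : R => b + t * d) t _ _ DC D.
  move=> H; have := @is_deriveZ _ _ _ (fun t : R => cos (b + t * d)) a t 1 _ H.
  move=> {}H; apply: is_derive_eq; rewrite exprSr -/d -/a.
  have -> : dotp z y + c + l.+1%:R * (pi / 2) + t * d = b + t * d + pi / 2.
    by rewrite /b -natr1 [(l%:R + 1) * _]mulrDl mul1r; ring.
  by rewrite cosDpihalf /GRing.scale/= -mulrA; congr (_ * _); rewrite mulrC.
have Fm (t : R) : `|t| <= 1 -> `|F m t| <= `|dotp v y| ^+ m.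
  move=> _; rewrite /F normrM normrX ler_piMr ?exprn_ge0//.
  by rewrite ler_norml cos_geN1 cos_le1.
have := taylor1 dF Fm (t := 1); rewrite normr1 expr1n mulr1 => /(_ (lexx _)).
have -> // : F 0 1 - \sum_(l < m) 1 ^+ l / (l`!)%:R * F l 0 = oscrem m z v c y.
congr (_ - _).
  by rewrite /F expr0 !mul1r mul0r addr0 /osc dotpDl addrAC.
apply: eq_bigr => l _; rewrite expr1n [1 / _]mul1r /F [0 * _]mul0r addr0.
rewrite /osc [dotp z y + (_ + _)]addrA; set f := dotp v y ^+ l; set C := cos _.
by rewrite mulrA [_^-1 * _]mulrC.
Qed.

Lemma smooth_oscrem m z v c : smooth (oscrem m z v c).
Proof.
elim: m => [|m IH].
  by have -> : oscrem 0 z v c = osc (z + v) c;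
    [apply/funext => y; exact: oscrem0 | exact: smooth_osc].
have -> : oscrem m.+1 z v c = fun y => oscrem m z v c y -
    (m`!)%:R^-1 * dotp v y ^+ m * osc z (c + m%:R * (pi / 2)) y.
  by apply/funext => y; rewrite oscremS [_ / _]mulrC.
apply: (smoothB IH); apply: smoothM; last exact: smooth_osc.
by apply: smoothZ; apply: smoothX; exact: smooth_dotp.
Qed.

Lemma pd_oscrem0 z v c j : pd j (oscrem 0 z v c) =
  fun y => (z + v) ord0 j * oscrem 0 z v (c + pi / 2) y.
Proof.
have E c' : oscrem 0 z v c' = osc (z + v) c' by apply/funext => y; exact: oscrem0.
by rewrite !E pd_osc.
Qed.

Lemma has_pd_dotpX v j m : has_pd j (fun y => dotp v y ^+ m)
  (fun y => m%:R * dotp v y ^+ m.-1 * v ord0 j).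
Proof.
have D : has_pd j (dotp v) (fun=> v ord0 j).
  by rewrite -(pd_dotp v j); exact/smooth_has_pd/smooth_dotp.
have := @has_pd_comp _ _ j (fun t => t ^+ m) (fun t => m%:R * t ^+ m.-1) _ _ _ D.
apply=> t; have := @is_deriveX _ _ id m t 1 1 (is_derive_id _ _). rewrite /GRing.scale /= mulr1 (_ : id ^+ m = (fun t : R => t ^+ m)) //; apply/funext => u; elim: m => [//|m IH]; by rewrite !exprS -IH.
Qed.

Lemma pd_oscterm (a : R) z v c j m :
  pd j (fun y => a * dotp v y ^+ m * osc z c y) =
  fun y => a * (m%:R * dotp v y ^+ m.-1 * v ord0 j) * osc z c y
           + a * dotp v y ^+ m * (z ord0 j * osc z (c + pi / 2) y).
Proof.
apply: has_pdE; apply: has_pdM; last by rewrite -pd_osc; exact/smooth_has_pd/smooth_osc.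
have := @has_pdM _ _ j (fun=> a) (fun y => dotp v y ^+ m) _ _ (has_pd_cst j a) (has_pd_dotpX v j m).
by under [X in has_pd _ _ X -> _]eq_fun do rewrite mul0r add0r.
Qed.

(** A derivative in y either leaves the order of the remainder or lowers it by one in exchange for a
    factor v_j. Derivatives therefore never lose powers of [v], which is what [oscrem_bound]
    exploits. *)
Lemma pd_oscremS m z v c j : pd j (oscrem m.+1 z v c) =
  fun y => z ord0 j * oscrem m.+1 z v (c + pi / 2) y + v ord0 j * oscrem m z v (c + pi / 2) y.
Proof.
have step m' : pd j (oscrem m'.+1 z v c) = fun y => pd j (oscrem m' z v c) y -
   ((m'`!)%:R^-1 * (m'%:R * dotp v y ^+ m'.-1 * v ord0 j) * osc z (c + m'%:R * (pi / 2)) y +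
   (m'`!)%:R^-1 * dotp v y ^+ m' * (z ord0 j * osc z (c + m'%:R * (pi / 2) + pi / 2) y)).
  have -> : oscrem m'.+1 z v c = fun y => oscrem m' z v c y + -1 *
      ((m'`!)%:R^-1 * dotp v y ^+ m' * osc z (c + m'%:R * (pi / 2)) y).
    by apply/funext => y; rewrite oscremS mulN1r [_ / _]mulrC.
  have sT : smooth (fun y => (m'`!)%:R^-1 * dotp v y ^+ m' * osc z (c + m'%:R * (pi / 2)) y).
    apply: smoothM; last exact: smooth_osc.
    by apply: smoothZ; apply: smoothX; exact: smooth_dotp.
  rewrite (pdD _ (smooth_oscrem m' z v c) (smoothZ (-1) sT)) (pdZ _ (-1) sT) pd_oscterm.
  by apply/funext => y; rewrite mulN1r.
have A (k : nat) : c + k%:R * (pi / 2) + pi / 2 = c + pi / 2 + k%:R * (pi / 2).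
  by rewrite addrAC.
elim: m => [|m IH]; apply/funext => y; rewrite step.
  rewrite pd_oscrem0 [in RHS]oscremS !oscrem0 A mxE /= !expr0 !mul0r !addr0 !mulr0 !mul0r.
  by rewrite add0r; ring.
rewrite IH [in RHS]oscremS [oscrem m.+1 z v (c + pi / 2) y in X in _ = _ + X]oscremS A.
set a := oscrem m.+1 _ _ _ _; set b := oscrem m _ _ _ _.
rewrite -(A m) (_ : c + m%:R * (pi / 2) + pi / 2 = c + m.+1%:R * (pi / 2)); last first.
  by rewrite -[m.+1%:R]natr1 [(m%:R + 1) * _]mulrDl mul1r addrA.
set o := osc z (c + m.+1%:R * _) y; set o' := osc z _ y.
have F0 : (m`!)%:R != 0 :> R by rewrite pnatr_eq0 -lt0n fact_gt0.
have S0 : (m.+1)%:R != 0 :> R by rewrite pnatr_eq0.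
rewrite /= factS natrM invfM.
have R1 (p q f z' v' a' b' o1 o2 d e : R) : p != 0 ->
   z' * a' + v' * b' - (p^-1 * f * (p * d * v') * o1 + p^-1 * f * e * (z' * o2)) =
   z' * (a' - e * (p^-1 * f) * o2) + v' * (b' - d * f * o1) by move=> p0; field.
by apply: R1.
Qed.

Lemma oscrem_bound (K : R) (m : nat) (s : seq 'I_n) : 0 <= K -> exists C, 0 <= C /\
  forall z v c y, (forall j, `|z ord0 j| <= K) -> n1 v <= K ->
    `|iter_pd s (oscrem m z v c) y| <= C * n1 v ^+ m * nW y ^+ m.
Proof.
move=> K0; elim/last_ind: s m => [|s j IH] m.
  exists 1; split=> // z v c y _ _; rewrite mul1r -exprMn.
  apply: (le_trans (oscrem_le _ _ _ _ _)).
  by rewrite lerXn2r ?nnegrE ?mulr_ge0 ?n1_ge0 ?(ltW (nW_gt0 _))//; exact: dotp_le.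
have vj v : `|v ord0 j| <= n1 v by rewrite /n1 (bigD1 j)//= lerDl sumr_ge0.
case: m => [|m].
  have [C [C0 HC]] := IH 0%N; exists ((K + K) * C).
  split=> [|z v c y zK vK]; first by rewrite mulr_ge0// addr_ge0.
  rewrite -cats1 iter_pd_cat /= pd_oscrem0 iter_pdZ; last exact: smooth_oscrem.
  rewrite normrM -!mulrA; apply: ler_pM => //.
    rewrite mxE (le_trans (ler_normD _ _))// lerD//; exact: le_trans (vj v) vK.
  by have := HC z v (c + pi / 2) y zK vK; rewrite -!mulrA.
have [C [C0 HC]] := IH m.+1; have [D [D0 HD]] := IH m.
exists (K * C + D); split=> [|z v c y zK vK]; first by rewrite addr_ge0// mulr_ge0.
have nv := n1_ge0 v; have nW1 := nW_ge1 y; have nW0 := ltW (nW_gt0 y).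
rewrite -cats1 iter_pd_cat /= pd_oscremS.
rewrite (iter_pdD s (smoothZ _ (smooth_oscrem _ _ _ _)) (smoothZ _ (smooth_oscrem _ _ _ _))).
rewrite !iter_pdZ; try exact: smooth_oscrem.
apply: (le_trans (ler_normD _ _)); rewrite [(K * C + D) * _]mulrDl [(_ + _) * nW y ^+ _]mulrDl.
apply: lerD.
  rewrite normrM -!mulrA; apply: ler_pM => //.
  by rewrite mulrA; exact: HC.
rewrite normrM; apply: (@le_trans _ _ (n1 v * (D * n1 v ^+ m * nW y ^+ m))).
  by apply: ler_pM => //; exact: HD.
rewrite (_ : D * n1 v ^+ m.+1 * nW y ^+ m.+1 = n1 v * (D * n1 v ^+ m * nW y ^+ m) * nW y).
  by rewrite ler_peMr// !mulr_ge0// exprn_ge0.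
by rewrite !exprS; ring.
Qed.

(** Dividing by |v|^m makes the remainders a bounded family, so that a tempered functional bounds
    them all at once. The inverse of zero being zero, v = 0 needs no exclusion. *)
Lemma utemp_oscrem (I : Type) (z v : I -> 'rV[R]_n) (c : I -> R) (K : R) m : 0 <= K ->
  (forall i j, `|z i ord0 j| <= K) -> (forall i, n1 (v i) <= K) ->
  utemp (fun i y => (n1 (v i))^- m * oscrem m (z i) (v i) (c i) y).
Proof.
move=> K0 zK vK; split=> [i|s]; first by apply: smoothZ; exact: smooth_oscrem.
have [C [C0 HC]] := oscrem_bound m s K0; exists m, C => i y.
have nv : 0 <= (n1 (v i))^- m by rewrite invr_ge0 exprn_ge0// n1_ge0.
rewrite iter_pdZ; last exact: smooth_oscrem.
rewrite normrM (ger0_norm nv).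
apply: (le_trans (ler_wpM2l nv (HC _ _ (c i) y (zK i) (vK i)))).
rewrite mulrA ler_wpM2r ?exprn_ge0 ?(ltW (nW_gt0 _))// mulrCA ler_piMr//.
have [->|h] := eqVneq (n1 (v i) ^+ m) 0; first by rewrite mulr0.
by rewrite mulVf.
Qed.

End OscTaylor.

Section TemperedOsc.
Context {R : realType} {n : nat}.
Variable tau : ('rV[R]_n -> R) -> R.
Hypothesis ttau : rtempered tau.
Implicit Types (z v y : 'rV[R]_n) (c : R).

Lemma rapid_mul_osc (Psi : 'rV[R]_n -> R) z c : rapid Psi -> rapid (fun y => Psi y * osc z c y).
Proof.
move=> rP; apply: urapidM => //; apply: (@utemp_osc _ _ _ (fun=> z) (fun=> c) (n1 z)) => _ j.
by rewrite /n1 (bigD1 j)//= lerDl sumr_ge0.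
Qed.

Lemma urapid_oscrem (I : Type) (Psi : I -> 'rV[R]_n -> R) (z v : I -> 'rV[R]_n) (c : I -> R) K m :
  0 <= K -> urapid Psi -> (forall i j, `|z i ord0 j| <= K) -> (forall i, n1 (v i) <= K) ->
  urapid (fun i y => (n1 (v i))^- m * (Psi i y * oscrem m (z i) (v i) (c i) y)).
Proof.
move=> K0 uP zK vK.
have -> : (fun i y => (n1 (v i))^- m * (Psi i y * oscrem m (z i) (v i) (c i) y)) =
   (fun i y => Psi i y * ((n1 (v i))^- m * oscrem m (z i) (v i) (c i) y)).
  by apply/funext => i; apply/funext => y; rewrite mulrCA.
by apply: urapidM => //; exact: utemp_oscrem zK vK.
Qed.

Lemma rapid_mul_oscrem (Psi : 'rV[R]_n -> R) m z v c : rapid Psi ->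
  rapid (fun y => Psi y * oscrem m z v c y).
Proof.
move=> rP.
have H z' c' := rapid_mul_osc z' c' rP.
elim: m => [|m IH].
  have -> // : oscrem 0 z v c = osc (z + v) c by apply/funext => y; exact: oscrem0.
have -> : (fun y => Psi y * oscrem m.+1 z v c y) = (fun y => Psi y * oscrem m z v c y +
    - (m`!)%:R^-1 * ((Psi y * osc z (c + m%:R * (pi / 2)) y) * dotp v y ^+ m)).
  have Rr (p a d i o : R) : p * (a - d * i * o) = p * a + - i * (p * o * d) by ring.
  by apply/funext => y; rewrite oscremS; exact: Rr.
apply: (urapidD IH (urapidZ _ _)).
elim: m {IH} (c + _) => [|m IH] c'.
  have -> : (fun y => Psi y * osc z c' y * dotp v y ^+ 0) = (fun y => Psi y * osc z c' y).
    by apply/funext => y; rewrite expr0 mulr1.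
  exact: H.
have -> : (fun y => Psi y * osc z c' y * dotp v y ^+ m.+1) =
   (fun y => \sum_i v ord0 i * (y ord0 i * (Psi y * osc z c' y * dotp v y ^+ m))).
  apply/funext => y; rewrite exprS mulrCA {1}/dotp mulr_suml; apply: eq_bigr => i _.
  exact: esym (mulrA _ _ _).
by apply: rapid_sum => i; apply: urapidZ; exact: (rapid_coord i (IH c')).
Qed.

Lemma n1_eq0 v : n1 v = 0 -> v = 0.
Proof.
move=> /eqP; rewrite psumr_eq0// => /allP H; apply/rowP => i.
by have := H i (mem_index_enum i); rewrite normr_eq0 mxE => /eqP.
Qed.

Lemma oscrem_v0 m z c y : (0 < m)%N -> oscrem m z 0 c y = 0.
Proof.
move=> m0; apply/normr0_eq0/eqP; rewrite eq_le normr_ge0 andbT.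
rewrite (le_trans (oscrem_le _ _ _ _ _))//.
by rewrite /dotp big1 ?normr0 ?expr0n ?gtn_eqF// => i _; rewrite mxE mul0r.
Qed.

(** The transform of [Psi] times [tau] has a Taylor remainder of order |v|^m, uniformly in the
    index, the base point and the phase. *)
Lemma tau_oscrem (I : Type) (Psi : I -> 'rV[R]_n -> R) (m : nat) (K : R) : 0 <= K -> urapid Psi ->
  exists C, 0 <= C /\ forall i z v c, (forall j, `|z ord0 j| <= K) -> n1 v <= K ->
    `|tau (fun y => Psi i y * oscrem m z v c y)| <= C * n1 v ^+ m.
Proof.
move=> K0 uP.
(* All parameters are packed into one index type, so that a single constant serves them all. *)
pose J := {p : (I * R) * ('rV[R]_n * 'rV[R]_n) |
  (forall j, `|p.2.1 ord0 j| <= K) /\ n1 p.2.2 <= K}.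
pose z (p : J) := (sval p).2.1; pose v (p : J) := (sval p).2.2; pose c (p : J) := (sval p).1.2.
have uR := @urapid_oscrem J (fun p => Psi (sval p).1.1) z v c K m K0
  (urapid_reindex (fun p : J => (sval p).1.1) uP) (fun p => proj1 (svalP p)) (fun p => proj2 (svalP p)).
have [C [C0 HC]] := rtempered_urapid ttau uR.
exists C; split=> // i z' v' c' zK vK.
have := HC (exist _ ((i, c'), (z', v')) (conj zK vK)); rewrite /z /v /c /= => H.
have rP : rapid (fun y => Psi i y * oscrem m z' v' c' y).
  exact/rapid_mul_oscrem/(urapid_rapid i uP).
rewrite rtemperedZ// normrM in H.
have [n0|n0] := eqVneq (n1 v' ^+ m) 0; last first.
  have np : 0 < n1 v' ^+ m by rewrite lt_def n0 exprn_ge0// n1_ge0.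
  by move: H; rewrite ger0_norm ?invr_ge0 ?(ltW np)// mulrC ler_pdivrMr.
rewrite n0 mulr0; move/eqP: n0; rewrite expf_eq0 => /andP[m0 /eqP /n1_eq0 ->].
have -> : (fun y => Psi i y * oscrem m z' 0 c' y) = fun=> 0.
  by apply/funext => y; rewrite oscrem_v0// mulr0.
by rewrite rtempered0// normr0.
Qed.

Lemma tau_osc_diff (Psi : 'rV[R]_n -> R) c z z0 : rapid Psi ->
  tau (fun y => Psi y * osc z c y) - tau (fun y => Psi y * osc z0 c y) =
  tau (fun y => Psi y * oscrem 1 z0 (z - z0) c y).
Proof.
move=> rP; rewrite -[X in _ - X]mul1r -mulNr -rtemperedZ//; last exact: rapid_mul_osc.
rewrite -rtemperedD//; [|exact: rapid_mul_osc|by apply: urapidZ; exact: rapid_mul_osc].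
congr tau; apply/funext => y; rewrite oscremS oscrem0 subrKC.
by rewrite expr0 fact0 divr1 [0%:R * _]mul0r addr0 [1 * osc _ _ _]mul1r; ring.
Qed.

Lemma n1_continuous : continuous (@n1 R n).
Proof.
apply: contP => z; apply: (@sum_continuous R _ _ (index_enum 'I_n) (fun i (z : 'rV[R]_n) => `|z ord0 i|)) => i.
by apply: cont_norm; exact: coordc.
Qed.

Lemma near_n1 z0 (e : R) : 0 < e -> \forall z \near z0, n1 (z - z0) <= e.
Proof.
move=> e0; have H : {for z0, continuous (fun z => n1 (z - z0))}.
  apply: (@cont_comp _ _ _ (fun z => z - z0) n1); last exact: n1_continuous.
  by apply: contBV; [exact: contid | exact: contC].
apply: nearS (cont_near H e0) => z; rewrite subrr.
have -> : n1 (0 : 'rV[R]_n) = 0 by rewrite /n1 big1// => i _; rewrite mxE normr0.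
by rewrite subr0 ger0_norm ?n1_ge0.
Qed.

Lemma tau_osc_continuous (Psi : 'rV[R]_n -> R) c : rapid Psi ->
  continuous (fun z => tau (fun y => Psi y * osc z c y)).
Proof.
move=> rP; apply: contP => z0; apply: cont_eps => e e0.
have K0 : 0 <= n1 z0 + 1 by rewrite addr_ge0 ?n1_ge0.
have [C [C0 HC]] := tau_oscrem 1 K0 rP.
have d0 : 0 < Num.min 1 (e / (C + 1)) by rewrite lt_min ltr01/= divr_gt0// ltr_wpDl.
apply: nearS (near_n1 z0 d0) => z; rewrite le_min => /andP[h1 h2].
rewrite tau_osc_diff//; apply: (le_trans (HC tt z0 (z - z0) c _ _)) => [j||].
- by rewrite (@le_trans _ _ (n1 z0))// ?lerDl// /n1 (bigD1 j)//= lerDl sumr_ge0.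
- by rewrite (le_trans h1)// lerDr n1_ge0.
rewrite expr1; apply: (@le_trans _ _ (C * (e / (C + 1)))); first by rewrite ler_wpM2l.
by rewrite mulrCA ger_pMr// ler_pdivrMr ?mul1r ?ltr_wpDl// lerDl.
Qed.

Lemma iter_pd_mul_oscint s (Psi g : 'rV[R]_n -> R) c y : rapid Psi -> rapid g ->
  iter_pd s (fun x => Psi x * oscint c g x) y =
    intRn (fun z => iter_pd s (fun x => g z * (Psi x * osc z c x)) y) /\
  dec (fun z => iter_pd s (fun x => g z * (Psi x * osc z c x)) y).
Proof.
elim/last_ind: s Psi g c => [|s j IH] Psi g c rP rg.
  have E : (fun z => g z * (Psi y * osc z c y)) = (fun z => Psi y * (osc y c z * g z)).
    by apply/funext => z; rewrite oscC; ring.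
  have D := rapid_osc y c rg.
  rewrite /= E; split; last exact/rapid_dec/urapidZ.
  by rewrite intRnZ//; exact/dec_intble/rapid_dec.
have sP : smooth Psi := proj1 rP tt.
have rp := urapid_pd j rP; have rj := rapid_coord j rg.
have sT (f h : 'rV[R]_n -> R) c' : rapid f -> rapid h -> smooth (fun x => f x * oscint c' h x).
  by move=> rf rh; exact: (smoothM (proj1 rf tt) (smooth_oscint _ rh)).
have sO (f : 'rV[R]_n -> R) z c' (a : R) : smooth f -> smooth (fun x => a * (f x * osc z c' x)).
  by move=> sf; exact: (smoothZ _ (smoothM sf (smooth_osc z c'))).
have E1 : pd j (fun x => Psi x * oscint c g x) = fun x => pd j Psi x * oscint c g x +
    Psi x * oscint (c + pi / 2) (fun z => z ord0 j * g z) x.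
  by rewrite (pdM _ sP (smooth_oscint c rg)) (has_pdE (has_pd_oscint c j rg)).
have E2 z : pd j (fun x => g z * (Psi x * osc z c x)) = fun x => g z * (pd j Psi x * osc z c x) +
    (z ord0 j * g z) * (Psi x * osc z (c + pi / 2) x).
  rewrite (pdZ _ _ (smoothM sP (smooth_osc z c))) (pdM _ sP (smooth_osc z c)) pd_osc.
  have Rr (a p o t q o' : R) : a * (p * o + t * (q * o')) = a * (p * o) + q * a * (t * o') by ring.
  by apply/funext => x; exact: Rr.
have E3 : (fun z => iter_pd (rcons s j) (fun x => g z * (Psi x * osc z c x)) y) =
    (fun z => iter_pd s (fun x => g z * (pd j Psi x * osc z c x)) y +
    iter_pd s (fun x => (z ord0 j * g z) * (Psi x * osc z (c + pi / 2) x)) y).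
  apply/funext => z; rewrite -cats1 iter_pd_cat /= E2.
  by rewrite (iter_pdD s (sO _ z c (g z) (smooth_pd j sP)) (sO _ z (c + pi / 2) (z ord0 j * g z) sP)).
have [I1 D1] := IH _ _ c rp rg; have [I2 D2] := IH _ _ (c + pi / 2) rP rj.
rewrite E3; split; last exact: decD.
rewrite (intRnD (dec_intble D1) (dec_intble D2)) -I1 -I2 -cats1 iter_pd_cat /= E1.
by rewrite (iter_pdD s (sT _ _ c rp rg) (sT _ _ (c + pi / 2) rP rj)).
Qed.

End TemperedOsc.

Section TemperedCommute.
Context {R : realType} {n : nat}.
Variable tau : ('rV[R]_n -> R) -> R.
Hypothesis ttau : rtempered tau.

Lemma sbd_le k (F : 'rV[R]_n -> R) A B : sbd k F A -> A <= B -> sbd k F B.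
Proof. by move=> [sF FA] AB; split=> // s sk x; exact: le_trans (FA s sk x) AB. Qed.

Lemma sbdD k (F G : 'rV[R]_n -> R) A B : sbd k F A -> sbd k G B ->
  sbd k (fun x => F x + G x) (A + B).
Proof.
move=> [sF FA] [sG GB]; split; first exact: smoothD.
move=> s sk x; rewrite iter_pdD// (le_trans _ (lerD (FA s sk x) (GB s sk x)))//.
by rewrite -mulrDl ler_wpM2r ?ler_normD// exprn_ge0// (ltW (nW_gt0 x)).
Qed.

Lemma sbdZ k (F : 'rV[R]_n -> R) (c : R) A : sbd k F A -> sbd k (fun x => c * F x) (`|c| * A).
Proof.
move=> [sF FA]; split; first exact: smoothZ.
by move=> s sk x; rewrite iter_pdZ// normrM -mulrA ler_wpM2l// FA.
Qed.

(** The Fourier transform of [Psi] times [tau] is a function, namely z -> tau(Psi [osc z c]): the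
    functional is taken under the integral of [oscint c g] by [intRn_commute] in the gauge
    [sbd k]. *)
Lemma tau_osc_commute (Psi g : 'rV[R]_n -> R) c : rapid Psi -> rapid g ->
  tau (fun y => Psi y * oscint c g y) = intRn (fun z => g z * tau (fun y => Psi y * osc z c y)) /\
  dec (fun z => g z * tau (fun y => Psi y * osc z c y)).
Proof.
move=> rP rg; have [tl [k [C [C0 HC]]]] := ttau.
have sP : smooth Psi := proj1 rP tt.
pose S z := fun x => g z * (Psi x * osc z c x).
have rS z : rapid (S z) by exact: (urapidZ (g z) (rapid_mul_osc z c rP)).
have ST z : tau (S z) = g z * tau (fun y => Psi y * osc z c y).
  by rewrite /S (rtemperedZ _ ttau (rapid_mul_osc z c rP)).
have SI y : intRn (S ^~ y) = Psi y * oscint c g y by have [/= -> _] := iter_pd_mul_oscint [::] c y rP rg.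
have [D DC] : exists D, forall z, sbd k (S z) (D / nW z ^+ 2).
  have uS : urapid (fun z x => nW z ^+ 2 * S z x).
    have -> : (fun z x => nW z ^+ 2 * S z x) = (fun z x => Psi x * (nW z ^+ 2 * g z * osc z c x)).
      by apply/funext => z; apply/funext => x; rewrite /S; ring.
    apply: (@urapidM _ _ _ (fun=> Psi) (fun z x => nW z ^+ 2 * g z * osc z c x)).
      exact: (urapid_reindex (fun=> tt) rP).
    split=> [z|s]; first by exact: (smoothZ _ (smooth_osc z c)).
    have [_ gC] := urapid_qmon s rg; have [B HB] := gC [::] 2; exists 0%N, B => z x.
    rewrite (iter_pdZ s _ (smooth_osc z c)) iter_pd_osc expr0 mulr1.
    apply: le_trans (HB tt z) => /=.
    have R1 (A a q o : R) : 0 <= A -> `|o| <= 1 -> `|A * a * (q * o)| <= `|q * a| * A.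
      move=> A0 o1; rewrite !normrM (ger0_norm A0) [leLHS](_ : _ = `|q| * `|a| * A * `|o|); last by ring.
      by rewrite ler_piMr// !mulr_ge0.
    by apply: R1; [rewrite exprn_ge0// (ltW (nW_gt0 z)) | exact: osc_le1].
  have [B [B0 HB]] := urapid_sbd k uS; exists B => z.
  have z0 : 0 < nW z ^+ 2 by rewrite exprn_gt0// nW_gt0.
  have := sbdZ (nW z ^+ 2)^-1 (HB z).
  have -> : (fun x => (nW z ^+ 2)^-1 * (nW z ^+ 2 * S z x)) = S z.
    by apply/funext => x; rewrite mulKf// gt_eqF.
  by have -> : `|(nW z ^+ 2)^-1| = (nW z ^+ 2)^-1; [apply: ger0_norm; rewrite invr_ge0 ltW | rewrite mulrC].
have Sc (z0 : 'rV[R]_n) e : 0 < e -> \forall z \near z0, sbd k (fun x => S z x - S z0 x) (e / nW z).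
  move=> e0; have K0 : 0 <= n1 z0 + 1 by rewrite addr_ge0 ?n1_ge0.
  have zj j : `|z0 ord0 j| <= n1 z0 + 1.
    by rewrite (@le_trans _ _ (n1 z0)) ?lerDl// /n1 (bigD1 j)//= lerDl sumr_ge0.
  pose J := {v : 'rV[R]_n | n1 v <= n1 z0 + 1}.
  have uR := @urapid_oscrem R n J (fun=> Psi) (fun=> z0) (fun v => sval v) (fun=> c) _ 1 K0
    (urapid_reindex (fun=> tt) rP) (fun _ j => zj j) (fun v => svalP v).
  have [B1 [B10 HB1]] := urapid_sbd k uR.
  have [B2 [B20 HB2]] := urapid_sbd k (rapid_mul_osc z0 c rP).
  have [g0 _] := rapid_dec rg.
  (* This majorizes [nW z] times the gauge of S(z) - S(z0), split into the change of frequency and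
     the change of amplitude; it is continuous and vanishes at [z0]. *)
  pose G z := (`|g z| * n1 (z - z0) * B1 + `|g z - g z0| * B2) * nW z.
  have cG : {for z0, continuous G}.
    apply: contM; last exact: nW_continuous.
    apply: contD; apply: contM; try exact: contC.
      apply: contM; first by apply: cont_norm; exact: g0.
      apply: (@cont_comp _ _ _ (fun z : 'rV[R]_n => z - z0) n1); last exact: n1_continuous.
      by apply: contBV; [exact: contid | exact: contC].
    by apply: cont_norm; apply: contB; [exact: g0 | exact: contC].
  have G0 : G z0 = 0.
    have z00 : n1 (0 : 'rV[R]_n) = 0 by rewrite /n1 big1// => i _; rewrite mxE normr0.
    by rewrite /G !subrr z00 normr0 mulr0 !mul0r addr0 mul0r.
  have H1 := near_n1 z0 ltr01; have H2 := cont_near cG e0.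
  apply: filterS2 H1 H2 => z h1; rewrite G0 subr0 => h2.
  have h3 : `|g z| * n1 (z - z0) * B1 + `|g z - g z0| * B2 <= e / nW z.
    by rewrite ler_pdivlMr ?nW_gt0//; exact: le_trans (ler_norm _) h2.
  apply: sbd_le h3.
  have -> : (fun x => S z x - S z0 x) = (fun x => g z * (Psi x * oscrem 1 z0 (z - z0) c x) +
      (g z - g z0) * (Psi x * osc z0 c x)).
    apply/funext => x; rewrite /S oscremS oscrem0 subrKC expr0 fact0 divr1 [0%:R * _]mul0r addr0.
    by rewrite [1 * osc _ _ _]mul1r; ring.
  apply: sbdD; last exact: (sbdZ (g z - g z0) (HB2 tt)).
  have h4 : n1 (z - z0) <= n1 z0 + 1 by rewrite (le_trans h1)// lerDr n1_ge0.
  have := sbdZ (g z * n1 (z - z0)) (HB1 (exist _ (z - z0) h4 : J)); rewrite /= normrM (ger0_norm (n1_ge0 _)).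
  have [/n1_eq0 ->|n0] := eqVneq (n1 (z - z0)) 0.
    have -> : n1 (0 : 'rV[R]_n) = 0 by rewrite /n1 big1// => i _; rewrite mxE normr0.
    rewrite !mulr0 !mul0r => _.
    have -> : (fun x => g z * (Psi x * oscrem 1 z0 0 c x)) = fun=> 0.
      by apply/funext => x; rewrite oscrem_v0// !mulr0.
    by split=> [|s _ x]; [exact: smooth_cst | rewrite iter_pd0 normr0 mul0r].
  have -> // : (fun x => g z * n1 (z - z0) * ((n1 (z - z0))^- 1 * (Psi x * oscrem 1 z0 (z - z0) c x)))
    = (fun x => g z * (Psi x * oscrem 1 z0 (z - z0) c x)).
  by apply/funext => x; rewrite expr1 -mulrA mulVKf.
have E_lin a f h : rapid f -> rapid h -> rapid (fun x : 'rV[R]_n => a * f x + h x).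
  by move=> rf rh; exact: (urapidD (urapidZ a rf) rh).
have EI : rapid (fun x => intRn (S ^~ x)).
  by under eq_fun do rewrite SI; exact: (urapidM rP (urapid_temp (urapid_oscint c rg))).
have bd0 : sbd k (fun _ : 'rV[R]_n => 0 : R) 0.
  by split=> [|s _ x]; [exact: smooth_cst | rewrite iter_pd0 normr0 mul0r].
have bdZ (a : R) (f : 'rV[R]_n -> R) A : 0 <= a -> sbd k f A -> sbd k (fun x => a * f x) (a * A).
  by move=> a0 /(sbdZ a); rewrite ger0_norm.
have bd_int (l : seq 'rV[R]_n) (lam : 'rV[R]_n -> 'rV[R]_n -> R) e :
  (forall c, dec (lam c)) ->
  (forall z, sbd k (fun x => S z x - \sum_(c <- l) lam c z * S c x) (e / nW z)) ->
  sbd k (fun x => intRn (S ^~ x) - \sum_(c <- l) intRn (lam c) * S c x) (e * InW n).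
  move=> dlam He.
  have sS z : smooth (S z) := proj1 (rS z) tt.
  have sI : smooth (fun x => intRn (S ^~ x)) := proj1 EI tt.
  have ssum (a : 'rV[R]_n -> R) : smooth (fun x => \sum_(c <- l) a c * S c x).
    by apply: smooth_sum => d; exact: (smoothZ _ (sS d)).
  have isum (a : 'rV[R]_n -> R) s x : iter_pd s (fun x => \sum_(c <- l) a c * S c x) x =
      \sum_(c <- l) a c * iter_pd s (S c) x.
    rewrite (iter_pd_sum s _ (fun d => smoothZ _ (sS d))).
    by apply: eq_bigr => d _; rewrite (iter_pdZ s _ (sS d)).
  split; first exact: (smoothB sI (ssum _)).
  move=> s sk x.
  have [I1 D1] := iter_pd_mul_oscint s c x rP rg.
  have D2 d : dec (fun z => lam d z * iter_pd s (S d) x).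
    have -> : (fun z => lam d z * iter_pd s (S d) x) = (fun z => iter_pd s (S d) x * lam d z).
      by apply/funext => z; rewrite mulrC.
    exact: decZ.
  have D3 : dec (fun z => \sum_(d <- l) lam d z * iter_pd s (S d) x) by exact: dec_sum.
  have B (F G : 'rV[R]_n -> R) : smooth F -> smooth G ->
      iter_pd s (fun x => F x - G x) x = iter_pd s F x - iter_pd s G x.
    by move=> sF sG; rewrite (iter_pdD s sF (smoothN sG)) (iter_pdN s sG).
  have -> : iter_pd s (fun x => intRn (S ^~ x) - \sum_(d <- l) intRn (lam d) * S d x) x =
      intRn (fun z => iter_pd s (S z) x - \sum_(d <- l) lam d z * iter_pd s (S d) x).
    rewrite (intRnD (dec_intble D1) (intbleN (dec_intble D3))) (intRnN (dec_intble D3)).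
    rewrite (B _ _ sI (ssum _)) isum (intRn_sum _ D2); congr (_ - _).
      by rewrite -I1; congr (iter_pd s _ x); apply/funext => y; exact: SI.
    apply: eq_bigr => d _; rewrite mulrC -(intRnZ _ (dec_intble (dlam d))).
    by congr intRn; apply/funext => z; rewrite mulrC.
  have H : `|intRn (fun z => iter_pd s (S z) x - \sum_(d <- l) lam d z * iter_pd s (S d) x)| <=
      (e / nW x ^+ k) * InW n.
    apply: intRn_small; first exact: (intbleD (dec_intble D1) (intbleN (dec_intble D3))).
    move=> z; have [_ /(_ s sk x)] := He z.
    rewrite (B _ _ (sS z) (ssum _)) isum ler_pdivlMr ?nW_gt0// ler_pdivlMr ?exprn_gt0 ?nW_gt0//.
    by rewrite mulrAC.
  move: H; rewrite mulrAC => /le_trans; rewrite -ler_pdivlMr ?exprn_gt0 ?nW_gt0//.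
  by apply.
have tl' (a : R) f h : rapid f -> rapid h -> tau (fun x => a * f x + h x) = a * tau f + tau h.
  exact: tl.
have EST : (fun z => g z * tau (fun y => Psi y * osc z c y)) = (fun z => tau (S z)).
  by apply/funext => z; rewrite ST.
have ESI : (fun y => Psi y * oscint c g y) = (fun y => intRn (S ^~ y)).
  by apply/funext => y; rewrite SI.
rewrite EST ESI; split.
  exact: (@intRn_commute R 'rV[R]_n n (fun f => rapid f) (sbd k) tau C S D bd0
    (fun f h A B => @sbdD k f h A B) bdZ (fun f A B => @sbd_le k f A B) Sc DC E_lin rS EI tl' C0
    HC bd_int).
exact: (@dec_commute R 'rV[R]_n n (fun f => rapid f) (sbd k) tau C S D Sc DC E_lin rS tl' C0 HC).
Qed.

End TemperedCommute.

(** * The asymptotic class *)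

Section MonomialDerivative.
Context {R : realType} {n : nat}.
Implicit Types (s : seq 'I_n) (j : 'I_n).

Lemma smooth_qmon s : smooth (@qmon R n s).
Proof. by apply: smooth_prod => j; exact: smooth_coord. Qed.

(** The words obtained from [s] by deleting one occurrence of [j]; repetitions encode the exponent
    that differentiation brings down. *)
Fixpoint qder j s : seq (seq 'I_n) :=
  if s is i :: s' then (if j == i then [:: s'] else [::]) ++ map (cons i) (qder j s') else [::].

Lemma pd_qmon j s : pd j (@qmon R n s) = fun q => \sum_(t <- qder j s) qmon t q.
Proof.
elim: s => [|i s IH]; apply/funext => q.
  have -> : @qmon R n [::] = fun=> 1 by apply/funext => y; rewrite /qmon big_nil.
  by rewrite pd_cst big_nil.
have -> : @qmon R n (i :: s) = fun y => y ord0 i * qmon s y.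
  by apply/funext => y; rewrite qmon_cons.
rewrite (pdM _ (smooth_coord i) (smooth_qmon s)) (has_pdE (has_pd_coord j i)) IH /= big_cat/= big_map.
congr (_ + _); first by case: ifP => _; rewrite ?big_seq1 ?mul1r// big_nil mul0r.
by rewrite mulr_sumr; apply: eq_bigr => t _; rewrite qmon_cons.
Qed.

Lemma size_qder j s t : t \in qder j s -> (size t).+1 = size s.
Proof.
elim: s t => [//|i s IH] t /=; rewrite mem_cat => /orP[|/mapP[u /IH <- ->//]].
by case: ifP => // _; rewrite inE => /eqP ->.
Qed.

Lemma qmon_le s (q : 'rV[R]_n) : `|qmon s q| <= n1 q ^+ size s.
Proof.
elim: s => [|i s IH]; first by rewrite /qmon big_nil normr1 expr0.
rewrite qmon_cons normrM exprS; apply: ler_pM => //.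
by rewrite /n1 (bigD1 i)//= lerDl sumr_ge0.
Qed.

End MonomialDerivative.

Section BoxTest.
Context {R : realType} {n : nat}.
Implicit Types (r v : 'rV[R]_n -> R) (rho : R).

Definition btest rho r := smooth r /\ forall (z : 'rV[R]_n) i, rho < `|z ord0 i| -> r z = 0.

Lemma btest_out rho r : btest rho r -> forall z : 'rV[R]_n, ~ (forall i, `|z ord0 i| <= rho) -> r z = 0.
Proof. by move=> [_ r0] z /existsNP[i /negP]; rewrite -ltNge; exact: r0. Qed.

Lemma btest_rapid rho r : btest rho r -> rapid r.
Proof.
move=> br; have [sr _] := br; apply: (compact_support_rapid sr (@box_compact R n rho)) => z /= nz.
exact: btest_out br z nz.
Qed.

Lemma btest_pd rho r i : btest rho r -> btest rho (pd i r).
Proof.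
move=> br; have [sr r0] := br; split; first exact: smooth_pd.
move=> z j zj; rewrite -[pd i r]/(iter_pd [:: i] r).
apply: (@iter_pd_support R n _ r [:: i] (@box_closed R n rho) (btest_out br)).
by move=> /= /(_ j); rewrite leNgt zj.
Qed.

Lemma btest_iter_pd rho r s : btest rho r -> btest rho (iter_pd s r).
Proof. by move=> br; elim: s => [//|i s IH]; exact: btest_pd. Qed.

Lemma dec_mul_btest rho v r : continuous v -> btest rho r -> dec (fun z => v z * r z).
Proof.
move=> cv br; have [sr _] := br.
apply: (@dec_compact _ _ _ [set z : 'rV[R]_n | forall i, `|z ord0 i| <= rho]).
- by apply: contP => z; apply: contM; [exact: cv | exact: smooth_continuous].
- exact: box_compact.
- by move=> z /= nz; rewrite (btest_out br) ?mulr0.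
Qed.

End BoxTest.

Section GeometricSeries.
Context {R : realType} {T : topologicalType}.
Implicit Types (f : nat -> T -> R) (C th : R).

Lemma geometric_tail f C th : 0 <= th -> th < 1 -> (forall n x, `|f n x| <= C * th ^+ n) ->
  forall x (k l : nat), `|\sum_(k <= n < k + l) f n x| <= C / (1 - th) * th ^+ k.
Proof.
move=> th0 th1 fC x k l.
have C0 : 0 <= C by have := fC 0 x; rewrite expr0 mulr1; exact: le_trans.
have d0 : 0 < 1 - th by rewrite subr_gt0.
suff : `|\sum_(k <= n < k + l) f n x| <= C / (1 - th) * th ^+ k * (1 - th ^+ l).
  move=> /le_trans; apply; rewrite ler_piMr ?gerBl ?exprn_ge0//.
  by rewrite mulr_ge0 ?exprn_ge0// divr_ge0// ltW.
elim: l => [|l IH]; first by rewrite addn0 big_geq// normr0 expr0 subrr mulr0.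
rewrite addnS big_nat_recr ?leq_addr//= (le_trans (ler_normD _ _))//.
apply: (le_trans (lerD IH (fC _ x))).
rewrite le_eqVlt; apply/orP; left; apply/eqP; rewrite exprD exprS.
by field; rewrite gt_eqF.
Qed.

(** The rate of convergence is kept in the conclusion: it is used again for the integrals against
    test functions and for the pointwise bound of the sum. *)
Lemma geometric_series f C th : 0 <= th -> th < 1 -> (forall n, continuous (f n)) ->
  (forall n x, `|f n x| <= C * th ^+ n) ->
  exists F : T -> R, continuous F /\
    forall x k, `|F x - \sum_(0 <= n < k) f n x| <= C / (1 - th) * th ^+ k.
Proof.
move=> th0 th1 cf fC.
have cvg_th (a : R) : (fun k => a * th ^+ k) @ \oo --> (0 : R).
  rewrite -[X in _ --> X](mulr0 a); apply: cvgM; first exact: cvg_cst.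
  by apply: cvg_expr; rewrite ger0_norm.
pose S x k := \sum_(0 <= n < k) f n x.
have T1 x k l : `|S x (k + l)%N - S x k| <= C / (1 - th) * th ^+ k.
  rewrite /S (@big_cat_nat _ _ _ k) ?leq_addr//= addrAC subrr add0r.
  exact: geometric_tail.
have cS x : cvgn (S x).
  apply/cauchy_cvgP; apply/cauchyP => e e0.
  have /cvgrPdist_lt/(_ e e0)[k _ Hk] := cvg_th (C / (1 - th)).
  exists (S x k); exists k => // m /= km; rewrite -ball_normE /= distrC -(subnKC km).
  apply: (le_lt_trans (T1 x k (m - k)%N)).
  have := Hk k (leqnn k); rewrite /= sub0r normrN; apply: le_lt_trans; exact: ler_norm.
exists (fun x => limn (S x)).
have B x k : `|limn (S x) - S x k| <= C / (1 - th) * th ^+ k.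
  apply/ler_addgt0Pr => e e0.
  have /cvgrPdist_le/(_ e e0)[m _ Hm] := cS x.
  have := Hm (k + m)%N (leq_addl _ _); have := T1 x k m => h1 h2.
  by have := ler_distD (S x (k + m)%N) (limn (S x)) (S x k); move: h1 h2 => /=; lra.
split=> //; apply: contP => x; apply: cont_eps => e e0.
have e3 : 0 < e / 3 by rewrite divr_gt0.
have /cvgrPdist_le/(_ _ e3)[k _ Hk] := cvg_th (C / (1 - th)).
have b0 : C / (1 - th) * th ^+ k <= e / 3.
  by have := Hk k (leqnn k); rewrite /= sub0r normrN; apply: le_trans; exact: ler_norm.
have cSk : {for x, continuous (fun y => S y k)}.
  by apply: sum_continuous => i; exact: cf.
apply: nearS (cont_near cSk e3) => y hy.
have h1 := le_trans (B x k) b0; have h2 := le_trans (B y k) b0.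
move: hy h1 h2; rewrite !ler_norml; set a := limn _; set b := limn _.
move=> /andP[? ?] /andP[? ?] /andP[? ?]; apply/andP; split; lra.
Qed.

End GeometricSeries.

(* [cls rho delta] models the right-hand side of the theorem on real test functions supported in
   the box of half-size [rho]; it is stable under the operations used in the proof. *)
Section AsymptoticClass.
Context {R : realType} {N M : nat}.
Local Notation Z := 'rV[R]_(N + M).
Implicit Types (S V : (Z -> R) -> R) (r : Z -> R) (rho delta : R).

Definition lmap (s : seq 'I_N) : seq 'I_(N + M) := map (lshift M) s.

Inductive cls rho delta : ((Z -> R) -> R) -> Prop :=
| cls_gen (s : seq 'I_N) (v : Z -> R) (C : R) : continuous v -> 0 < delta + (size s)%:R ->
    (forall z : Z, `|v z| <= C * powR (n1 (lsubmx z)) (delta + (size s)%:R)) ->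
    cls rho delta (fun r => intRn (fun z => v z * iter_pd (lmap s) r z))
| cls_pol (s : seq 'I_N) (c : 'rV[R]_M -> R) : continuous c -> (size s)%:R < delta ->
    cls rho delta (fun r => intRn (fun z => c (rsubmx z) * qmon s (lsubmx z) * r z))
| cls_zero : cls rho delta (fun=> 0)
| cls_add S V : cls rho delta S -> cls rho delta V -> cls rho delta (fun r => S r + V r)
| cls_scale a S : cls rho delta S -> cls rho delta (fun r => a * S r)
| cls_ext S V : cls rho delta S -> (forall r, btest rho r -> S r = V r) -> cls rho delta V.

Lemma cls_sum rho delta (I : Type) (l : seq I) (P : pred I) (S : I -> (Z -> R) -> R) :
  (forall i, P i -> cls rho delta (S i)) -> cls rho delta (fun r => \sum_(i <- l | P i) S i r).
Proof.
move=> cS; elim: l => [|i l IH].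
  by apply: cls_ext (cls_zero _ _) _ => r _; rewrite big_nil.
have [Pi|nP] := boolP (P i).
  by apply: cls_ext (cls_add (cS i Pi) IH) _ => r _; rewrite big_cons Pi.
by apply: cls_ext IH _ => r _; rewrite big_cons (negbTE nP).
Qed.

Lemma cont_pol (s : seq 'I_N) (c : 'rV[R]_M -> R) : continuous c ->
  continuous (fun z : Z => c (rsubmx z) * qmon s (lsubmx z)).
Proof.
move=> cc; apply: contP => z; apply: contM.
  by apply: (@cont_comp _ _ _ rsubmx c); [exact: rsubmx_continuous | exact: cc].
apply: (@cont_comp _ _ _ lsubmx (qmon s)); first exact: lsubmx_continuous.
exact/smooth_continuous/smooth_qmon.
Qed.

Lemma intRn_pol_pd rho s (c : 'rV[R]_M -> R) j r : continuous c -> btest rho r ->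
  intRn (fun z : Z => c (rsubmx z) * qmon s (lsubmx z) * pd (lshift M j) r z) =
  \sum_(t <- qder j s) -1 * intRn (fun z => c (rsubmx z) * qmon t (lsubmx z) * r z).
Proof.
move=> cc br; have [sr _] := br; have brp := btest_pd (lshift M j) br.
have D t r' : btest rho r' -> dec (fun z : Z => c (rsubmx z) * qmon t (lsubmx z) * r' z).
  by move=> br'; apply: dec_mul_btest br'; exact: cont_pol.
have Ds : dec (fun z : Z => \sum_(t <- qder j s) c (rsubmx z) * qmon t (lsubmx z) * r z).
  by apply: dec_sum => t; exact: D.
have hp : has_pd (lshift M j) (fun z : Z => c (rsubmx z) * qmon s (lsubmx z) * r z)
    (fun z => c (rsubmx z) * qmon s (lsubmx z) * pd (lshift M j) r z +
      \sum_(t <- qder j s) c (rsubmx z) * qmon t (lsubmx z) * r z).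
  have h1 := @has_pdM _ _ _ _ _ _ _ (@has_pd_rsubmx0 R N M c j)
    (@has_pd_lsubmx R N M _ j (smooth_qmon s)).
  have := has_pdM h1 (smooth_has_pd (lshift M j) sr).
  rewrite [X in has_pd _ _ X -> _](_ : _ = (fun z => c (rsubmx z) * qmon s (lsubmx z) * pd (lshift M j) r z +
      \sum_(t <- qder j s) c (rsubmx z) * qmon t (lsubmx z) * r z)) //.
  apply/funext => z; rewrite pd_qmon mul0r add0r addrC mulr_sumr mulr_suml.
  by [].
have := intRn_partial0 (D s r br) (decD (D s _ brp) Ds) hp.
rewrite (intRnD (dec_intble (D s _ brp)) (dec_intble Ds)) => /eqP.
rewrite addr_eq0 => /eqP ->; rewrite (intRn_sum _ (fun t => D t r br)) -sumrN.
by apply: eq_bigr => t _; rewrite mulN1r.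
Qed.

(** For a generator the new letter joins the word and delta + 1 + |s| is unchanged as a total
    exponent. A polynomial term is integrated by parts and loses a degree, which matches the loss of
    one in [delta]. *)
Lemma cls_pd rho delta j S : cls rho (delta + 1) S -> cls rho delta (fun r => S (pd (lshift M j) r)).
Proof.
elim=> [s v C cv s0 vC|s c cc sd||S1 S2 _ I1 _ I2|a S1 _ I1|S1 S2 _ I1 E].
- have E : delta + 1 + (size s)%:R = delta + (size (rcons s j))%:R.
    by rewrite size_rcons -natr1 -addrA [1 + _]addrC.
  rewrite E in s0 vC; apply: cls_ext (cls_gen rho cv s0 vC) _ => r _.
  by congr intRn; apply/funext => z; rewrite /lmap map_rcons -cats1 iter_pd_cat.
- have H t : t \in qder j s -> cls rho delta
      (fun r => -1 * intRn (fun z => c (rsubmx z) * qmon t (lsubmx z) * r z)).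
    move=> ts; apply: cls_scale; apply: cls_pol => //.
    by move: sd; rewrite -(size_qder ts) -natr1 ltrD2r.
  have := @cls_sum rho delta _ (qder j s) (fun t => t \in qder j s) _ H.
  move=> {}H; apply: cls_ext H _ => r br; rewrite (intRn_pol_pd _ _ cc br).
  by rewrite -big_seq.
- exact: cls_zero.
- exact: cls_add.
- exact: cls_scale.
- by apply: cls_ext I1 _ => r br; apply: E; exact: btest_pd.
Qed.

Lemma cls_iter_pd rho s delta S : cls rho (delta + (size s)%:R) S ->
  cls rho delta (fun r => S (iter_pd (lmap s) r)).
Proof.
elim: s delta S => [|j s IH] delta S /=; first by rewrite addr0.
rewrite -natr1 [_ + 1]addrC addrA [delta + 1]addrC => H.
have {H} : cls rho (delta + (size s)%:R + 1) S by rewrite addrAC [delta + 1]addrC.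
by move=> /(cls_pd j)/IH.
Qed.

(** The class itself is not closed under pointwise limits, so convergence of a series to a member of
    it is a notion of its own. *)
Definition climit rho delta (S : nat -> (Z -> R) -> R) : Prop :=
  exists V, cls rho delta V /\ forall r, btest rho r ->
    (fun k => \sum_(0 <= n < k) S n r) @ \oo --> V r.

Lemma climit_add rho delta (S V : nat -> (Z -> R) -> R) : climit rho delta S -> climit rho delta V ->
  climit rho delta (fun n r => S n r + V n r).
Proof.
move=> [A [cA HA]] [B [cB HB]]; exists (fun r => A r + B r); split; first exact: cls_add.
move=> r br; under eq_fun do rewrite big_split/=.
exact: cvgD (HA r br) (HB r br).
Qed.

Lemma climit_scale rho delta (a : R) (S : nat -> (Z -> R) -> R) : climit rho delta S ->
  climit rho delta (fun n r => a * S n r).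
Proof.
move=> [A [cA HA]]; exists (fun r => a * A r); split; first exact: cls_scale.
move=> r br; under eq_fun do rewrite -mulr_sumr.
by apply: cvgM; [exact: cvg_cst | exact: HA].
Qed.

Lemma climit_ext rho delta (S V : nat -> (Z -> R) -> R) : climit rho delta S ->
  (forall n r, btest rho r -> S n r = V n r) -> climit rho delta V.
Proof.
move=> [A [cA HA]] E; exists A; split=> // r br.
have -> : (fun k => \sum_(0 <= n < k) V n r) = (fun k => \sum_(0 <= n < k) S n r).
  by apply/funext => k; apply: eq_bigr => n _; rewrite E.
exact: HA.
Qed.

Lemma climit_zero rho delta : climit rho delta (fun _ _ => 0).
Proof.
exists (fun=> 0); split; first exact: cls_zero.
move=> r _; under eq_fun do rewrite big1//; exact: cvg_cst.
Qed.

Lemma climit_sum rho delta (I : Type) (l : seq I) (S : I -> nat -> (Z -> R) -> R) :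
  (forall i, climit rho delta (S i)) -> climit rho delta (fun n r => \sum_(i <- l) S i n r).
Proof.
move=> cS; elim: l => [|i l IH].
  by apply: climit_ext (climit_zero _ _) _ => n r _; rewrite big_nil.
by apply: climit_ext (climit_add (cS i) IH) _ => n r _; rewrite big_cons.
Qed.

Lemma climit_iter_pd rho delta s (S : nat -> (Z -> R) -> R) : climit rho (delta + (size s)%:R) S ->
  climit rho delta (fun n r => S n (iter_pd (lmap s) r)).
Proof.
move=> [A [cA HA]]; exists (fun r => A (iter_pd (lmap s) r)); split; first exact: cls_iter_pd.
by move=> r br; apply: HA; exact: btest_iter_pd.
Qed.

Lemma climit_geometric rho (v : nat -> Z -> R) (V : Z -> R) (C th : R) : 0 <= th -> th < 1 ->
  continuous V -> (forall n, continuous (v n)) ->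
  (forall z k, `|V z - \sum_(0 <= n < k) v n z| <= C * th ^+ k) ->
  forall r, btest rho r ->
    (fun k => \sum_(0 <= n < k) intRn (fun z => v n z * r z)) @ \oo --> intRn (fun z => V z * r z).
Proof.
move=> th0 th1 cV cv VC r br; have rr := btest_rapid br; have [sr _] := br.
have cr := smooth_continuous sr.
have Dn n : dec (fun z => v n z * r z) by exact: dec_mul_btest br.
have DV : dec (fun z => V z * r z) by exact: dec_mul_btest br.
have cnr : continuous (fun z : Z => `|r z|).
  by apply: contP => z; apply: cont_norm; exact: cr.
have Dr : dec (fun z : Z => `|r z|).
  by apply: (dec_dom cnr (rapid_dec rr)) => z; rewrite normr_id.
have E k : `|intRn (fun z => V z * r z) - \sum_(0 <= n < k) intRn (fun z => v n z * r z)| <=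
    intRn (fun z : Z => `|r z|) * C * th ^+ k.
  have Ds : dec (fun z => \sum_(0 <= n < k) v n z * r z) by exact: dec_sum.
  rewrite -(intRn_sum _ Dn) -(intRnN (dec_intble Ds)).
  rewrite -(intRnD (dec_intble DV) (intbleN (dec_intble Ds))).
  rewrite -mulrA mulrC -(intRnZ _ (dec_intble Dr)).
  apply: intRn_abs_le; [exact: (intbleD (dec_intble DV) (intbleN (dec_intble Ds)))
    | exact: (intbleZ _ (dec_intble Dr)) |].
  by move=> z; rewrite -mulr_suml -mulrBl normrM ler_wpM2r.
apply/cvgrPdist_le => e e0.
have : (fun k => intRn (fun z : Z => `|r z|) * C * th ^+ k) @ \oo --> (0 : R).
  rewrite -[X in _ --> X](mulr0 (intRn (fun z : Z => `|r z|) * C)).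
  by apply: cvgM; [exact: cvg_cst | apply: cvg_expr; rewrite ger0_norm].
move=> /cvgrPdist_le/(_ e e0); apply: filterS => k /=; rewrite sub0r normrN => h.
exact: le_trans (le_trans (E k) (ler_norm _)) h.
Qed.

(** The two bounds on [f] have different tasks: the geometric one makes the sum continuous, the one
    on partial sums gives its order |q|^beta. The polynomial coefficients are summed separately, by
    geometric decay alone. *)
Lemma climit_expansion rho beta (th C : R) (W : seq (seq 'I_N))
    (c : nat -> seq 'I_N -> 'rV[R]_M -> R) (f : nat -> Z -> R) :
  0 <= th -> th < 1 -> 0 < beta -> (forall s, s \in W -> (size s)%:R < beta) ->
  (forall n s, continuous (c n s)) -> (forall s, exists D, forall n x, `|c n s x| <= D * th ^+ n) ->
  (forall n, continuous (f n)) -> (forall n z, `|f n z| <= C * th ^+ n) ->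
  (forall z k, \sum_(0 <= n < k) `|f n z| <= C * powR (n1 (lsubmx z)) beta) ->
  climit rho beta (fun n r =>
    intRn (fun z => (\sum_(s <- W) c n s (rsubmx z) * qmon s (lsubmx z) + f n z) * r z)).
Proof.
move=> th0 th1 b0 Wb cc cC cf fC fS.
(* The indicator changes nothing in the sum, but [climit_sum] asks for every word while the degree
   bound holds on [W] only. *)
have lW : climit rho beta (fun n r => \sum_(s <- W) (s \in W)%:R *
    intRn (fun z => c n s (rsubmx z) * qmon s (lsubmx z) * r z)).
  apply: climit_sum => s; have [sW|sW] := boolP (s \in W); last first.
    by apply: climit_ext (climit_zero _ _) _ => n r _; rewrite mul0r.
  have [D HD] := cC s; have [c' [cc' Hs]] := geometric_series th0 th1 (fun n => cc n s) HD.
  apply: climit_scale; exists (fun r => intRn (fun z => c' (rsubmx z) * qmon s (lsubmx z) * r z)).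
  split; first by apply: cls_pol => //; exact: Wb.
  move=> r br; have [sr _] := br; pose r' z : R := qmon s (lsubmx z) * r z.
  have br' : btest rho r'.
    split=> [|z i zi]; last by rewrite /r' ((proj2 br) z i zi) mulr0.
    apply: smoothM; [apply: smooth_lsubmx; exact: smooth_qmon | exact: sr].
  have Er (d : 'rV[R]_M -> R) : (fun z : Z => d (rsubmx z) * qmon s (lsubmx z) * r z) =
      (fun z => d (rsubmx z) * r' z) by apply/funext => z; rewrite /r' mulrA.
  have -> : (fun k => \sum_(0 <= n < k) intRn (fun z => c n s (rsubmx z) * qmon s (lsubmx z) * r z)) =
      (fun k => \sum_(0 <= n < k) intRn (fun z => c n s (rsubmx z) * r' z)).
    by apply/funext => k; apply: eq_bigr => n _; rewrite Er.
  have cd (d : 'rV[R]_M -> R) : continuous d -> continuous (fun z : Z => d (rsubmx z)).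
    move=> cd; apply: contP => z; apply: (@cont_comp _ _ _ rsubmx d); last exact: cd.
    exact: rsubmx_continuous.
  rewrite Er; apply: (climit_geometric th0 th1 (cd _ cc') (fun n => cd _ (cc n s)) _ br').
  by move=> z k; exact: Hs.
have [F [cF HF]] := geometric_series th0 th1 cf fC.
(* The bound on partial sums passes to the limit; the empty word is written out to fit [cls_gen]. *)
have FB z : `|F z| <= C * powR (n1 (lsubmx z)) (beta + (size ([::] : seq 'I_N))%:R).
  rewrite addr0; apply/ler_addgt0Pr => e e0.
  have : (fun k => C / (1 - th) * th ^+ k) @ \oo --> (0 : R).
    rewrite -[X in _ --> X](mulr0 (C / (1 - th))).
    by apply: cvgM; [exact: cvg_cst | apply: cvg_expr; rewrite ger0_norm].
  move=> /cvgrPdist_le/(_ e e0)[k _ /(_ k (leqnn k))] /=; rewrite sub0r normrN => hk.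
  have h1 := le_trans (HF z k) (le_trans (ler_norm _) hk).
  have h2 := le_trans (ler_norm_sum _ _ _) (fS z k).
  have := ler_normD (F z - \sum_(0 <= n < k) f n z) (\sum_(0 <= n < k) f n z).
  by rewrite subrK; move: h1 h2; rewrite -/(\sum_(0 <= n < k) f n z); lra.
have lf : climit rho beta (fun n r => intRn (fun z => f n z * r z)).
  exists (fun r => intRn (fun z => F z * r z)); split.
    apply: cls_ext (@cls_gen rho beta [::] F C cF _ FB) _ => //.
    by rewrite addr0.
  by move=> r br; exact: climit_geometric HF r br.
apply: climit_ext (climit_add lW lf) _ => n r br.
have Ds s : dec (fun z : Z => c n s (rsubmx z) * qmon s (lsubmx z) * r z).
  by apply: dec_mul_btest br; exact: cont_pol.
have Df : dec (fun z => f n z * r z) by exact: dec_mul_btest br.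
have -> : \sum_(s <- W) (s \in W)%:R * intRn (fun z => c n s (rsubmx z) * qmon s (lsubmx z) * r z) =
    \sum_(s <- W) intRn (fun z => c n s (rsubmx z) * qmon s (lsubmx z) * r z).
  by rewrite big_seq [RHS]big_seq; apply: eq_bigr => s ->; rewrite mul1r.
rewrite -(intRn_sum _ Ds) -(intRnD (dec_intble (dec_sum _ Ds)) (dec_intble Df)).
by congr intRn; apply/funext => z; rewrite mulrDl mulr_suml.
Qed.

End AsymptoticClass.

Section ShortWords.
Context {R : realType} {n : nat}.

Definition wordsLt (m : nat) : seq (seq 'I_n) := flatten [seq words l | l <- index_iota 0 m].

Lemma sum_wordsLt m (F : seq 'I_n -> R) :
  \sum_(s <- wordsLt m) F s = \sum_(l < m) \sum_(s <- words l) F s.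
Proof. by rewrite big_flatten/= big_map big_mkord. Qed.

Lemma size_wordsLt m s : s \in wordsLt m -> (size s < m)%N.
Proof.
move=> /flattenP[w /mapP[l]]; rewrite mem_index_iota => /andP[_ lm] ->.
by move=> /size_words ->.
Qed.

Lemma dotp_pow l (q y : 'rV[R]_n) : dotp q y ^+ l = \sum_(s <- words l) qmon s q * qmon s y.
Proof.
elim: l => [|l IH]; first by rewrite big_seq1 /qmon !big_nil mul1r.
rewrite sum_words exprS IH mulr_sumr; apply: eq_bigr => s _.
by rewrite /dotp mulr_suml; apply: eq_bigr => j _; rewrite !qmon_cons; ring.
Qed.

End ShortWords.

Section Exponents.
Context {R : realType}.

Lemma ceil_exists (b : R) : 0 < b -> exists m : nat,
  [/\ (0 < m)%N, b <= m%:R & forall l : nat, (l < m)%N -> l%:R < b].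
Proof.
move=> b0; have ex : exists m : nat, b <= m%:R.
  by exists (Num.truncn b).+1; rewrite ltW// truncnS_gt.
exists (ex_minn ex); case: ex_minnP => m bm Hm; split=> //.
  by rewrite lt0n; apply: contraTneq bm => ->; rewrite -ltNge.
by move=> l lm; rewrite ltNge; apply/negP => /Hm; rewrite leqNgt lm.
Qed.

(** On a bounded range an integer order [m] is at least as good as the real order [b], at the cost
    of a constant. *)
Lemma pow_le_powR (x K b : R) (m : nat) : 0 <= x -> x <= K -> (0 < m)%N -> b <= m%:R ->
  x ^+ m <= powR K (m%:R - b) * powR x b.
Proof.
move=> x0 xK m0 bm; have K0 := le_trans x0 xK.
have [->|xn0] := eqVneq x 0; first by rewrite expr0n gtn_eqF//= mulr_ge0 ?powR_ge0.
rewrite -powR_mulrn// (_ : powR x m%:R = powR x (m%:R - b) * powR x b).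
  by rewrite ler_wpM2r ?powR_ge0// ge0_ler_powR ?nnegrE// subr_ge0.
rewrite -powRD ?subrK//; apply/implyP => _; exact: xn0.
Qed.

End Exponents.

Section Families.
Context {R : realType}.

Lemma nW_lrsubmx N M (z : 'rV[R]_(N + M)) : nW z = nW (lsubmx z) * nW (rsubmx z).
Proof.
by rewrite /nW big_split_ord; congr (_ * _); apply: eq_bigr => i _; rewrite mxE.
Qed.

(** The two words depend on [s] alone and not on the functions, so bounds remain uniform over
    families. *)
Lemma iter_pd_tensor N M (s : seq 'I_(N + M)) : exists sl sr,
  forall (g : 'rV[R]_N -> R) (f : 'rV[R]_M -> R), smooth g -> smooth f ->
    iter_pd s (fun z : 'rV[R]_(N + M) => g (lsubmx z) * f (rsubmx z)) =
    fun z => iter_pd sl g (lsubmx z) * iter_pd sr f (rsubmx z).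
Proof.
elim: s => [|i s [sl [sr IH]]]; first by exists [::], [::].
case: (split_ordP i) => j ->.
  exists (j :: sl), sr => g f sg sf; rewrite iter_pd_cons (IH g f sg sf); apply: has_pdE.
  have := has_pdM (@has_pd_lsubmx R N M _ j (smooth_iter_pd sl sg))
    (@has_pd_rsubmx0 R N M (iter_pd sr f) j).
  by under [X in has_pd _ _ X -> _]eq_fun do rewrite mulr0 addr0.
exists sl, (j :: sr) => g f sg sf; rewrite iter_pd_cons (IH g f sg sf); apply: has_pdE.
have := has_pdM (@has_pd_lsubmx0 R N M (iter_pd sl g) j)
  (@has_pd_rsubmx R N M _ j (smooth_iter_pd sr sf)).
by under [X in has_pd _ _ X -> _]eq_fun do rewrite mul0r add0r.
Qed.

Lemma urapid_tensor N M (I : Type) (g : I -> 'rV[R]_N -> R) (f : 'rV[R]_M -> R) :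
  urapid g -> rapid f ->
  urapid (fun i (z : 'rV[R]_(N + M)) => g i (lsubmx z) * f (rsubmx z)).
Proof.
move=> [sg gC] [sf fC]; split=> [i|s L].
  by apply: smoothM; [apply: smooth_lsubmx; exact: sg | apply: smooth_rsubmx; exact: (sf tt)].
have [sl [sr E]] := iter_pd_tensor s.
have [C HC] := gC sl L; have [D HD] := fC sr L; exists (C * D) => i z.
rewrite (E _ _ (sg i) (sf tt)) normrM nW_lrsubmx exprMn mulrACA.
by apply: ler_pM; rewrite ?HC ?(HD tt)// mulr_ge0// exprn_ge0// ltW// nW_gt0.
Qed.

(** Contracting the argument multiplies each derivative by a factor of modulus at most 1. *)
Lemma utemp_dilate n (I : Type) (lam : I -> R) (h : 'rV[R]_n -> R) :
  (forall i, `|lam i| <= 1) -> smooth h -> (forall s, exists C, forall x, `|iter_pd s h x| <= C) ->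
  utemp (fun i x => h (lam i *: x)).
Proof.
move=> l1 sh hC.
have E i : (fun x => h (lam i *: x)) = (fun x => h (lam i *: x + 0)).
  by apply/funext => x; rewrite addr0.
split=> [i|s]; first by rewrite E; exact: smooth_affine.
have [C HC] := hC s; exists 0%N, C => i x; rewrite E iter_pd_affine// expr0 mulr1 normrM.
apply: le_trans (HC (lam i *: x + 0)); rewrite ler_piMl// normrX exprn_ile1//.
Qed.

Lemma nW_dilate n (a : R) (y : 'rV[R]_n) : 1 <= a -> nW y <= (a ^+ 2) ^+ n * nW (a^-1 *: y).
Proof.
move=> a1; have a0 : a != 0 by rewrite gt_eqF// (lt_le_trans ltr01).
have -> : (a ^+ 2) ^+ n * nW (a^-1 *: y) = \prod_(i < n) (a ^+ 2 * (1 + (a^-1 *: y) ord0 i ^+ 2)).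
  by rewrite big_split/= prodr_const card_ord.
apply: ler_prod => i _; rewrite ltW ?onesq_gt0//= mxE mulrDr mulr1 -exprMn mulVKf//.
by rewrite lerD2r exprn_ege1.
Qed.

End Families.

(** * Kernels far from the origin *)

Section FarKernel.
Context {R : realType} {n : nat}.
Variables (kap : 'rV[R]_n -> R) (R0 : R).
Hypotheses (rk : rapid kap) (R00 : 0 < R0).

Definition dyad (k : nat) : R := 2 ^- k.

Lemma dyad_gt0 k : 0 < dyad k. Proof. by rewrite invr_gt0 exprn_gt0. Qed.

Lemma dyad_le1 k : dyad k <= 1.
Proof. by rewrite invf_le1 ?exprn_gt0// exprn_ege1// ler1n. Qed.

Lemma norm_dyad k : `|dyad k| = dyad k. Proof. by rewrite ger0_norm// ltW// dyad_gt0. Qed.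

(* [dyad k * p] stays in a fixed box on the support of [near_ker k], while [far_ker k] is smaller than
   every power of [dyad k]. *)
Definition near_ker (k : nat) (p : 'rV[R]_n) : R := chi R0 (dyad k *: p) * kap p.
Definition far_ker (k : nat) (p : 'rV[R]_n) : R := (1 - chi R0 (dyad k *: p)) * kap p.

Lemma chi_bound s : exists C : R, forall x : 'rV[R]_n, `|iter_pd s (fun x => 1 - chi R0 x) x| <= C.
Proof.
have sc := @smooth_chi R n R0 R00.
have rc : rapid (@chi R n R0).
  apply: supp_rapid => //; exists (2 * R0); split; first by rewrite mulr_gt0.
  by move=> x i h; apply: chi_eq0; exact: ltW h.
have [_ /(_ s 0%N)[C HC]] := rc; exists (1 + C) => x.
have -> : (fun x : 'rV[R]_n => 1 - chi R0 x) = (fun x => 1 + -1 * chi R0 x).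
  by apply/funext => y; rewrite mulN1r.
rewrite (iter_pdD s (smooth_cst 1) (smoothZ (-1) sc)) (iter_pdZ s (-1) sc).
rewrite (le_trans (ler_normD _ _))// lerD//; last first.
  by rewrite normrM normrN1 mul1r; have := HC tt x; rewrite expr0 mulr1.
case/lastP: s {HC} => [|s j]; first by rewrite /= normr1.
by rewrite -cats1 iter_pd_cat /= pd_cst iter_pd0 normr0.
Qed.

Lemma smooth_dilate_chi k : smooth (fun p : 'rV[R]_n => 1 - chi R0 (dyad k *: p)).
Proof.
have sc := @smooth_chi R n R0 R00.
have -> : (fun p : 'rV[R]_n => 1 - chi R0 (dyad k *: p)) = (fun p => 1 - chi R0 (dyad k *: p + 0)).
  by apply/funext => p; rewrite addr0.
exact: (smoothB (smooth_cst 1) (smooth_affine _ _ sc)).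
Qed.

Lemma urapid_far0 : urapid far_ker.
Proof.
have D : utemp (fun k (p : 'rV[R]_n) => 1 - chi R0 (dyad k *: p)).
  apply: (@utemp_dilate R n nat dyad (fun x => 1 - chi R0 x)).
  - by move=> k; rewrite norm_dyad dyad_le1.
  - by have := smooth_dilate_chi 0; rewrite /dyad expr0 invr1; under eq_fun do rewrite scale1r.
  - exact: chi_bound.
have := urapidM (urapid_reindex (fun _ : nat => tt) rk) D.
by have -> // : (fun (k : nat) x => kap x * (1 - chi R0 (dyad k *: x))) = far_ker;
  apply/funext => k; apply/funext => x; rewrite /far_ker mulrC.
Qed.

Lemma far_ker_vanish k s (p : 'rV[R]_n) : (forall i, `|p ord0 i| < 2 ^+ k * R0) -> iter_pd s (far_ker k) p = 0.
Proof.
move=> pk; have z0 : iter_pd s (fun _ : 'rV[R]_n => 0 : R) p = 0 by rewrite iter_pd0.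
rewrite -[RHS]z0; apply: (@iter_pd_local R n (~` [set x : 'rV[R]_n | exists i, 2 ^+ k * R0 <= `|x ord0 i|])).
- apply: closed_openC; have -> : [set x : 'rV[R]_n | exists i, 2 ^+ k * R0 <= `|x ord0 i|] =
    \bigcup_(i in [set: 'I_n]) [set x : 'rV[R]_n | 2 ^+ k * R0 <= `|x ord0 i|].
    by apply/seteqP; split=> [x [i h]|x [i _ h]]; exists i.
  apply: closed_bigcup; first exact: finite_finset.
  move=> i _; apply: (@closed_comp _ _ (fun x : 'rV[R]_n => `|x ord0 i|) [set t | 2 ^+ k * R0 <= t]).
    by move=> x _; apply: cont_norm; exact: coordc.
  exact: closed_ge.
- move=> x /= nx; rewrite /far_ker chi_eq1 ?subrr ?mul0r// => i.
  rewrite leNgt mxE normrM norm_dyad; apply/negP => h; apply: nx; exists i.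
  by rewrite -ler_pdivlMl ?exprn_gt0// ltW.
- by case=> i; rewrite leNgt pk.
Qed.

(** Where [far_ker k] does not vanish some coordinate of [p] has size at least 2^k [R0], so [A]
    powers of 2^k are paid for by [A] more powers of the weight. *)
Lemma urapid_far A : urapid (fun k p => (2 ^+ k) ^+ A * far_ker k p).
Proof.
have [sF FC] := urapid_far0; split=> [k|s L]; first exact: (smoothZ _ (sF k)).
have [C HC] := FC s (L + A)%N; exists (R0^-1 ^+ A * C) => k p.
rewrite (iter_pdZ s _ (sF k)).
have [out|] := pselect (forall i, `|p ord0 i| < 2 ^+ k * R0).
  rewrite (far_ker_vanish s out) mulr0 normr0 mul0r mulr_ge0 ?exprn_ge0 ?invr_ge0 ?(ltW R00)//.
  by apply: le_trans (HC k p); rewrite mulr_ge0 ?exprn_ge0 ?(ltW (nW_gt0 _)).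
move=> /existsNP[i /negP]; rewrite -leNgt => pi.
have h : 2 ^+ k <= R0^-1 * nW p.
  by rewrite ler_pdivlMl// mulrC (le_trans pi)// coord_le_nW.
rewrite normrM (ger0_norm (exprn_ge0 _ (exprn_ge0 _ _)))//.
apply: (@le_trans _ _ ((R0^-1 * nW p) ^+ A * `|iter_pd s (far_ker k) p| * nW p ^+ L)).
  rewrite ler_wpM2r ?exprn_ge0 ?(ltW (nW_gt0 _))// ler_wpM2r//.
  by rewrite lerXn2r ?nnegrE ?exprn_ge0// mulr_ge0 ?invr_ge0 ?(ltW R00) ?(ltW (nW_gt0 _)).
rewrite exprMn -!mulrA ler_wpM2l ?exprn_ge0 ?invr_ge0 ?(ltW R00)//.
by rewrite mulrCA [nW p ^+ A * _]mulrC -exprD; exact: HC.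
Qed.

(** Dilation spreads the transform over a region of size 2^k and would destroy uniform decay; the
    smallness of [far_ker] beyond all powers of 2^k restores it. *)
Lemma urapid_far_dilate c : urapid (fun k y => oscint c (far_ker k) (dyad k *: y)).
Proof.
have rf k : rapid (far_ker k) by exact: urapid_rapid k urapid_far0.
have E k : (fun y => oscint c (far_ker k) (dyad k *: y)) =
    (fun y => oscint c (far_ker k) (dyad k *: y + 0)).
  by apply/funext => y; rewrite addr0.
split=> [k|s L]; first by rewrite E; exact/smooth_affine/smooth_oscint.
(* By [nW_dilate] each power of [nW y] costs 4^(k n), hence the exponent 2 n L of 2^k. *)
have [_ /(_ s L)[C HC]] := urapid_oscint c (urapid_far (2 * n * L)).
exists C => k y; rewrite E (iter_pd_affine s _ _ (smooth_oscint c (rf k))) addr0.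
have p2 : 1 <= 2 ^+ k :> R by rewrite exprn_ege1// ler1n.
have W : nW y ^+ L <= (2 ^+ k) ^+ (2 * n * L) * nW (dyad k *: y) ^+ L.
  rewrite !exprM -exprMn lerXn2r ?nnegrE ?(ltW (nW_gt0 _))//; last exact: nW_dilate.
  by rewrite mulr_ge0 ?exprn_ge0 ?(ltW (nW_gt0 _)).
have := HC k (dyad k *: y); rewrite (oscintZ c _ (rf k)) (iter_pdZ s _ (smooth_oscint c (rf k))).
rewrite normrM (ger0_norm (exprn_ge0 _ (exprn_ge0 _ _)))// => /(le_trans _); apply.
rewrite normrM normrX norm_dyad.
set D := `|iter_pd _ _ _|; apply: (@le_trans _ _ (D * nW y ^+ L)).
  rewrite ler_wpM2r ?exprn_ge0 ?(ltW (nW_gt0 _))// ler_piMl ?normr_ge0//.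
  by rewrite exprn_ile1 ?dyad_le1 ?(ltW (dyad_gt0 _)).
by rewrite [_ * D]mulrC -[leRHS]mulrA ler_wpM2l ?normr_ge0.
Qed.

End FarKernel.

Section BoxBounds.
Context {R : realType}.

Lemma geometric_sum_le (th : R) k : 0 <= th -> th < 1 -> \sum_(0 <= n < k) th ^+ n <= (1 - th)^-1.
Proof.
move=> th0 th1; have := @geometric_tail R R (fun n _ => th ^+ n) 1 th th0 th1 _ 0 0 k.
rewrite expr0 mulr1 mul1r => H; apply: le_trans (ler_norm _) (H _) => n _.
by rewrite mul1r ger0_norm// exprn_ge0.
Qed.

Lemma chi_bounded n (rho : R) : 0 < rho -> exists C, 0 <= C /\ forall x : 'rV[R]_n, `|chi rho x| <= C.
Proof.
move=> r0; have [C HC] := @chi_bound R n rho r0 [::]; exists (1 + C).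
have h (x : 'rV[R]_n) : `|chi rho x| <= 1 + C.
  have := HC x; have := ler_normB 1 (1 - chi rho x); rewrite /= subKr normr1; lra.
by split=> //; exact: le_trans (h 0).
Qed.

Lemma n1_le n (K : R) (x : 'rV[R]_n) : (forall i, `|x ord0 i| <= K) -> n1 x <= n%:R * K.
Proof.
move=> xK; apply: (@le_trans _ _ (\sum_(i < n) K)); first exact: ler_sum.
by rewrite sumr_const card_ord mulr_natl.
Qed.

Lemma n1_lsubmx N M (z : 'rV[R]_(N + M)) : n1 (row_mx (lsubmx z) (0 : 'rV[R]_M)) = n1 (lsubmx z).
Proof.
rewrite /n1 big_split_ord/= [X in _ + X]big1 ?addr0 => [|i _]; last by rewrite row_mxEr mxE normr0.
by apply: eq_bigr => i _; rewrite row_mxEl.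
Qed.

Lemma chi_neq0 n (rho : R) (x : 'rV[R]_n) i : chi rho x != 0 -> `|x ord0 i| <= 2 * rho.
Proof. by apply: contra_neqT; rewrite -ltNge => /ltW; exact: chi_eq0. Qed.

Lemma chi_continuous n (rho : R) : 0 < rho -> continuous (@chi R n rho).
Proof. by move=> r0; exact/smooth_continuous/smooth_chi. Qed.

Lemma dyad_pow k L : (0 < L)%N -> @dyad R k ^+ L <= 2^-1 ^+ k.
Proof.
move=> L0; rewrite exprVn -/(dyad k); case: L L0 => // L _.
by rewrite exprS ler_piMr ?(ltW (dyad_gt0 _))// exprn_ile1 ?dyad_le1 ?(ltW (dyad_gt0 _)).
Qed.

End BoxBounds.

Section Nonlocal.
Context {R : realType} {N M : nat}.
Local Notation Z := 'rV[R]_(N + M).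
Variables (tau : (Z -> R) -> R) (f : 'rV[R]_M -> R) (kap : 'rV[R]_N -> R).
Variables (R0 rho beta c0 c : R) (L : nat).
Hypotheses (ttau : rtempered tau) (rf : rapid f) (rk : rapid kap).
Hypotheses (R00 : 0 < R0) (rho0 : 0 < rho) (beta0 : 0 < beta) (L0 : (0 < L)%N).

Let Psi k (z : Z) : R := oscint c0 (far_ker kap R0 k) (dyad k *: lsubmx z) * f (rsubmx z).

Let uPsi : urapid Psi.
Proof. exact: (urapid_tensor (urapid_far_dilate rk R00 c0) rf). Qed.

Let Psis k s (z : Z) : R := Psi k z * qmon s (lsubmx z).

Let uPsis s : urapid (Psis^~ s).
Proof.
apply: urapidM => //; split=> [k|w]; first exact/smooth_lsubmx/smooth_qmon.
have : utemp (fun (_ : nat) (z : Z) => qmon s (lsubmx z)); last by case.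
elim: s => [|j s IH].
  have -> : (fun (_ : nat) (z : Z) => qmon [::] (lsubmx z)) = (fun _ _ => 1).
    by apply/funext => k; apply/funext => z; rewrite /qmon big_nil.
  by apply: (@utemp_cst _ _ _ (fun=> 1) 1) => i; rewrite normr1.
have -> : (fun (_ : nat) (z : Z) => qmon (j :: s) (lsubmx z)) =
    (fun _ z => z ord0 (lshift M j) * qmon s (lsubmx z)).
  by apply/funext => k; apply/funext => z; rewrite qmon_cons mxE.
by apply: utempM => //; exact: utemp_coord.
Qed.

Let b (z : Z) : Z := row_mx 0 (rsubmx z).
Let v (z : Z) : Z := row_mx (lsubmx z) 0.

Let bv z : b z + v z = z.
Proof. by rewrite /b /v add_row_mx add0r addr0 hsubmxK. Qed.

Let dv z y : dotp (v z) y = dotp (lsubmx z) (lsubmx y).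
Proof.
rewrite /dotp big_split_ord/= [X in _ + X]big1 ?addr0 => [|i _]; last by rewrite row_mxEr mxE mul0r.
by apply: eq_bigr => i _; rewrite row_mxEl [in RHS]mxE [lsubmx y _ _]mxE [lsubmx z _ _]mxE.
Qed.

Lemma rtempered_sum (I : Type) (l : seq I) (F : I -> Z -> R) : (forall i, rapid (F i)) ->
  tau (fun y => \sum_(i <- l) F i y) = \sum_(i <- l) tau (F i).
Proof.
move=> rF; elim: l => [|i l IH].
  by rewrite big_nil -[RHS](rtempered0 ttau); congr tau; apply/funext => y; rewrite big_nil.
rewrite big_cons -IH -(rtemperedD ttau (rF i) (rapid_sum l rF)).
by congr tau; apply/funext => y; rewrite big_cons.
Qed.

(** Taylor coefficients at q = 0 and q' = x of the transform of [Psi k] times [tau]; words let the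
    power of the scalar product q.y split into monomials in q and in y. *)
Let coef k s (x : 'rV[R]_M) : R := ((size s)`!)%:R^-1 *
  tau (fun y => Psis k s y * osc (row_mx 0 x) (c + (size s)%:R * (pi / 2)) y).

Let expansion m k z : tau (fun y => Psi k y * osc z c y) =
  \sum_(s <- wordsLt m) coef k s (rsubmx z) * qmon s (lsubmx z) +
  tau (fun y => Psi k y * oscrem m (b z) (v z) c y).
Proof.
have rP : rapid (Psi k) := urapid_rapid k uPsi.
have rs s : rapid (Psis k s) := urapid_rapid k (uPsis s).
have rt (s : seq 'I_N) : rapid (fun y => (((size s)`!)%:R^-1 * qmon s (lsubmx z)) *
    (Psis k s y * osc (b z) (c + (size s)%:R * (pi / 2)) y)).
  exact: (urapidZ _ (rapid_mul_osc _ _ (rs s))).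
have -> : (fun y => Psi k y * osc z c y) = (fun y =>
    \sum_(s <- wordsLt m) (((size s)`!)%:R^-1 * qmon s (lsubmx z)) *
      (Psis k s y * osc (b z) (c + (size s)%:R * (pi / 2)) y) +
    Psi k y * oscrem m (b z) (v z) c y).
  apply/funext => y; rewrite /oscrem bv mulrBr addrC sum_wordsLt mulr_sumr.
  set A := \sum_(i < m) _; set B := \sum_(i < m) _; suff -> : A = B by rewrite subrK.
  apply: eq_bigr => l _; rewrite dv dotp_pow !mulr_suml mulr_sumr big_seq [RHS]big_seq.
  apply: eq_bigr => s /size_words <-; rewrite /Psis.
  set o := osc _ _ _; set fa := _%:R^-1; set P := Psi k y; set q1 := qmon _ _; set q2 := qmon _ _.
  by ring.
rewrite (rtemperedD ttau (rapid_sum _ rt) (rapid_mul_oscrem m (b z) (v z) c rP)).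
rewrite (rtempered_sum _ rt); congr (_ + _); apply: eq_bigr => s _.
by rewrite (rtemperedZ _ ttau (rapid_mul_osc _ _ (rs s))) /coef mulrAC.
Qed.

Let coef_continuous k s : continuous (coef k s).
Proof.
apply: contP => x; apply: contM; first exact: contC.
have rs := urapid_rapid k (uPsis s).
apply: (@cont_comp _ _ _ (fun x : 'rV[R]_M => row_mx (0 : 'rV[R]_N) x)
  (fun z => tau (fun y => Psis k s y * osc z (c + (size s)%:R * (pi / 2)) y))).
  apply: (@cont_comp _ _ _ (fun x : 'rV[R]_M => ((0 : 'rV[R]_N), x))
    (fun p : 'rV[R]_N * 'rV[R]_M => row_mx p.1 p.2)); last exact: row_mx_continuous.
  by apply: cont_pair; [exact: contC | exact: contid].
exact: tau_osc_continuous.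
Qed.

(** The transform is expanded in q up to the least integer m >= beta, with remainder O(|q|^m), hence
    O(|q|^beta) on a box. Since the functions [Psi k] form one bounded family, the factor 2^(-k L)
    makes everything geometric. *)
Lemma climit_nonlocal : climit rho beta (fun k r =>
  dyad k ^+ L * tau (fun z => oscint c0 (far_ker kap R0 k) (dyad k *: lsubmx z) * f (rsubmx z) *
    oscint c r z)).
Proof.
have [m [m0 bm mb]] := ceil_exists beta0.
(* On the support of the cutoff this bounds both the coordinates of the base point (0, q') and the
   size of the increment (q, 0). *)
pose K : R := (N + M)%:R * (2 * rho) + 2 * rho.
have r2 : 0 <= 2 * rho by rewrite mulr_ge0// ltW.
have K0 : 0 <= K by rewrite addr_ge0// mulr_ge0.
have rK : 2 * rho <= K by rewrite lerDr mulr_ge0.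
have [Cz [Cz0 HCz]] := @chi_bounded R (N + M) rho rho0.
have [Cx [Cx0 HCx]] := @chi_bounded R M rho rho0.
have [C1 [C10 HC1]] := tau_oscrem ttau m K0 uPsi.
(* The cutoffs, equal to 1 wherever a test function lives, turn bounds on a box into the global
   bounds required by [climit_expansion]. *)
pose cc k s (x : 'rV[R]_M) : R := dyad k ^+ L * (chi rho x * coef k s x).
pose g k (z : Z) : R := dyad k ^+ L * (chi rho z * tau (fun y => Psi k y * oscrem m (b z) (v z) c y)).
pose C : R := Cz * C1 * K ^+ m + 2 * (Cz * C1 * powR K (m%:R - beta)).
have h0 : 0 <= 2^-1 :> R by rewrite invr_ge0.
have h1 : 2^-1 < 1 :> R by rewrite invf_lt1// ltr1n.
have CC0 : 0 <= Cz * C1 by exact: mulr_ge0.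
have box z : chi rho z != 0 -> (forall j, `|b z ord0 j| <= K) /\ n1 (v z) <= K.
  move=> cz; have zj j := le_trans (chi_neq0 j cz) rK.
  split=> [j|].
    case: (split_ordP j) => i ->; first by rewrite row_mxEl mxE normr0.
    by rewrite row_mxEr mxE.
  rewrite n1_lsubmx (le_trans (n1_le (K := 2 * rho) _)) => [//|i|].
    by rewrite mxE; exact: chi_neq0.
  by rewrite /K (@le_trans _ _ ((N + M)%:R * (2 * rho))) ?lerDl// ler_wpM2r// ler_nat leq_addr.
have gb k z : `|g k z| <= Cz * C1 * n1 (lsubmx z) ^+ m * 2^-1 ^+ k /\ (chi rho z != 0 -> n1 (lsubmx z) <= K).
  have n0 : 0 <= n1 (lsubmx z) ^+ m by rewrite exprn_ge0// n1_ge0.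
  have [z0|zn0] := eqVneq (chi rho z) 0.
    rewrite /g z0 mul0r mulr0 normr0; split=> //.
    by rewrite !mulr_ge0// exprn_ge0.
  have [bz vz] := box z zn0; split=> [|_]; last by move: vz; rewrite n1_lsubmx.
  rewrite /g normrM mulrC normrX norm_dyad; apply: ler_pM => //.
  - by rewrite exprn_ge0// ltW// dyad_gt0.
  - rewrite normrM -mulrA; apply: ler_pM => //.
    by have := HC1 k _ _ c bz vz; rewrite n1_lsubmx.
  - exact: dyad_pow.
have gK k z : `|g k z| <= Cz * C1 * K ^+ m * 2^-1 ^+ k /\
    `|g k z| <= Cz * C1 * (powR K (m%:R - beta) * powR (n1 (lsubmx z)) beta) * 2^-1 ^+ k.
  have [z0|zn0] := eqVneq (chi rho z) 0.
    rewrite /g z0 mul0r mulr0 normr0 !mulr_ge0 ?exprn_ge0 ?powR_ge0//.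
  have [gk nk] := gb k z; have {}nk := nk zn0; have n0 := n1_ge0 (lsubmx z).
  split; apply: (le_trans gk); rewrite ler_wpM2r ?exprn_ge0// ler_wpM2l//.
    by rewrite lerXn2r.
  exact: pow_le_powR.
have cg k : continuous (g k).
  have -> : g k = fun z => dyad k ^+ L * (chi rho z * (tau (fun y => Psi k y * osc z c y) -
      \sum_(s <- wordsLt m) coef k s (rsubmx z) * qmon s (lsubmx z))).
    by apply/funext => z; rewrite (expansion m) addrAC subrr add0r.
  apply: contP => z; apply: contM; first exact: contC.
  apply: contM; first exact: chi_continuous.
  apply: contB; first exact/tau_osc_continuous/(urapid_rapid k uPsi).
  apply: (@sum_continuous R _ _ (wordsLt m) (fun s (z : Z) => coef k s (rsubmx z) * qmon s (lsubmx z))) => s.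
  have cp := @cont_pol R N M s _ (@coef_continuous k s); exact: cp.
have := @climit_expansion R N M rho beta 2^-1 C (wordsLt m) cc g h0 h1 beta0.
move=> H; have {}H := H _ _ _ cg _ _.
apply: climit_ext (H _ _ _ _ _) _.
- by move=> s /size_wordsLt; exact: mb.
- move=> k s; apply: contP => x; apply: contM; first exact: contC.
  by apply: contM; [exact: chi_continuous | exact: coef_continuous].
- move=> s; have [C2 [C20 HC2]] := tau_oscrem ttau 0 K0 (uPsis s).
  exists (Cx * (((size s)`!)%:R^-1 * C2)) => k x.
  have [x0|xn0] := eqVneq (chi rho x) 0.
    by rewrite /cc x0 mul0r mulr0 normr0 !mulr_ge0 ?exprn_ge0 ?invr_ge0.
  rewrite /cc normrM mulrC normrX norm_dyad; apply: ler_pM => //.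
  - by rewrite exprn_ge0// ltW// dyad_gt0.
  - rewrite normrM; apply: ler_pM => //; rewrite /coef normrM ger0_norm ?invr_ge0//.
    rewrite ler_wpM2l ?invr_ge0//.
    have nn0 : n1 (0 : Z) <= K by rewrite /n1 big1// => i _; rewrite mxE normr0.
    have xK j : `|(row_mx 0 x : Z) ord0 j| <= K.
      case: (split_ordP j) => i ->; first by rewrite row_mxEl mxE normr0.
      by rewrite row_mxEr; apply: le_trans rK; exact: chi_neq0.
    have := HC2 k _ _ (c + (size s)%:R * (pi / 2)) xK nn0; rewrite expr0 mulr1.
    by under eq_fun do rewrite oscrem0 addr0.
  - exact: dyad_pow.
- move=> k z; have [+ _] := gK k z; move=> /le_trans; apply.
  by rewrite ler_wpM2r ?exprn_ge0// lerDl !mulr_ge0// powR_ge0.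
- move=> z k; apply: (@le_trans _ _ (\sum_(0 <= n < k)
     (Cz * C1 * (powR K (m%:R - beta) * powR (n1 (lsubmx z)) beta) * 2^-1 ^+ n))).
    by apply: ler_sum => n _; have [_] := gK n z.
  have p0 : 0 <= Cz * C1 * (powR K (m%:R - beta) * powR (n1 (lsubmx z)) beta).
    by rewrite !mulr_ge0 ?powR_ge0.
  rewrite -mulr_sumr (le_trans (ler_wpM2l p0 (geometric_sum_le k h0 h1)))//.
  have -> : (1 - 2^-1 : R)^-1 = 2 by field.
  rewrite mulrA mulrAC ler_wpM2r ?powR_ge0// [leLHS]mulrC lerDr !mulr_ge0// exprn_ge0//.
- move=> k r br.
  have [-> _] := tau_osc_commute ttau c (urapid_rapid k uPsi) (btest_rapid br).
  rewrite -intRnZ; last first.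
    by apply: dec_intble; have [] := tau_osc_commute ttau c (urapid_rapid k uPsi) (btest_rapid br).
  congr intRn; apply/funext => z.
  have [zb|/(btest_out br) ->] := pselect (forall i, `|z ord0 i| <= rho); last by rewrite mul0r !mulr0.
  have cx : chi rho (rsubmx z) = 1 by apply: chi_eq1 => // i; rewrite mxE.
  have -> : \sum_(s <- wordsLt m) cc k s (rsubmx z) * qmon s (lsubmx z) =
      dyad k ^+ L * \sum_(s <- wordsLt m) coef k s (rsubmx z) * qmon s (lsubmx z).
    by rewrite mulr_sumr; apply: eq_bigr => s _; rewrite /cc cx mul1r mulrA.
  rewrite (expansion m) /g chi_eq1// mul1r.
  set A := \sum_(s <- _) _; set B := tau _; set D := dyad k ^+ L; ring.
Qed.

End Nonlocal.

(** * Kernels near the origin *)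

(* With [H x = x^th / (1 + x^th)] the terms are dominated by differences [H (2x) - H x], so that the
   series telescopes. *)
Section DyadicSum.
Context {R : realType}.
Variables (m : nat) (beta : R).
Hypotheses (mb : m%:R < beta) (bm : beta < m.+1%:R).

Let th : R := Num.min (m.+1%:R - beta) (beta - m%:R).
Let y2 : R := powR 2 th.
Let H (x : R) : R := powR x th / (1 + powR x th).
Let c : R := 2 * (1 + y2) / (y2 - 1).

Let th0 : 0 < th. Proof. by rewrite lt_min !subr_gt0 bm mb. Qed.

Let y21 : 1 < y2.
Proof.
have := @gt0_ltr_powR R th th0 1 2; rewrite !nnegrE powR1 ler01 ltr1n.
by move=> /(_ isT) /(_ (ler0n _ _)) /(_ isT).
Qed.

Let H01 x : 0 <= H x /\ H x <= 1.
Proof.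
have p0 := powR_ge0 x th; have p1 : 0 < 1 + powR x th by rewrite ltr_pwDl.
by split; [rewrite divr_ge0// ltW | rewrite ler_pdivrMr// mul1r lerDr].
Qed.

(** With Y = x^th the difference is (y2 - 1) Y / ((1 + y2 Y)(1 + Y)), which is comparable to the
    smaller of Y and 1 / Y; [c] is the constant of this comparison. *)
Let gap (Y : R) : 0 < Y ->
  (Y <= 1 -> Y <= c * (y2 * Y / (1 + y2 * Y) - Y / (1 + Y))) /\
  (1 <= Y -> Y^-1 <= c * (y2 * Y / (1 + y2 * Y) - Y / (1 + Y))).
Proof.
move=> Y0; have y0 : 0 < y2 by rewrite (lt_trans _ y21).
have d1 : 0 < 1 + y2 * Y by rewrite ltr_pwDl// mulr_ge0// ltW.
have d2 : 0 < 1 + Y by rewrite ltr_pwDl// ltW.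
have d3 : 0 < y2 - 1 by rewrite subr_gt0.
have -> : c * (y2 * Y / (1 + y2 * Y) - Y / (1 + Y)) =
    2 * (1 + y2) * Y / ((1 + y2 * Y) * (1 + Y)).
  by rewrite /c; field; rewrite !gt_eqF.
split=> Y1; rewrite ler_pdivlMr ?mulr_gt0//.
  have h : (1 + y2 * Y) * (1 + Y) <= (1 + y2) * 2.
    apply: ler_pM; rewrite ?(ltW d1) ?(ltW d2)//; first by rewrite lerD2l ger_pMr.
    by rewrite -[2]/(1 + 1) lerD2l.
  by rewrite [Y * _]mulrC ler_wpM2r ?(ltW Y0)// [2 * _]mulrC.
rewrite ler_pdivrMl//.
have h : (1 + y2 * Y) * (1 + Y) <= ((1 + y2) * Y) * (2 * Y).
  apply: ler_pM; rewrite ?(ltW d1) ?(ltW d2)//; first by rewrite mulrDl mul1r lerD2r.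
  by rewrite mulrDl mul1r lerD2r.
by apply: (le_trans h); rewrite le_eqVlt; apply/orP; left; apply/eqP; ring.
Qed.

(** Divided by x^beta the left side is x^(m + 1 - beta) for x <= 1 and x^(m - beta) beyond; [th] is
    the smaller of the two distances from beta to an integer, so it serves both ranges. *)
Let key x : 0 < x -> x ^+ m * Num.min x 1 <= powR x beta * (c * (H (2 * x) - H x)).
Proof.
move=> x0; have xn0 : x != 0 by rewrite gt_eqF.
have Y0 : 0 < powR x th by exact: powR_gt0.
have [g1 g2] := gap Y0.
have -> : H (2 * x) = y2 * powR x th / (1 + y2 * powR x th).
  by rewrite /H powRM// ltW.
have pw (b : R) : powR x b = powR x beta * powR x (b - beta).
  by rewrite -powRD ?subrKC//; apply/implyP.
have [x1|x1] := leP x 1.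
  rewrite -exprSr -powR_mulrn ?(ltW x0)// [X in X <= _]pw ler_wpM2l ?powR_ge0//.
  apply: le_trans (g1 _).
    apply: ger_powR; [by rewrite x0 x1 | by rewrite ge_min lexx].
  have /= := @ge0_ler_powR R th (ltW th0) x 1; rewrite !nnegrE powR1; apply=> //.
  exact: ltW.
rewrite mulr1 -powR_mulrn ?(ltW x0)// [X in X <= _]pw ler_wpM2l ?powR_ge0//.
have Y1 : 1 <= powR x th.
  have /= := @ge0_ler_powR R th (ltW th0) 1 x; rewrite !nnegrE powR1; apply=> //; exact: ltW.
apply: le_trans (g2 Y1); rewrite -powRN; apply: ler_powR; first exact: ltW.
by rewrite -opprB lerN2 ge_min lexx orbT.
Qed.

Lemma dyadic_sum : exists C, 0 <= C /\ forall x k, 0 <= x ->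
  \sum_(0 <= n < k) powR (dyad n) beta * ((2 ^+ n * x) ^+ m * Num.min (2 ^+ n * x) 1) <=
  C * powR x beta.
Proof.
have c0 : 0 <= c.
  by apply: divr_ge0; [rewrite mulr_ge0// addr_ge0//; exact: powR_ge0 | rewrite subr_ge0 ltW].
exists c; split=> // x k; rewrite le_eqVlt => /predU1P[<-|x0].
  rewrite big1 ?(mulr_ge0 c0 (powR_ge0 _ _))// => n _.
  by rewrite mulr0 minEle ler01 !mulr0.
apply: (@le_trans _ _ (\sum_(0 <= n < k) powR x beta * c * (H (2 ^+ n.+1 * x) - H (2 ^+ n * x)))).
  apply: ler_sum => n _; have p2 : 0 < 2 ^+ n * x :> R by rewrite mulr_gt0// exprn_gt0.
  apply: (le_trans (ler_wpM2l (powR_ge0 _ _) (key p2))).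
  rewrite [leLHS]mulrA -powRM ?(ltW p2) ?(ltW (dyad_gt0 _))//.
  rewrite (_ : dyad n * _ = x); last by rewrite mulrA mulVf ?mul1r// expf_neq0.
  by rewrite -mulrA [2 * _]mulrA -exprS.
rewrite -mulr_sumr telescope_sumr// [_ * c]mulrC ler_piMr ?(mulr_ge0 c0 (powR_ge0 _ _))//.
have [h1 h2] := H01 (2 ^+ k * x); have [h3 h4] := H01 (2 ^+ 0 * x); lra.
Qed.

End DyadicSum.

Section DyadicExponents.
Context {R : realType}.

Lemma dyad_powR_expr k (m : nat) (b : R) :
  powR (dyad k) b * (2 ^+ k) ^+ m = powR 2 (m%:R - b) ^+ k.
Proof.
have p2 : 0 <= 2 ^+ k :> R by rewrite exprn_ge0.
rewrite /dyad -(powR_inv1 p2) -powRrM mulN1r -(powR_mulrn m p2) -powRD; last first.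
  by apply/implyP => _; rewrite expf_neq0.
by rewrite addrC -[2 ^+ k](powR_mulrn k (ler0n R 2)) powRAC powR_mulrn// powR_ge0.
Qed.

Lemma dyad_expr_powR k L (a : R) : dyad k ^+ L * powR (dyad k) a = powR (dyad k) (a + L%:R).
Proof.
rewrite -powR_mulrn ?(ltW (dyad_gt0 k))// -powRD ?[L%:R + a]addrC//.
by apply/implyP => _; rewrite gt_eqF// dyad_gt0.
Qed.

Lemma powR2_lt1 (b : R) : b < 0 -> powR 2 b < 1.
Proof.
move=> b0; rewrite -[b]opprK powRN invf_lt1 ?powR_gt0//.
have := @gt0_ltr_powR R (- b) _ 1 2; rewrite !nnegrE powR1 oppr_gt0 b0 ler01 ltr1n.
by move=> /(_ isT isT) /(_ (ler0n _ _)) /(_ isT).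
Qed.

End DyadicExponents.

Section KernelIntegrals.
Context {R : realType} {N M : nat}.
Local Notation Z := 'rV[R]_(N + M).
Implicit Types (kap : 'rV[R]_N -> R) (g h : Z -> R).

Definition padr (p : 'rV[R]_N) : Z := row_mx p 0.

Lemma padr_continuous : continuous padr.
Proof.
apply: contP => p; apply: (@cont_comp _ _ _ (fun p : 'rV[R]_N => (p, (0 : 'rV[R]_M)))
  (fun p : 'rV[R]_N * 'rV[R]_M => row_mx p.1 p.2)); last exact: row_mx_continuous.
by apply: cont_pair; [exact: contid | exact: contC].
Qed.

Lemma cont_translate h (s : R) : continuous h ->
  continuous (fun q : 'rV[R]_N * Z => h (q.2 + padr (s *: q.1))).
Proof.
move=> ch; apply: contP => q; apply: (@cont_comp _ _ _ (fun q : 'rV[R]_N * Z => q.2 + padr (s *: q.1)) h);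
  last exact: ch.
apply: contDV; first exact: contsnd.
apply: (@cont_comp _ _ _ (fun q : 'rV[R]_N * Z => s *: q.1) padr); last exact: padr_continuous.
by apply: contZV; [exact: contC | exact: contfst].
Qed.

Lemma cont_slice (X Y : topologicalType) (F : X * Y -> R) x :
  continuous F -> continuous (fun y => F (x, y)).
Proof.
move=> cF; apply: contP => y; apply: (@cont_comp _ _ _ (fun y => (x, y)) F); last exact: cF.
by apply: cont_pair; [exact: contC | exact: contid].
Qed.

Lemma cont_slicel (X Y : topologicalType) (F : X * Y -> R) y :
  continuous F -> continuous (fun x => F (x, y)).
Proof.
move=> cF; apply: contP => x; apply: (@cont_comp _ _ _ (fun x => (x, y)) F); last exact: cF.
by apply: cont_pair; [exact: contid | exact: contC].
Qed.

Lemma dec_bounded n (g : 'rV[R]_n -> R) : dec g -> exists C, 0 <= C /\ forall x, `|g x| <= C.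
Proof.
move=> [_ [C gC]]; have h x : `|g x| <= C.
  by apply: le_trans (gC x); rewrite ler_peMr// exprn_ege1// nW_ge1.
by exists C; split=> //; exact: le_trans (h 0).
Qed.

Lemma translate_Fubini kap g h (s : R) : dec kap -> dec g -> continuous h ->
  (exists C, forall z, `|h z| <= C) ->
  intRn (fun z => g z * intRn (fun p => kap p * h (z + padr (s *: p)))) =
  intRn (fun p => kap p * intRn (fun z => g z * h (z + padr (s *: p)))).
Proof.
move=> dk dg ch [C hC]; have [ck [Ck kC]] := dk; have [cg [Cg gC]] := dg.
have C0 : 0 <= C := le_trans (normr_ge0 _) (hC 0).
pose F p z := kap p * (g z * h (z + padr (s *: p))).
have chs := @cont_translate h s ch.
have cF : continuous (fun q : 'rV[R]_N * Z => F q.1 q.2).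
  apply: contP => q.
  apply: contM; first by apply: (@cont_comp _ _ _ fst kap); [exact: contfst | exact: ck].
  apply: contM; first by apply: (@cont_comp _ _ _ snd g); [exact: contsnd | exact: cg].
  exact: chs.
have bF p z : `|F p z| * nW p ^+ 2 * nW z ^+ 2 <= Ck * (Cg * C).
  rewrite /F !normrM (_ : _ * _ = (`|kap p| * nW p ^+ 2) * (`|g z| * nW z ^+ 2 * `|h (z + padr (s *: p))|));
    last by ring.
  by apply: ler_pM; rewrite ?mulr_ge0 ?exprn_ge0 ?(ltW (nW_gt0 _))//; apply: ler_pM;
    rewrite ?mulr_ge0 ?exprn_ge0 ?(ltW (nW_gt0 _)).
have dh z : dec (fun p => kap p * h (z + padr (s *: p))).
  split; last first.
    exists (Ck * C) => p; rewrite normrM mulrAC.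
    by apply: ler_pM; rewrite ?mulr_ge0 ?exprn_ge0 ?(ltW (nW_gt0 _)).
  apply: contP => p; apply: contM; first exact: ck.
  exact: (@cont_slicel _ _ _ z chs).
have dg' p : dec (fun z => g z * h (z + padr (s *: p))).
  split; last first.
    exists (Cg * C) => z; rewrite normrM mulrAC.
    by apply: ler_pM; rewrite ?mulr_ge0 ?exprn_ge0 ?(ltW (nW_gt0 _)).
  apply: contP => z; apply: contM; first exact: cg.
  exact: (@cont_slice _ _ _ p chs).
have [_ E] := intRn_Fubini cF bF.
transitivity (intRn (fun z => intRn (F ^~ z))).
  congr intRn; apply/funext => z; rewrite -(intRnZ _ (dec_intble (dh z))).
  by congr intRn; apply/funext => p; rewrite /F mulrCA.
rewrite -E; congr intRn; apply/funext => p.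
by rewrite -(intRnZ _ (dec_intble (dg' p))).
Qed.

(** Fubini brings the kernel outside, and a translation of the inner variable moves the shift from
    one factor to the other. *)
Lemma convolution_adjoint kap (w h : Z -> R) (lam : R) : dec kap -> dec w -> dec h ->
  intRn (fun z => w z * intRn (fun p => kap p * h (z + padr ((- lam) *: p)))) =
  intRn (fun z => h z * intRn (fun p => kap p * w (z + padr (lam *: p)))).
Proof.
move=> dk dw dh; have [Bw [_ HBw]] := dec_bounded dw; have [Bh [_ HBh]] := dec_bounded dh.
have cw := proj1 dw; have ch := proj1 dh.
rewrite (translate_Fubini (- lam) dk dw ch); last by exists Bh.
rewrite (translate_Fubini lam dk dh cw); last by exists Bw.
congr intRn; apply/funext => p; congr (_ * _).
have D : dec (fun z => w z * h (z + padr (- lam *: p))).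
  have [_ [C wC]] := dw; split.
    apply: contP => z; apply: contM; first exact: cw.
    exact: (@cont_slice _ _ _ p (@cont_translate h (- lam) ch)).
  exists (C * Bh) => z; rewrite normrM mulrAC.
  by apply: ler_pM; rewrite ?mulr_ge0 ?exprn_ge0 ?(ltW (nW_gt0 _)).
rewrite -(intRn_shift (padr (lam *: p)) D); congr intRn; apply/funext => z.
rewrite mulrC -addrA /padr add_row_mx scaleNr subrr addr0 row_mx0 addr0.
by [].
Qed.

Lemma n1Z n (a : R) (x : 'rV[R]_n) : n1 (a *: x) = `|a| * n1 x.
Proof. by rewrite /n1 mulr_sumr; apply: eq_bigr => i _; rewrite mxE normrM. Qed.

Lemma n1D n (x y : 'rV[R]_n) : n1 (x + y) <= n1 x + n1 y.
Proof.
by rewrite /n1 -big_split; apply: ler_sum => i _; rewrite mxE; exact: ler_normD.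
Qed.

Lemma qmonZ n (s : seq 'I_n) (a : R) (q : 'rV[R]_n) : qmon s (a *: q) = a ^+ size s * qmon s q.
Proof.
elim: s => [|j s IH]; first by rewrite /qmon !big_nil mulr1.
by rewrite !qmon_cons IH mxE exprS; ring.
Qed.

Lemma one_n1_le n (p : 'rV[R]_n) : 1 + n1 p <= (1 + n%:R) * nW p.
Proof.
rewrite mulrDl mul1r lerD ?nW_ge1// (n1_le (K := nW p))// => i; exact: coord_le_nW.
Qed.

Lemma powR_n1_le n (a : R) (J : nat) (p : 'rV[R]_n) : 0 < a -> a <= J%:R ->
  powR (1 + n1 p) a <= (1 + n%:R) ^+ J * nW p ^+ J.
Proof.
move=> a0 aJ; have p1 : 1 <= 1 + n1 p by rewrite lerDl n1_ge0.
apply: (le_trans (ler_powR p1 aJ)); rewrite powR_mulrn ?(le_trans ler01)// -exprMn.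
by rewrite lerXn2r ?nnegrE ?(le_trans ler01 p1) ?one_n1_le// mulr_ge0 ?addr_ge0 ?(ltW (nW_gt0 _)).
Qed.

Lemma integral_bound n (I : Type) (ker : I -> 'rV[R]_n -> R) (J : nat) : urapid ker ->
  exists E, 0 <= E /\ forall i (g : 'rV[R]_n -> R) D, continuous g ->
    (forall P, `|g P| <= D * nW P ^+ J) ->
    dec (fun P => ker i P * g P) /\ `|intRn (fun P => ker i P * g P)| <= E * D.
Proof.
move=> [sk kC]; have [C HC] := kC [::] J.+2; exists (`|C| * InW n).
split=> [|i g D cg gD]; first by rewrite mulr_ge0 ?InW_ge0.
have D0 : 0 <= D.
  by have := gD 0; rewrite /nW big1 ?expr1n ?mulr1 => [|j _]; [exact: le_trans | rewrite mxE expr0n addr0].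
have cC P : `|ker i P| * nW P ^+ J.+2 <= `|C| := le_trans (HC i P) (ler_norm C).
have B P : `|ker i P * g P| * nW P ^+ 2 <= `|C| * D.
  have n0 k : 0 <= nW P ^+ k by rewrite exprn_ge0// (ltW (nW_gt0 _)).
  rewrite normrM; apply: (@le_trans _ _ (`|ker i P| * (D * nW P ^+ J) * nW P ^+ 2)).
    by rewrite ler_wpM2r// ler_wpM2l.
  rewrite [leLHS](_ : _ = (`|ker i P| * nW P ^+ J.+2) * D); first by rewrite ler_wpM2r.
  have -> : nW P ^+ J.+2 = nW P ^+ J * nW P ^+ 2 by rewrite -exprD addn2.
  by ring.
have dkg : dec (fun P => ker i P * g P).
  split; last by exists (`|C| * D).
  by apply: contP => P; apply: contM; [exact: smooth_continuous | exact: cg].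
split=> //; rewrite mulrAC; apply: intRn_small; first exact: dec_intble.
move=> P; apply: le_trans (B P); rewrite ler_wpM2l// expr2 ler_peMr ?nW_ge1//.
exact: ltW (nW_gt0 _).
Qed.

End KernelIntegrals.

Section Local.
Context {R : realType} {N M : nat}.
Local Notation Z := 'rV[R]_(N + M).
Variables (ker : nat -> 'rV[R]_N -> R) (w : Z -> R) (a Cw rho : R) (L m : nat).
Local Notation beta := (a + L%:R).
Hypotheses (uk : urapid ker) (dw : dec w) (a0 : 0 < a) (Cw0 : 0 <= Cw).
Hypothesis wb : forall z, `|w z| <= Cw * powR (n1 (lsubmx z)) a.
Hypotheses (L0 : (0 < L)%N) (mb : m%:R < beta) (bm : beta < m.+1%:R) (rho0 : 0 < rho).

(** An integer above [a], so that growth of order [a] can be measured by powers of [nW]. *)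
Let J : nat := projT1 (cid (ceil_exists a0)).
Let aJ : a <= J%:R. Proof. by rewrite /J; case: cid => j [? ? ?]. Qed.
Let D : R := Cw * (1 + N%:R) ^+ J.
Let D0 : 0 <= D. Proof. by rewrite mulr_ge0// exprn_ge0// addr_ge0. Qed.
Let cw : continuous w := proj1 dw.

Let wq k (x : 'rV[R]_M) (P : 'rV[R]_N) : R := w (row_mx (dyad k *: P) x).
Let wk k (z : Z) : R := intRn (fun p => ker k p * w (z + padr (dyad k *: p))).

Let Jpow (P : 'rV[R]_N) (b : R) : 0 <= b -> b <= 1 + n1 P -> Cw * powR b a <= D * nW P ^+ J.
Proof.
move=> b0 bP; rewrite /D -mulrA ler_wpM2l//; apply: le_trans (powR_n1_le P a0 aJ).
by rewrite ge0_ler_powR ?nnegrE ?addr_ge0 ?n1_ge0// ltW.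
Qed.

Let wq_bound k x P : `|wq k x P| <= powR (dyad k) a * D * nW P ^+ J.
Proof.
apply: (le_trans (wb _)); rewrite row_mxKl n1Z norm_dyad powRM ?n1_ge0 ?(ltW (dyad_gt0 _))//.
by rewrite mulrCA -mulrA ler_wpM2l ?powR_ge0// Jpow ?n1_ge0// lerDr.
Qed.

Let wq_cont k : continuous (fun q : 'rV[R]_N * 'rV[R]_M => wq k q.2 q.1).
Proof.
apply: contP => q; apply: (@cont_comp _ _ _ (fun q : 'rV[R]_N * 'rV[R]_M => row_mx (dyad k *: q.1) q.2) w);
  last exact: cw.
apply: (@cont_comp _ _ _ (fun q : 'rV[R]_N * 'rV[R]_M => (dyad k *: q.1, q.2))
  (fun p : 'rV[R]_N * 'rV[R]_M => row_mx p.1 p.2)); last exact: row_mx_continuous.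
apply: cont_pair; last exact: contsnd.
by apply: contZV; [exact: contC | exact: contfst].
Qed.

Let wq_contP k x : continuous (wq k x).
Proof. exact: (@cont_slicel _ _ _ _ x (@wq_cont k)). Qed.

(** The substitution P = p + 2^k q removes q from the merely continuous [w] and puts it into the
    smooth kernel, where it can be expanded. *)
Let wk_shift k z : wk k z =
  intRn (fun P => ker k (P + (- 2 ^+ k) *: lsubmx z) * wq k (rsubmx z) P).
Proof.
have [Bw [Bw0 HBw]] := dec_bounded dw.
have [E [_ HE]] := integral_bound 0 uk.
have cs := @cont_slicel _ _ _ _ z (@cont_translate R N M w (dyad k) cw).
have wB P : `|w (z + padr (dyad k *: P))| <= Bw * nW P ^+ 0 by rewrite expr0 mulr1.
have [D1 _] := HE k _ Bw cs wB.
rewrite /wk -(intRn_shift ((- 2 ^+ k) *: lsubmx z) D1); congr intRn; apply/funext => P.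
rewrite /wq /=; congr (_ * w _).
rewrite scalerDr scalerA mulrN mulVf ?expf_neq0// scaleN1r /padr -{1}[z]hsubmxK add_row_mx.
by rewrite addr0 addrCA subrr addr0.
Qed.

(** Coefficients of the Taylor expansion of the kernel in Q = -2^k q, integrated against [w]. They
    depend on q' alone. *)
Let coef k s (x : 'rV[R]_M) : R := dyad k ^+ L * (((size s)`!)%:R^-1 *
  ((- 2 ^+ k) ^+ size s * intRn (fun P => iter_pd s (ker k) P * wq k x P))).

Let pk k : R := powR (dyad k) beta.
Let pk0 k : 0 <= pk k. Proof. exact: powR_ge0. Qed.

Let coef_bound s : exists E, 0 <= E /\ forall k x,
  `|coef k s x| <= E * (pk k * (2 ^+ k) ^+ size s).
Proof.
have [E [E0 HE]] := integral_bound J (urapid_iter_pd s uk).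
exists (E * D); split=> [|k x]; first exact: mulr_ge0.
have [_ H] := HE k (wq k x) _ (@wq_contP k x) (@wq_bound k x).
rewrite /coef !normrM !normrX normrN norm_dyad (ger0_norm (exprn_ge0 _ _))//.
rewrite (ger0_norm (_ : 0 <= _^-1)) ?invr_ge0//.
set I := `|intRn _|; have d0 : 0 <= dyad k ^+ L :> R by rewrite exprn_ge0// ltW// dyad_gt0.
have t0 : 0 <= (2 ^+ k) ^+ size s :> R by rewrite !exprn_ge0.
apply: (@le_trans _ _ (dyad k ^+ L * (1 * ((2 ^+ k) ^+ size s * (E * (powR (dyad k) a * D)))))).
  rewrite ler_wpM2l//; apply: ler_pM; rewrite ?invr_ge0 ?mulr_ge0 ?normr_ge0//.
    by rewrite invf_le1 ?ltr0n ?fact_gt0// ler1n fact_gt0.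
  by rewrite ler_wpM2l.
rewrite /pk -dyad_expr_powR le_eqVlt; apply/orP; left; apply/eqP; ring.
Qed.

Let nn (z : Z) := n1_ge0 (lsubmx z).

Let rem k (z : Z) : R := dyad k ^+ L * wk k z -
  \sum_(s <- wordsLt m.+1) coef k s (rsubmx z) * qmon s (lsubmx z).

(** In the range X >= 1 nothing cancels: the function and each term of its expansion are separately
    O(X^m). *)
Let rem_far : exists C, 0 <= C /\ forall k z, 1 <= 2 ^+ k * n1 (lsubmx z) ->
  `|rem k z| <= C * (pk k * (2 ^+ k * n1 (lsubmx z)) ^+ m).
Proof.
have [E [E0 HE]] := integral_bound J uk.
have [F HF] := choice coef_bound.
exists (E * D + \sum_(s <- wordsLt m.+1) F s).
split=> [|k z X1].
  by rewrite addr_ge0 ?mulr_ge0 ?sumr_ge0// => s _; have [] := HF s.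
set X := 2 ^+ k * _ in X1 *.
have X0 : 0 <= X := le_trans ler01 X1.
have d0 : 0 <= dyad k :> R by rewrite ltW// dyad_gt0.
have lX : n1 (lsubmx z) = dyad k * X by rewrite /X mulrA mulVf ?mul1r// expf_neq0.
apply: (le_trans (ler_normB _ _)); rewrite mulrDl; apply: lerD.
  have cs := @cont_slicel _ _ _ _ z (@cont_translate R N M w (dyad k) cw).
  have ws p : `|w (z + padr (dyad k *: p))| <= powR (dyad k) a * powR X a * D * nW p ^+ J.
    apply: (le_trans (wb _)).
    have nb : n1 (lsubmx (z + padr (dyad k *: p))) <= dyad k * (X * (1 + n1 p)).
      have -> : lsubmx (z + padr (dyad k *: p)) = lsubmx z + dyad k *: p.
        by rewrite -{1}[z]hsubmxK /padr add_row_mx row_mxKl.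
      apply: (le_trans (n1D _ _)); rewrite n1Z norm_dyad lX -mulrDr ler_wpM2l//.
      by rewrite mulrDr mulr1 lerD2l ler_peMl// n1_ge0.
    apply: (@le_trans _ _ (Cw * powR (dyad k * (X * (1 + n1 p))) a)).
      rewrite ler_wpM2l// ge0_ler_powR ?nnegrE ?n1_ge0 ?mulr_ge0 ?addr_ge0 ?n1_ge0//.
      exact: ltW.
    rewrite powRM ?mulr_ge0 ?addr_ge0 ?n1_ge0// powRM ?addr_ge0 ?n1_ge0//.
    rewrite [leLHS](_ : _ = powR (dyad k) a * powR X a * (Cw * powR (1 + n1 p) a)); last by ring.
    by rewrite -[leRHS]mulrA ler_wpM2l ?mulr_ge0 ?powR_ge0// Jpow// addr_ge0 ?n1_ge0.
  have [_ H] := HE k _ _ cs ws.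
  rewrite normrM normrX norm_dyad.
  apply: (@le_trans _ _ (dyad k ^+ L * (E * (powR (dyad k) a * powR X a * D)))).
    by rewrite ler_wpM2l ?exprn_ge0.
  (* Here a <= m because a + L < m + 1 and L >= 1. *)
  have aX : powR X a <= X ^+ m.
    rewrite -powR_mulrn//; apply: ler_powR => //.
    have := bm; have : 1 <= L%:R :> R by rewrite ler1n.
    by rewrite -natr1; lra.
  rewrite /pk -dyad_expr_powR [leLHS](_ : _ = E * D * (dyad k ^+ L * powR (dyad k) a * powR X a)); last by ring.
  by rewrite ler_wpM2l ?mulr_ge0// ler_wpM2l ?mulr_ge0 ?powR_ge0 ?exprn_ge0.
apply: (le_trans (ler_norm_sum _ _ _)); rewrite mulr_suml big_seq [leRHS]big_seq.
apply: ler_sum => s /size_wordsLt; rewrite ltnS => sm; have [Fs0 HFs] := HF s.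
rewrite normrM; apply: (@le_trans _ _ (F s * (pk k * (2 ^+ k) ^+ size s) * n1 (lsubmx z) ^+ size s)).
  by apply: ler_pM => //; exact: qmon_le.
rewrite -!mulrA -exprMn -/X ler_wpM2l// ler_wpM2l//.
exact: ler_weXn2l.
Qed.

(** In the range X <= 1 Taylor's formula of order m + 1 applies to the kernel. The displacement is
    then at most 1, so by Peetre's inequality the weights at the two points are comparable. *)
Let rem_near : exists C, 0 <= C /\ forall k z, 2 ^+ k * n1 (lsubmx z) <= 1 ->
  `|rem k z| <= C * (pk k * (2 ^+ k * n1 (lsubmx z)) ^+ m.+1).
Proof.
(* Room for m + 1 derivatives and for J + 1 powers of the weight: J against the growth of [w] and
   one for integrability. *)
have [B [B0 HB]] := urapid_sbd (m + J).+2 uk.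
exists (B * (2 ^+ N * 2 ^+ N) ^+ J.+1 * D * InW N).
split=> [|k z X1]; first by rewrite !mulr_ge0 ?InW_ge0 ?exprn_ge0.
set X := 2 ^+ k * _ in X1 *.
have X0 : 0 <= X by rewrite mulr_ge0 ?exprn_ge0.
pose x := rsubmx z; pose Q := (- 2 ^+ k) *: lsubmx z.
have nQ : n1 Q = X by rewrite n1Z normrN ger0_norm ?exprn_ge0.
have sker : smooth (ker k) by have [] := uk.
pose T P := ker k (P + Q) - \sum_(l < m.+1) (l`!)%:R^-1 * \sum_(s <- words l) qmon s Q * iter_pd s (ker k) P.
have dI s := proj1 (proj2 (projT2 (cid (integral_bound J (urapid_iter_pd s uk)))) k (wq k x) _ (@wq_contP k x) (@wq_bound k x)).
have dsh : dec (fun P => ker k (P + Q) * wq k x P).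
  have [Bw [Bw0 HBw]] := dec_bounded dw.
  have dk : dec (fun P => ker k (P + Q)) by apply: dec_shift; exact/rapid_dec/(urapid_rapid k uk).
  have [ck [Ck HCk]] := dk; split.
    by apply: contP => P; apply: contM; [exact: ck | exact: wq_contP].
  exists (Ck * Bw) => P; rewrite normrM mulrAC.
  by apply: ler_pM; rewrite ?mulr_ge0 ?exprn_ge0 ?(ltW (nW_gt0 _))// /wq.
have remE : rem k z = dyad k ^+ L * intRn (fun P => T P * wq k x P).
  have dS : dec (fun P => \sum_(s <- wordsLt m.+1) (((size s)`!)%:R^-1 * qmon s Q) * (iter_pd s (ker k) P * wq k x P)).
    by apply: dec_sum => s; apply: decZ; exact: dI.
  have -> : (fun P => T P * wq k x P) = (fun P => ker k (P + Q) * wq k x P -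
      \sum_(s <- wordsLt m.+1) (((size s)`!)%:R^-1 * qmon s Q) * (iter_pd s (ker k) P * wq k x P)).
    apply/funext => P; rewrite /T mulrBl; congr (_ - _); rewrite sum_wordsLt mulr_suml.
    apply: eq_bigr => l _; rewrite mulr_sumr mulr_suml big_seq [RHS]big_seq.
    by apply: eq_bigr => s /size_words ->; rewrite !mulrA.
  rewrite (intRnD (dec_intble dsh) (intbleN (dec_intble dS))) (intRnN (dec_intble dS)).
  rewrite /rem (wk_shift k z) -/Q -/x mulrBr; congr (_ - _).
  rewrite intRn_sum; last by move=> s; apply: decZ; exact: dI.
  rewrite mulr_sumr; apply: eq_bigr => s _.
  by rewrite (intRnZ _ (dec_intble (dI s))) /coef /Q qmonZ; ring.
have dT : dec (fun P => T P * wq k x P).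
  have dS : dec (fun P => \sum_(s <- wordsLt m.+1) (((size s)`!)%:R^-1 * qmon s Q) * (iter_pd s (ker k) P * wq k x P)).
    by apply: dec_sum => s; apply: decZ; exact: dI.
  have -> : (fun P => T P * wq k x P) = (fun P => ker k (P + Q) * wq k x P -
      \sum_(s <- wordsLt m.+1) (((size s)`!)%:R^-1 * qmon s Q) * (iter_pd s (ker k) P * wq k x P)).
    apply/funext => P; rewrite /T mulrBl; congr (_ - _); rewrite sum_wordsLt mulr_suml.
    apply: eq_bigr => l _; rewrite mulr_sumr mulr_suml big_seq [RHS]big_seq.
    by apply: eq_bigr => s /size_words ->; rewrite !mulrA.
  exact: (decD dsh (decN dS)).
have TB P : `|T P| * nW P ^+ J.+1 <= B * (2 ^+ N * 2 ^+ N) ^+ J.+1 * X ^+ m.+1.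
  have nP : 0 < nW P ^+ J.+1 by rewrite exprn_gt0// nW_gt0.
  have H (t : R) : `|t| <= 1 -> forall s, size s = m.+1 ->
      `|iter_pd s (ker k) (P + t *: Q)| <= B * (2 ^+ N * 2 ^+ N) ^+ J.+1 / nW P ^+ J.+1.
    move=> t1 s sm; rewrite ler_pdivlMr//.
    have tQ : nW (t *: Q) <= 2 ^+ N.
      apply: (@le_trans _ _ (\prod_(i < N) 2)); last by rewrite prodr_const card_ord.
      apply: ler_prod => i _; rewrite (ltW (onesq_gt0 _))//= -[2]/(1 + 1) lerD2l.
      rewrite -real_normK ?num_real// exprn_ile1// mxE normrM mulr_ile1//.
      apply: le_trans X1; rewrite -nQ /n1 (bigD1 i)//= lerDl sumr_ge0//.
    have W : nW P <= 2 ^+ N * 2 ^+ N * nW (P + t *: Q).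
      apply: (le_trans (nW_shift (t *: Q) P)).
      by rewrite ler_wpM2r ?(ltW (nW_gt0 _))// ler_wpM2l ?exprn_ge0.
    have W2 : nW P ^+ J.+1 <= (2 ^+ N * 2 ^+ N) ^+ J.+1 * nW (P + t *: Q) ^+ (m + J).+2.
      apply: (@le_trans _ _ ((2 ^+ N * 2 ^+ N * nW (P + t *: Q)) ^+ J.+1)).
        by rewrite lerXn2r ?nnegrE ?mulr_ge0 ?exprn_ge0 ?(ltW (nW_gt0 _)).
      rewrite exprMn ler_wpM2l ?exprn_ge0 ?mulr_ge0 ?exprn_ge0//.
      by apply: ler_weXn2l; [exact: nW_ge1 | rewrite ltnS; apply: leqW; exact: leq_addl].
    apply: (le_trans (ler_wpM2l (normr_ge0 _) W2)).
    have [_ /(_ s _ (P + t *: Q))] := HB k; rewrite sm => h.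
    rewrite mulrCA mulrC ler_wpM2r ?exprn_ge0 ?mulr_ge0 ?exprn_ge0// h//.
    by rewrite ltnS leqW// leq_addr.
  have := taylor sker H; rewrite nQ -/(T P) => h.
  by rewrite -ler_pdivlMr// mulrAC.
rewrite remE normrM normrX norm_dyad.
have H : `|intRn (fun P => T P * wq k x P)| <=
    (B * (2 ^+ N * 2 ^+ N) ^+ J.+1 * X ^+ m.+1 * (powR (dyad k) a * D)) * InW N.
  apply: intRn_small; first exact: dec_intble.
  move=> P; rewrite normrM.
  apply: (@le_trans _ _ (`|T P| * (powR (dyad k) a * D * nW P ^+ J) * nW P)).
    by rewrite ler_wpM2r ?(ltW (nW_gt0 _))// ler_wpM2l.
  rewrite [leLHS](_ : _ = (`|T P| * nW P ^+ J.+1) * (powR (dyad k) a * D)); last by rewrite exprSr; ring.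
  by rewrite ler_wpM2r// mulr_ge0 ?powR_ge0.
apply: (le_trans (ler_wpM2l (exprn_ge0 L (ltW (dyad_gt0 k))) H)).
by rewrite /pk -dyad_expr_powR le_eqVlt; apply/orP; left; apply/eqP; ring.
Qed.

Let coef_continuous k s : continuous (coef k s).
Proof.
apply: contP => x; apply: contM; first exact: contC.
apply: contM; first exact: contC.
apply: contM; first exact: contC.
have us := urapid_iter_pd s uk.
have [E [E0 HE]] := integral_bound J us.
have [Bw [Bw0 HBw]] := dec_bounded dw.
have [cs [Cs HCs]] := rapid_dec (urapid_rapid k us).
apply: (@intRn_continuous_param R _ N (fun P x => iter_pd s (ker k) P * wq k x P) x (Cs * Bw)).
- by move=> y; have [d _] := HE k _ _ (@wq_contP k y) (@wq_bound k y); exact: dec_intble.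
- move=> P; apply: contM; last exact: wq_cont.
  by apply: (@cont_comp _ _ _ fst (iter_pd s (ker k))); [exact: contfst | exact: cs].
- apply: filterE => y P; rewrite normrM mulrAC.
  by apply: ler_pM; rewrite ?mulr_ge0 ?exprn_ge0 ?(ltW (nW_gt0 _))// /wq.
Qed.

Let wk_continuous k : continuous (wk k).
Proof.
apply: contP => z.
have [E [E0 HE]] := integral_bound 0 uk.
have [Bw [Bw0 HBw]] := dec_bounded dw.
have [ck [Ck HCk]] := rapid_dec (urapid_rapid k uk).
have ct := @cont_translate R N M w (dyad k) cw.
rewrite /wk; apply: (@intRn_continuous_param R _ N (fun p (z : Z) => ker k p * w (z + padr (dyad k *: p))) z (Ck * Bw)).
- move=> y; have wB P : `|w (y + padr (dyad k *: P))| <= Bw * nW P ^+ 0 by rewrite expr0 mulr1.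
  have [d _] := HE k _ Bw (@cont_slicel _ _ _ _ y ct) wB; exact: dec_intble.
- move=> P; apply: contM; last exact: ct.
  by apply: (@cont_comp _ _ _ fst (ker k)); [exact: contfst | exact: ck].
- apply: filterE => y P; rewrite normrM mulrAC.
  by apply: ler_pM; rewrite ?mulr_ge0 ?exprn_ge0 ?(ltW (nW_gt0 _)).
Qed.

(** The convolution is moved from the test function to [w], where [rem_near] and [rem_far] combine
    into 2^(-k beta) X^m min(X, 1). [dyadic_sum] then adds the remainders up to O(|q|^beta). *)
Lemma climit_local : climit rho beta (fun k r => dyad k ^+ L *
  intRn (fun z => w z * intRn (fun p => ker k p * r (z + padr ((- dyad k) *: p))))).
Proof.
have [C1 [C10 H1]] := rem_near; have [C2 [C20 H2]] := rem_far.
have [Cz [Cz0 HCz]] := @chi_bounded R (N + M) rho rho0.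
have [Cs [Cs0 HCs]] := dyadic_sum mb bm.
pose C := C1 + C2; pose K : R := N%:R * (2 * rho).
have C0 : 0 <= C by rewrite addr_ge0.
have K0 : 0 <= K by rewrite !mulr_ge0// ltW.
have b0 : 0 < beta by rewrite (le_lt_trans _ mb).
(* A coefficient of degree |s| <= m has size 2^(-k beta) 2^(k |s|), at most the k-th power of this
   ratio. *)
pose th : R := powR 2 (m%:R - beta).
have th0 : 0 <= th by exact: powR_ge0.
have th1 : th < 1 by apply: powR2_lt1; rewrite subr_lt0.
have remB k z : `|rem k z| <= C * (pk k * ((2 ^+ k * n1 (lsubmx z)) ^+ m * Num.min (2 ^+ k * n1 (lsubmx z)) 1)).
  have X0 : 0 <= 2 ^+ k * n1 (lsubmx z) by rewrite mulr_ge0 ?exprn_ge0 ?nn.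
  have [X1|X1] := leP (2 ^+ k * n1 (lsubmx z)) 1.
    apply: (le_trans (H1 k z X1)); rewrite exprSr ler_wpM2r ?lerDl// !mulr_ge0// exprn_ge0//.
  apply: (le_trans (H2 k z (ltW X1))); rewrite mulr1 ler_wpM2r ?lerDr// mulr_ge0// exprn_ge0//.
pose g k (z : Z) : R := chi rho z * rem k z.
(* Longer words do not occur in the expansion, but the geometric bound is demanded for every word
   and fails for them. *)
pose cc k s (x : 'rV[R]_M) : R := if (size s <= m)%N then coef k s x else 0.
have ccE k z : \sum_(s <- wordsLt m.+1) cc k s (rsubmx z) * qmon s (lsubmx z) =
    \sum_(s <- wordsLt m.+1) coef k s (rsubmx z) * qmon s (lsubmx z).
  rewrite big_seq [RHS]big_seq; apply: eq_bigr => s /size_wordsLt; rewrite ltnS => sm.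
  by rewrite /cc sm.
have cg k : continuous (g k).
  apply: contP => z; apply: contM; first exact: chi_continuous.
  apply: contB; first by apply: contM; [exact: contC | exact: wk_continuous].
  apply: (@sum_continuous R _ _ (wordsLt m.+1) (fun s (z : Z) => coef k s (rsubmx z) * qmon s (lsubmx z))) => s.
  have cp := @cont_pol R N M s _ (@coef_continuous k s); exact: cp.
pose CC := Cz * (C * K ^+ m) + Cz * (C * Cs).
have KC0 : 0 <= Cz * (C * K ^+ m) by rewrite !mulr_ge0// exprn_ge0.
have SC0 : 0 <= Cz * (C * Cs) by rewrite !mulr_ge0.
apply: climit_ext (@climit_expansion R N M rho beta th CC (wordsLt m.+1) cc g th0 th1 b0 _ _ _ cg _ _) _.
- move=> s /size_wordsLt; rewrite ltnS => sm; apply: le_lt_trans mb.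
  by rewrite ler_nat.
- move=> k s; rewrite /cc; case: (size s <= m)%N; first exact: coef_continuous.
  by apply: contP => x; exact: contC.
- move=> s; have [E [E0 HE]] := coef_bound s; exists E => k x; rewrite /cc; case: ifP => sm; last first.
    by rewrite normr0 mulr_ge0// exprn_ge0.
  apply: (le_trans (HE k x)); rewrite ler_wpM2l// /th -dyad_powR_expr ler_wpM2l ?powR_ge0//.
  by apply: ler_weXn2l => //; rewrite exprn_ege1// ler1n.
- move=> k z; have [z0|zn0] := eqVneq (chi rho z) 0.
    by rewrite /g z0 mul0r normr0 mulr_ge0 ?exprn_ge0// addr_ge0.
  have nK : n1 (lsubmx z) <= K by apply: n1_le => i; rewrite mxE; exact: chi_neq0.
  apply: (@le_trans _ _ (Cz * (C * K ^+ m) * th ^+ k)); last first.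
    by rewrite ler_wpM2r ?exprn_ge0// lerDl.
  rewrite /g normrM -mulrA; apply: ler_pM => //.
  apply: (le_trans (remB k z)); rewrite -mulrA ler_wpM2l// /th -dyad_powR_expr [leRHS]mulrCA ler_wpM2l ?pk0//.
  have n0 := nn z; apply: (@le_trans _ _ ((2 ^+ k * n1 (lsubmx z)) ^+ m)).
    by rewrite ler_piMr ?exprn_ge0 ?mulr_ge0 ?exprn_ge0// ge_min lexx orbT.
  by rewrite exprMn [leRHS]mulrC ler_wpM2l ?exprn_ge0// lerXn2r.
- move=> z k; apply: (@le_trans _ _ (\sum_(0 <= n < k) Cz * (C * (pk n *
      ((2 ^+ n * n1 (lsubmx z)) ^+ m * Num.min (2 ^+ n * n1 (lsubmx z)) 1))))).
    by apply: ler_sum => n _; rewrite /g normrM; apply: ler_pM.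
  rewrite -!mulr_sumr; apply: (@le_trans _ _ (Cz * (C * (Cs * powR (n1 (lsubmx z)) beta)))).
    by rewrite !ler_wpM2l// HCs// nn.
  by rewrite !mulrA ler_wpM2r ?powR_ge0// -!mulrA lerDr.
- move=> k r br; have dr := rapid_dec (btest_rapid br).
  have dk := rapid_dec (urapid_rapid k uk).
  have dwk : dec (fun z => r z * wk k z).
    have -> : (fun z => r z * wk k z) = (fun z => wk k z * r z).
      by apply/funext => z; rewrite mulrC.
    exact: dec_mul_btest (@wk_continuous k) br.
  rewrite (convolution_adjoint (dyad k) dk dw dr) -(intRnZ _ (dec_intble dwk)).
  congr intRn; apply/funext => z.
  have [zb|/(btest_out br) ->] := pselect (forall i, `|z ord0 i| <= rho); last by rewrite mul0r !mulr0.
  rewrite ccE /g chi_eq1// mul1r /rem subrKC -/(wk k z).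
  by ring.
Qed.

End Local.

(** * Assembling complex functionals from real ones *)

Section ComplexExponential.
Context {R : realType}.

Definition expint {n} (r : 'rV[R]_n -> R) (k : 'rV[R]_n) : R[i] :=
  Complex (oscint 0 r k) (oscint (- (pi / 2)) r k).

Lemma FTf_cR n (r : 'rV[R]_n -> R) : FTf (fun y => cR (r y)) = expint r.
Proof.
apply/funext => k; rewrite /FTf /cint /expint /oscint; congr Complex; congr intRn; apply/funext => y.
  by rewrite /cRe /osc /= mulr0 subr0 addr0.
by rewrite /cIm /osc cosBpihalf /= mulr0 add0r.
Qed.

Lemma expint_coord n (r : 'rV[R]_n -> R) j (k : 'rV[R]_n) : rapid r ->
  cR (k ord0 j) * expint r k = 'i%C * expint (pd j r) k.
Proof.
move=> rr; have rp := urapid_pd j rr.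
have H c : oscint (c + pi / 2) (pd j r) k = k ord0 j * oscint c r k by rewrite oscint_coord.
have H0 := H 0; have H1 := H (- (pi / 2)); rewrite addNr in H1.
have H2 : oscint (0 + pi / 2) (pd j r) k = - oscint (- (pi / 2)) (pd j r) k.
  rewrite /oscint -(intRnN (dec_intble (rapid_dec (rapid_osc k _ rp)))).
  congr intRn; apply/funext => y; rewrite /osc cosBpihalf add0r cosDpihalf.
  by rewrite mulNr.
apply: complex_ext; rewrite !(ReMc, ImMc) /=.
  by rewrite -H0 H2; ring.
by rewrite -H1; ring.
Qed.

Lemma expint_qmon n (r : 'rV[R]_n -> R) s (k : 'rV[R]_n) : rapid r ->
  cR (qmon s k) * expint r k = 'i%C ^+ size s * expint (iter_pd s r) k.
Proof.
elim/last_ind: s r => [|s j IH] r rr.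
  by rewrite /qmon big_nil expr0 (_ : cR 1 = 1) ?mul1r.
rewrite (_ : qmon (rcons s j) k = qmon s k * k ord0 j); last first.
  by rewrite /qmon -cats1 big_cat big_seq1.
rewrite cRM -mulrA expint_coord// mulrCA (IH _ (urapid_pd j rr)) size_rcons exprS.
by rewrite mulrA -cats1 iter_pd_cat.
Qed.

End ComplexExponential.

Section TemperateMultipliers.
Context {R : realType} {N M : nat}.
Local Notation Z := 'rV[R]_(N + M).

Lemma utemp_tensor (I : Type) (g : I -> 'rV[R]_N -> R) (f : I -> 'rV[R]_M -> R) :
  utemp g -> utemp f -> utemp (fun i (z : Z) => g i (lsubmx z) * f i (rsubmx z)).
Proof.
move=> [sg gC] [sf fC]; split=> [i|s].
  by apply: smoothM; [apply: smooth_lsubmx; exact: sg | apply: smooth_rsubmx; exact: sf].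
have [sl [sr E]] := @iter_pd_tensor R N M s.
have [L [C HC]] := gC sl; have [L' [D HD]] := fC sr; exists (L + L')%N, (`|C| * `|D|) => i z.
rewrite (E _ _ (sg i) (sf i)) normrM nW_lrsubmx.
have w1 := nW_ge1 (lsubmx z); have w2 := nW_ge1 (rsubmx z).
have p1 : 0 <= nW (lsubmx z) := ltW (nW_gt0 _); have p2 : 0 <= nW (rsubmx z) := ltW (nW_gt0 _).
apply: (@le_trans _ _ ((`|C| * nW (lsubmx z) ^+ L) * (`|D| * nW (rsubmx z) ^+ L'))).
  by apply: ler_pM => //; [apply: (le_trans (HC i _)) | apply: (le_trans (HD i _))];
    rewrite ler_wpM2r ?exprn_ge0// ler_norm.
rewrite mulrACA ler_wpM2l ?mulr_ge0// exprMn; apply: ler_pM; rewrite ?exprn_ge0//.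
  by rewrite ler_weXn2l// leq_addr.
by rewrite ler_weXn2l// leq_addl.
Qed.

Definition temperate {n} (X : 'rV[R]_n -> R) := utemp (fun _ : unit => X).
Definition ctemp {n} (X : 'rV[R]_n -> R[i]) := temperate (cRe X) /\ temperate (cIm X).

Lemma rapid_atom (X : 'rV[R]_N -> R) (f : 'rV[R]_M -> R) c (r : Z -> R) :
  temperate X -> rapid f -> rapid r ->
  rapid (fun z => X (lsubmx z) * f (rsubmx z) * oscint c r z).
Proof.
move=> tX rf rr.
have -> : (fun z => X (lsubmx z) * f (rsubmx z) * oscint c r z) =
    (fun z => oscint c r z * (X (lsubmx z) * f (rsubmx z))) by apply/funext => z; rewrite mulrC.
exact: (urapidM (urapid_oscint c rr) (utemp_tensor tX (urapid_temp rf))).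
Qed.

Variables (s : distr R (N + M)) (f : 'rV[R]_M -> R[i]).
Hypotheses (ts : tempered s) (sf : schwartz f).

(** The Fourier transform of the distribution X(y) s(y, x) f(x), tested on a real function [r]. *)
Definition SF (X : 'rV[R]_N -> R[i]) (r : Z -> R) : R[i] :=
  s (fun z => f (rsubmx z) * (X (lsubmx z) * expint r z)).

Local Notation hp := (- (pi / 2) : R).

(** The real building block: each of [s], [f], [X] and the exponential contributes a real and an
    imaginary part, so [SF] is a signed sum of sixteen such terms. *)
Definition atom (tau : (Z -> R) -> R) (g : 'rV[R]_M -> R) (X : 'rV[R]_N -> R) c r : R :=
  tau (fun z => X (lsubmx z) * g (rsubmx z) * oscint c r z).

Let f1 := cRe f.
Let f2 := cIm f.
Let rf1 : rapid f1 := proj1 (schwartz_rapid sf).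
Let rf2 : rapid f2 := proj2 (schwartz_rapid sf).

Let SF_Re X r : cRe (fun z : Z => f (rsubmx z) * (X (lsubmx z) * expint r z)) =
  fun z => (cRe X (lsubmx z) * f1 (rsubmx z) * oscint 0 r z
    + -1 * (cIm X (lsubmx z) * f1 (rsubmx z) * oscint hp r z))
    + (-1 * (cRe X (lsubmx z) * f2 (rsubmx z) * oscint hp r z)
    + -1 * (cIm X (lsubmx z) * f2 (rsubmx z) * oscint 0 r z)).
Proof.
apply/funext => z; rewrite /cRe /f1 /f2 !ReMc ImMc /cIm /cRe /=.
by set a := oscint 0 r z; set b := oscint hp r z; ring.
Qed.

Let SF_Im X r : cIm (fun z : Z => f (rsubmx z) * (X (lsubmx z) * expint r z)) =
  fun z => (cRe X (lsubmx z) * f1 (rsubmx z) * oscint hp r z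
    + cIm X (lsubmx z) * f1 (rsubmx z) * oscint 0 r z)
    + (cRe X (lsubmx z) * f2 (rsubmx z) * oscint 0 r z
    + -1 * (cIm X (lsubmx z) * f2 (rsubmx z) * oscint hp r z)).
Proof.
apply/funext => z; rewrite /cIm /f1 /f2 !ImMc ReMc /cIm /cRe /=.
by set a := oscint 0 r z; set b := oscint hp r z; ring.
Qed.

Lemma SF_schwartz X r : ctemp X -> rapid r ->
  schwartz (fun z : Z => f (rsubmx z) * (X (lsubmx z) * expint r z)).
Proof.
move=> [tX tY] rr.
have A c := rapid_atom c tX rf1 rr; have A2 c := rapid_atom c tX rf2 rr.
have B c := rapid_atom c tY rf1 rr; have B2 c := rapid_atom c tY rf2 rr.
apply: rapid_schwartz.
  rewrite SF_Re; exact: (urapidD (urapidD (A 0) (urapidZ (-1) (B hp)))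
    (urapidD (urapidZ (-1) (A2 hp)) (urapidZ (-1) (B2 0)))).
rewrite SF_Im; exact: (urapidD (urapidD (A hp) (B 0)) (urapidD (A2 0) (urapidZ (-1) (B2 hp)))).
Qed.

Lemma SF_parts X r : ctemp X -> rapid r -> SF X r =
  Complex
   ((atom (tauRe s) f1 (cRe X) 0 r + -1 * atom (tauRe s) f1 (cIm X) hp r)
     + (-1 * atom (tauRe s) f2 (cRe X) hp r + -1 * atom (tauRe s) f2 (cIm X) 0 r)
    + -1 * ((atom (tauIm s) f1 (cRe X) hp r + atom (tauIm s) f1 (cIm X) 0 r)
     + (atom (tauIm s) f2 (cRe X) 0 r + -1 * atom (tauIm s) f2 (cIm X) hp r)))
   ((atom (tauIm s) f1 (cRe X) 0 r + -1 * atom (tauIm s) f1 (cIm X) hp r)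
     + (-1 * atom (tauIm s) f2 (cRe X) hp r + -1 * atom (tauIm s) f2 (cIm X) 0 r)
    + ((atom (tauRe s) f1 (cRe X) hp r + atom (tauRe s) f1 (cIm X) 0 r)
     + (atom (tauRe s) f2 (cRe X) 0 r + -1 * atom (tauRe s) f2 (cIm X) hp r))).
Proof.
move=> tXY rr; have [tX tY] := tXY.
have A c := rapid_atom c tX rf1 rr; have A2 c := rapid_atom c tX rf2 rr.
have B c := rapid_atom c tY rf1 rr; have B2 c := rapid_atom c tY rf2 rr.
rewrite /SF (tempered_split ts (SF_schwartz tXY rr)) SF_Re SF_Im.
have E tau : rtempered tau ->
  tau (fun z => (cRe X (lsubmx z) * f1 (rsubmx z) * oscint 0 r z
    + -1 * (cIm X (lsubmx z) * f1 (rsubmx z) * oscint hp r z))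
    + (-1 * (cRe X (lsubmx z) * f2 (rsubmx z) * oscint hp r z)
    + -1 * (cIm X (lsubmx z) * f2 (rsubmx z) * oscint 0 r z))) =
  (atom tau f1 (cRe X) 0 r + -1 * atom tau f1 (cIm X) hp r)
     + (-1 * atom tau f2 (cRe X) hp r + -1 * atom tau f2 (cIm X) 0 r) /\
  tau (fun z => (cRe X (lsubmx z) * f1 (rsubmx z) * oscint hp r z
    + cIm X (lsubmx z) * f1 (rsubmx z) * oscint 0 r z)
    + (cRe X (lsubmx z) * f2 (rsubmx z) * oscint 0 r z
    + -1 * (cIm X (lsubmx z) * f2 (rsubmx z) * oscint hp r z))) =
  (atom tau f1 (cRe X) hp r + atom tau f1 (cIm X) 0 r)
     + (atom tau f2 (cRe X) 0 r + -1 * atom tau f2 (cIm X) hp r).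
  move=> tt'; split.
    rewrite (rtemperedD tt' (urapidD (A 0) (urapidZ (-1) (B hp)))
      (urapidD (urapidZ (-1) (A2 hp)) (urapidZ (-1) (B2 0)))).
    rewrite (rtemperedD tt' (A 0) (urapidZ (-1) (B hp))).
    rewrite (rtemperedD tt' (urapidZ (-1) (A2 hp)) (urapidZ (-1) (B2 0))).
    by rewrite (rtemperedZ (-1) tt' (B hp)) (rtemperedZ (-1) tt' (A2 hp)) (rtemperedZ (-1) tt' (B2 0)).
  rewrite (rtemperedD tt' (urapidD (A hp) (B 0)) (urapidD (A2 0) (urapidZ (-1) (B2 hp)))).
  rewrite (rtemperedD tt' (A hp) (B 0)) (rtemperedD tt' (A2 0) (urapidZ (-1) (B2 hp))).
  by rewrite (rtemperedZ (-1) tt' (B2 hp)).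
have [E1 E2] := E _ (rtempered_Re ts); have [E3 E4] := E _ (rtempered_Im ts).
rewrite E1 E2 E3 E4; congr Complex; by rewrite [X in _ = _ + X]mulN1r.
Qed.

Lemma SF_lin (a : R[i]) X Y r : ctemp X -> ctemp Y -> rapid r ->
  SF (fun y => a * X y + Y y) r = a * SF X r + SF Y r.
Proof.
move=> tX tY rr; have [sl _] := ts; rewrite /SF -sl; [|exact: SF_schwartz|exact: SF_schwartz].
congr s; apply/funext => z; rewrite [(_ + Y _) * _]mulrDl mulrDr; congr (_ + _).
by rewrite -mulrA mulrCA.
Qed.

(** Here the factors y gained from the decomposition of the shell function turn into derivatives on
    the test function. *)
Lemma SF_qmon w X r : ctemp X -> rapid r ->
  SF (fun y => cR (qmon w y) * X y) r = 'i%C ^+ size w * SF X (iter_pd (lmap w) r).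
Proof.
move=> tX rr; have rp := urapid_iter_pd (lmap w) rr; have [sl _] := ts.
have t0 : ctemp (fun _ : 'rV[R]_N => 0 : R[i]).
  by split; apply: (@utemp_cst _ _ _ (fun=> 0) 0) => _; rewrite normr0.
have Z0 : SF (fun y => 0) (iter_pd (lmap w) r) = 0.
  have E := SF_lin 1 t0 t0 rp.
  have F : (fun _ : 'rV[R]_N => 1 * 0 + 0 : R[i]) = fun=> 0 by apply/funext => y; rewrite mulr0 addr0.
  rewrite F mul1r in E; move/eqP: E.
  by rewrite -subr_eq0 opprD addrA subrr add0r oppr_eq0 => /eqP.
have := SF_lin ('i%C ^+ size w) tX t0 rp; rewrite Z0 addr0 => <-.
congr s; apply/funext => z; congr (_ * _); rewrite addr0.
have -> : qmon w (lsubmx z) = qmon (lmap w) z.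
  by rewrite /qmon big_map; apply: eq_bigr => j _; rewrite mxE.
rewrite mulrAC expint_qmon// size_map.
by rewrite -[RHS]mulrA [RHS]mulrCA [RHS]mulrC -mulrA.
Qed.

End TemperateMultipliers.

Section ComplexLimits.
Context {R : realType} {N M : nat}.
Local Notation Z := 'rV[R]_(N + M).

Definition cclimit (rho delta : R) (S : nat -> (Z -> R) -> R[i]) : Prop :=
  climit rho delta (fun k r => complex.Re (S k r)) /\ climit rho delta (fun k r => complex.Im (S k r)).

Lemma cclimit_add rho delta (S V : nat -> (Z -> R) -> R[i]) :
  cclimit rho delta S -> cclimit rho delta V -> cclimit rho delta (fun k r => S k r + V k r).
Proof.
move=> [S1 S2] [V1 V2]; split.
  by apply: climit_ext (climit_add S1 V1) _ => k r _; rewrite ReDc.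
by apply: climit_ext (climit_add S2 V2) _ => k r _; rewrite ImDc.
Qed.

Lemma cclimit_scale rho delta (a : R[i]) (S : nat -> (Z -> R) -> R[i]) :
  cclimit rho delta S -> cclimit rho delta (fun k r => a * S k r).
Proof.
move=> [S1 S2]; split.
  apply: climit_ext (climit_add (climit_scale (complex.Re a) S1) (climit_scale (- complex.Im a) S2)) _.
  by move=> k r _; rewrite ReMc mulNr.
apply: climit_ext (climit_add (climit_scale (complex.Re a) S2) (climit_scale (complex.Im a) S1)) _.
by move=> k r _; rewrite ImMc.
Qed.

Lemma cclimit_ext rho delta (S V : nat -> (Z -> R) -> R[i]) : cclimit rho delta S ->
  (forall n r, btest rho r -> S n r = V n r) -> cclimit rho delta V.
Proof.
by move=> [S1 S2] E; split; [apply: climit_ext S1 _ | apply: climit_ext S2 _] => k r br; rewrite E.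
Qed.

Lemma cclimit_sum rho delta (I : eqType) (l : seq I) (S : I -> nat -> (Z -> R) -> R[i]) :
  (forall i, i \in l -> cclimit rho delta (S i)) ->
  cclimit rho delta (fun k r => \sum_(i <- l) S i k r).
Proof.
elim: l => [|i l IH] cS.
  by split; apply: climit_ext (climit_zero _ _) _ => k r _; rewrite big_nil.
have cl j : j \in l -> cclimit rho delta (S j) by move=> jl; apply: cS; rewrite inE jl orbT.
apply: cclimit_ext (cclimit_add (cS i (mem_head _ _)) (IH cl)) _ => k r _.
by rewrite big_cons.
Qed.

Lemma cclimit_iter_pd rho delta s (S : nat -> (Z -> R) -> R[i]) : cclimit rho (delta + (size s)%:R) S ->
  cclimit rho delta (fun k r => S k (iter_pd (lmap s) r)).
Proof. by move=> [S1 S2]; split; exact: (climit_iter_pd (S := fun k r => _ (S k r))). Qed.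

End ComplexLimits.

(** * Convolution in the variable q *)

Section Convolution.
Context {R : realType} {N M : nat}.
Local Notation Z := 'rV[R]_(N + M).
Implicit Types (kap : 'rV[R]_N -> R) (r : Z -> R) (lam : R).

Definition kconv kap lam r (z : Z) : R := intRn (fun p => kap p * r (z + padr ((- lam) *: p))).

Lemma rapid_bounded n (r : 'rV[R]_n -> R) : rapid r -> exists C, 0 <= C /\ forall z, `|r z| <= C.
Proof. by move=> /rapid_dec/dec_bounded. Qed.

Lemma conv_integrand_dec kap lam r z : rapid kap -> rapid r ->
  dec (fun p => kap p * r (z + padr ((- lam) *: p))).
Proof.
move=> rk rr; have [C [C0 HC]] := rapid_bounded rr.
have [E [_ HE]] := integral_bound 0 rk.
have cr := smooth_continuous (proj1 rr tt).
have cs := @cont_slicel _ _ _ _ z (@cont_translate R N M r (- lam) cr).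
have wB P : `|r (z + padr ((- lam) *: P))| <= C * nW P ^+ 0 by rewrite expr0 mulr1.
by have [] := HE tt _ C cs wB.
Qed.

Lemma conv_continuous kap lam r : rapid kap -> rapid r -> continuous (kconv kap lam r).
Proof.
move=> rk rr; apply: contP => z.
have [ck [Ck HCk]] := rapid_dec rk; have [C [C0 HC]] := rapid_bounded rr.
have cr := smooth_continuous (proj1 rr tt).
have ct := @cont_translate R N M r (- lam) cr.
rewrite /kconv; apply: (@intRn_continuous_param R _ N (fun p (z : Z) => kap p * r (z + padr ((- lam) *: p))) z (Ck * C)).
- by move=> y; exact/dec_intble/conv_integrand_dec.
- move=> P; apply: contM; last exact: ct.
  by apply: (@cont_comp _ _ _ fst kap); [exact: contfst | exact: ck].
- apply: filterE => y P; rewrite normrM mulrAC.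
  by apply: ler_pM; rewrite ?mulr_ge0 ?exprn_ge0 ?(ltW (nW_gt0 _)).
Qed.

Lemma has_pd_conv kap lam r j : rapid kap -> rapid r ->
  has_pd j (kconv kap lam r) (kconv kap lam (pd j r)).
Proof.
move=> rk rr z; have rp := urapid_pd j rr; have sr := proj1 rr tt.
have [C [C0 HC]] := rapid_bounded rp; have [ck [Ck HCk]] := rapid_dec rk.
pose F (h : R) p := kap p * r (z + h *: evec j + padr ((- lam) *: p)).
pose F' (h : R) p := kap p * pd j r (z + h *: evec j + padr ((- lam) *: p)).
have dF h : dec (F h) by exact: conv_integrand_dec.
have isF (h : R) p : `|h| <= 1 -> is_derive h 1 (F ^~ p) (F' h p).
  move=> _; pose b := z + padr ((- lam) *: p).
  have D : is_derive h 1 (fun t : R => r (b + t *: evec j)) (pd j r (b + h *: evec j)).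
    by apply: (@is_derive_line _ _ r (pd j r)) => {}x; exact: smooth_has_pd.
  have := @is_deriveZ _ _ _ (fun t : R => r (b + t *: evec j)) (kap p) h 1 _ D.
  rewrite /F /F' [z + h *: _ + _]addrAC -/b.
  have -> // : (fun t : R => kap p * r (z + t *: evec j + padr (- lam *: p))) =
      (fun t : R => kap p *: r (b + t *: evec j)).
  by apply/funext => t; rewrite addrAC.
have cp := smooth_continuous (smooth_pd j sr).
have cF' p : {for (p, 0 : R), continuous (fun q : 'rV[R]_N * R => F' q.2 q.1)}.
  apply: contM; first by apply: (@cont_comp _ _ _ fst kap); [exact: contfst | exact: ck].
  apply: (@cont_comp _ _ _ (fun q : 'rV[R]_N * R => (q.1, z + q.2 *: evec j))
    (fun q : 'rV[R]_N * Z => pd j r (q.2 + padr ((- lam) *: q.1)))).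
    apply: cont_pair; first exact: contfst.
    by apply: contDV; [exact: contC | apply: contZV; [exact: contsnd | exact: contC]].
  exact: (@cont_translate R N M (pd j r) (- lam) cp).
have bF (h : R) p : `|h| <= 1 -> `|F' h p| * nW p ^+ 2 <= Ck * C.
  move=> _; rewrite normrM mulrAC.
  by apply: ler_pM; rewrite ?mulr_ge0 ?exprn_ge0 ?(ltW (nW_gt0 _)).
have [_ D] := intRn_derive dF isF cF' bF.
have -> // : kconv kap lam (pd j r) z = intRn (F' 0).
by rewrite /kconv /F' scale0r addr0.
Qed.

Lemma smooth_conv kap lam r : rapid kap -> rapid r -> smooth (kconv kap lam r).
Proof.
move=> rk rr; apply: (@smooth_coind _ _ (fun g => exists r, rapid r /\ g = kconv kap lam r));
  last by exists r.
move=> _ [{rr}r [rr ->]]; split; first exact: conv_continuous.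
move=> j; exists (kconv kap lam (pd j r)); last exact: has_pd_conv.
by exists (pd j r); split=> //; exact: urapid_pd.
Qed.

Lemma iter_pd_conv kap lam r s : rapid kap -> rapid r ->
  iter_pd s (kconv kap lam r) = kconv kap lam (iter_pd s r).
Proof.
move=> rk rr; elim: s => [//|j s IH]; rewrite iter_pd_cons IH.
by apply: has_pdE; apply: has_pd_conv => //; exact: urapid_iter_pd.
Qed.

Definition kernel_supp kap lam (B : R) := forall p, kap p != 0 -> forall i, `|lam * p ord0 i| <= B.

Lemma conv_integrand0 kap lam r rho B (z : Z) i : kernel_supp kap lam B -> 0 <= B -> btest rho r ->
  rho + B < `|z ord0 i| -> forall p, kap p * r (z + padr ((- lam) *: p)) = 0.
Proof.
move=> kB B0 [_ r0] zi p; have [->|pn0] := eqVneq (kap p) 0; first by rewrite mul0r.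
rewrite (r0 _ i) ?mulr0//.
have zp : `|(padr (- lam *: p) : Z) ord0 i| <= B.
  rewrite /padr; case: (split_ordP i) => j ->; last by rewrite row_mxEr mxE normr0.
  by rewrite row_mxEl mxE mulNr normrN; exact: kB.
rewrite mxE; have := ler_normB (z ord0 i + padr (- lam *: p) ord0 i) (padr (- lam *: p) ord0 i).
by rewrite addrK; move: zi zp; lra.
Qed.

Lemma conv_supp kap lam r rho B (z : Z) i : kernel_supp kap lam B -> 0 <= B -> btest rho r ->
  rho + B < `|z ord0 i| -> kconv kap lam r z = 0.
Proof.
move=> kB B0 br zi; rewrite /kconv -[RHS](intRn0 N); congr intRn; apply/funext => p.
exact: (conv_integrand0 kB B0 br zi).
Qed.

Lemma oscint_half_turn n (psi : 'rV[R]_n -> R) k : rapid psi ->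
  oscint (- (pi / 2) - pi / 2) psi k = - oscint 0 psi k.
Proof.
move=> rp; rewrite /oscint -intRnN; last exact/dec_intble/rapid_dec/rapid_osc.
congr intRn; apply/funext => y; rewrite /osc.
rewrite [X in cos X * _](_ : _ = dotp k y - pi / 2 - pi / 2); last by rewrite addrA.
by rewrite cosBpihalf sinBpihalf addr0 mulNr.
Qed.

(** The convolution theorem in real form: translating [r] by lam p turns the phase of its transform,
    and the addition formula separates [kap] from [r]. *)
Lemma oscint_conv kap lam r rho B c (k : Z) : rapid kap -> btest rho r -> 0 < rho ->
  kernel_supp kap lam B -> 0 <= B ->
  oscint c (kconv kap lam r) k =
  oscint 0 kap (lam *: lsubmx k) * oscint c r k -
  oscint (- (pi / 2)) kap (lam *: lsubmx k) * oscint (c - pi / 2) r k.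
Proof.
move=> rk br rho0 kB B0; have rr := btest_rapid br.
have b0 : 0 < rho + B by rewrite ltr_wpDr.
(* The wave alone does not decay, so Fubini is applied to its cutoff; the cutoff is 1 on the support
   of the convolution. *)
pose g z := chi (rho + B) z * osc k c z.
have rchi : rapid (@chi R (N + M) (rho + B)).
  apply: supp_rapid; first exact: smooth_chi.
  exists (2 * (rho + B)); split; first by rewrite mulr_gt0.
  by move=> x i h; apply: chi_eq0; exact: ltW h.
have dg : dec g by exact/rapid_dec/rapid_mul_osc.
have gE z p : g z * (kap p * r (z + padr ((- lam) *: p))) =
    osc k c z * (kap p * r (z + padr ((- lam) *: p))).
  have [zb|/existsNP[i /negP]] := pselect (forall i, `|z ord0 i| <= rho + B).
    by rewrite /g chi_eq1// mul1r.
  by rewrite -ltNge => zi; rewrite (conv_integrand0 kB B0 br zi) !mulr0.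
have di z := conv_integrand_dec lam z rk rr.
have -> : oscint c (kconv kap lam r) k = intRn (fun z => g z * kconv kap lam r z).
  congr intRn; apply/funext => z; rewrite /kconv -!(intRnZ _ (dec_intble (di z))).
  by congr intRn; apply/funext => p; rewrite gE.
have cr := smooth_continuous (proj1 rr tt).
rewrite (translate_Fubini (- lam) (rapid_dec rk) dg cr); last first.
  by have [C [_ HC]] := rapid_bounded rr; exists C.
have E p : kap p * intRn (fun z => g z * r (z + padr ((- lam) *: p))) =
    oscint c r k * (osc (lam *: lsubmx k) 0 p * kap p) +
    - oscint (c - pi / 2) r k * (osc (lam *: lsubmx k) (- (pi / 2)) p * kap p).
  have [->|pn0] := eqVneq (kap p) 0; first by rewrite !mulr0 mul0r addr0.
  have -> : intRn (fun z => g z * r (z + padr ((- lam) *: p))) =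
      oscint c (fun z => r (z + padr ((- lam) *: p))) k.
    congr intRn; apply/funext => z; apply: (mulfI pn0).
    by rewrite [LHS]mulrCA [RHS]mulrCA gE.
  have dk : dotp k (padr ((- lam) *: p)) = - dotp (lam *: lsubmx k) p.
    rewrite /dotp big_split_ord/= [X in _ + X]big1 ?addr0 => [|i _]; last first.
      by rewrite /padr row_mxEr mxE mulr0.
    rewrite -sumrN; apply: eq_bigr => i _; rewrite /padr row_mxEl !mxE.
    by rewrite mulNr mulrN mulrCA mulrA.
  rewrite (oscint_shift c _ k rr) dk (oscint_phase _ _ _ rr) cosN sinN.
  rewrite /osc cosBpihalf addr0.
  set O1 := oscint c r k; set O2 := oscint (c - _) r k; set C := cos _; set S := sin _.
  by ring.
have d1 := rapid_dec (rapid_osc (lam *: lsubmx k) 0 rk).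
have d2 := rapid_dec (rapid_osc (lam *: lsubmx k) (- (pi / 2)) rk).
under eq_fun do rewrite E.
rewrite (intRnD (intbleZ _ (dec_intble d1)) (intbleZ _ (dec_intble d2))).
rewrite (intRnZ _ (dec_intble d1)) (intRnZ _ (dec_intble d2)) -!/(oscint _ _ _) mulNr.
by rewrite [X in X - _]mulrC [X in _ - X]mulrC.
Qed.

Lemma expint_conv kap lam r rho B (k : Z) : rapid kap -> btest rho r -> 0 < rho ->
  kernel_supp kap lam B -> 0 <= B ->
  expint (kconv kap lam r) k = expint kap (lam *: lsubmx k) * expint r k.
Proof.
move=> rk br rho0 kB B0; have rr := btest_rapid br.
apply: complex_ext; rewrite ?ReMc ?ImMc /= (oscint_conv _ _ rk br rho0 kB B0).
  by rewrite sub0r.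
by rewrite (oscint_half_turn k rr) mulrN opprK.
Qed.

Lemma near_ker_supp kap (R0 : R) n : kernel_supp (near_ker kap R0 n) (dyad n) (2 * R0).
Proof.
move=> p; rewrite /near_ker mulf_eq0 negb_or => /andP[c0 _] i.
by have := chi_neq0 i c0; rewrite mxE.
Qed.

Lemma conv_testfn kap lam r rho B (O : set Z) : rapid kap -> btest rho r -> kernel_supp kap lam B ->
  0 <= B -> (forall z : Z, (forall i, `|z ord0 i| <= rho + B) -> O z) ->
  testfn O (fun z => cR (kconv kap lam r z)).
Proof.
move=> rk br kB B0 OB; split.
  by split; [apply: smooth_conv => //; exact: btest_rapid br | exact: smooth_cst].
exists [set z : Z | forall i, `|z ord0 i| <= rho + B]; split; first exact: box_compact.
split; first by move=> z /= zb; exact: OB.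
move=> z /= /existsNP[i /negP]; rewrite -ltNge => zi.
by rewrite (conv_supp kB B0 br zi).
Qed.

End Convolution.

Section NormComparison.
Context {R : realType}.

Lemma enorm_le_n1 n (x : 'rV[R]_n) : enorm x <= n1 x.
Proof.
rewrite /enorm -[leRHS]ger0_norm ?n1_ge0// -sqrtr_sqr ler_sqrt ?sqr_ge0//.
rewrite expr2 {1}/n1 mulr_suml; apply: ler_sum => i _.
rewrite -real_normK ?num_real// expr2 ler_wpM2l//.
by rewrite /n1 (bigD1 i)//= lerDl sumr_ge0.
Qed.

Lemma n1_le_enorm n (x : 'rV[R]_n) : n1 x <= n%:R * enorm x.
Proof.
apply: n1_le => i; rewrite /enorm -sqrtr_sqr ler_sqrt; last by apply: sumr_ge0 => j _; exact: sqr_ge0.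
by rewrite (bigD1 i)//= lerDl sumr_ge0// => j _; exact: sqr_ge0.
Qed.

(** Equality on the right would make [eps] an integer; this is where 0 < eps < 1 enters. *)
Lemma nonint_ceil (d : int) (eps b : R) (l : nat) : 0 < eps < 1 -> b = d%:~R - eps + l%:R ->
  0 < b -> exists m : nat, m%:R < b /\ b < m.+1%:R.
Proof.
move=> /andP[e0 e1] bE b0; have [[|m] [m0 bm mb]] := ceil_exists b0; first by [].
exists m; split; first exact: mb.
rewrite lt_neqAle bm andbT; apply/eqP => bE2.
have E : eps = (d + l%:Z - m.+1%:Z)%:~R.
  by rewrite rmorphB rmorphD /= -!pmulrn -bE2 bE; ring.
move: e0 e1; rewrite E ltr0z -[1]/(1%:~R) ltr_int => h1 h2.
by move: (lt_le_trans h2 h1); rewrite ltxx.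
Qed.

End NormComparison.

Section KernelLimit.
Context {R : realType} {N M : nat}.
Local Notation Z := 'rV[R]_(N + M).

(** [v] is only controlled on [O], so continuity at other points has to come from the cutoff, which
    vanishes in a neighbourhood of each of them. *)
Lemma cutoff_dec (O : set Z) (v : Z -> R) (rho1 : R) : 0 < rho1 ->
  (forall z : Z, (forall i, `|z ord0 i| <= 2 * rho1) -> O z) ->
  (forall z, O z -> {for z, continuous v}) -> dec (fun z => chi rho1 z * v z).
Proof.
move=> r0 bO cv; apply: (@dec_compact _ _ _ [set z : Z | forall i, `|z ord0 i| <= 2 * rho1]).
- apply: contP => z; have [zO|nz] := pselect (O z).
    by apply: contM; [exact: chi_continuous | exact: cv].
  have /existsNP[i /negP] : ~ (forall i, `|z ord0 i| <= 2 * rho1) by move=> h; exact: nz (bO z h).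
  rewrite -ltNge => zi; apply: cont_eps => e e0.
  have e1 : 0 < `|z ord0 i| - 2 * rho1 by rewrite subr_gt0.
  have cn : {for z, continuous (fun z : Z => `|z ord0 i|)} by apply: cont_norm; exact: coordc.
  apply: nearS (cont_near cn e1) => y hy.
  rewrite (chi_eq0 (ltW zi)) mul0r subr0 (@chi_eq0 _ _ _ _ i) ?mul0r ?normr0 ?(ltW e0)//.
  by move: hy; rewrite ler_norml => /andP[h _]; move: h; lra.
- exact: box_compact.
- by move=> z /= /existsNP[i /negP]; rewrite -ltNge => /ltW/chi_eq0 ->; rewrite mul0r.
Qed.

Lemma perm_liftN (al : 'I_N -> nat) : perm_eq (mseq (@liftN N M al)) (lmap (mseq al)).
Proof.
apply/allP => i _ /=; rewrite count_mseq /liftN; apply/eqP.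
case: (split_ordP i) => j ->.
  rewrite /lmap count_map -(count_mseq al j); apply: eq_count => k /=.
  by rewrite (inj_eq (@lshift_inj _ _)).
rewrite /lmap count_map (@eq_count _ _ pred0) ?count_pred0// => k /=.
by rewrite eq_lrshift.
Qed.

Lemma Dr_liftN (al : 'I_N -> nat) (r : Z -> R) : smooth r ->
  Dr (liftN al) r = iter_pd (lmap (mseq al)) r.
Proof. by move=> sr; apply: iter_pd_perm => //; exact: perm_liftN. Qed.

Variables (kap : 'rV[R]_N -> R) (rk : rapid kap).

Lemma rapid_near (R0 : R) : 0 < R0 -> urapid (near_ker kap R0).
Proof.
move=> R00; have uk : urapid (fun _ : nat => kap) := urapid_reindex (fun _ : nat => tt) rk.
have := urapidD uk (urapidZ (-1) (urapid_far0 rk R00)).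
have -> // : (fun (i : nat) x => kap x + -1 * far_ker kap R0 i x) = near_ker kap R0.
by apply/funext => k; apply/funext => x; rewrite /far_ker /near_ker; ring.
Qed.

(** Origin of the factor 6: a test function lives in the box of size rho, the near kernel spreads it
    to 3 rho, and a cutoff equal to 1 there is supported in 6 rho. *)
Lemma climit_near (O : set Z) (v : Z -> R) (rho C a b : R) (L : nat) w :
  0 < rho -> 0 < a -> b + (size w)%:R = a + L%:R -> (0 < L)%N ->
  (exists m : nat, m%:R < a + L%:R /\ a + L%:R < m.+1%:R) ->
  (forall z : Z, (forall i, `|z ord0 i| <= 6 * rho) -> O z) ->
  (forall z, O z -> {for z, continuous v}) ->
  (forall z, O z -> `|v z| <= C * powR (n1 (lsubmx z)) a) ->
  climit rho b (fun k r => dyad k ^+ L *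
    intRn (fun z => v z * iter_pd (lmap w) (kconv (near_ker kap rho k) (dyad k) r) z)).
Proof.
move=> rho0 a0 bE L0 [m [ma am]] bO cv vC.
have r3 : 0 < rho + 2 * rho by rewrite addr_gt0// mulr_gt0.
have E6 : 2 * (rho + 2 * rho) = 6 * rho by ring.
have bO' (z : Z) : (forall i, `|z ord0 i| <= 2 * (rho + 2 * rho)) -> O z by rewrite E6; exact: bO.
have dw := cutoff_dec r3 bO' cv.
have [Cz [Cz0 HCz]] := @chi_bounded R (N + M) _ r3.
have wb z : `|chi (rho + 2 * rho) z * v z| <= Cz * `|C| * powR (n1 (lsubmx z)) a.
  rewrite normrM; have [zO|nz] := pselect (O z).
    rewrite -mulrA; apply: ler_pM => //; apply: (le_trans (vC z zO)).
    by rewrite ler_wpM2r ?powR_ge0// ler_norm.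
  have /existsNP[i /negP] : ~ (forall i, `|z ord0 i| <= 2 * (rho + 2 * rho)) by move=> h; exact: nz (bO' z h).
  by rewrite -ltNge => /ltW/chi_eq0 ->; rewrite normr0 mul0r !mulr_ge0 ?powR_ge0.
have un := rapid_near rho0.
have H := climit_local un dw a0 (mulr_ge0 Cz0 (normr_ge0 C)) wb L0 ma am rho0.
rewrite -bE in H; have {}H := climit_iter_pd H.
apply: climit_ext H _ => k r br; congr (_ * _); congr intRn; apply/funext => z.
have nk := urapid_rapid k un; have rr := btest_rapid br.
rewrite (iter_pd_conv _ _ nk rr) -/(kconv (near_ker kap rho k) (dyad k) (iter_pd (lmap w) r) z).
have [zb|/existsNP[i /negP]] := pselect (forall i, `|z ord0 i| <= rho + 2 * rho).
  by rewrite chi_eq1// mul1r.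
rewrite -ltNge => zi.
have r2 : 0 <= 2 * rho by rewrite mulr_ge0// ltW.
by rewrite (conv_supp (@near_ker_supp R N kap rho k) r2 (btest_iter_pd _ br) zi) !mulr0.
Qed.

End KernelLimit.

Section KernelSeries.
Context {R : realType} {N M : nat}.
Local Notation Z := 'rV[R]_(N + M).
Variables (s : distr R (N + M)) (f : 'rV[R]_M -> R[i]) (d : int) (eps : R) (L : nat).
Local Notation delta := (d%:~R - eps).
Hypotheses (ts : tempered s) (sf : schwartz f) (eps01 : 0 < eps < 1) (L0 : (0 < L)%N).
Hypothesis dL0 : 0 < delta + L%:R.

Lemma ctemp_expint (kap : 'rV[R]_N -> R) k : rapid kap ->
  ctemp (fun y => expint kap (dyad k *: y)).
Proof.
move=> rk; have H c : temperate (fun y => oscint c kap (dyad k *: y)).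
  have ro := urapid_oscint c rk; have so := proj1 ro tt.
  apply: (@utemp_dilate R N unit (fun=> dyad k) (oscint c kap)) => //.
    by move=> _; rewrite norm_dyad dyad_le1.
  move=> w; have [_ /(_ w 0%N)[C HC]] := ro; exists C => x.
  by have := HC tt x; rewrite expr0 mulr1.
by split; exact: H.
Qed.

Lemma cclimit_far (kap : 'rV[R]_N -> R) (rho : R) : rapid kap -> 0 < rho ->
  cclimit rho (delta + L%:R) (fun k r =>
    cR (dyad k ^+ L) * SF s f (fun y => expint (far_ker kap rho k) (dyad k *: y)) r).
Proof.
move=> rk r0; have [rf1 rf2] := schwartz_rapid sf.
have at_ (tau : (Z -> R) -> R) (g : 'rV[R]_M -> R) c0 c : rtempered tau -> rapid g -> climit rho (delta + L%:R) (fun k r =>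
    dyad k ^+ L * atom tau g (fun y => oscint c0 (far_ker kap rho k) (dyad k *: y)) c r).
  by move=> tt' rg; exact: (climit_nonlocal c0 c tt' rg rk r0 r0 dL0 L0).
have neg (tau : (Z -> R) -> R) (g : 'rV[R]_M -> R) c0 c : rtempered tau -> rapid g -> climit rho (delta + L%:R) (fun k r =>
    dyad k ^+ L * (-1 * atom tau g (fun y => oscint c0 (far_ker kap rho k) (dyad k *: y)) c r)).
  move=> tt' rg; have H1 := at_ tau g c0 c tt' rg; have H2 := climit_scale (-1) H1.
  by apply: climit_ext H2 _ => k r _; rewrite mulrCA.
have add (S V : nat -> (Z -> R) -> R) :
  climit rho (delta + L%:R) (fun k r => dyad k ^+ L * S k r) ->
  climit rho (delta + L%:R) (fun k r => dyad k ^+ L * V k r) ->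
  climit rho (delta + L%:R) (fun k r => dyad k ^+ L * (S k r + V k r)).
  by move=> cS cV; apply: climit_ext (climit_add cS cV) _ => k r _; rewrite mulrDr.
have scl (S : nat -> (Z -> R) -> R) :
  climit rho (delta + L%:R) (fun k r => dyad k ^+ L * S k r) ->
  climit rho (delta + L%:R) (fun k r => dyad k ^+ L * (-1 * S k r)).
  by move=> cS; apply: climit_ext (climit_scale (-1) cS) _ => k r _; rewrite mulrCA.
have tR := rtempered_Re ts; have tI := rtempered_Im ts.
have tf k : ctemp (fun y => expint (far_ker kap rho k) (dyad k *: y)).
  by apply: ctemp_expint; exact: (urapid_rapid k (urapid_far0 rk r0)).
pose X c k (y : 'rV[R]_N) := oscint c (far_ker kap rho k) (dyad k *: y).
pose RE (tau : (Z -> R) -> R) k (r : Z -> R) : R := (atom tau (cRe f) (X 0 k) 0 r + -1 * atom tau (cRe f) (X (- (pi / 2)) k) (- (pi / 2)) r)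
  + (-1 * atom tau (cIm f) (X 0 k) (- (pi / 2)) r + -1 * atom tau (cIm f) (X (- (pi / 2)) k) 0 r).
pose IM (tau : (Z -> R) -> R) k (r : Z -> R) : R := (atom tau (cRe f) (X 0 k) (- (pi / 2)) r + atom tau (cRe f) (X (- (pi / 2)) k) 0 r)
  + (atom tau (cIm f) (X 0 k) 0 r + -1 * atom tau (cIm f) (X (- (pi / 2)) k) (- (pi / 2)) r).
pose hp : R := - (pi / 2).
have cRE (tau : (Z -> R) -> R) : rtempered tau -> climit rho (delta + L%:R) (fun k r => dyad k ^+ L * RE tau k r).
  move=> tt'; exact: (add _ _ (add _ _ (at_ tau _ 0 0 tt' rf1) (neg tau _ hp hp tt' rf1))
    (add _ _ (neg tau _ 0 hp tt' rf2) (neg tau _ hp 0 tt' rf2))).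
have cIM (tau : (Z -> R) -> R) : rtempered tau -> climit rho (delta + L%:R) (fun k r => dyad k ^+ L * IM tau k r).
  move=> tt'; exact: (add _ _ (add _ _ (at_ tau _ 0 hp tt' rf1) (at_ tau _ hp 0 tt' rf1))
    (add _ _ (at_ tau _ 0 0 tt' rf2) (neg tau _ hp hp tt' rf2))).
have E k r : btest rho r -> SF s f (fun y => expint (far_ker kap rho k) (dyad k *: y)) r =
    Complex (RE (tauRe s) k r + -1 * IM (tauIm s) k r) (RE (tauIm s) k r + IM (tauRe s) k r).
  by move=> br; rewrite (SF_parts ts sf (tf k) (btest_rapid br)).
split.
  apply: climit_ext (add _ _ (cRE _ tR) (scl _ (cIM _ tI))) _ => k r br.
  by rewrite (E k r br) ReMc /= mul0r subr0.
apply: climit_ext (add _ _ (cRE _ tI) (cIM _ tR)) _ => k r br.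
by rewrite (E k r br) ImMc /= mul0r addr0.
Qed.

Variables (O : set Z) (K : nat) (ua : {ffun 'I_N -> 'I_K.+1} -> Z -> R[i]).
Hypothesis uac : forall a z, O z ->
  {for z, continuous (cRe (ua a))} /\ {for z, continuous (cIm (ua a))}.
Hypothesis ua0 : forall a, delta + (mabs (ordmi a))%:R < 0 -> forall z, O z -> ua a z = 0.
Hypothesis uab : forall a, exists C : R, forall z, O z ->
  cabs (ua a z) <= C * powR (enorm (lsubmx z)) (delta + (mabs (ordmi a))%:R).
Hypothesis uaE : forall g, testfn O g ->
  FTd (tprod s f) g = \sum_a (-1) ^+ (mabs (ordmi a)) *
    cint (fun z => ua a z * Dc (liftN (ordmi a)) g z).
Variable rho : R.
Hypotheses (rho0 : 0 < rho) (rhoO : forall z : Z, (forall i, `|z ord0 i| <= 6 * rho) -> O z).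

Lemma near_sum (kap : 'rV[R]_N -> R) k r : rapid kap -> btest rho r ->
  SF s f (fun y => expint (near_ker kap rho k) (dyad k *: y)) r =
  \sum_a (-1) ^+ (mabs (ordmi a)) * Complex
    (intRn (fun z => cRe (ua a) z *
      iter_pd (lmap (mseq (ordmi a))) (kconv (near_ker kap rho k) (dyad k) r) z))
    (intRn (fun z => cIm (ua a) z *
      iter_pd (lmap (mseq (ordmi a))) (kconv (near_ker kap rho k) (dyad k) r) z)).
Proof.
move=> rk br; have rn := urapid_rapid k (rapid_near rk rho0).
have r2 : 0 <= 2 * rho by rewrite mulr_ge0// ltW.
have ks := @near_ker_supp R N kap rho k.
have tg : testfn O (fun z => cR (kconv (near_ker kap rho k) (dyad k) r z)).
  apply: (conv_testfn rn br ks r2) => z zb; apply: rhoO => i; apply: (le_trans (zb i)).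
  by move: rho0; lra.
have -> : SF s f (fun y => expint (near_ker kap rho k) (dyad k *: y)) r =
    FTd (tprod s f) (fun z => cR (kconv (near_ker kap rho k) (dyad k) r z)).
  rewrite /FTd /tprod /SF FTf_cR; congr s; apply/funext => z; congr (_ * _).
  by rewrite (expint_conv z rn br rho0 ks r2).
rewrite (uaE tg); apply: eq_bigr => a _; congr (_ * _); rewrite /cint.
have sk : smooth (kconv (near_ker kap rho k) (dyad k) r) by apply: smooth_conv => //; exact: btest_rapid br.
have Dz z : Dc (liftN (ordmi a)) (fun z => cR (kconv (near_ker kap rho k) (dyad k) r z)) z =
    cR (iter_pd (lmap (mseq (ordmi a))) (kconv (near_ker kap rho k) (dyad k) r) z).
  by rewrite -(Dr_liftN _ sk); apply: complex_ext => //; rewrite /= /Dr /cIm /= iter_pd0.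
congr Complex; congr intRn; apply/funext => z.
  by rewrite {1}/cRe Dz ReMc [complex.Im (cR _)]/= mulr0 subr0.
by rewrite {1}/cIm Dz ImMc [complex.Im (cR _)]/= mulr0 add0r.
Qed.

Lemma int_neq_eps n : delta + n%:R != 0.
Proof.
apply/eqP => E; move: eps01 => /andP[e0 e1].
have E2 : eps = (d + n%:Z)%:~R by rewrite rmorphD /= -pmulrn; move: E; lra.
move: e0 e1; rewrite E2 ltr0z -[1]/(1%:~R) ltr_int => h1 h2.
by move: (lt_le_trans h2 h1); rewrite ltxx.
Qed.

(** The terms are sorted by the sign of delta + |a|: negative ones vanish by assumption, positive
    ones are covered by [climit_near], and zero is impossible. The |a| derivatives on the test
    function cancel the gain |a| in the exponent. *)
Lemma cclimit_near (kap : 'rV[R]_N -> R) : rapid kap ->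
  cclimit rho (delta + L%:R) (fun k r =>
    cR (dyad k ^+ L) * SF s f (fun y => expint (near_ker kap rho k) (dyad k *: y)) r).
Proof.
move=> rk.
have H (a : {ffun 'I_N -> 'I_K.+1}) (P : (Z -> R[i]) -> Z -> R) :
   (forall z, O z -> {for z, continuous (P (ua a))}) ->
   (forall z, `|P (ua a) z| <= cabs (ua a z)) ->
   climit rho (delta + L%:R) (fun k r => dyad k ^+ L *
    intRn (fun z => P (ua a) z *
      iter_pd (lmap (mseq (ordmi a))) (kconv (near_ker kap rho k) (dyad k) r) z)).
  move=> cP Pu; set n := mabs (ordmi a); have [an|an|an] := ltgtP (delta + n%:R) 0.
  - apply: climit_ext (climit_zero _ _) _ => k r br; rewrite -[LHS](mulr0 (dyad k ^+ L)).
    congr (_ * _); rewrite -[LHS](intRn0 (N + M)); congr intRn; apply/funext => z.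
    have rn := urapid_rapid k (rapid_near rk rho0); have rr := btest_rapid br.
    have r2 : 0 <= 2 * rho by rewrite mulr_ge0// ltW.
    have [zO|nz] := pselect (O z).
      suff -> : P (ua a) z = 0 by rewrite mul0r.
      apply/normr0_eq0/eqP; rewrite eq_le normr_ge0 andbT (le_trans (Pu z))// (ua0 an zO).
      by rewrite (_ : (0 : R[i]) = cR 0)// cabs_real normr0.
    have /existsNP[i /negP] : ~ (forall i, `|z ord0 i| <= 6 * rho) by move=> h; exact: nz (rhoO h).
    rewrite -ltNge => zi; rewrite (iter_pd_conv _ _ rn rr).
    rewrite (conv_supp (i := i) (@near_ker_supp R N kap rho k) r2 (btest_iter_pd _ br)) ?mulr0//.
    by apply: le_lt_trans zi; move: rho0; lra.
  - have [C HC] := uab a.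
    have sz : size (mseq (ordmi a)) = n by rewrite size_mseq.
    have bE : delta + L%:R + (size (mseq (ordmi a)))%:R = delta + n%:R + L%:R by rewrite sz addrAC.
    have mE : exists m : nat, m%:R < delta + n%:R + L%:R /\ delta + n%:R + L%:R < m.+1%:R.
      apply: (@nonint_ceil R d eps _ (n + L)%N eps01); first by rewrite natrD addrA.
      by rewrite addr_gt0// ltr0n.
    have vC z : O z -> `|P (ua a) z| <= `|C| * powR (n1 (lsubmx z)) (delta + n%:R).
      move=> zO; apply: (le_trans (Pu z)); apply: (le_trans (HC z zO)).
      apply: (@le_trans _ _ (`|C| * powR (enorm (lsubmx z)) (delta + n%:R))).
        by rewrite ler_wpM2r ?powR_ge0// ler_norm.
      by rewrite ler_wpM2l// ge0_ler_powR ?nnegrE ?n1_ge0 ?sqrtr_ge0 ?enorm_le_n1// ltW.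
    exact: (climit_near rk rho0 an bE L0 mE rhoO cP vC).
  - by move: (int_neq_eps n); rewrite an eqxx.
have S (a : {ffun 'I_N -> 'I_K.+1}) : cclimit rho (delta + L%:R) (fun k r => (-1) ^+ (mabs (ordmi a)) *
   (cR (dyad k ^+ L) * Complex
    (intRn (fun z => cRe (ua a) z *
      iter_pd (lmap (mseq (ordmi a))) (kconv (near_ker kap rho k) (dyad k) r) z))
    (intRn (fun z => cIm (ua a) z *
      iter_pd (lmap (mseq (ordmi a))) (kconv (near_ker kap rho k) (dyad k) r) z)))).
  apply: cclimit_scale; split.
    apply: climit_ext (H a (fun u => cRe u) _ _) _.
    - by move=> z zO; have [] := uac a zO.
    - by move=> z; exact: Re_le_cabs.
    - by move=> k r _; rewrite ReMc /= mul0r subr0.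
  apply: climit_ext (H a (fun u => cIm u) _ _) _.
  - by move=> z zO; have [] := uac a zO.
  - by move=> z; exact: Im_le_cabs.
  - by move=> k r _; rewrite ImMc /= mul0r addr0.
apply: cclimit_ext (@cclimit_sum R N M rho _ _ (index_enum {ffun 'I_N -> 'I_K.+1}) _ (fun a _ => S a)) _ => k r br.
rewrite (near_sum k rk br) mulr_sumr; apply: eq_bigr => a _.
by rewrite mulrCA.
Qed.

Lemma kernel_cclimit (kap : 'rV[R]_N -> R) : rapid kap ->
  cclimit rho (delta + L%:R) (fun k r =>
    cR (dyad k ^+ L) * SF s f (fun y => expint kap (dyad k *: y)) r).
Proof.
move=> rk; apply: cclimit_ext (cclimit_add (cclimit_near rk) (cclimit_far rk rho0)) _ => k r br.
have rn := urapid_rapid k (rapid_near rk rho0); have rf := urapid_rapid k (urapid_far0 rk rho0).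
rewrite -mulrDr; congr (_ * _).
have := SF_lin ts sf 1 (ctemp_expint k rn) (ctemp_expint k rf) (btest_rapid br).
rewrite mul1r => <-; congr SF; apply/funext => y; rewrite mul1r.
have E c : oscint c kap (dyad k *: y) = oscint c (near_ker kap rho k) (dyad k *: y) +
    oscint c (far_ker kap rho k) (dyad k *: y).
  rewrite -[RHS]/((fun q => oscint c (near_ker kap rho k) q + oscint c (far_ker kap rho k) q) (dyad k *: y)).
  rewrite -(oscintD c rn rf); congr (oscint c _ _); apply/funext => p.
  by rewrite /near_ker /far_ker; ring.
by rewrite /expint !E.
Qed.

End KernelSeries.

(** * The splitting function *)

Section SplittingFunction.
Context {R : realType} {N : nat}.
Variable Th : 'rV[R]_N -> R.
Hypothesis uTh : UVsplit Th.

Let sTh : smooth Th. Proof. by case: uTh. Qed.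
Let Th01 y : `|Th y| <= 1.
Proof. by have [_ [/(_ y)/andP[h1 h2] _]] := uTh; rewrite ger0_norm. Qed.

Lemma norm_coord_le_enorm n (y : 'rV[R]_n) i : `|y ord0 i| <= enorm y.
Proof.
rewrite /enorm -sqrtr_sqr ler_sqrt; last by apply: sumr_ge0 => j _; exact: sqr_ge0.
by rewrite (bigD1 i)//= lerDl sumr_ge0// => j _; exact: sqr_ge0.
Qed.

Lemma enormZ n (a : R) (y : 'rV[R]_n) : 0 <= a -> enorm (a *: y) = a * enorm y.
Proof.
move=> a0; rewrite /enorm -[X in X * _]ger0_norm// -sqrtr_sqr -sqrtrM ?sqr_ge0//.
by congr Num.sqrt; rewrite mulr_sumr; apply: eq_bigr => i _; rewrite mxE exprMn.
Qed.

Lemma split_near0 : exists eta : R, 0 < eta /\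
  forall y : 'rV[R]_N, (forall i, `|y ord0 i| <= eta) -> Th y = 0.
Proof.
have [_ [_ [/nbhs_ballP[e /= e0 He] _]]] := uTh.
exists (e / 2); split=> [|y ye]; first by rewrite divr_gt0.
apply: He; rewrite -ball_normE /= sub0r normrN.
apply: (@le_lt_trans _ _ (e / 2)); last by rewrite ltr_pdivrMr// ltr_pMr// ltr1n.
rewrite [`|y|]mx_normrE; apply/bigmax_leP; split=> [|[i j] _ /=]; first by rewrite divr_ge0// ltW.
by rewrite (ord1 i); exact: ye.
Qed.

Definition ring_part (y : 'rV[R]_N) : R := Th y - Th (2^-1 *: y).

Lemma smooth_ring_part : smooth ring_part.
Proof.
have -> : ring_part = fun y => Th y - Th (2^-1 *: y + 0).
  by apply/funext => y; rewrite /ring_part addr0.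
exact: (smoothB sTh (smooth_affine _ _ sTh)).
Qed.

Lemma ring_part_supp : compactly_supported ring_part.
Proof.
have [_ [_ [_ [l [l0 Hl]]]]] := uTh.
exists (2 * l); split=> [|y i yi]; first by rewrite mulr_gt0.
have h : l < enorm (2^-1 *: y).
  rewrite enormZ ?invr_ge0// ltr_pdivlMl//; exact: lt_le_trans yi (norm_coord_le_enorm y i).
have := Hl 2 (2^-1 *: y); rewrite ltr1n => /(_ isT h).
by rewrite scalerA mulfV ?pnatr_eq0// scale1r /ring_part => ->; rewrite subrr.
Qed.

Lemma dotp_self_ge0 n (y : 'rV[R]_n) : 0 <= dotp y y.
Proof. by apply: sumr_ge0 => i _; rewrite -expr2 sqr_ge0. Qed.

Lemma smooth_dotp_self n : smooth (fun y : 'rV[R]_n => dotp y y).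
Proof.
by apply: smooth_sum => i; apply: smoothM; exact: smooth_coord.
Qed.

(* Away from the origin [1 = \sum_s y_s * y_s / |y|^(2L)], the sum over words of length [L]. *)
Lemma ring_part_factor (L : nat) : exists psi : seq 'I_N -> 'rV[R]_N -> R,
  (forall s, smooth (psi s) /\ compactly_supported (psi s)) /\
  forall y, ring_part y = \sum_(s <- words L) qmon s y * psi s y.
Proof.
have [eta [e0 He]] := split_near0.
have eta2 : 0 < eta / 2 by rewrite divr_gt0.
have rp0 (y : 'rV[R]_N) : (forall i, `|y ord0 i| <= eta) -> ring_part y = 0.
  move=> ye; rewrite /ring_part !He ?subrr// => i; rewrite mxE normrM ger0_norm ?invr_ge0//.
  by apply: le_trans (ye i); rewrite ler_piMl// invf_le1// ler1n.
(* A denominator without zeros that agrees with |y|^2 wherever the shell function does not vanish,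
   since the bump is zero outside the box of size [eta]. *)
pose D (y : 'rV[R]_N) := dotp y y + chi (eta / 2) y.
have sc := @smooth_chi R N _ eta2.
have sD : smooth D by apply: smoothD; [exact: smooth_dotp_self | exact: sc].
have Dn0 y : D y != 0.
  have [yb|/existsNP[i /negP]] := pselect (forall i, `|y ord0 i| <= eta / 2).
    by rewrite gt_eqF// /D chi_eq1// ltr_wpDl// dotp_self_ge0.
  rewrite -ltNge => yi; rewrite gt_eqF// ltr_pwDl ?chi_ge0//.
  rewrite /dotp (bigD1 i)//= ltr_pwDl//; last by apply: sumr_ge0 => j _; rewrite -expr2 sqr_ge0.
  rewrite -expr2 -real_normK ?num_real// exprn_gt0//; exact: lt_trans yi.
have sI := smoothX L (smooth_inv sD Dn0).
exists (fun s y => ring_part y * (qmon s y * (D y)^-1 ^+ L)); split=> [s|y].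
  split; first exact: (smoothM smooth_ring_part (smoothM (smooth_qmon s) sI)).
  have [r [r0 Hr]] := ring_part_supp; exists r; split=> // x i xi.
  by rewrite (Hr x i xi) mul0r.
have -> : \sum_(s <- words L) qmon s y * (ring_part y * (qmon s y * (D y)^-1 ^+ L)) =
    ring_part y * (dotp y y * (D y)^-1) ^+ L.
  rewrite exprMn dotp_pow mulr_suml mulr_sumr; apply: eq_bigr => s _; by ring.
have [yb|/existsNP[i /negP]] := pselect (forall i, `|y ord0 i| <= eta).
  by rewrite rp0// mul0r.
rewrite -ltNge => yi; have De : D y = dotp y y.
  rewrite /D (@chi_eq0 _ _ _ _ i) ?addr0// (_ : 2 * (eta / 2) = eta) ?ltW//.
  by rewrite mulrCA mulfV ?mulr1// pnatr_eq0.
by rewrite -De mulfV ?Dn0// expr1n mulr1.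
Qed.

(** Beyond radius l the function is homogeneous of degree 0, so its derivatives are homogeneous of
    degree -|s| and are bounded by their values on the sphere of radius 2l. *)
Lemma split_pd_bounded s : exists C, forall y, `|iter_pd s Th y| <= C.
Proof.
have [->|sn] := eqVneq s [::]; first by exists 1 => y; exact: Th01.
have [_ [_ [_ [l [l0 Hl]]]]] := uTh.
have l2 : 0 < 2 * l by rewrite mulr_gt0.
have sD := smooth_iter_pd s sTh.
have sc := @smooth_chi R N _ l2.
have rg : rapid (fun y => chi (2 * l) y * iter_pd s Th y).
  apply: supp_rapid; first exact: (smoothM sc sD).
  exists (2 * (2 * l)); split; first by rewrite mulr_gt0.
  by move=> x i xi; rewrite (@chi_eq0 _ _ _ _ i) ?mul0r// ltW.
have [C [C0 HC]] := rapid_bounded rg; exists C => y.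
have inbox (x : 'rV[R]_N) : enorm x <= 2 * l -> `|iter_pd s Th x| <= C.
  move=> xl; have := HC x; rewrite chi_eq1 ?mul1r// => i.
  exact: le_trans (norm_coord_le_enorm x i) xl.
have [/inbox//|yl] := leP (enorm y) (2 * l).
pose lam := enorm y / (2 * l); have lam1 : 1 < lam by rewrite /lam ltr_pdivlMr// mul1r.
have lam0 : 0 < lam := lt_trans ltr01 lam1.
pose x := lam^-1 *: y; have yE : y = lam *: x by rewrite /x scalerA mulfV ?scale1r// gt_eqF.
have xn : enorm x = 2 * l.
  rewrite /x enormZ ?invr_ge0 ?ltW// /lam invf_div divfK// gt_eqF//.
  exact: lt_trans l2 yl.
pose U := [set z : 'rV[R]_N | l < enorm z].
have cE : continuous (@enorm R N).
  apply: contP => z; apply: (@cont_comp _ _ _ (fun z : 'rV[R]_N => \sum_i z ord0 i ^+ 2) Num.sqrt);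
    last exact: sqrt_continuous.
  apply: (@sum_continuous R _ _ (index_enum 'I_N) (fun i (z : 'rV[R]_N) => z ord0 i ^+ 2)) => i.
  by apply: contX; exact: coordc.
have oU : open U.
  apply: (@open_comp _ _ (@enorm R N) [set t | l < t]); last exact: open_gt.
  by move=> z _; exact: cE.
have Ux : U x by rewrite /U /= xn ltr_pMl// ltr1n.
have E := @iter_pd_local R N U (fun z => Th (lam *: z + 0)) Th s oU
  (fun z Uz => etrans (congr1 Th (addr0 _)) (Hl lam z lam1 Uz)) x Ux.
rewrite (iter_pd_affine s lam 0 sTh) addr0 -yE in E.
have := inbox x; rewrite xn lexx -E normrM normrX (ger0_norm (ltW lam0)) => /(_ isT).
apply: le_trans; rewrite ler_peMl// exprn_ege1// ltW//.
Qed.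

(** Without derivatives the factor 2^k is dominated by the weight, because Th(y / 2^k) vanishes
    unless y has size at least 2^k eta. With derivatives the chain rule provides 2^(-k). This gives
    the rate at which the tail of the telescoping series dies. *)
Lemma utemp_split_tail : utemp (fun k y => 2 ^+ k * Th (dyad k *: y)).
Proof.
have [eta [e0 He]] := split_near0.
have E k : (fun y => Th (dyad k *: y)) = (fun y => Th (dyad k *: y + 0)).
  by apply/funext => y; rewrite addr0.
have sk k : smooth (fun y => Th (dyad k *: y)) by rewrite E; exact: smooth_affine.
split=> [k|s]; first exact: (smoothZ _ (sk k)).
have [C HC] := split_pd_bounded s; exists 1%N, (Num.max eta^-1 C) => k y.
have p2 : 0 <= 2 ^+ k :> R by rewrite exprn_ge0.
rewrite (iter_pdZ s _ (sk k)) E (iter_pd_affine s _ _ sTh) expr1 addr0 normrM (ger0_norm p2).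
case: s HC => [|j s] HC.
  rewrite /= expr0 mul1r.
  apply: (@le_trans _ _ (eta^-1 * nW y)); last first.
    by rewrite ler_wpM2r ?(ltW (nW_gt0 _))// le_max lexx.
  have [yb|/existsNP[i /negP]] := pselect (forall i, `|(dyad k *: y) ord0 i| <= eta).
    by rewrite He// normr0 mulr0 mulr_ge0 ?invr_ge0 ?(ltW e0) ?(ltW (nW_gt0 _)).
  rewrite -ltNge mxE normrM norm_dyad => yi.
  apply: (@le_trans _ _ (2 ^+ k)); first by rewrite ler_piMr.
  rewrite ler_pdivlMl// mulrC; apply: le_trans (coord_le_nW y i).
  by rewrite -ler_pdivlMl ?exprn_gt0// ltW.
rewrite normrM normrX norm_dyad /= exprS mulrA mulrA mulfV ?expf_neq0// mul1r.
apply: (@le_trans _ _ C).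
  apply: le_trans (HC (dyad k *: y)); rewrite ler_piMl// exprn_ile1 ?dyad_le1 ?(ltW (dyad_gt0 _))//.
have C0 : 0 <= C := le_trans (normr_ge0 _) (HC 0).
apply: (@le_trans _ _ (C * nW y)); first by rewrite ler_peMr ?nW_ge1.
by rewrite ler_wpM2r ?(ltW (nW_gt0 _))// le_max lexx orbT.
Qed.

End SplittingFunction.

Section TemperateClosure.
Context {R : realType} {N : nat}.

Lemma temperateZ (a : R) (X : 'rV[R]_N -> R) : temperate X -> temperate (fun y => a * X y).
Proof.
by move=> tX; apply: (utempM (f := fun _ _ => a)) => //; apply: (@utemp_cst _ _ _ (fun=> a) `|a|).
Qed.

Lemma ctemp_lin (a : R[i]) (X Y : 'rV[R]_N -> R[i]) : ctemp X -> ctemp Y ->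
  ctemp (fun y => a * X y + Y y).
Proof.
move=> [x1 x2] [y1 y2]; split.
  have -> : cRe (fun y => a * X y + Y y) = fun y => (complex.Re a * cRe X y +
      (- complex.Im a) * cIm X y) + cRe Y y.
    by apply/funext => y; rewrite /cRe ReDc ReMc mulNr.
  exact: (utempD (utempD (temperateZ _ x1) (temperateZ _ x2)) y1).
have -> : cIm (fun y => a * X y + Y y) = fun y => (complex.Re a * cIm X y +
    complex.Im a * cRe X y) + cIm Y y.
  by apply/funext => y; rewrite /cIm ImDc ImMc.
exact: (utempD (utempD (temperateZ _ x2) (temperateZ _ x1)) y2).
Qed.

Lemma temperate0 n : temperate (fun _ : 'rV[R]_n => 0 : R).
Proof. by apply: (@utemp_cst _ _ _ (fun=> 0) 0) => _; rewrite normr0. Qed.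

Lemma ctemp_cR (X : 'rV[R]_N -> R) : temperate X -> ctemp (fun y => cR (X y)).
Proof. by move=> tX; split=> //; exact: temperate0. Qed.

Lemma temperate_qmon (w : seq 'I_N) : temperate (@qmon R N w).
Proof.
elim: w => [|j w IH].
  have -> : @qmon R N [::] = fun=> 1 by apply/funext => y; rewrite /qmon big_nil.
  by apply: (@utemp_cst _ _ _ (fun=> 1) 1) => _; rewrite normr1.
have -> : @qmon R N (j :: w) = fun y => y ord0 j * qmon w y.
  by apply/funext => y; rewrite qmon_cons.
exact: (utempM (@utemp_coord R N unit j) IH).
Qed.

Lemma ctemp_qmon w (X : 'rV[R]_N -> R[i]) : ctemp X -> ctemp (fun y => cR (qmon w y) * X y).
Proof.
move=> [x1 x2]; have tw := temperate_qmon w; split.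
  have -> : cRe (fun y => cR (qmon w y) * X y) = fun y => qmon w y * cRe X y.
    by apply/funext => y; rewrite /cRe ReMc /= mul0r subr0.
  exact: (utempM tw x1).
have -> : cIm (fun y => cR (qmon w y) * X y) = fun y => qmon w y * cIm X y.
  by apply/funext => y; rewrite /cIm ImMc /= mul0r addr0.
exact: (utempM tw x2).
Qed.

End TemperateClosure.

(** * Summing the dyadic series *)

Section ThetaFunctional.
Context {R : realType} {N M : nat}.
Local Notation Z := 'rV[R]_(N + M).
Variables (s : distr R (N + M)) (f : 'rV[R]_M -> R[i]) (delta rho : R) (L : nat).
Hypotheses (ts : tempered s) (sf : schwartz f).
Hypothesis kernel : forall kap : 'rV[R]_N -> R, rapid kap ->
  cclimit rho (delta + L%:R) (fun k r =>
    cR (dyad k ^+ L) * SF s f (fun y => expint kap (dyad k *: y)) r).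
Variable Th : 'rV[R]_N -> R.
Hypothesis uTh : UVsplit Th.

Lemma SF0 (r : Z -> R) : rapid r -> SF s f (fun=> 0) r = 0.
Proof.
move=> rr; have t0 : ctemp (fun _ : 'rV[R]_N => 0 : R[i]) by split; exact: temperate0.
have E := SF_lin ts sf 1 t0 t0 rr.
have F : (fun _ : 'rV[R]_N => 1 * 0 + 0 : R[i]) = fun=> 0 by apply/funext => y; rewrite mulr0 addr0.
rewrite F mul1r in E; move/eqP: E.
by rewrite -subr_eq0 opprD addrA subrr add0r oppr_eq0 => /eqP.
Qed.

Lemma SFZ (a : R[i]) X (r : Z -> R) : ctemp X -> rapid r -> SF s f (fun y => a * X y) r = a * SF s f X r.
Proof.
move=> tX rr; have t0 : ctemp (fun _ : 'rV[R]_N => 0 : R[i]) by split; exact: temperate0.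
have := SF_lin ts sf a tX t0 rr; rewrite SF0// addr0 => <-.
by congr SF; apply/funext => y; rewrite addr0.
Qed.

Lemma SF_sum (I : Type) (l : seq I) (X : I -> 'rV[R]_N -> R[i]) (r : Z -> R) :
  (forall i, ctemp (X i)) -> rapid r ->
  ctemp (fun y => \sum_(i <- l) X i y) /\
  SF s f (fun y => \sum_(i <- l) X i y) r = \sum_(i <- l) SF s f (X i) r.
Proof.
move=> tX rr; elim: l => [|i l [IH1 IH2]].
  have -> : (fun y => \sum_(i <- [::]) X i y) = fun=> 0 by apply/funext => y; rewrite big_nil.
  by rewrite big_nil SF0//; split=> //; split; exact: temperate0.
have -> : (fun y => \sum_(j <- i :: l) X j y) = fun y => 1 * X i y + \sum_(j <- l) X j y.
  by apply/funext => y; rewrite big_cons mul1r.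
by split; [exact: ctemp_lin | rewrite SF_lin// mul1r IH2 big_cons].
Qed.

Lemma SF_bounded (X : nat -> 'rV[R]_N -> R) (r : Z -> R) : utemp X -> rapid r ->
  exists B, forall k, `|complex.Re (SF s f (fun y => cR (X k y)) r)| <= B /\
    `|complex.Im (SF s f (fun y => cR (X k y)) r)| <= B.
Proof.
move=> uX rr; have [rf1 rf2] := schwartz_rapid sf.
have bnd (tau : (Z -> R) -> R) (g : 'rV[R]_M -> R) c (Y : nat -> 'rV[R]_N -> R) :
    rtempered tau -> rapid g -> utemp Y ->
    exists B, 0 <= B /\ forall k, `|atom tau g (Y k) c r| <= B.
  move=> tt' rg uY; apply: (rtempered_urapid tt').
  have uo : urapid (fun _ : nat => oscint c r) := urapid_reindex (fun _ : nat => tt) (urapid_oscint c rr).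
  have ug : utemp (fun _ : nat => g) := urapid_temp (urapid_reindex (fun _ : nat => tt) rg).
  have := urapidM uo (utemp_tensor uY ug).
  have -> // : (fun (i : nat) (x : Z) => oscint c r x * (Y i (lsubmx x) * g (rsubmx x))) =
    (fun i z => Y i (lsubmx z) * g (rsubmx z) * oscint c r z).
  by apply/funext => i; apply/funext => z; rewrite mulrC.
have u0 : utemp (fun (_ : nat) (_ : 'rV[R]_N) => 0 : R).
  by apply: (@utemp_cst _ _ _ (fun=> 0) 0) => _; rewrite normr0.
have tR := rtempered_Re ts; have tI := rtempered_Im ts.
pose hp : R := - (pi / 2).
have [B1 [b1 H1]] := bnd _ _ 0 _ tR rf1 uX; have [B2 [b2 H2]] := bnd _ _ hp _ tR rf1 u0.
have [B3 [b3 H3]] := bnd _ _ hp _ tR rf2 uX; have [B4 [b4 H4]] := bnd _ _ 0 _ tR rf2 u0.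
have [B5 [b5 H5]] := bnd _ _ hp _ tI rf1 uX; have [B6 [b6 H6]] := bnd _ _ 0 _ tI rf1 u0.
have [B7 [b7 H7]] := bnd _ _ 0 _ tI rf2 uX; have [B8 [b8 H8]] := bnd _ _ hp _ tI rf2 u0.
have [C1 [c1 K1]] := bnd _ _ 0 _ tI rf1 uX; have [C2 [c2 K2]] := bnd _ _ hp _ tI rf1 u0.
have [C3 [c3 K3]] := bnd _ _ hp _ tI rf2 uX; have [C4 [c4 K4]] := bnd _ _ 0 _ tI rf2 u0.
have [C5 [c5 K5]] := bnd _ _ hp _ tR rf1 uX; have [C6 [c6 K6]] := bnd _ _ 0 _ tR rf1 u0.
have [C7 [c7 K7]] := bnd _ _ 0 _ tR rf2 uX; have [C8 [c8 K8]] := bnd _ _ hp _ tR rf2 u0.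
have A8 (x1 x2 x3 x4 x5 x6 x7 x8 e1 e2 e3 e4 e5 e6 e7 e8 a : R) :
   `|x1| <= e1 -> `|x2| <= e2 -> `|x3| <= e3 -> `|x4| <= e4 ->
   `|x5| <= e5 -> `|x6| <= e6 -> `|x7| <= e7 -> `|x8| <= e8 ->
   `|a| = 1 ->
   `|(x1 + -1 * x2) + (-1 * x3 + -1 * x4) + a * ((x5 + x6) + (x7 + -1 * x8))| <=
     e1 + e2 + (e3 + e4) + (e5 + e6 + (e7 + e8)).
  move=> h1 h2 h3 h4 h5 h6 h7 h8 ha.
  have T4 (y1 y2 y3 y4 g1 g2 g3 g4 : R) : `|y1| <= g1 -> `|y2| <= g2 -> `|y3| <= g3 -> `|y4| <= g4 ->
      `|(y1 + y2) + (y3 + y4)| <= g1 + g2 + (g3 + g4).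
    move=> k1 k2 k3 k4; apply: (le_trans (ler_normD _ _)); apply: lerD;
      by apply: (le_trans (ler_normD _ _)); exact: lerD.
  apply: (le_trans (ler_normD _ _)); apply: lerD; last rewrite normrM ha mul1r;
    by apply: T4; rewrite ?mulN1r ?normrN.
pose BA := B1 + B2 + (B3 + B4) + (B5 + B6 + (B7 + B8)).
pose BB := C1 + C2 + (C3 + C4) + (C5 + C6 + (C7 + C8)).
exists (BA + BB) => k.
have A0 : 0 <= BA by rewrite !addr_ge0.
have B0 : 0 <= BB by rewrite !addr_ge0.
have tX : ctemp (fun y => cR (X k y)) by apply: ctemp_cR; exact: (utemp_reindex (fun _ : unit => k) uX).
rewrite (SF_parts ts sf tX rr) /=; split.
  apply: (@le_trans _ _ BA); last by rewrite lerDl.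
  have n1' : `|-1 : R| = 1 by rewrite normrN1.
  exact: (A8 _ _ _ _ _ _ _ _ _ _ _ _ _ _ _ _ (-1) (H1 k) (H2 k) (H3 k) (H4 k) (H5 k) (H6 k) (H7 k) (H8 k) n1').
apply: (@le_trans _ _ BB); last by rewrite lerDr.
rewrite -[X in _ + X]mul1r.
exact: (A8 _ _ _ _ _ _ _ _ _ _ _ _ _ _ _ _ 1 (K1 k) (K2 k) (K3 k) (K4 k) (K5 k) (K6 k) (K7 k) (K8 k) (normr1 _)).
Qed.

Let temperate_Th k : temperate (fun y => Th (dyad k *: y)).
Proof.
have [sTh _] := uTh.
apply: (@utemp_dilate R N unit (fun=> dyad k) Th) => //; last exact: split_pd_bounded.
by move=> _; rewrite norm_dyad dyad_le1.
Qed.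

Let shell n (r : Z -> R) : R[i] := SF s f (fun y => cR (ring_part Th (dyad n *: y))) r.

Let shell_sum k r : rapid r ->
  \sum_(0 <= n < k) shell n r = SF s f (fun y => cR (Th y)) r - SF s f (fun y => cR (Th (dyad k *: y))) r.
Proof.
move=> rr; have E0 : (fun y => cR (Th y)) = (fun y => cR (Th (dyad 0 *: y))).
  by apply/funext => y; rewrite /dyad expr0 invr1 scale1r.
have E n : shell n r = SF s f (fun y => cR (Th (dyad n *: y))) r - SF s f (fun y => cR (Th (dyad n.+1 *: y))) r.
  rewrite /shell addrC -mulN1r -(SF_lin ts sf); [|exact: ctemp_cR|exact: ctemp_cR|by []].
  congr SF; apply/funext => y; rewrite mulN1r addrC /ring_part scalerA.
  have -> : 2^-1 * dyad n = dyad n.+1 :> R by rewrite /dyad exprS invfM.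
  by apply: complex_ext => /=; rewrite ?subr0// addr0 oppr0.
rewrite (eq_bigr _ (fun n _ => E n)) E0.
elim: k => [|k IH]; first by rewrite big_geq// subrr.
by rewrite big_nat_recr//= IH addrA subrK.
Qed.

(** The partial sums telescope, and the tail is 2^(-k) times a quantity bounded by
    [utemp_split_tail] and [SF_bounded]. *)
Let shell_cvg r : rapid r ->
  (fun k => \sum_(0 <= n < k) complex.Re (shell n r)) @ \oo --> complex.Re (SF s f (fun y => cR (Th y)) r) /\
  (fun k => \sum_(0 <= n < k) complex.Im (shell n r)) @ \oo --> complex.Im (SF s f (fun y => cR (Th y)) r).
Proof.
move=> rr; have [B HB] := SF_bounded (utemp_split_tail uTh) rr.
have tail k : SF s f (fun y => cR (Th (dyad k *: y))) r =
    cR (dyad k) * SF s f (fun y => cR (2 ^+ k * Th (dyad k *: y))) r.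
  rewrite -SFZ//; last by apply: ctemp_cR; apply: temperateZ.
  congr SF; apply/funext => y; rewrite -cRM mulrA mulVf ?mul1r// expf_neq0//.
have dB : (fun k => dyad k * B) @ \oo --> (0 : R).
  rewrite -[X in _ --> X](mul0r B); apply: cvgM; last exact: cvg_cst.
  have -> : @dyad R = fun k => 2^-1 ^+ k by apply/funext => k; rewrite /dyad exprVn.
  by apply: cvg_expr; rewrite ger0_norm ?invr_ge0// invf_lt1// ltr1n.
have lim (P : R[i] -> R) : (forall x y, P (x + y) = P x + P y) ->
    (forall k, `|P (SF s f (fun y => cR (Th (dyad k *: y))) r)| <= dyad k * B) ->
    (fun k => \sum_(0 <= n < k) P (shell n r)) @ \oo --> P (SF s f (fun y => cR (Th y)) r).
  move=> PD Pt; have P0 : P 0 = 0.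
    by have := PD 0 0; rewrite addr0 => /eqP; rewrite -subr_eq0 opprD addrA subrr add0r oppr_eq0 => /eqP.
  have Psum k : \sum_(0 <= n < k) P (shell n r) = P (\sum_(0 <= n < k) shell n r).
    by rewrite (big_morph P PD P0).
  apply/cvgrPdist_le => e e0; have /cvgrPdist_le/(_ e e0) := dB.
  apply: filterS => k /=; rewrite sub0r normrN => hk; rewrite Psum.
  have := PD (SF s f (fun y => cR (Th y)) r - SF s f (fun y => cR (Th (dyad k *: y))) r)
    (SF s f (fun y => cR (Th (dyad k *: y))) r).
  rewrite subrK shell_sum// => ->; rewrite addrAC subrr add0r.
  exact: le_trans (Pt k) (le_trans (ler_norm _) hk).
split; apply: lim.
- exact: ReDc.
- move=> k; rewrite tail ReMc /= mul0r subr0 normrM norm_dyad.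
  by rewrite ler_wpM2l ?(ltW (dyad_gt0 _))//; have [] := HB k.
- exact: ImDc.
- move=> k; rewrite tail ImMc /= mul0r addr0 normrM norm_dyad.
  by rewrite ler_wpM2l ?(ltW (dyad_gt0 _))//; have [] := HB k.
Qed.

(** Each factor of the shell function is a Fourier transform of a rapidly decreasing kernel, to
    which [kernel] applies at order delta + L; the L derivatives coming from the monomial bring the
    order down to delta. *)
Let shell_cclimit : cclimit rho delta shell.
Proof.
have [psi [psiP psiE]] := ring_part_factor uTh L.
have inv w : exists p : ('rV[R]_N -> R) * ('rV[R]_N -> R), [/\ rapid p.1, rapid p.2 &
    forall y, 'i%C * expint p.2 y + expint p.1 y = cR (psi w y)].
  have [p1 [p2 [r1 r2 E]]] := fourier_inversion (proj1 (psiP w)) (proj2 (psiP w)).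
  exists (p1, p2); split=> //= y; have [E1 E2] := E y.
  apply: complex_ext; rewrite ?ReDc ?ImDc ?ReMc ?ImMc /=.
    by rewrite E1; set a := oscint _ _ _; set b := oscint _ _ _; ring.
  by rewrite [RHS]E2; set a := oscint _ _ _; set b := oscint _ _ _; ring.
have [p Hp] := choice inv.
have r1 w : rapid (p w).1 by have [] := Hp w.
have r2 w : rapid (p w).2 by have [] := Hp w.
pose X w n (y : 'rV[R]_N) : R[i] := 'i%C * expint (p w).2 (dyad n *: y) + expint (p w).1 (dyad n *: y).
have tX w n : ctemp (X w n) by apply: ctemp_lin; exact: ctemp_expint.
have H w : w \in words L -> cclimit rho delta (fun n r => 'i%C ^+ L *
    (cR (dyad n ^+ L) * SF s f (fun y => expint (p w).1 (dyad n *: y)) (iter_pd (lmap w) r) +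
     'i%C * (cR (dyad n ^+ L) * SF s f (fun y => expint (p w).2 (dyad n *: y)) (iter_pd (lmap w) r)))).
  move=> /size_words sw; apply: cclimit_scale.
  have K1 := kernel (r1 w); have K2 := kernel (r2 w).
  rewrite -sw in K1 K2; have D1 := cclimit_iter_pd K1; have D2 := cclimit_iter_pd K2.
  by rewrite sw in D1 D2; exact: (cclimit_add D1 (cclimit_scale 'i%C D2)).
apply: cclimit_ext (cclimit_sum H) _ => n r br; have rr := btest_rapid br.
have -> : shell n r = SF s f (fun y => \sum_(w <- words L) cR (dyad n ^+ size w) * (cR (qmon w y) * X w n y)) r.
  congr SF; apply/funext => y; rewrite psiE.
  rewrite (big_morph cR (@cRD R) (erefl (0 : R[i]))); apply: eq_bigr => w _.
  by rewrite qmonZ !cRM -mulrA; have [_ _ <-] := Hp w.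
have tq w : ctemp (fun y => cR (qmon w y) * X w n y) by exact: ctemp_qmon.
have tZ w : ctemp (fun y => cR (dyad n ^+ size w) * (cR (qmon w y) * X w n y)).
  have t0 : ctemp (fun _ : 'rV[R]_N => 0 : R[i]) by split; exact: temperate0.
  have := ctemp_lin (cR (dyad n ^+ size w)) (tq w) t0.
  by under eq_fun do rewrite addr0.
have [_ ->] := SF_sum (words L) tZ rr.
rewrite big_seq [RHS]big_seq; apply: eq_bigr => w /size_words sw.
have rp := urapid_iter_pd (lmap w) rr.
rewrite SFZ// (SF_qmon ts sf w (tX w n) rr) /X SF_lin//; [|exact: ctemp_expint|exact: ctemp_expint].
by rewrite sw; set A := SF _ _ _ _; set B := SF _ _ _ _; ring.
Qed.

(** The same partial sums converge to the functional of [Th] and to a member of the class, so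
    uniqueness of limits identifies the two. *)
Lemma theta_cls : exists S1 S2 : (Z -> R) -> R, [/\ cls rho delta S1, cls rho delta S2 &
  forall r, btest rho r -> SF s f (fun y => cR (Th y)) r = Complex (S1 r) (S2 r)].
Proof.
have [[S1 [c1 H1]] [S2 [c2 H2]]] := shell_cclimit.
exists S1, S2; split=> // r br; have [h1 h2] := shell_cvg (btest_rapid br).
apply: complex_ext => /=.
  by rewrite -(cvg_lim (@norm_hausdorff _ R) h1) (cvg_lim (@norm_hausdorff _ R) (H1 r br)).
by rewrite -(cvg_lim (@norm_hausdorff _ R) h2) (cvg_lim (@norm_hausdorff _ R) (H2 r br)).
Qed.

End ThetaFunctional.

(** * Conversion to multi-indices *)

Section NormalForm.
Context {R : realType} {N M : nat}.
Local Notation Z := 'rV[R]_(N + M).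
Variables (d : int) (eps rho : R).
Hypothesis eps0 : 0 < eps.
Local Notation delta := (d%:~R - eps).
Local Notation D := (`|d|%N.+1).

Lemma xpow_count n (s : seq 'I_n) (x : 'rV[R]_n) : xpow x (fun i => count_mem i s) = qmon s x.
Proof.
elim: s => [|j s IH]; first by rewrite /qmon big_nil /xpow big1.
rewrite qmon_cons -IH /xpow; under eq_bigr do rewrite /= exprD.
rewrite big_split/= (bigD1 j)//= eqxx expr1 big1 ?mulr1// => i ij.
by rewrite eq_sym (negbTE ij).
Qed.

Lemma xpow_mseq n (a : 'I_n -> nat) (x : 'rV[R]_n) : xpow x a = qmon (mseq a) x.
Proof.
rewrite -xpow_count; congr (xpow x); apply/funext => i; by rewrite count_mseq.
Qed.

Lemma count_index (s : seq 'I_N) K : (size s <= K)%N -> exists a : {ffun 'I_N -> 'I_K.+1},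
  ordmi a = (fun i => count_mem i s) /\ mabs (ordmi a) = size s.
Proof.
move=> sK; exists [ffun i => inord (count_mem i s)].
have E : ordmi [ffun i => inord (count_mem i s) : 'I_K.+1] = (fun i => count_mem i s).
  apply/funext => i; rewrite /ordmi ffunE inordK// ltnS.
  exact: leq_trans (count_size _ _) sK.
split=> //; rewrite E -size_mseq; apply/esym/perm_size; exact: perm_mseq.
Qed.

Definition normal_form (K : nat) (S : (Z -> R) -> R) : Prop :=
  exists (v : {ffun 'I_N -> 'I_K.+1} -> Z -> R) (c : {ffun 'I_N -> 'I_D} -> 'rV[R]_M -> R),
  [/\ forall a, continuous (v a),
      forall a, delta + (mabs (ordmi a))%:R < 0 -> forall z, v a z = 0,
      forall a, exists C, forall z, `|v a z| <= C * powR (n1 (lsubmx z)) (delta + (mabs (ordmi a))%:R),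
      forall gm, continuous (c gm) &
      forall r, btest rho r -> S r =
        \sum_a (-1) ^+ mabs (ordmi a) * intRn (fun z => v a z * Dr (liftN (ordmi a)) r z) +
        \sum_(gm | ((mabs (ordmi gm))%:Z < d)%R)
          intRn (fun z => c gm (rsubmx z) * xpow (lsubmx z) (ordmi gm) * r z)].

Lemma cont0 (X : topologicalType) : continuous (fun _ : X => 0 : R).
Proof. by apply: contP => x; exact: contC. Qed.

Lemma normal_form0 K : normal_form K (fun=> 0).
Proof.
exists (fun _ _ => 0), (fun _ _ => 0); split=> [a|//|a|gm|r br]; [exact: cont0 | | exact: cont0 |].
  by exists 0 => z; rewrite normr0 mul0r.
rewrite !big1 ?addr0// => [gm _|a _].
  rewrite -[RHS](intRn0 (N + M)); congr intRn; apply/funext => z; by rewrite !mul0r.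
rewrite -[RHS](mulr0 ((-1) ^+ mabs (ordmi a))) -[in RHS](intRn0 (N + M)).
by congr (_ * intRn _); apply/funext => z; rewrite mul0r.
Qed.

Lemma normal_form_lin K (b : R) S V : normal_form K S -> normal_form K V ->
  normal_form K (fun r => b * S r + V r).
Proof.
move=> [v [c [v1 v2 v3 c1 E1]]] [w [e [w1 w2 w3 e1 E2]]].
exists (fun a z => b * v a z + w a z), (fun gm x => b * c gm x + e gm x); split.
- move=> a; apply: contP => z; apply: contD; last exact: w1.
  by apply: contM; [exact: contC | exact: v1].
- by move=> a an z; rewrite v2// w2// mulr0 addr0.
- move=> a; have [C HC] := v3 a; have [C' HC'] := w3 a; exists (`|b| * C + C') => z.
  rewrite mulrDl (le_trans (ler_normD _ _))// lerD// normrM -mulrA ler_wpM2l//.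
- move=> gm; apply: contP => z; apply: contD; last exact: e1.
  by apply: contM; [exact: contC | exact: c1].
move=> r br; have [sr _] := br; rewrite E1// E2// mulrDr addrACA !mulr_sumr -!big_split/=; congr (_ + _).
  apply: eq_bigr => a _; rewrite (Dr_liftN _ sr); have bd := btest_iter_pd (lmap (mseq (ordmi a))) br.
  have d1 := dec_mul_btest (v1 a) bd; have d2 := dec_mul_btest (w1 a) bd.
  rewrite mulrCA -mulrDr -(intRnZ _ (dec_intble d1)); congr (_ * _).
  rewrite -(intRnD (intbleZ _ (dec_intble d1)) (dec_intble d2)).
  by congr intRn; apply/funext => z; rewrite mulrDl mulrA.
apply: eq_bigr => gm _.
have H (h : 'rV[R]_M -> R) : continuous h -> dec (fun z : Z => h (rsubmx z) * xpow (lsubmx z) (ordmi gm) * r z).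
  move=> ch; under eq_fun do rewrite xpow_mseq.
  by apply: dec_mul_btest br; exact: cont_pol.
have d1 := H _ (c1 gm); have d2 := H _ (e1 gm).
rewrite -(intRnZ _ (dec_intble d1)) -(intRnD (intbleZ _ (dec_intble d1)) (dec_intble d2)).
by congr intRn; apply/funext => z; ring.
Qed.

(** Every larger index bound must be allowed, so that two normal forms, or the real and the
    imaginary part, can be brought to a common one and added. *)
Lemma cls_normal_form S : cls rho delta S -> exists K, forall K', (K <= K')%N -> normal_form K' S.
Proof.
elim=> [s v C cv s0 vC|s c cc sd||S1 S2 _ [K1 H1] _ [K2 H2]|b S1 _ [K1 H1]|S1 S2 _ [K1 H1] E].
- exists (size s) => K sK; have [a0 [Ea0 Ma0]] := count_index sK.
  (* The sign compensates the one that the definition of a distributional derivative carries. *)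
  exists (fun a z => if a == a0 then (-1) ^+ size s * v z else 0), (fun _ _ => 0); split.
  + move=> a; case: (a == a0); last exact: cont0.
    by apply: contP => z; apply: contM; [exact: contC | exact: cv].
  + move=> a an z; case: eqP => // aE; move: an; rewrite aE Ma0 => h.
    by move: (lt_trans h s0); rewrite ltxx.
  + move=> a; have [->|_] := eqVneq a a0; last by exists 0 => z; rewrite normr0 mul0r.
    by exists C => z; rewrite normrM normrX normrN1 expr1n mul1r Ma0.
  + by move=> gm; exact: cont0.
  move=> r br; have [sr _] := br; rewrite (bigD1 a0)//= eqxx [X in _ + X + _]big1 => [|a /negbTE an].
    rewrite addr0 [X in _ + X]big1 ?addr0 => [|gm _]; last first.
      by rewrite -[RHS](intRn0 (N + M)); congr intRn; apply/funext => z; rewrite !mul0r.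
    have bd := btest_iter_pd (lmap s) br; have d1 := dec_mul_btest cv bd.
    have -> : Dr (liftN (ordmi a0)) r = iter_pd (lmap s) r.
      rewrite (Dr_liftN _ sr); apply: iter_pd_perm => //; rewrite Ea0 perm_sym.
      exact: perm_map (perm_mseq s).
    have -> : (fun z => (-1) ^+ size s * v z * iter_pd (lmap s) r z) =
      (fun z => (-1) ^+ size s * (v z * iter_pd (lmap s) r z)) by apply/funext => z; rewrite mulrA.
    by rewrite (intRnZ _ (dec_intble d1)) Ma0 mulrA -exprMn mulrN1 opprK expr1n mul1r.
  rewrite an -[RHS](mulr0 ((-1) ^+ mabs (ordmi a))) -[in RHS](intRn0 (N + M)).
  by congr (_ * intRn _); apply/funext => z; rewrite mul0r.
(* A degree below d - eps is below d as [eps] is positive; the word therefore fits the index type of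
   the coefficients. *)
- have sdZ : ((size s)%:Z < d)%R.
    by rewrite -(@ltr_int R) -pmulrn; apply: lt_trans sd _; rewrite ltrBlDr ltrDl.
  have sD : (size s <= `|d|)%N by rewrite -lez_nat (le_trans (ltW sdZ))// lez_abs.
  exists 0%N => K _; have [g0 [Eg0 Mg0]] := count_index sD.
  exists (fun _ _ => 0), (fun gm x => if gm == g0 then c x else 0); split.
  + by move=> a; exact: cont0.
  + by [].
  + by move=> a; exists 0 => z; rewrite normr0 mul0r.
  + by move=> gm; case: (gm == g0); [exact: cc | exact: cont0].
  move=> r br; rewrite [X in X + _]big1 ?add0r => [|a _]; last first.
    rewrite -[RHS](mulr0 ((-1) ^+ mabs (ordmi a))) -[in RHS](intRn0 (N + M)).
    by congr (_ * intRn _); apply/funext => z; rewrite mul0r.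
  rewrite (bigD1 g0)/=; last by rewrite Mg0.
  rewrite eqxx [X in _ + X]big1 ?addr0 => [|gm /andP[_ /negbTE gn]]; last first.
    by rewrite gn -[RHS](intRn0 (N + M)); congr intRn; apply/funext => z; rewrite !mul0r.
  by congr intRn; apply/funext => z; rewrite Eg0 xpow_count.
- by exists 0%N => K _; exact: normal_form0.
- exists (maxn K1 K2) => K; rewrite geq_max => /andP[h1 h2].
  have := normal_form_lin 1 (H1 K h1) (H2 K h2).
  by under eq_fun do rewrite mul1r.
- exists K1 => K h; have := normal_form_lin b (H1 K h) (normal_form0 K).
  by under eq_fun do rewrite addr0.
exists K1 => K h; have [v [c [v1 v2 v3 c1 E1]]] := H1 K h.
by exists v, c; split=> // r br; rewrite -E// E1.
Qed.

End NormalForm.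

Section Conclusion.
Context {R : realType} {N M : nat}.
Local Notation Z := 'rV[R]_(N + M).

Lemma FTf_split n (g : 'rV[R]_n -> R[i]) k : rapid (cRe g) -> rapid (cIm g) ->
  FTf g k = expint (cRe g) k + 'i%C * expint (cIm g) k.
Proof.
move=> r1 r2; have d1 c := dec_intble (rapid_dec (rapid_osc k c r1)).
have d2 c := dec_intble (rapid_dec (rapid_osc k c r2)).
have cE y : cos (dotp k y) = osc k 0 y by rewrite /osc addr0.
have sE y : sin (dotp k y) = osc k (- (pi / 2)) y by rewrite /osc cosBpihalf.
apply: complex_ext; rewrite ?ReDc ?ImDc ?ReMc ?ImMc /=.
  rewrite mul0r mul1r sub0r /oscint -(intRnN (d2 _)) -(intRnD (d1 _) (intbleN (d2 _))).
  by congr intRn; apply/funext => y; rewrite {1}/cRe ReMc /= cE sE.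
rewrite mul0r mul1r add0r /oscint -(intRnD (d1 _) (d2 _)).
by congr intRn; apply/funext => y; rewrite {1}/cIm ImMc /= cE sE addrC.
Qed.

Lemma cint_mul (u g : Z -> R[i]) :
  intble (fun z => cRe u z * cRe g z) -> intble (fun z => cIm u z * cIm g z) ->
  intble (fun z => cRe u z * cIm g z) -> intble (fun z => cIm u z * cRe g z) ->
  cint (fun z => u z * g z) =
  Complex (intRn (fun z => cRe u z * cRe g z) - intRn (fun z => cIm u z * cIm g z))
          (intRn (fun z => cIm u z * cRe g z) + intRn (fun z => cRe u z * cIm g z)).
Proof.
move=> h1 h2 h3 h4; apply: complex_ext => /=.
  rewrite -(intRnN h2) -(intRnD h1 (intbleN h2)).
  by congr intRn; apply/funext => z; rewrite {1}/cRe ReMc.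
rewrite -(intRnD h4 h3); congr intRn; apply/funext => z; by rewrite {1}/cIm ImMc addrC.
Qed.

Lemma Re_sum (I : Type) (l : seq I) (P : pred I) (F : I -> R[i]) :
  complex.Re (\sum_(i <- l | P i) F i) = \sum_(i <- l | P i) complex.Re (F i).
Proof. by apply: big_morph => //; exact: ReDc. Qed.

Lemma Im_sum (I : Type) (l : seq I) (P : pred I) (F : I -> R[i]) :
  complex.Im (\sum_(i <- l | P i) F i) = \sum_(i <- l | P i) complex.Im (F i).
Proof. by apply: big_morph => //; exact: ImDc. Qed.

Lemma sign_cR n : (-1) ^+ n = cR ((-1) ^+ n) :> R[i].
Proof.
elim: n => [//|n IH]; rewrite !exprS IH cRM; congr (_ * _).
by apply: complex_ext => /=; rewrite ?oppr0.
Qed.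

Lemma testfn_btest (rho : R) (g : Z -> R[i]) :
  testfn [set z : Z | forall i, `|z ord0 i| < rho] g -> btest rho (cRe g) /\ btest rho (cIm g).
Proof.
move=> [[s1 s2] [K [_ [KO K0]]]].
have out (z : Z) i : rho < `|z ord0 i| -> g z = 0.
  by move=> zi; apply: K0 => /KO /(_ i); rewrite ltNge (ltW zi).
by split; split=> // z i zi; rewrite /cRe /cIm (out z i zi).
Qed.

Lemma small_box n (O : set 'rV[R]_n) : open O -> O 0 -> exists rho : R, 0 < rho /\
  forall z : 'rV[R]_n, (forall i, `|z ord0 i| <= 6 * rho) -> O z.
Proof.
move=> oO O0; have /nbhs_ballP[e /= e0 He] : nbhs (0 : 'rV[R]_n) O by exact: open_nbhs_nbhs.
(* Any divisor above 6 would do, the ball being open and the box closed. *)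
exists (e / 7); split=> [|z zb]; first by rewrite divr_gt0.
apply: He; rewrite -ball_normE /= sub0r normrN.
have h : 6 * (e / 7) < e by move: e0; lra.
apply: le_lt_trans h; rewrite [`|z|]mx_normrE; apply/bigmax_leP.
split=> [|[i j] _ /=]; first by rewrite mulr_ge0// divr_ge0// ltW.
by rewrite (ord1 i); exact: zb.
Qed.

Lemma open_box n (rho : R) : open [set z : 'rV[R]_n | forall i, `|z ord0 i| < rho].
Proof.
have -> : [set z : 'rV[R]_n | forall i, `|z ord0 i| < rho] =
    ~` \bigcup_(i in [set: 'I_n]) [set z : 'rV[R]_n | rho <= `|z ord0 i|].
  apply/seteqP; split=> z /= h; first by case=> i _ /=; rewrite leNgt h.
  by move=> i; rewrite ltNge; apply/negP => zi; apply: h; exists i.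
apply: closed_openC; apply: closed_bigcup; first exact: finite_finset.
move=> i _; apply: (@closed_comp _ _ (fun z : 'rV[R]_n => `|z ord0 i|) [set t | rho <= t]).
  by move=> z _; apply: cont_norm; exact: coordc.
exact: closed_ge.
Qed.

End Conclusion.

Unset Implicit Arguments.

Theorem theorem3p8 (R : realType) (N M : nat)
  (s : distr R (N + M)) (f : 'rV[R]_M -> R[i]) (d : int) (eps : R) :
  (2 <= N)%N -> tempered s -> schwartz f -> 0 < eps < 1 ->
  Odist (FTd (tprod s f)) (d%:~R - eps) ->
  forall Th : 'rV[R]_N -> R, UVsplit Th ->
  exists c : {ffun 'I_N -> 'I_(`|d|%N.+1)} -> 'rV[R]_M -> R[i],
    (forall gm, ((mabs (ordmi gm))%:Z < d)%R ->
       continuous (cRe (c gm)) /\ continuous (cIm (c gm))) /\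
    Odist (fun g => FTd (tTheta Th (tprod s f)) g - polyterm c g)
      (d%:~R - eps).
Proof.
move=> _ ts sf eps01 odist Th uTh.
have [U [oU [U0 [K [ua [uac [ua0 [uab uaE]]]]]]]] := odist.
have [rho [rho0 rhoO]] := small_box oU U0.
have eps0 : 0 < eps by have /andP[] := eps01.
(* Taking [L] at least this large gives both L > 0 and d - eps + L > 0. *)
have b1 : 0 < `|d%:~R - eps| + 1 :> R by rewrite ltr_wpDl.
have [L [L0 bL _]] := ceil_exists b1.
have dL0 : 0 < d%:~R - eps + L%:R.
  by have := ler_norm (- (d%:~R - eps)); rewrite normrN; move: bL; lra.
have kernel (kap : 'rV[R]_N -> R) : rapid kap -> cclimit rho (d%:~R - eps + L%:R) (fun k r =>
    cR (dyad k ^+ L) * SF s f (fun y => expint kap (dyad k *: y)) r).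
  by move=> rk; exact: (kernel_cclimit ts sf eps01 L0 dL0 uac ua0 uab uaE rho0 rhoO rk).
have [S1 [S2 [cls1 cls2 SE]]] := theta_cls ts sf kernel uTh.
have [K1 H1] := cls_normal_form eps0 cls1; have [K2 H2] := cls_normal_form eps0 cls2.
have [v [c [v1 v2 v3 c1 E1]]] := H1 (maxn K1 K2) (leq_maxl _ _).
have [w [e [w1 w2 w3 e1 E2]]] := H2 (maxn K1 K2) (leq_maxr _ _).
exists (fun gm x => Complex (c gm x) (e gm x)); split.
  by move=> gm _; split; [exact: c1 | exact: e1].
(* An open box inside the one of [btest], so that test functions on it have real and imaginary parts
   in the range of [theta_cls]. *)
exists [set z | forall i, `|z ord0 i| < rho]; split; first exact: open_box.
split; first by move=> i /=; rewrite mxE normr0.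
exists (maxn K1 K2), (fun a z => Complex (v a z) (w a z)); split; [|split; [|split]].
- by move=> a z _; split; [exact: v1 | exact: w1].
- by move=> a an z _; rewrite v2// w2.
- move=> a; have [C HC] := v3 a; have [C' HC'] := w3 a.
  set b := d%:~R - eps + _ in HC HC' *.
  (* Comparing powers of the two norms needs a nonnegative exponent; for a negative one the
     functions vanish. *)
  have [b0|b0] := ltP b 0.
    by exists 0 => z _; rewrite v2// w2// (cabs_real 0) normr0 mul0r.
  exists ((`|C| + `|C'|) * powR N%:R b) => z _; rewrite -mulrA.
  have P : powR (n1 (lsubmx z)) b <= powR N%:R b * powR (enorm (lsubmx z)) b.
    rewrite -powRM ?sqrtr_ge0// ge0_ler_powR ?nnegrE ?n1_ge0 ?n1_le_enorm//.
    by rewrite mulr_ge0// sqrtr_ge0.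
  apply: (le_trans (cabs_le _)); rewrite /= mulrDl; apply: lerD.
    apply: (le_trans (HC z)); apply: (@le_trans _ _ (`|C| * powR (n1 (lsubmx z)) b)).
      by rewrite ler_wpM2r ?powR_ge0// ler_norm.
    by rewrite ler_wpM2l.
  apply: (le_trans (HC' z)); apply: (@le_trans _ _ (`|C'| * powR (n1 (lsubmx z)) b)).
    by rewrite ler_wpM2r ?powR_ge0// ler_norm.
  by rewrite ler_wpM2l.
move=> g tg; have [bR bI] := testfn_btest tg.
have rR := btest_rapid bR; have rI := btest_rapid bI.
have [sR _] := bR; have [sI _] := bI.
have tTh : ctemp (fun y => cR (Th y)).
  apply: ctemp_cR; have [sTh _] := uTh.
  have := @utemp_dilate R N unit (fun=> 1) Th; under eq_fun do under eq_fun do rewrite scale1r.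
  by apply=> //; [move=> _; rewrite normr1 | exact: split_pd_bounded].
(* A complex test function is split into real ones by linearity, since [theta_cls] speaks about real
   tests only. *)
have -> : FTd (tTheta Th (tprod s f)) g =
    'i%C * SF s f (fun y => cR (Th y)) (cIm g) + SF s f (fun y => cR (Th y)) (cRe g).
  have [sl _] := ts.
  rewrite /SF -(sl _ _ _ (SF_schwartz sf tTh rI) (SF_schwartz sf tTh rR)).
  congr s; apply/funext => z; rewrite (FTf_split z rR rI).
  set A := expint (cRe g) z; set B := expint (cIm g) z; set T := cR _; set F := f _.
  by rewrite /= -/T; ring.
rewrite (SE _ bR) (SE _ bI) (E1 _ bR) (E1 _ bI) (E2 _ bR) (E2 _ bI).
pose A (u : {ffun 'I_N -> 'I_(maxn K1 K2).+1} -> 'rV[R]_(N + M) -> R) r : R :=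
  \sum_a (-1) ^+ mabs (ordmi a) * intRn (fun z => u a z * Dr (liftN (ordmi a)) r z).
pose P (h : {ffun 'I_N -> 'I_(`|d|%N.+1)} -> 'rV[R]_M -> R) r : R :=
  \sum_(gm | ((mabs (ordmi gm))%:Z < d)%R)
    intRn (fun z : 'rV[R]_(N + M) => h gm (rsubmx z) * xpow (lsubmx z) (ordmi gm) * r z).
rewrite -!/(A _ _) -!/(P _ _).
have iA (u r : 'rV[R]_(N + M) -> R) : continuous u -> btest rho r -> forall a : {ffun 'I_N -> 'I_(maxn K1 K2).+1},
    intble (fun z : 'rV[R]_(N + M) => u z * Dr (liftN (ordmi a)) r z).
  move=> cu br a; rewrite (Dr_liftN _ (proj1 br)).
  by apply: dec_intble; apply: (dec_mul_btest cu); exact: btest_iter_pd br.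
have iP (h : 'rV[R]_M -> R) al (r : 'rV[R]_(N + M) -> R) : continuous h -> btest rho r ->
    intble (fun z : 'rV[R]_(N + M) => h (rsubmx z) * xpow (lsubmx z) al * r z).
  move=> ch br; under eq_fun do rewrite xpow_mseq.
  by apply: dec_intble; apply: (dec_mul_btest _ br); exact: cont_pol.
have polyE : polyterm (fun gm x => Complex (c gm x) (e gm x)) g =
    Complex (P c (cRe g) - P e (cIm g)) (P e (cRe g) + P c (cIm g)).
  have T gm : cint (fun z => Complex (c gm (rsubmx z)) (e gm (rsubmx z)) *
      cR (xpow (lsubmx z) (ordmi gm)) * g z) =
      Complex (intRn (fun z => c gm (rsubmx z) * xpow (lsubmx z) (ordmi gm) * cRe g z) -
               intRn (fun z => e gm (rsubmx z) * xpow (lsubmx z) (ordmi gm) * cIm g z))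
              (intRn (fun z => e gm (rsubmx z) * xpow (lsubmx z) (ordmi gm) * cRe g z) +
               intRn (fun z => c gm (rsubmx z) * xpow (lsubmx z) (ordmi gm) * cIm g z)).
    pose X (z : 'rV[R]_(N + M)) : R[i] := Complex (c gm (rsubmx z)) (e gm (rsubmx z)) * cR (xpow (lsubmx z) (ordmi gm)).
    have UR : cRe X = fun z => c gm (rsubmx z) * xpow (lsubmx z) (ordmi gm).
      by apply/funext => z; rewrite /cRe ReMc /= mulr0 subr0.
    have UI : cIm X = fun z => e gm (rsubmx z) * xpow (lsubmx z) (ordmi gm).
      by apply/funext => z; rewrite /cIm ImMc /= mulr0 add0r.
    have := @cint_mul R N M X g; rewrite UR UI; apply; exact: iP.
  rewrite /polyterm (eq_bigr _ (fun gm _ => T gm)); apply: complex_ext.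
    by rewrite Re_sum /= /P -sumrN -big_split.
  by rewrite Im_sum /= /P -big_split.
have aE : \sum_a (-1) ^+ mabs (ordmi a) * cint (fun z => Complex (v a z) (w a z) * Dc (liftN (ordmi a)) g z) =
    Complex (A v (cRe g) - A w (cIm g)) (A w (cRe g) + A v (cIm g)).
  have T a : cint (fun z => Complex (v a z) (w a z) * Dc (liftN (ordmi a)) g z) =
      Complex (intRn (fun z => v a z * Dr (liftN (ordmi a)) (cRe g) z) -
               intRn (fun z => w a z * Dr (liftN (ordmi a)) (cIm g) z))
              (intRn (fun z => w a z * Dr (liftN (ordmi a)) (cRe g) z) +
               intRn (fun z => v a z * Dr (liftN (ordmi a)) (cIm g) z)).
    exact: (@cint_mul R N M (fun z => Complex (v a z) (w a z)) (Dc (liftN (ordmi a)) g)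
      (iA _ _ (v1 a) bR a) (iA _ _ (w1 a) bI a) (iA _ _ (v1 a) bI a) (iA _ _ (w1 a) bR a)).
  rewrite (eq_bigr _ (fun a _ => congr1 _ (T a))); apply: complex_ext.
    rewrite Re_sum /= /A -sumrN -big_split; apply: eq_bigr => a _.
    by rewrite sign_cR ReMc /= mul0r subr0 mulrBr.
  rewrite Im_sum /= /A -big_split; apply: eq_bigr => a _.
  by rewrite sign_cR ImMc /= mul0r addr0 mulrDr.
rewrite polyE aE; apply: complex_ext; rewrite ?ReDc ?ImDc ?ReMc ?ImMc /=.
  by rewrite mul0r mul1r sub0r; ring.
by rewrite mul0r mul1r add0r; ring.
Qed.
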